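(* There exists an $\aleph_3$-separable unital C*-algebra $E$ that satisfies the following properties: (i) $E$ has index of nilpotence $2$, and real rank and stable rank both equal to $1$. (ii) $(\mathrm{V}(E),[1_E])$ is the positive cone of a dimension group with order-unit of index two. (iii) For every C*-algebra $B$ of real rank $0$ and for every (von Neumann) regular ring $B$, there exists no surjective pre-V-homomorphism from $\mathrm{V}(B)$ onto $\mathrm{V}(E)$. In particular, there is no ring $B$ which is either a C*-algebra of real rank $0$ or a regular ring such that $\mathrm{V}(E)\cong\mathrm{V}(B)$. Furthermore, $E$ can be constructed as the (unital) C*-direct limit of a system of $\aleph_3$ finite products of members of $\mathcal{A}$.
   Context: Let $\mathrm{C}([0,1],X)$ denote the algebra of continuous $X$-valued functions on $[0,1]$, $\mathbb{D}=\{x\in\mathrm{C}([0,1],\mathrm{M}_2(\mathbb{C}))\mid x(0)\text{ is a diagonal matrix}\}$, and $\mathcal{A}=\{\mathbb{C},\ \mathbb{D},\ \mathrm{M}_2(\mathrm{C}([0,1],\mathbb{C}))\}$. C*-direct limits are taken for unital C*-algebras and unital C*-homomorphisms. A C*-algebra is $\aleph_3$-separable if it has a dense subset of cardinality at most $\aleph_3$. A ring $R$ has index of nilpotence at most $n$ if $x^{n+1}=0$ implies $x^n=0$ for all $x\in R$; its index of nilpotence is the least such $n$. Rings and C*-algebras $B$ in (iii) are not assumed unital; a ring $R$ is regular if for every $x\in R$ there is $y\in R$ with $xyx=x$. A commutative monoid is conical if $x+y=0$ implies $x=y=0$; $x\leq y$ means $y=x+z$ for some $z$ in the monoid. An order-unit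 is an element $u$ such that each $x$ satisfies $x\leq nu$ for some positive integer $n$. An element $a$ has index at most $n$ if $(n+1)x\leq a$ implies $x=0$, for each $x$; its index is the least such $n$. A dimension group is a partially ordered abelian group $G$ which is directed ($G=G^++(-G^+)$), unperforated ($mx\geq0$ with $m$ a positive integer implies $x\geq0$), and whose positive cone satisfies refinement: if $a_0+a_1=b_0+b_1$ in $G^+$, there are $c_{j,k}\in G^+$ ($j,k\in\{0,1\}$) with $a_j=c_{j,0}+c_{j,1}$ and $b_j=c_{0,j}+c_{1,j}$. For a ring $R$, $\mathrm{V}(R)$ is the conical commutative monoid of equivalence classes $[a]_R$ of idempotents $a$ of $\mathrm{M}_\infty(R)=\bigcup_n\mathrm{M}_n(R)$ (embedding $\mathrm{M}_n(R)$ into $\mathrm{M}_{n+1}(R)$ by adding a zero row and column), where $a\sim b$ if $a=xy$, $b=yx$ for some $x,y\in\mathrm{M}_\infty(R)$, with addition determined by $[a]_R+[b]_R=[a+b]_R$ whenever $ab=ba=0$. For conical commutative monoids $M,N$, a monoid homomorphism $f\colon M\to N$ is a pre-V-homomorphism if whenever $a,b\in N$ and $c\in M$ with $f(c)=a+b$, there are $x,y\in M$ such that $c=x+y$, $f(x)=a$, and $f(y)=b$. *)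

(* Defs.v *)
From HB Require Import structures.
From mathcomp Require Import all_boot all_order all_algebra generic_quotient.
From mathcomp Require Import all_classical all_reals all_analysis.
From mathcomp Require Import complex.

Set Implicit Arguments.
Unset Strict Implicit.
Unset Printing Implicit Defensive.

Import Order.TTheory GRing.Theory Num.Theory numFieldNormedType.Exports.

Local Open Scope ring_scope.
Local Open Scope classical_set_scope.
Local Open Scope card_scope.
Local Open Scope quotient_scope.

HB.mixin Record Zmodule_isRng S of GRing.Zmodule S := {
  rmul : S -> S -> S;
  rmulA : associative rmul;
  rmulDl : left_distributive rmul +%R;
  rmulDr : right_distributive rmul +%R
}.

#[short(type="rngType")]
HB.structure Definition Rng := {S of GRing.Zmodule S & Zmodule_isRng S}.

Notation "x ** y" := (rmul x y) (at level 40, left associativity) : ring_scope.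

Section RngTheory.
Variable S : rngType.
Implicit Types x y z a b c : S.

Lemma rmul0r x : 0 ** x = 0.
Proof. by apply: (@addrI _ (0 ** x)); rewrite -rmulDl !addr0. Qed.

Lemma rmulr0 x : x ** 0 = 0.
Proof. by apply: (@addrI _ (x ** 0)); rewrite -rmulDr !addr0. Qed.

Lemma rmul_sumr I (r : seq I) (P : pred I) (F : I -> S) x :
  x ** (\sum_(i <- r | P i) F i) = \sum_(i <- r | P i) x ** F i.
Proof. by elim/big_rec2: _ => [|i y z _ <-]; rewrite ?rmulr0 ?rmulDr. Qed.

Lemma rmul_suml I (r : seq I) (P : pred I) (F : I -> S) x :
  (\sum_(i <- r | P i) F i) ** x = \sum_(i <- r | P i) F i ** x.
Proof. by elim/big_rec2: _ => [|i y z _ <-]; rewrite ?rmul0r ?rmulDl. Qed.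

Definition regular_rng := forall x, exists y, x ** y ** x = x.

Definition idem := {a : S | a ** a == a}.
HB.instance Definition _ := SubChoice.on idem.

Lemma idemP (a : idem) : val a ** val a = val a.
Proof. exact/eqP/(valP a). Qed.

Definition idem_eqv (a b : idem) : bool :=
  `[< exists x y, val a = x ** y /\ val b = y ** x >].

Lemma idem_eqv_refl : reflexive idem_eqv.
Proof. by move=> a; apply/asboolP; exists (val a), (val a); rewrite idemP. Qed.

Lemma idem_eqv_sym : symmetric idem_eqv.
Proof.
by move=> a b; apply/asboolP/asboolP => -[x [y [ex ey]]]; exists y, x.
Qed.

Lemma idem_eqv_trans : transitive idem_eqv.
Proof.
move=> b a c /asboolP[x [y [ax by_]]] /asboolP[z [w [bz cw]]].
apply/asboolP; exists (x ** z), (w ** y); split.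
  by rewrite -rmulA (rmulA z) -bz by_ !rmulA -ax -rmulA -ax idemP.
by rewrite -rmulA (rmulA y) -by_ bz !rmulA -cw -rmulA -cw idemP.
Qed.

Definition idem_eqv_equiv :=
  EquivRel idem_eqv idem_eqv_refl idem_eqv_sym idem_eqv_trans.

Definition orthogonal_idem (a b : idem) :=
  val a ** val b = 0 /\ val b ** val a = 0.

Lemma idem_add_subproof (a b : idem) : orthogonal_idem a b ->
  (val a + val b) ** (val a + val b) == val a + val b.
Proof. by case=> ab ba; rewrite rmulDl !rmulDr ab ba !idemP addr0 add0r. Qed.

Definition idem_add (a b : idem) (ab : orthogonal_idem a b) : idem :=
  exist (fun a : S => is_true (a ** a == a)) _ (idem_add_subproof ab).

Lemma idem_eqv_norm (a b : idem) : idem_eqv a b ->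
  exists x y, [/\ val a = x ** y, val b = y ** x,
    x = val a ** x /\ x = x ** val b & y = val b ** y /\ y = y ** val a].
Proof.
case/asboolP=> x [y [ax by_]].
exists (val a ** x ** val b), (val b ** y ** val a); split.
- have h : x ** val b ** y = val a.
    by rewrite by_ rmulA -ax -rmulA -ax idemP.
  rewrite -!rmulA (rmulA (val b) (val b)) idemP (rmulA (val b) y).
  by rewrite (rmulA x) (rmulA x (val b) y) h !idemP.
- have h : y ** val a ** x = val b.
    by rewrite ax rmulA -by_ -rmulA -by_ idemP.
  rewrite -!rmulA (rmulA (val a) (val a)) idemP (rmulA (val a) x).
  by rewrite (rmulA y) (rmulA y (val a) x) h !idemP.
- by rewrite !rmulA idemP -!rmulA idemP.
- by rewrite !rmulA idemP -!rmulA idemP.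
Qed.

Lemma idem_eqv_add (a b a' b' : idem)
    (ab : orthogonal_idem a b) (ab' : orthogonal_idem a' b') :
  idem_eqv a a' -> idem_eqv b b' -> idem_eqv (idem_add ab) (idem_add ab').
Proof.
case/idem_eqv_norm=> x [y [axy ayx [ax xa] [ay ya]]].
case/idem_eqv_norm=> z [w [bzw bwz [bz zb] [bw wb]]].
apply/asboolP; exists (x + z), (y + w).
have mid (u v p q : S) : p ** q = 0 -> u = u ** p -> v = q ** v -> u ** v = 0.
  by move=> pq -> ->; rewrite -rmulA (rmulA p) pq rmul0r rmulr0.
rewrite !rmulDl !rmulDr /= -axy -ayx -bzw -bwz.
rewrite (mid x w _ _ ab'.1 xa bw) (mid z y _ _ ab'.2 zb ay).
by rewrite (mid y z _ _ ab.1 ya bz) (mid w x _ _ ab.2 wb ax) !addr0 !add0r.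
Qed.

End RngTheory.

(* The library's pzRingType is not used: Hierarchy Builder cannot join it with
   completeNormedModType. The ring may be zero. *)
HB.mixin Record Rng_hasOne S of Rng S := {
  rone : S;
  rmul1l : left_id rone rmul;
  rmul1r : right_id rone rmul
}.

#[short(type="unitalRngType")]
HB.structure Definition UnitalRng := {S of Rng S & Rng_hasOne S}.

Definition rexp (S : unitalRngType) (x : S) (n : nat) : S :=
  iter n (rmul x) rone.

Definition nilpotence_index_le (S : unitalRngType) (n : nat) :=
  forall x : S, rexp x n.+1 = 0 -> rexp x n = 0.

Section Minf.
Variable S : rngType.

Definition fin_mx (a : nat -> nat -> S) : Prop :=
  exists n, forall i j, (n <= i)%N || (n <= j)%N -> a i j = 0.

(* The union of the M_n(S), each embedded in the next one by a zero row and a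
   zero column. *)
Definition Minf := {a : nat -> nat -> S | `[< fin_mx a >]}.
HB.instance Definition _ := SubChoice.on Minf.

Lemma MinfP (a : Minf) :
  exists n, forall i j, (n <= i)%N || (n <= j)%N -> val a i j = 0.
Proof. by case: a => a /= /asboolP. Qed.

Lemma Minf_eqP (a b : Minf) : (forall i j, val a i j = val b i j) -> a = b.
Proof. by move=> h; apply/val_inj/funext => i; apply/funext => j. Qed.

Definition mkMinf (a : nat -> nat -> S) (h : fin_mx a) : Minf :=
  exist (fun a => is_true `[< fin_mx a >]) a (asboolT h).

Lemma fin_mx0 : fin_mx (fun _ _ => 0). Proof. by exists 0%N. Qed.

Lemma fin_mxD (a b : Minf) : fin_mx (fun i j => val a i j + val b i j).
Proof.
have [n hn] := MinfP a; have [m hm] := MinfP b; exists (maxn n m) => i j.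
by rewrite !geq_max => /orP[] /andP[h1 h2]; rewrite hn ?hm ?addr0 // ?h1 ?h2 ?orbT.
Qed.

Lemma fin_mxN (a : Minf) : fin_mx (fun i j => - val a i j).
Proof. by have [n hn] := MinfP a; exists n => i j h; rewrite hn ?oppr0. Qed.

(* The sum over all k in nat has finite support. *)
Definition Minf_mul_fun (a b : nat -> nat -> S) i j :=
  \sum_(k \in [set: nat]) a i k ** b k j.

Lemma sum_nat_finsupp (F : nat -> S) n : (forall k, (n <= k)%N -> F k = 0) ->
  \sum_(k \in [set: nat]) F k = \sum_(0 <= k < n) F k.
Proof.
move=> h; rewrite (@fsbigE _ _ _ _ _ (index_iota 0 n)) ?iota_uniq //.
  by apply: eq_bigl => k; rewrite in_setT.
by move=> k _; rewrite mem_index_iota /= -leqNgt => /h.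
Qed.

Lemma Minf_mulE (a b : nat -> nat -> S) n i j :
    (forall k, (n <= k)%N -> a i k = 0) ->
  Minf_mul_fun a b i j = \sum_(0 <= k < n) a i k ** b k j.
Proof. by move=> h; apply: sum_nat_finsupp => k hk; rewrite h // rmul0r. Qed.

Lemma fin_mxM (a b : Minf) : fin_mx (Minf_mul_fun (val a) (val b)).
Proof.
have [n hn] := MinfP a; have [m hm] := MinfP b; exists (maxn n m) => i j.
rewrite !geq_max => h; rewrite (@Minf_mulE _ _ n); last first.
  by move=> k hk; rewrite hn // hk orbT.
rewrite big1 // => k _; case/orP: h => /andP[h1 h2].
  by rewrite hn ?h1 // rmul0r.
by rewrite hm ?h2 ?orbT // rmulr0.
Qed.

Definition Minf0 := mkMinf fin_mx0.
Definition MinfD a b := mkMinf (fin_mxD a b).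
Definition MinfN a := mkMinf (fin_mxN a).
Definition MinfM a b := mkMinf (fin_mxM a b).

Lemma MinfDA : associative MinfD.
Proof. by move=> a b c; apply: Minf_eqP => i j /=; rewrite addrA. Qed.
Lemma MinfDC : commutative MinfD.
Proof. by move=> a b; apply: Minf_eqP => i j /=; rewrite addrC. Qed.
Lemma Minf0D : left_id Minf0 MinfD.
Proof. by move=> a; apply: Minf_eqP => i j /=; rewrite add0r. Qed.
Lemma MinfND : left_inverse Minf0 MinfN MinfD.
Proof. by move=> a; apply: Minf_eqP => i j /=; rewrite addNr. Qed.

HB.instance Definition _ :=
  GRing.isZmodule.Build Minf MinfDA MinfDC Minf0D MinfND.

Lemma MinfMA : associative MinfM.
Proof.
move=> a b c; apply: Minf_eqP => i j /=.
have [n hn] := MinfP a; have [m hm] := MinfP b.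
have hn' i' k : (n <= k)%N -> val a i' k = 0 by move=> h; rewrite hn // h orbT.
have hm' i' k : (m <= k)%N -> val b i' k = 0 by move=> h; rewrite hm // h orbT.
rewrite (Minf_mulE _ _ (hn' i)) (@Minf_mulE _ _ m); last first.
  move=> k hk; rewrite (Minf_mulE _ _ (hn' i)) big1 // => l _.
  by rewrite (hm' l k hk) rmulr0.
under eq_bigr => k _ do rewrite (Minf_mulE _ _ (hm' k)) rmul_sumr.
under [RHS]eq_bigr => k _ do rewrite (Minf_mulE _ _ (hn' i)) rmul_suml.
rewrite exchange_big /=; apply: eq_bigr => k _; apply: eq_bigr => l _.
by rewrite rmulA.
Qed.

Lemma MinfMDl : left_distributive MinfM +%R.
Proof.
move=> a b c; apply: Minf_eqP => i j /=.
have [n hn] := MinfP c.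
have E (d : Minf) : Minf_mul_fun (val d) (val c) i j
    = \sum_(0 <= k < n) val d i k ** val c k j.
  by apply: sum_nat_finsupp => k hk; rewrite hn ?hk // rmulr0.
rewrite (E (a + b)) !E -big_split /=; apply: eq_bigr => k _.
by rewrite rmulDl.
Qed.

Lemma MinfMDr : right_distributive MinfM +%R.
Proof.
move=> a b c; apply: Minf_eqP => i j /=.
have [n hn] := MinfP a.
have E (d : Minf) : Minf_mul_fun (val a) (val d) i j
    = \sum_(0 <= k < n) val a i k ** val d k j.
  by apply: Minf_mulE => k hk; rewrite hn // hk orbT.
rewrite (E (b + c)) !E -big_split /=; apply: eq_bigr => k _.
by rewrite rmulDr.
Qed.

HB.instance Definition _ := Zmodule_isRng.Build Minf MinfMA MinfMDl MinfMDr.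

Lemma Minf_mulP (a b : Minf) i j n : (forall k, (n <= k)%N -> val a i k = 0) ->
  val (a ** b) i j = \sum_(0 <= k < n) val a i k ** val b k j.
Proof. exact: Minf_mulE. Qed.

Lemma idem_entry (a : idem Minf) n i j :
    (forall i k, (n <= k)%N -> val (val a) i k = 0) ->
  val (val a) i j = \sum_(0 <= k < n) val (val a) i k ** val (val a) k j.
Proof. by move=> h; rewrite -{1}(idemP a) (@Minf_mulP _ _ _ _ n) // => k /h. Qed.

Section Spread.
Variables (m r : nat).
Hypothesis rm : (r < m)%N.

Definition spread_fun (a : nat -> nat -> S) i j :=
  if (i %% m == r)%N && (j %% m == r)%N then a (i %/ m)%N (j %/ m)%N else 0.

Lemma divm_ge n i : (n * m <= i)%N -> (n <= i %/ m)%N.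
Proof. by rewrite leq_divRL ?(leq_ltn_trans _ rm). Qed.

Lemma fin_mx_spread (a : Minf) : fin_mx (spread_fun (val a)).
Proof.
have [n hn] := MinfP a; exists (n * m)%N => i j h; rewrite /spread_fun.
case: ifP => // _; apply: hn.
by case/orP: h => /divm_ge ->; rewrite ?orbT.
Qed.

Definition spread a := mkMinf (fin_mx_spread a).

Let lrow_fun (a : nat -> nat -> S) i j :=
  if (i %% m == r)%N then a (i %/ m)%N j else 0.
Let lcol_fun (a : nat -> nat -> S) i j :=
  if (j %% m == r)%N then a i (j %/ m)%N else 0.

Let fin_lrow (a : Minf) : fin_mx (lrow_fun (val a)).
Proof.
have [n hn] := MinfP a; exists (n * m)%N => i j h; rewrite /lrow_fun.
case: ifP => // _; apply: hn; case/orP: h => [/divm_ge -> //|h].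
by rewrite (leq_trans _ h) ?orbT // leq_pmulr // (leq_ltn_trans _ rm).
Qed.

Let fin_lcol (a : Minf) : fin_mx (lcol_fun (val a)).
Proof.
have [n hn] := MinfP a; exists (n * m)%N => i j h; rewrite /lcol_fun.
case: ifP => // _; apply: hn; case/orP: h => [h|/divm_ge ->]; last exact: orbT.
by rewrite (leq_trans _ h) // leq_pmulr // (leq_ltn_trans _ rm).
Qed.

Lemma sum_spread (F : nat -> S) n :
  \sum_(0 <= k < n * m) (if (k %% m == r)%N then F (k %/ m)%N else 0)
    = \sum_(0 <= k < n) F k.
Proof.
have m0 : (0 < m)%N by exact: leq_ltn_trans rm.
elim: n => [|n IH]; first by rewrite mul0n !big_nil.
rewrite big_nat_recr //= -IH mulSnr (@big_cat_nat _ _ _ (n * m)) ?leq_addr //=.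
congr (_ + _); rewrite -{1}[(n * m)%N]add0n big_addn addKn big_mkord.
rewrite (bigD1 (Ordinal rm)) //= big1 ?addr0 => [|i].
  by rewrite addnC modnMDl modn_small // eqxx divnMDl // divn_small // addn0.
rewrite -val_eqE /= => /negbTE ir.
by rewrite addnC modnMDl modn_small ?ir.
Qed.

Lemma spread_idem_subproof (a : idem Minf) :
  spread (val a) ** spread (val a) == spread (val a).
Proof.
apply/eqP/Minf_eqP => i j; have [n hn] := MinfP (val a).
have hn' i' k : (n <= k)%N -> val (val a) i' k = 0.
  by move=> hk; rewrite hn // hk orbT.
rewrite (@Minf_mulP _ _ _ _ (n * m)); last first.
  move=> k /divm_ge hk /=; rewrite /spread_fun.
  by case: ifP => // _; rewrite hn // hk orbT.
rewrite /= /spread_fun.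
case: (boolP (i %% m == r)%N) => ir; last first.
  by rewrite big1 //= => k _; rewrite rmul0r.
case: (boolP (j %% m == r)%N) => jr; last first.
  by rewrite big1 //= => k _; rewrite andbF rmulr0.
rewrite [RHS](idem_entry _ _ hn').
rewrite -sum_spread; apply: eq_bigr => k _ /=; rewrite andbT.
by case: ifP => // _; rewrite rmul0r.
Qed.

Definition spread_idem (a : idem Minf) : idem Minf :=
  exist (fun a : Minf => is_true (a ** a == a)) _ (spread_idem_subproof a).

Lemma spread_eqv (a : idem Minf) : idem_eqv a (spread_idem a).
Proof.
apply/asboolP; have [n hn] := MinfP (val a).
have hn' i k : (n <= k)%N -> val (val a) i k = 0.
  by move=> hk; rewrite hn // hk orbT.
exists (mkMinf (fin_lcol (val a))), (mkMinf (fin_lrow (val a))); split.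
  apply: Minf_eqP => i j; rewrite (@Minf_mulP _ _ _ _ (n * m)); last first.
    by move=> k /divm_ge hk /=; rewrite /lcol_fun hn' //; case: ifP.
  rewrite [LHS](idem_entry _ _ hn').
  rewrite -sum_spread; apply: eq_bigr => k _ /=.
  by rewrite /lcol_fun /lrow_fun; case: ifP => // _; rewrite rmul0r.
apply: Minf_eqP => i j; rewrite (@Minf_mulP _ _ _ _ n); last first.
  by move=> k hk /=; rewrite /lrow_fun hn' //; case: ifP.
rewrite /= /spread_fun /lrow_fun /lcol_fun.
case: (boolP (i %% m == r)%N) => ir; last first.
  by rewrite big1 // => k _; rewrite rmul0r.
case: (boolP (j %% m == r)%N) => jr; last first.
  by rewrite big1 // => k _; rewrite rmulr0.
by rewrite [LHS](idem_entry _ _ hn').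
Qed.

End Spread.

Lemma spread_orth m r s (rm : (r < m)%N) (sm : (s < m)%N) a b : r != s ->
  orthogonal_idem (spread_idem rm a) (spread_idem sm b).
Proof.
have main r' s' (rm' : (r' < m)%N) (sm' : (s' < m)%N) (a' b' : Minf) :
    r' != s' -> spread rm' a' ** spread sm' b' = 0.
  move=> rs; apply: Minf_eqP => i j.
  have [n hn] := MinfP (spread rm' a').
  rewrite (@Minf_mulP _ _ _ _ n); last by move=> k hk; rewrite hn // hk orbT.
  rewrite big1 // => k _ /=; rewrite /spread_fun.
  case: (eqVneq (k %% m)%N r') => [->|_].
    by rewrite (negbTE rs) /= rmulr0.
  by rewrite andbF rmul0r.
by move=> rs; split; apply: main; rewrite // eq_sym.
Qed.

End Minf.

Section V.
Variable S : rngType.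

Definition V := {eq_quot (idem_eqv_equiv (Minf S))}.
HB.instance Definition _ := Choice.on V.
HB.instance Definition _ := EqQuotient.on V.

Definition Vclass (a : idem (Minf S)) : V := \pi_V a.

Lemma Vclass_eqP a b : reflect (Vclass a = Vclass b) (idem_eqv a b).
Proof.
apply: (iffP idP) => h; first exact/eqmodP.
by apply/(eqmodP (idem_eqv_equiv (Minf S))).
Qed.

Lemma VclassP (X : V) : exists a, X = Vclass a.
Proof. by exists (repr X); rewrite /Vclass reprK. Qed.

Lemma Minf0_idem : (0 : Minf S) ** 0 == 0.
Proof. by rewrite rmulr0. Qed.

Definition V0 : V :=
  Vclass (exist (fun a : Minf S => is_true (a ** a == a)) 0 Minf0_idem).

(* The representatives are moved to the even and to the odd indices, where they
   are orthogonal; Vclass_addE gives the sum of any two orthogonal idempotents. *)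
Definition Vadd (X Y : V) : V :=
  Vclass (idem_add (spread_orth (isT : (0 < 2)%N) (isT : (1 < 2)%N)
                      (repr X) (repr Y) isT)).

Lemma Vadd_class a b (ab : orthogonal_idem a b) :
  Vadd (Vclass a) (Vclass b) = Vclass (idem_add ab).
Proof.
apply/Vclass_eqP/idem_eqv_add.
  apply: (@idem_eqv_trans _ (repr (Vclass a))).
    by rewrite idem_eqv_sym spread_eqv.
  by apply/Vclass_eqP; rewrite /Vclass reprK.
apply: (@idem_eqv_trans _ (repr (Vclass b))).
  by rewrite idem_eqv_sym spread_eqv.
by apply/Vclass_eqP; rewrite /Vclass reprK.
Qed.

Lemma Vclass_spread m r (rm : (r < m)%N) a :
  Vclass (spread_idem rm a) = Vclass a.
Proof. by apply/Vclass_eqP; rewrite idem_eqv_sym spread_eqv. Qed.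

Lemma Vclass_val a b : val a = val b -> Vclass a = Vclass b.
Proof. by move=> /val_inj ->. Qed.

Lemma VaddC : commutative Vadd.
Proof.
move=> X Y; have [a ->] := VclassP X; have [b ->] := VclassP Y.
rewrite -(Vclass_spread (isT : (0 < 2)%N) a) -(Vclass_spread (isT : (1 < 2)%N) b).
have o1 := spread_orth (isT : (0 < 2)%N) (isT : (1 < 2)%N) a b isT.
have o2 := spread_orth (isT : (1 < 2)%N) (isT : (0 < 2)%N) b a isT.
by rewrite (Vadd_class o1) (Vadd_class o2); apply: Vclass_val; rewrite /= addrC.
Qed.

Lemma VaddA : associative Vadd.
Proof.
move=> X Y Z; have [a ->] := VclassP X; have [b ->] := VclassP Y.
have [c ->] := VclassP Z.
rewrite -(Vclass_spread (isT : (0 < 3)%N) a) -(Vclass_spread (isT : (1 < 3)%N) b).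
rewrite -(Vclass_spread (isT : (2 < 3)%N) c).
set a' := spread_idem _ a; set b' := spread_idem _ b; set c' := spread_idem _ c.
have ab : orthogonal_idem a' b' by exact: spread_orth.
have ac : orthogonal_idem a' c' by exact: spread_orth.
have bc : orthogonal_idem b' c' by exact: spread_orth.
rewrite (Vadd_class ab) (Vadd_class bc).
have a_bc : orthogonal_idem a' (idem_add bc).
  by split; rewrite /= ?rmulDr ?rmulDl ?ab.1 ?ab.2 ?ac.1 ?ac.2 addr0.
have ab_c : orthogonal_idem (idem_add ab) c'.
  by split; rewrite /= ?rmulDr ?rmulDl ?ac.1 ?ac.2 ?bc.1 ?bc.2 addr0.
by rewrite (Vadd_class a_bc) (Vadd_class ab_c); apply: Vclass_val; rewrite /= addrA.
Qed.

Lemma V0add : left_id V0 Vadd.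
Proof.
move=> X; have [a ->] := VclassP X.
have o : orthogonal_idem (exist (fun a : Minf S => is_true (a ** a == a)) 0 Minf0_idem) a.
  by split; rewrite /= ?rmul0r ?rmulr0.
by rewrite /V0 (Vadd_class o); apply: Vclass_val; rewrite /= add0r.
Qed.

HB.instance Definition _ := GRing.isNmodule.Build V VaddA VaddC V0add.

Lemma Vclass_addE a b (ab : orthogonal_idem a b) :
  Vclass a + Vclass b = Vclass (idem_add ab).
Proof. exact: Vadd_class. Qed.

End V.

Definition order_unit (M : nmodType) (u : M) :=
  forall x : M, exists2 n : nat, (0 < n)%N & exists z, u *+ n = x + z.

Definition monoid_index_le (M : nmodType) (a : M) (n : nat) :=
  forall x : M, (exists z, a = x *+ n.+1 + z) -> x = 0.

Definition least (P : nat -> Prop) (n : nat) :=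
  P n /\ forall m, P m -> (n <= m)%N.

Definition monoid_index (M : nmodType) (a : M) := least (monoid_index_le a).

Definition pre_V_hom (M N : nmodType) (f : {additive M -> N}) :=
  forall (a b : N) (c : M), f c = a + b ->
    exists x y, [/\ c = x + y, f x = a & f y = b].

Definition dimension_group (G : porderZmodType) :=
  [/\ forall x y z : G, x <= y -> x + z <= y + z,
      forall x : G, exists y z, [/\ 0 <= y, 0 <= z & x = y - z],
      forall (x : G) (m : nat), (0 < m)%N -> 0 <= x *+ m -> 0 <= x
    & forall a0 a1 b0 b1 : G, 0 <= a0 -> 0 <= a1 -> 0 <= b0 -> 0 <= b1 ->
        a0 + a1 = b0 + b1 ->
        exists c00 c01 c10 c11 : G,
          [/\ 0 <= c00, 0 <= c01, 0 <= c10 & 0 <= c11] /\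
          [/\ a0 = c00 + c01, a1 = c10 + c11,
              b0 = c00 + c10 & b1 = c01 + c11]].

Definition positive_cone_of (M : nmodType) (G : porderZmodType)
    (f : {additive M -> G}) :=
  injective f /\ range f = [set x : G | 0 <= x].

Definition cplx (R : realType) : numClosedFieldType := complex R.

HB.mixin Record isCstarAlgebra (R : realType) A
    of CompleteNormedModule (cplx R) A & Rng A := {
  star : A -> A;
  rscalerAl : forall (a : cplx R) (x y : A), a *: (x ** y) = (a *: x) ** y;
  rscalerAr : forall (a : cplx R) (x y : A), a *: (x ** y) = x ** (a *: y);
  starK : involutive star;
  starD : {morph star : x y / x + y};
  starZ : forall (a : cplx R) (x : A), star (a *: x) = Num.conj a *: star x;
  starM : forall x y : A, star (x ** y) = star y ** star x;
  ler_normrM : forall x y : A, `|x ** y| <= `|x| * `|y|;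
  normr_starM : forall x : A, `|star x ** x| = `|x| ^+ 2
}.

#[short(type="cstarType")]
HB.structure Definition CstarAlgebra (R : realType) :=
  {A of CompleteNormedModule (cplx R) A & Rng A & isCstarAlgebra R A}.

#[short(type="ucstarType")]
HB.structure Definition UnitalCstarAlgebra (R : realType) :=
  {A of CstarAlgebra R A & UnitalRng A}.

Definition star_hom (R : realType) (A B : cstarType R) (f : A -> B) :=
  [/\ {morph f : x y / x + y},
      forall (a : cplx R) x, f (a *: x) = a *: f x,
      {morph f : x y / x ** y} & {morph f : x / star x}].

Definition unital_star_hom (R : realType) (A B : ucstarType R) (f : A -> B) :=
  star_hom f /\ f rone = rone.

Definition nilpotence_index (S : unitalRngType) := least (nilpotence_index_le S).

(* Brown and Pedersen: the self-adjoint (n+1)-tuples whose sum of squares is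
   invertible are dense among all self-adjoint (n+1)-tuples. *)
Definition real_rank_le (R : realType) (A : ucstarType R) (n : nat) :=
  forall x : 'I_n.+1 -> A, (forall i, star (x i) = x i) ->
  forall e : cplx R, 0 < e ->
  exists y : 'I_n.+1 -> A,
    [/\ forall i, star (y i) = y i,
        forall i, `|x i - y i| < e
      & exists z : A, z ** (\sum_i y i ** y i) = rone /\
                      (\sum_i y i ** y i) ** z = rone].

Definition real_rank (R : realType) (A : ucstarType R) :=
  least (real_rank_le A).

(* Rieffel: the n-tuples generating A as a left ideal are dense in A^n. For
   C*-algebras this agrees with the Bass stable rank (Herman and
   Vaserstein). *)
Definition stable_rank_le (R : realType) (A : ucstarType R) (n : nat) :=
  (0 < n)%N /\
  forall (x : 'I_n -> A) (e : cplx R), 0 < e ->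
  exists y : 'I_n -> A,
    (forall i, `|x i - y i| < e) /\
    exists z : 'I_n -> A, \sum_i z i ** y i = rone.

Definition stable_rank (R : realType) (A : ucstarType R) :=
  least (stable_rank_le A).

(* U is B itself if B has a unit, and otherwise B with a unit adjoined. *)
Definition unitization (R : realType) (B : cstarType R) (U : ucstarType R)
    (j : B -> U) :=
  star_hom j /\ injective j /\
  ((forall u : U, exists b, u = j b) \/
   ((~ exists e : B, forall b, e ** b = b /\ b ** e = b) /\
    forall u : U, exists b (l : cplx R), u = j b + l *: rone)).

Definition real_rank_zero (R : realType) (B : cstarType R) :=
  exists (U : ucstarType R) (j : B -> U), unitization j /\ real_rank U 0.

(* A has cardinality aleph_n: the aleph after the cardinality of B is the
   cardinality of A when B is strictly smaller than A and no subset of A lies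
   strictly between. *)
Fixpoint is_aleph (n : nat) (T : Type) (A : set T) : Prop :=
  if n is m.+1 then
    exists B : set T, [/\ is_aleph m B, B `<=` A, ~ (A #<= B)
      & forall C : set T, C `<=` A -> (C #<= B) \/ (A #<= C)]
  else A #= [set: nat].

Definition card_le_aleph (n : nat) (T : Type) (A : set T) :=
  exists (U : Type) (K : set U), is_aleph n K /\ A #<= K.

Definition aleph_separable (n : nat) (R : realType) (A : cstarType R) :=
  exists D : set A, dense D /\ card_le_aleph n D.

Definition directed_poset d (I : porderType d) :=
  (exists i : I, True) /\
  forall i j : I, exists k, (i <= k)%O /\ (j <= k)%O.

(* The maps f i j are relevant only for i <= j. *)
Definition direct_system (R : realType) d (I : porderType d)
    (A : I -> ucstarType R) (f : forall i j, A i -> A j) :=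
  [/\ forall i j, (i <= j)%O -> unital_star_hom (f i j),
      forall i (x : A i), f i i x = x
    & forall i j k (x : A i), (i <= j)%O -> (j <= k)%O ->
        f j k (f i j x) = f i k x].

Definition cocone (R : realType) d (I : porderType d)
    (A : I -> ucstarType R) (f : forall i j, A i -> A j)
    (B : ucstarType R) (g : forall i, A i -> B) :=
  (forall i, unital_star_hom (g i)) /\
  forall i j (x : A i), (i <= j)%O -> g j (f i j x) = g i x.

(* Universal property in the category of unital C*-algebras. *)
Definition direct_limit (R : realType) d (I : porderType d)
    (A : I -> ucstarType R) (f : forall i j, A i -> A j)
    (E : ucstarType R) (g : forall i, A i -> E) :=
  [/\ directed_poset I, direct_system f, cocone f g
    & forall (B : ucstarType R) (h : forall i, A i -> B), cocone f h ->
        exists! u : E -> B,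
          unital_star_hom u /\ forall i (x : A i), u (g i x) = h i x].

Definition I01 (R : realType) : topologicalType := set_type `[0 : R, 1].

(* phi is a *-isomorphism of A onto a *-subalgebra, with set of elements T, of
   the *-algebra given by the ring X, the scalar multiplication sc and the
   involution st. Norms are not mentioned: a *-isomorphism between C*-algebras
   is isometric. *)
Definition star_iso_onto (R : realType) (A : ucstarType R) (X : pzRingType)
    (sc : cplx R -> X -> X) (st : X -> X) (T : set X) (phi : A -> X) :=
  [/\ {morph phi : x y / x + y}, {morph phi : x y / x ** y >-> x * y} & phi rone = 1] /\
  [/\ forall a x, phi (a *: x) = sc a (phi x),
      forall x, phi (star x) = st (phi x), injective phi & range phi = T].

Definition is_C (R : realType) (A : ucstarType R) :=
  exists phi : A -> cplx R,
    star_iso_onto (fun a z => a * z) (fun z => Num.conj z) setT phi.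

Definition is_D (R : realType) (A : ucstarType R) :=
  exists phi : A -> (I01 R -> 'M[cplx R]_2),
    star_iso_onto (fun a x t => a *: x t)
      (fun x t => map_mx Num.conj (x t)^T)
      [set x : I01 R -> 'M[cplx R]_2 |
       continuous x /\ forall t, set_val t = 0 -> is_diag_mx (x t)] phi.

Definition is_M2C (R : realType) (A : ucstarType R) :=
  exists phi : A -> 'M[I01 R -> cplx R]_2,
    star_iso_onto (fun a x => map_mx (fun f t => a * f t) x)
      (fun x => map_mx (fun f t => Num.conj (f t)) x^T)
      [set x : 'M[I01 R -> cplx R]_2 | forall i j, continuous (x i j)] phi.

Definition block (R : realType) (A : ucstarType R) :=
  [\/ is_C A, is_D A | is_M2C A].

Definition finite_block_product (R : realType) (A : ucstarType R) :=
  exists (n : nat) (B : 'I_n -> ucstarType R) (p : forall k, A -> B k),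
    [/\ forall k, block (B k), forall k, unital_star_hom (p k)
      & forall b : (forall k, B k), exists! x : A, forall k, p k x = b k].

Section VUnit.
Variable E : unitalRngType.

Definition unit_entry (i j : nat) : E :=
  if (i == 0%N) && (j == 0%N) then rone else 0.

Lemma fin_mx_unit : fin_mx unit_entry.
Proof.
by exists 1%N => i j; rewrite /unit_entry; case: i j => [|i] [|j].
Qed.

Lemma unit_idem_subproof :
  mkMinf fin_mx_unit ** mkMinf fin_mx_unit == mkMinf fin_mx_unit.
Proof.
apply/eqP/Minf_eqP => i j; rewrite (@Minf_mulP _ _ _ _ _ 1) /=.
  rewrite big_nat1 /unit_entry andbT /=.
  by case: (i == 0%N) => /=; rewrite ?rmul1l ?rmul0r.
by move=> k k1; rewrite /unit_entry; case: k k1 => // k _; rewrite andbF.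
Qed.

Definition Vunit : V E :=
  Vclass (exist (fun a : Minf E => is_true (a ** a == a)) _ unit_idem_subproof).

End VUnit.

(* Main.v *)
From HB Require Import structures.
Require Import Defs.
From mathcomp Require Import all_boot all_order all_algebra.
From mathcomp Require Import all_classical all_reals all_analysis.
From mathcomp Require Import complex ring lra zify finmap.

Set Implicit Arguments.
Unset Strict Implicit.
Unset Printing Implicit Defensive.

Import Order.TTheory GRing.Theory Num.Theory numFieldNormedType.Exports.
Local Open Scope ring_scope.
Local Open Scope classical_set_scope.

(** Let S have cardinality aleph_3 and let x range over the triples of elements
    of S with a blank added.  E consists of bounded families of continuous paths
    f(x, -) of 2 x 2 matrices which are uniformly approximated by x |-> f(r_F x, -),
    F finite in S, where r_F blanks the coordinates outside F.  If all coordinates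
    of x are present, f(x, -) is arbitrary.  If only the second (the first) is
    blank, f(x, 0) (resp. f(x, 1)) is diagonal.  If the third is blank, f(x, -) is
    a constant diagonal matrix.  If only the third is present, f(x, -) is a
    combination of a3 and 1 - a3, where a3 is a path of rank one projections from
    e22 to e11.  If all are blank, f(x, -) is a constant scalar.

    Contracting [0,1] to the end point where f(x, -) is diagonal shows that an
    idempotent over E is determined up to equivalence by its ranks at each x, and
    the possible rank functions form the positive cone of a dimension group.  A
    path of matrices is perturbed to an invertible one by moving finitely many
    nodes, which gives the stable rank and an upper bound for the real rank.

    For (iii) consider the projections e1(a), e2(b), equal to e11 where the first
    coordinate is a, resp. the second is b, and e3(c), equal to a3 where the third
    is c.  At (a, b, blank) and (blank, b, c) the two projections present agree,
    but at (a, blank, c) they are complementary.  A surjective pre-V-homomorphism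
    from V(B) lifts each splitting 1 = e + (1 - e) to a splitting of one idempotent
    p over B.  If B is regular or of real rank zero, p_a (p - p_b) and the like
    belong, up to a small error, to the ideal generated by idempotents whose
    classes vanish at (a, b, blank), hence also at (a, b, c) for all but finitely
    many c.  A triple (a, b, c) avoiding the three finite exceptional sets exists
    because S has cardinality at least aleph_2.  Modulo the idempotents vanishing at
    (a, b, c), one gets p_a = p_b = p_c = p - p_a, so p itself vanishes at
    (a, b, c), where it has rank 2. *)

(** A class in [V E] sees only ranks. At a full triple only the total rank is left, so [e1 a] and
    its complement have the same class there, and the disagreement of the three faces costs nothing
    in [V E]. It becomes a contradiction once the splittings are realised by elements of one corner,
    where products such as [p_a (p - p_b)] can be formed. Exceptional sets are finite because the
    rank function of a class is decided by finitely many coordinates. To make errors harmless, the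
    six products are assembled into the symmetry [p_a - (p - p_a)], whose square is [p]: six errors
    of norm below 1/7 add up to some [d] of norm below 1, and [p - d^2] is still invertible in the
    corner. The path [a3] is diagonal at both ends, with opposite diagonals, so that two of the
    faces read the third splitting in opposite ways. That [E] does not have real rank 0 is not
    computed: it is the case [B = E] of (iii). Positivity in C*-algebras is handled by norm
    estimates and convergent iterations, without spectra. *)

(** * Normalization of sums in abelian groups *)

Inductive abel_expr := AbVar of nat | AbAdd of abel_expr & abel_expr | AbOpp of abel_expr | AbZero.

Fixpoint abel_den (V : zmodType) (env : seq V) (e : abel_expr) : V :=
  match e with
  | AbVar i => nth 0 env i
  | AbAdd a b => abel_den env a + abel_den env b
  | AbOpp a => - abel_den env a
  | AbZero => 0
  end.

Fixpoint abel_coef (e : abel_expr) (i : nat) : int :=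
  match e with
  | AbVar j => (i == j)%:Z
  | AbAdd a b => abel_coef a i + abel_coef b i
  | AbOpp a => - abel_coef a i
  | AbZero => 0
  end.

Lemma abel_denE (V : zmodType) (env : seq V) e :
  abel_den env e = \sum_(i < size env) nth 0 env i *~ abel_coef e i.
Proof.
elim: e => [j|a IHa b IHb|a IHa|] /=; rewrite ?IHa ?IHb.
- have [jn|nj] := ltnP j (size env).
    rewrite (bigD1 (Ordinal jn)) //= eqxx mulr1z big1 ?addr0 // => i.
    by rewrite -val_eqE /= => /negbTE ->; rewrite mulr0z.
  rewrite nth_default // big1 // => i _.
  by rewrite ltn_eqF ?mulr0z // (leq_trans _ nj).
- by rewrite -big_split /=; apply: eq_bigr => i _; rewrite mulrzDr.
- by rewrite -sumrN; apply: eq_bigr => i _; rewrite mulrNz.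
- by rewrite big1 // => i _; rewrite mulr0z.
Qed.

(** Both sides are reified over one environment, so their integer coefficients can be compared by
    computation. *)
Lemma abelP (V : zmodType) (env : seq V) e1 e2 :
  all (fun i => abel_coef e1 i == abel_coef e2 i) (iota 0 (size env)) ->
  abel_den env e1 = abel_den env e2.
Proof.
move=> /allP h; rewrite !abel_denE; apply: eq_bigr => i _; congr (_ *~ _).
by apply/eqP/h; rewrite mem_iota add0n ltn_ord.
Qed.

Ltac abel_mem same x l :=
  lazymatch l with
  | nil => constr:(false)
  | cons ?y ?t => match constr:(Set) with
      | _ => let _ := match constr:(Set) with _ => same x y end in constr:(true)
      | _ => abel_mem same x t end
  end.
Ltac abel_env same t l :=
  lazymatch t with
  | (?a + ?b)%R => let l1 := abel_env same a l in abel_env same b l1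
  | (- ?a)%R => abel_env same a l
  | 0%R => l
  | ?x => let b := abel_mem same x l in
      lazymatch b with true => l | false => constr:(cons x l) end
  end.
Ltac abel_idx same x l :=
  lazymatch l with
  | cons ?y ?t => match constr:(Set) with
      | _ => let _ := match constr:(Set) with _ => same x y end in constr:(O)
      | _ => let n := abel_idx same x t in constr:(S n) end
  end.
Ltac abel_reify same t l :=
  lazymatch t with
  | (?a + ?b)%R => let x := abel_reify same a l in let y := abel_reify same b l in constr:(AbAdd x y)
  | (- ?a)%R => let x := abel_reify same a l in constr:(AbOpp x)
  | 0%R => constr:(AbZero)
  | ?x => let n := abel_idx same x l in constr:(AbVar n)
  end.
Ltac abel_with same :=
  lazymatch goal with
  | |- @eq ?T ?x ?y =>
    let l0 := abel_env same x (@nil T) in let l := abel_env same y l0 in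
    let e1 := abel_reify same x l in let e2 := abel_reify same y l in
    exact (@abelP _ l e1 e2 isT)
  end.
Ltac abel_unify x y := unify x y.
Ltac abel_syn x y :=
  first [ constr_eq x y
        | lazymatch x with
          | (?a *: ?b)%R => lazymatch y with (?c *: ?d)%R => abel_syn a c; abel_syn b d end
          | (?a *m ?b)%R => lazymatch y with (?c *m ?d)%R => abel_syn a c; abel_syn b d end
          end ].
(* Atoms of [abel] are compared up to conversion, those of [abels] syntactically up to instances. *)
Ltac abel := abel_with abel_unify.
Ltac abels := abel_with abel_syn.

(** * Operator bounds on 2 x 2 complex matrices *)

Section ComplexModulus.
Variable R : realType.
Notation C := (cplx R).
Implicit Types (z w : C) (r s : R).

Definition rc r : C := (r%:C)%C.
(** Norms take values in [C] itself; as a real number the modulus is open to ordered field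
    arithmetic. *)
Definition cn z : R := complex.Re `|z|.

Lemma cnE z : `|z| = rc (cn z).
Proof. by case: z => a b. Qed.
Lemma cn_ge0 z : 0 <= cn z.
Proof. by case: z => a b; rewrite /cn /= sqrtr_ge0. Qed.
Lemma rc_inj : injective rc.
Proof. by move=> a b []. Qed.
Lemma rcD r s : rc (r + s) = rc r + rc s.
Proof. by rewrite /rc rmorphD. Qed.
Lemma rcM r s : rc (r * s) = rc r * rc s.
Proof. by rewrite /rc rmorphM. Qed.
Lemma rcN r : rc (- r) = - rc r.
Proof. by rewrite /rc rmorphN. Qed.
Lemma rc1 : rc 1 = 1.
Proof. by []. Qed.
Lemma rc0 : rc 0 = 0.
Proof. by []. Qed.
Lemma rc_conj r : Num.conj (rc r) = rc r.
Proof. by apply/eqP; rewrite eq_complex /= eqxx oppr0 eqxx. Qed.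
Lemma rcV r : rc (r^-1) = (rc r)^-1.
Proof. by rewrite /rc fmorphV. Qed.
Lemma ler_rc r s : (rc r <= rc s) = (r <= s).
Proof. by rewrite /rc lecR. Qed.
Lemma ltr_rc r s : (rc r < rc s) = (r < s).
Proof. by rewrite /rc ltcR. Qed.
Lemma rc_ge0 r : (0 <= rc r) = (0 <= r).
Proof. by rewrite -rc0 ler_rc. Qed.
Lemma rc_gt0 r : (0 < rc r) = (0 < r).
Proof. by rewrite -rc0 ltr_rc. Qed.
Lemma posC (e : C) : 0 < e -> exists2 r, 0 < r & e = rc r.
Proof.
case: e => a b; rewrite ltcE /= => /andP[/eqP b0 a0]; exists a => //.
by rewrite /rc b0.
Qed.

Lemma cnM z w : cn (z * w) = cn z * cn w.
Proof. by apply: rc_inj; rewrite rcM -!cnE normrM. Qed.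
Lemma cnD z w : cn (z + w) <= cn z + cn w.
Proof. by rewrite -ler_rc rcD -!cnE ler_normD. Qed.
Lemma cnN z : cn (- z) = cn z.
Proof. by rewrite /cn normrN. Qed.
Lemma cnB z w : cn (z - w) = cn (w - z).
Proof. by rewrite /cn distrC. Qed.
Lemma cn0 : cn 0 = 0.
Proof. by rewrite /cn normr0. Qed.
Lemma cn1 : cn 1 = 1.
Proof. by rewrite /cn normr1. Qed.
Lemma cn_rc r : cn (rc r) = `|r|.
Proof. by rewrite /cn /rc normc_def /= expr0n addr0 sqrtr_sqr. Qed.
Lemma cnV z : cn z^-1 = (cn z)^-1.
Proof. by apply: rc_inj; rewrite rcV -!cnE normfV. Qed.
Lemma cn_conj z : cn (Num.conj z) = cn z.
Proof. by rewrite /cn norm_conjC. Qed.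
Lemma cn_eq0 z : (cn z == 0) = (z == 0).
Proof. by rewrite -(inj_eq rc_inj) -cnE normr_eq0. Qed.
Lemma cn_conjM z : Num.conj z * z = rc (cn z ^+ 2).
Proof. by rewrite mulrC -normCK cnE expr2 -rcM -expr2. Qed.
Lemma cn_Re z : `|complex.Re z| <= cn z.
Proof.
case: z => a b; rewrite /cn /= -sqrtr_sqr ler_wsqrtr // lerDl sqr_ge0 //.
Qed.
Lemma cn_Im z : `|complex.Im z| <= cn z.
Proof.
case: z => a b; rewrite /cn /= -sqrtr_sqr ler_wsqrtr // lerDr sqr_ge0 //.
Qed.
Lemma cn_ReIm z : cn z <= `|complex.Re z| + `|complex.Im z|.
Proof.
have -> : z = rc (complex.Re z) + (0 +i* 1)%C * rc (complex.Im z).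
  by case: z => a b; apply/eqP; rewrite eq_complex /=; apply/andP; split; apply/eqP; ring.
apply: le_trans (cnD _ _) _; rewrite cnM !cn_rc.
have -> : cn (0 +i* 1)%C = 1.
  by rewrite /cn /= expr0n add0r expr1n sqrtr1.
by case: z => a b /=; rewrite mul1r !(mul0r, mul1r, mulr0, addr0, subr0, oppr0, add0r).
Qed.
End ComplexModulus.

Section OperatorBound.
Variable R : realType.
Notation C := (cplx R).
Notation M := 'M[C]_2.
Implicit Types (m : M) (v w : 'cV[C]_2) (r s : R).

Definition sqn v : R := cn (v 0 0) ^+ 2 + cn (v 1 0) ^+ 2.
Definition vn v : R := Num.sqrt (sqn v).

Lemma sqn_ge0 v : 0 <= sqn v.
Proof. by rewrite addr_ge0 // sqr_ge0. Qed.
Lemma vn_ge0 v : 0 <= vn v. Proof. exact: sqrtr_ge0. Qed.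
Lemma vn_sq v : vn v ^+ 2 = sqn v.
Proof. by rewrite sqr_sqrtr // sqn_ge0. Qed.
Lemma vn_eq0 v : vn v = 0 -> v = 0.
Proof.
move=> v0; have := vn_sq v; rewrite v0 expr0n /sqn => /esym/eqP.
rewrite paddr_eq0 ?sqr_ge0 // !sqrf_eq0 !cn_eq0 => /andP[/eqP h0 /eqP h1].
by apply/matrixP => i j; rewrite mxE !ord1; case: i => [[|[]]] // p;
  [rewrite -[RHS]h0|rewrite -[RHS]h1]; congr (v _ _); apply: val_inj.
Qed.

Lemma le_sqr_norm (a b : R) : 0 <= b -> a ^+ 2 <= b ^+ 2 -> a <= b.
Proof. by move=> b0 h; nra. Qed.

Definition adj m : M := map_mx Num.conj m^T.

Lemma adjE m i j : adj m i j = Num.conj (m j i).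
Proof. by rewrite !mxE. Qed.
Lemma adjK : involutive adj.
Proof. by move=> m; apply/matrixP => i j; rewrite !adjE conjCK. Qed.
Lemma adjD m m' : adj (m + m') = adj m + adj m'.
Proof. by apply/matrixP => i j; rewrite !mxE rmorphD. Qed.
Lemma adjN m : adj (- m) = - adj m.
Proof. by apply/matrixP => i j; rewrite !mxE rmorphN. Qed.
Lemma adjZ (a : C) m : adj (a *: m) = Num.conj a *: adj m.
Proof. by apply/matrixP => i j; rewrite !mxE rmorphM. Qed.
Lemma adjM m m' : adj (m *m m') = adj m' *m adj m.
Proof. by rewrite /adj trmx_mul map_mxM. Qed.
Lemma adj1 : adj 1%:M = 1%:M.
Proof. by rewrite /adj trmx1 map_mx1. Qed.

Definition dotp v w : C := Num.conj (w 0 0) * v 0 0 + Num.conj (w 1 0) * v 1 0.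

Lemma dotpp v : dotp v v = rc (vn v ^+ 2).
Proof. by rewrite /dotp !cn_conjM -rcD vn_sq. Qed.

Lemma CS v w : cn (dotp v w) <= vn v * vn w.
Proof.
apply: le_sqr_norm; first by rewrite mulr_ge0 ?vn_ge0.
rewrite exprMn !vn_sq /sqn.
have h : cn (dotp v w) <= cn (w 0 0) * cn (v 0 0) + cn (w 1 0) * cn (v 1 0).
  by rewrite (le_trans (cnD _ _)) // !cnM !cn_conj.
have := cn_ge0 (dotp v w); have := cn_ge0 (w 0 0); have := cn_ge0 (w 1 0).
have := cn_ge0 (v 0 0); have := cn_ge0 (v 1 0).
move: h; move: (cn _) (cn _) (cn _) (cn _) (cn _) => a b c d e h e0 b0 d0 c0 a0.
have k : e ^+ 2 <= (d * c + b * a) ^+ 2 by rewrite ler_sqr ?nnegrE ?addr_ge0 ?mulr_ge0.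
apply: le_trans k _; rewrite -subr_ge0.
have -> : (c ^+ 2 + a ^+ 2) * (d ^+ 2 + b ^+ 2) - (d * c + b * a) ^+ 2 = (c * b - a * d) ^+ 2 by ring.
exact: sqr_ge0.
Qed.

Lemma mulmx2E (m : M) v i : (m *m v) i 0 = m i 0 * v 0 0 + m i 1 * v 1 0.
Proof. by rewrite mxE !big_ord_recl big_ord0 addr0; congr (_ * v _ _ + m _ _ * v _ _); apply: val_inj. Qed.

Lemma dotp_adj m v w : dotp (m *m v) w = dotp v (adj m *m w).
Proof.
rewrite /dotp !mulmx2E !adjE !rmorphD !rmorphM /= !conjCK; ring.
Qed.

Lemma dotpD v v' : dotp (v + v') (v + v') = dotp v v + dotp v v' + dotp v' v + dotp v' v'.
Proof. by rewrite /dotp !mxE !rmorphD /=; ring. Qed.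

Lemma vnD v w : vn (v + w) <= vn v + vn w.
Proof.
apply: le_sqr_norm; first by rewrite addr_ge0 ?vn_ge0.
have h : vn (v + w) ^+ 2 = vn v ^+ 2 + complex.Re (dotp v w) + complex.Re (dotp w v) + vn w ^+ 2.
  have := dotpD v w; rewrite !dotpp => /(congr1 (@complex.Re R)) /= ->.
  by case: (dotp v w) (dotp w v) => a b [c d].
have := CS v w; have := CS w v; have := cn_Re (dotp v w); have := cn_Re (dotp w v).
have := ler_norm (complex.Re (dotp v w)); have := ler_norm (complex.Re (dotp w v)).
by have := vn_ge0 v; have := vn_ge0 w; rewrite h; nra.
Qed.

Lemma vnZ (a : C) v : vn (a *: v) = cn a * vn v.
Proof.
have -> : vn (a *: v) = Num.sqrt (cn a ^+ 2 * sqn v).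
  by rewrite /vn /sqn !mxE !cnM; congr Num.sqrt; ring.
by rewrite sqrtrM ?sqr_ge0 // sqrtr_sqr ger0_norm ?cn_ge0.
Qed.

(** The operator norm for the Euclidean norm, given by its upper bounds. It is the norm for which
    the C*-identity holds. *)
Definition bd r m := forall v, vn (m *m v) <= r * vn v.

Lemma bd_le r s m : r <= s -> bd r m -> bd s m.
Proof. by move=> rs h v; apply: le_trans (h v) _; rewrite ler_wpM2r ?vn_ge0. Qed.
Lemma bdD r s m m' : bd r m -> bd s m' -> bd (r + s) (m + m').
Proof. by move=> h h' v; rewrite mulmxDl mulrDl (le_trans (vnD _ _)) // lerD. Qed.
Lemma bdZ r (a : C) m : bd r m -> bd (cn a * r) (a *: m).
Proof. by move=> h v; rewrite -scalemxAl vnZ -mulrA ler_wpM2l ?cn_ge0. Qed.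
Lemma bdN r m : bd r m -> bd r (- m).
Proof. by move=> /(bdZ (-1)); rewrite cnN cn1 mul1r scaleN1r. Qed.
Lemma bdB r s m m' : bd r m -> bd s m' -> bd (r + s) (m - m').
Proof. by move=> h h'; apply: bdD => //; apply: bdN. Qed.
Lemma bdC r m m' : bd r (m - m') -> bd r (m' - m).
Proof. by move=> /bdN; rewrite opprB. Qed.
Lemma bdM r s m m' : 0 <= r -> bd r m -> bd s m' -> bd (r * s) (m *m m').
Proof.
move=> r0 h h' v; rewrite -mulmxA (le_trans (h _)) // -mulrA ler_wpM2l //.
Qed.
Lemma bd1 : bd 1 1%:M.
Proof. by move=> v; rewrite mul1mx mul1r. Qed.
Lemma bd0 : bd 0 0.
Proof. by move=> v; rewrite mul0mx mul0r /vn /sqn !mxE cn0 expr0n addr0 sqrtr0. Qed.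
Lemma bd0' r : 0 <= r -> bd r 0.
Proof. by move=> r0; apply: bd_le bd0. Qed.
(** Cauchy-Schwarz for [|w|^2 = <m w, v>] with [w = adj m v], followed by cancelling [|w|]. *)
Lemma bd_adj r m : 0 <= r -> bd r m -> bd r (adj m).
Proof.
move=> r0 h v; set w := adj m *m v.
have e : vn w ^+ 2 = cn (dotp (m *m w) v).
  by rewrite dotp_adj -/w dotpp cn_rc ger0_norm // sqr_ge0.
have := CS (m *m w) v; rewrite -e => h1; have h2 := h w.
have w0 := vn_ge0 w; have v0 := vn_ge0 v.
have [->|wn0] := eqVneq (vn w) 0; first by rewrite mulr_ge0.
have wp : 0 < vn w by rewrite lt_def wn0.
by rewrite -(ler_pM2l wp); nra.
Qed.
(** [|m v|^2] is the inner product of [adj m m v] with [v]. If [s < 0], the hypothesis leaves only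
    [v = 0]. *)
Lemma bd_cstar s m : bd s (adj m *m m) -> bd (Num.sqrt s) m.
Proof.
move=> h v; have [s0|s0] := leP 0 s; last first.
  have : vn v = 0.
    by have := h v; have := vn_ge0 ((adj m *m m) *m v); have := vn_ge0 v; nra.
  move=> /vn_eq0 ->; rewrite mulmx0.
  have -> : vn (0 : 'cV[C]_2) = 0 by rewrite /vn /sqn !mxE cn0 expr0n addr0 sqrtr0.
  by rewrite mulr0.
apply: le_sqr_norm; first by rewrite mulr_ge0 ?sqrtr_ge0 ?vn_ge0.
have e : vn (m *m v) ^+ 2 = cn (dotp ((adj m *m m) *m v) v).
  have := cn_rc (vn (m *m v) ^+ 2); rewrite -dotpp ger0_norm ?sqr_ge0 // => <-.
  by rewrite -mulmxA [in RHS]dotp_adj adjK.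
rewrite e exprMn sqr_sqrtr // (le_trans (CS _ _)) //.
by have := h v; have := vn_ge0 v; nra.
Qed.
Lemma bd_closed r m : (forall e, 0 < e -> bd (r + e) m) -> bd r m.
Proof.
move=> h v; apply/ler_addgt0Pr => e e0.
have v0 := vn_ge0 v.
have [z|vn0] := eqVneq (vn v) 0.
  by have := h 1 ltr01 v; rewrite z !mulr0 add0r => /le_trans; apply; exact: ltW.
have vp : 0 < vn v by rewrite lt_def vn0.
by have := h (e / vn v) (divr_gt0 e0 vp) v; rewrite mulrDl divfK.
Qed.
Lemma bd_entry r m i j : bd r m -> cn (m i j) <= r.
Proof.
move=> /(_ (delta_mx j 0)); rewrite -colE.
have -> : vn (delta_mx j 0) = 1.
  rewrite /vn /sqn !mxE; case: j => [[|[]]] // p /=;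
  by rewrite ?cn1 ?cn0 expr1n expr0n ?addr0 ?add0r sqrtr1.
rewrite mulr1; apply: le_trans.
have [i0|i1] : i = 0 \/ i = 1 by case: i => [[|[]]] // p; [left|right]; apply: val_inj.
  rewrite i0; apply: le_sqr_norm; first exact: vn_ge0.
  by rewrite vn_sq /sqn !mxE; have := sqr_ge0 (cn (m 1 j)); lra.
rewrite i1; apply: le_sqr_norm; first exact: vn_ge0.
by rewrite vn_sq /sqn !mxE; have := sqr_ge0 (cn (m 0 j)); lra.
Qed.
Lemma bd_eq0 m : bd 0 m -> m = 0.
Proof.
move=> h; apply/matrixP => i j; rewrite mxE; apply/eqP; rewrite -cn_eq0.
by rewrite eq_le cn_ge0 (bd_entry _ _ h).
Qed.
Lemma entry_bd r m : 0 <= r -> (forall i j, cn (m i j) <= r) -> bd (2 * r) m.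
Proof.
move=> r0 h v.
have hi i : cn ((m *m v) i 0) <= r * (cn (v 0 0) + cn (v 1 0)).
  rewrite mulmx2E (le_trans (cnD _ _)) // !cnM mulrDr lerD // ler_wpM2r ?cn_ge0 //.
apply: le_sqr_norm; first by rewrite !mulr_ge0 ?vn_ge0.
rewrite exprMn !vn_sq /sqn.
have := hi 0; have := hi 1; have := cn_ge0 ((m *m v) 0 0); have := cn_ge0 ((m *m v) 1 0).
have := cn_ge0 (v 0 0); have := cn_ge0 (v 1 0).
move: (cn _) (cn _) (cn _) (cn _) => a b c d c0 d0 b0 a0 ha hb.
have q : (r * (d + c)) ^+ 2 <= 2 * r ^+ 2 * (d ^+ 2 + c ^+ 2).
  by have := sqr_ge0 (d - c); have := sqr_ge0 r; nra.
have qa : a ^+ 2 <= (r * (d + c)) ^+ 2 by nra.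
have qb : b ^+ 2 <= (r * (d + c)) ^+ 2 by nra.
by lra.
Qed.
End OperatorBound.

(** * C*-algebras of bounded matrix valued functions *)

(** These closure properties make a set of bounded functions a unital C*-algebra under the supremum
    of the operator norms. [E], the subalgebras over finite sets and the blocks are all
    instances. *)
Record csub (R : realType) (T : Type) := CSub {
  cs_pred : (T -> 'M[cplx R]_2) -> Prop;
  cs_bd : forall f, cs_pred f -> exists r, forall t, bd r (f t);
  cs_lin : forall a f g, cs_pred f -> cs_pred g ->
    cs_pred (fun t => a *: f t + g t);
  cs_one : cs_pred (fun=> 1%:M);
  cs_mul : forall f g, cs_pred f -> cs_pred g -> cs_pred (fun t => f t *m g t);
  cs_star : forall f, cs_pred f -> cs_pred (fun t => adj (f t));
  cs_lim : forall f, (forall e, 0 < e -> exists2 g, cs_pred g &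
    forall t, bd e (f t - g t)) -> cs_pred f }.

Section Carrier.
Variables (R : realType) (T : Type) (P : csub R T).
Notation C := (cplx R).

Definition carrier := {f : T -> 'M[C]_2 | `[< cs_pred P f >]}.
HB.instance Definition _ := SubChoice.on carrier.
Implicit Types f g h : carrier.

Lemma carrierP f : cs_pred P (val f).
Proof. by case: f => f /= /asboolP. Qed.
Lemma carrier_eqP f g : (forall t, val f t = val g t) -> f = g.
Proof. by move=> h; apply/val_inj/funext. Qed.
Definition mkcar (f : T -> 'M[C]_2) (h : cs_pred P f) : carrier :=
  exist (fun u : T -> 'M[C]_2 => is_true `[< cs_pred P u >]) f (asboolT h).

Lemma cs_zero : cs_pred P (fun=> 0).
Proof.
have := cs_lin (-1) (cs_one P) (cs_one P).
by under eq_fun => t do rewrite scaleN1r addNr.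
Qed.
Lemma cs_add f g : cs_pred P (fun t => val f t + val g t).
Proof.
have := cs_lin 1 (carrierP f) (carrierP g).
by under eq_fun => t do rewrite scale1r.
Qed.
Lemma cs_scale a f : cs_pred P (fun t => a *: val f t).
Proof.
have := cs_lin a (carrierP f) cs_zero.
by under eq_fun => t do rewrite addr0.
Qed.
Lemma cs_opp f : cs_pred P (fun t => - val f t).
Proof.
have := cs_scale (-1) f.
by under eq_fun => t do rewrite scaleN1r.
Qed.

Definition car0 := mkcar cs_zero.
Definition carD f g := mkcar (cs_add f g).
Definition carN f := mkcar (cs_opp f).
Definition carZ a f := mkcar (cs_scale a f).
Definition carM f g := mkcar (cs_mul (carrierP f) (carrierP g)).
Definition carS f := mkcar (cs_star (carrierP f)).
Definition car1 := mkcar (cs_one P).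

Lemma carDA : associative carD.
Proof. by move=> f g h; apply: carrier_eqP => t /=; rewrite addrA. Qed.
Lemma carDC : commutative carD.
Proof. by move=> f g; apply: carrier_eqP => t /=; rewrite addrC. Qed.
Lemma car0D : left_id car0 carD.
Proof. by move=> f; apply: carrier_eqP => t /=; rewrite add0r. Qed.
Lemma carND : left_inverse car0 carN carD.
Proof. by move=> f; apply: carrier_eqP => t /=; rewrite addNr. Qed.
HB.instance Definition _ := GRing.isZmodule.Build carrier carDA carDC car0D carND.

Lemma carZA a b f : carZ a (carZ b f) = carZ (a * b) f.
Proof. by apply: carrier_eqP => t /=; rewrite scalerA. Qed.
Lemma carZ1 : left_id 1 carZ.
Proof. by move=> f; apply: carrier_eqP => t /=; rewrite scale1r. Qed.
Lemma carZDr : right_distributive carZ +%R.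
Proof. by move=> a f g; apply: carrier_eqP => t /=; rewrite scalerDr. Qed.
Lemma carZDl f : {morph carZ^~ f : a b / a + b}.
Proof. by move=> a b; apply: carrier_eqP => t /=; rewrite scalerDl. Qed.
HB.instance Definition _ :=
  GRing.Zmodule_isLmodule.Build C carrier carZA carZ1 carZDr carZDl.

Lemma carMA : associative carM.
Proof. by move=> f g h; apply: carrier_eqP => t /=; rewrite mulmxA. Qed.
Lemma carMDl : left_distributive carM +%R.
Proof. by move=> f g h; apply: carrier_eqP => t /=; rewrite mulmxDl. Qed.
Lemma carMDr : right_distributive carM +%R.
Proof. by move=> f g h; apply: carrier_eqP => t /=; rewrite mulmxDr. Qed.
HB.instance Definition _ := Zmodule_isRng.Build carrier carMA carMDl carMDr.
Lemma car1M : left_id car1 carM.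
Proof. by move=> f; apply: carrier_eqP => t /=; rewrite mul1mx. Qed.
Lemma carM1 : right_id car1 carM.
Proof. by move=> f; apply: carrier_eqP => t /=; rewrite mulmx1. Qed.
HB.instance Definition _ := Rng_hasOne.Build carrier car1M carM1.

(** The norm is the infimum of the uniform bounds; [0 <= r] bounds this set from below, also when
    [T] is empty. *)
Definition car_bounds f : set R := [set r | 0 <= r /\ forall t, bd r (val f t)].
Definition car_norm f : R := inf (car_bounds f).

Lemma car_bounds_inf f : has_inf (car_bounds f).
Proof.
split; last by exists 0 => r [].
have [r hr] := cs_bd (carrierP f); exists (Num.max r 0); split=> [|t].
  by rewrite le_max lexx orbT.
by apply: bd_le (hr t); rewrite le_max lexx.
Qed.

Lemma car_norm_ge0 f : 0 <= car_norm f.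
Proof.
by apply: lb_le_inf; [have [] := car_bounds_inf f|move=> r []].
Qed.

Lemma car_norm_bd f t : bd (car_norm f) (val f t).
Proof.
apply: bd_closed => e e0.
have [r [_ hr] re] := inf_adherent e0 (car_bounds_inf f).
exact: bd_le (ltW re) (hr t).
Qed.

Lemma car_normP f r : 0 <= r -> (forall t, bd r (val f t)) -> car_norm f <= r.
Proof.
move=> r0 hr; apply: ge_inf; last by split.
by have [] := car_bounds_inf f.
Qed.

Lemma car_normD f g : rc (car_norm (f + g)) <= rc (car_norm f) + rc (car_norm g).
Proof.
rewrite -rcD ler_rc; apply: car_normP; first by rewrite addr_ge0 ?car_norm_ge0.
by move=> t; apply: bdD; apply: car_norm_bd.
Qed.
Lemma car_normZ (a : C) f : rc (car_norm (a *: f)) = `|a| * rc (car_norm f).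
Proof.
have le b k : car_norm (b *: k) <= cn b * car_norm k.
  apply: car_normP; first by rewrite mulr_ge0 ?car_norm_ge0 ?cn_ge0.
  by move=> t; apply/bdZ/car_norm_bd.
rewrite cnE -rcM; congr rc; apply/eqP; rewrite eq_le le /=.
have [->|a0] := eqVneq a 0; first by rewrite cn0 mul0r car_norm_ge0.
have := le a^-1 (a *: f); rewrite scalerA mulVf // scale1r cnV mulrC.
have ca : 0 < cn a by rewrite lt_def cn_eq0 a0 cn_ge0.
by rewrite ler_pdivlMr // mulrC.
Qed.
Lemma car_norm0 f : rc (car_norm f) = 0 -> f = 0.
Proof.
move=> f0; apply: carrier_eqP => t; apply: bd_eq0.
by have := car_norm_bd f t; rewrite (_ : car_norm f = 0) //; apply: rc_inj.
Qed.
HB.instance Definition _ := Lmodule_isNormed.Build C carrier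
  car_normD car_normZ car_norm0.

Lemma car_normE f : `|f| = rc (car_norm f).
Proof. by []. Qed.

Lemma car_ballP f g e : 0 < e -> ball f (rc e) g -> forall t, bd e (val f t - val g t).
Proof.
move=> e0; rewrite -ball_normE /ball_ /= car_normE ltr_rc => h t.
exact: bd_le (ltW h) (car_norm_bd (f - g) t).
Qed.

Lemma car_coord_cvg (F : set_system carrier) (FF : ProperFilter F) (phi : carrier -> R) :
  (forall f g, `|phi f - phi g| <= car_norm (f - g)) -> cauchy F ->
  cvg (phi @ F).
Proof.
move=> hphi Fc; apply: cauchy_cvg; apply: cauchy_exP => e e0.
have [f hf] := (cauchyP F).1 Fc (rc e) ltac:(by rewrite rc_gt0).
exists (phi f); suff : F [set g | ball (phi f) e (phi g)] by [].
apply: filterS hf => g; rewrite -ball_normE /ball_ /= car_normE ltr_rc => h.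
by rewrite /ball /= (le_lt_trans (hphi _ _)).
Qed.

Lemma ReB (z w : C) : complex.Re (z - w) = complex.Re z - complex.Re w.
Proof. by case: z w => a b []. Qed.
Lemma ImB (z w : C) : complex.Im (z - w) = complex.Im z - complex.Im w.
Proof. by case: z w => a b []. Qed.

(** Entries converge pointwise by [lipE]. A ball of the Cauchy filter serves all [t] at once, so the
    convergence is uniform and [cs_lim] applies. *)
Lemma car_complete (F : set_system carrier) : ProperFilter F -> cauchy F -> cvg F.
Proof.
move=> FF Fc.
have lipE t i j f g : cn (val f t i j - val g t i j) <= car_norm (f - g).
  by have := bd_entry i j (car_norm_bd (f - g) t); rewrite /= !mxE.
have cR t i j : cvg ((fun f : carrier => complex.Re (val f t i j)) @ F).
  apply: (@car_coord_cvg F FF) Fc => f g.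
  by rewrite -ReB (le_trans (cn_Re _)).
have cI t i j : cvg ((fun f : carrier => complex.Im (val f t i j)) @ F).
  apply: (@car_coord_cvg F FF) Fc => f g.
  by rewrite -ImB (le_trans (cn_Im _)).
pose L t : 'M[C]_2 := \matrix_(i, j)
  (lim ((fun f : carrier => complex.Re (val f t i j)) @ F) +i*
   lim ((fun f : carrier => complex.Im (val f t i j)) @ F))%C.
(* Members of one ball of radius [e] are at most [2 e] apart. The real and imaginary parts of the
   limit inherit this, so entries differ by at most [4 e] and matrices by at most [8 e]. *)
have key e : 0 < e -> exists2 f, F (ball f (rc e)) & forall g, ball f (rc e) g ->
    forall t, bd (8 * e) (L t - val g t).
  move=> e0; have [f hf] := (cauchyP F).1 Fc (rc e) ltac:(by rewrite rc_gt0).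
  exists f => // g hg t.
  have bdL h : ball f (rc e) h -> forall i j, cn (val h t i j - val g t i j) <= 2 * e.
    move=> hh i j; apply: le_trans (lipE _ _ _ _ _) _.
    apply: car_normP => [|t']; first by lra.
    have /= := bdB (car_ballP e0 hg t') (car_ballP e0 hh t').
    rewrite mulr_natl mulr2n; congr (bd _ _); rewrite /=.
    by rewrite opprB addrC addrA subrK.
  have -> : 8 * e = 2 * (4 * e) by lra.
  apply: entry_bd => [|i j]; first by lra.
  rewrite !mxE; apply: le_trans (cn_ReIm _) _; rewrite ReB ImB /=.
  have -> : 4 * e = 2 * e + 2 * e by lra.
  have cl (phi : carrier -> R) (l : R) : cvg (phi @ F) ->
      (forall h, ball f (rc e) h -> `|phi h - l| <= 2 * e) -> `|lim (phi @ F) - l| <= 2 * e.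
    move=> cphi hphi; rewrite ler_distl; apply/andP; split.
      apply: limr_ge => //; apply: filterS hf => h /hphi.
      by rewrite ler_distl => /andP[].
    apply: limr_le => //; apply: filterS hf => h /hphi.
    by rewrite ler_distl => /andP[].
  apply: lerD; apply: cl; [exact: cR| |exact: cI|].
    by move=> h hh; rewrite -ReB (le_trans (cn_Re _)) // bdL.
  by move=> h hh; rewrite -ImB (le_trans (cn_Im _)) // bdL.
have PL : cs_pred P L.
  apply: cs_lim => e e0.
  have [f _ hf] := key (e / 8) (divr_gt0 e0 (ltr0n R 8)).
  exists (val f); first exact: carrierP.
  move=> t; have := hf f _ t; rewrite [8 * _]mulrC divfK ?pnatr_eq0 //; apply.
  by apply: ballxx; rewrite rc_gt0 divr_gt0.
apply: (@cvgP _ _ (mkcar PL)); apply/cvg_ballP => e /posC[r r0 ->].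
have [f Ff hf] := key (r / 16) (divr_gt0 r0 (ltr0n R 16)).
apply: filterS Ff => g hg; rewrite -ball_normE /ball_ /= car_normE ltr_rc.
apply: (@le_lt_trans _ _ (8 * (r / 16))); last by lra.
apply: car_normP => [|t /=]; first by lra.
exact: hf.
Qed.
HB.instance Definition _ := Uniform_isComplete.Build carrier car_complete.

Lemma car_rscalerAl (a : C) f g : a *: (f ** g) = (a *: f) ** g.
Proof. by apply: carrier_eqP => t /=; rewrite scalemxAl. Qed.
Lemma car_rscalerAr (a : C) f g : a *: (f ** g) = f ** (a *: g).
Proof. by apply: carrier_eqP => t /=; rewrite scalemxAr. Qed.
Lemma car_starK : involutive carS.
Proof. by move=> f; apply: carrier_eqP => t /=; rewrite adjK. Qed.
Lemma car_starD : {morph carS : x y / x + y}.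
Proof. by move=> f g; apply: carrier_eqP => t /=; rewrite adjD. Qed.
Lemma car_starZ (a : C) f : carS (a *: f) = Num.conj a *: carS f.
Proof. by apply: carrier_eqP => t /=; rewrite adjZ. Qed.
Lemma car_starM f g : carS (f ** g) = carS g ** carS f.
Proof. by apply: carrier_eqP => t /=; rewrite adjM. Qed.
Lemma car_normM f g : `|f ** g| <= `|f| * `|g|.
Proof.
rewrite !car_normE -rcM ler_rc; apply: car_normP.
  by rewrite mulr_ge0 ?car_norm_ge0.
by move=> t; apply: bdM; rewrite ?car_norm_ge0 //; apply: car_norm_bd.
Qed.
Lemma car_norm_star f : `|carS f ** f| = `|f| ^+ 2.
Proof.
rewrite !car_normE expr2 -rcM; congr rc; apply/eqP; rewrite eq_le; apply/andP; split.
  apply: car_normP => [|t]; first by rewrite mulr_ge0 ?car_norm_ge0.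
  apply: bdM; rewrite ?car_norm_ge0 //; last exact: car_norm_bd.
  by apply: bd_adj; rewrite ?car_norm_ge0 //; apply: car_norm_bd.
have h : car_norm f <= Num.sqrt (car_norm (carS f ** f)).
  apply: car_normP; first exact: sqrtr_ge0.
  by move=> t; apply: bd_cstar; exact: (car_norm_bd (carS f ** f)).
rewrite -[leRHS]sqr_sqrtr ?car_norm_ge0 // -expr2 ler_sqr ?nnegrE //.
exact: car_norm_ge0.
Qed.
HB.instance Definition _ := isCstarAlgebra.Build R carrier car_rscalerAl
  car_rscalerAr car_starK car_starD car_starZ car_starM car_normM car_norm_star.
End Carrier.

(** * Alephs and free triples *)

Section Cardinals.
Local Open Scope card_scope.

Lemma card_le_of T U (A : set T) (B : set U) (f : T -> U) :
  (forall x, A x -> B (f x)) ->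
  (forall x y, A x -> A y -> f x = f y -> x = y) -> A #<= B.
Proof.
move=> fAB finj.
have [g] : $|{injfun A >-> B}|.
  apply/injfunPex; exists f => // x y /set_mem Ax /set_mem Ay; exact: finj.
exact: inj_card_le g.
Qed.

Lemma card_le_to T U (A : set T) (B : set U) (b : U) : A #<= B ->
  exists f : T -> U, (forall x, A x -> B (f x)) /\
    forall x y, A x -> A y -> f x = f y -> x = y.
Proof.
move=> /card_leP[f].
exists (fun x => if pselect (A x) is left h then set_val (f (SigSub (mem_set h))) else b).
split=> [x Ax|x y Ax Ay].
  by case: pselect => // h; apply: set_mem; exact: (valP (f _)).
case: pselect => // hx; case: pselect => // hy /val_inj.
by move=> /(@inj _ _ _ f _ _ (mem_set I) (mem_set I)) [].
Qed.

Lemma card_le_ne T U (A : set T) (B : set U) x : A #<= B -> A x -> exists y, B y.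
Proof.
move=> /card_leP[f] Ax; exists (set_val (f (SigSub (mem_set Ax)))).
by apply: set_mem; exact: (valP (f _)).
Qed.

Lemma cardLE0 T U (A : set T) (B : set U) : ~ (exists x, A x) -> A #<= B.
Proof.
by move=> h; rewrite (_ : A = set0) ?card_ge0 //; apply/seteqP; split=> // x Ax; apply: h; exists x.
Qed.

Lemma card_le_sur T U (A : set T) (B : set U) (r : U -> T -> Prop) :
  (forall x, A x -> exists2 y, B y & r y x) ->
  (forall y x x', A x -> A x' -> r y x -> r y x' -> x = x') -> A #<= B.
Proof.
move=> tot fn.
have [[x0 Ax0]|/cardLE0//] := pselect (exists x, A x).
have [y0 By0 _] := tot _ Ax0.
have /choice[f hf] : forall x, exists y, A x -> B y /\ r y x.
  move=> x; have [Ax|nAx] := pselect (A x).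
    by have [y By ryx] := tot _ Ax; exists y.
  by exists y0.
apply: (@card_le_of _ _ _ _ f) => [x Ax|x y Ax Ay e]; first exact: (hf _ Ax).1.
apply: (fn (f x)) => //; first exact: (hf _ Ax).2.
by rewrite e; exact: (hf _ Ay).2.
Qed.

(* Any maximal family of choice functions which pairwise differ at every
   coordinate maps onto some coordinate, and injects into all of them. *)
Lemma card_min (J T : Type) (A : J -> set T) (j0 : J) :
  exists j, forall k, A j #<= A k.
Proof.
have [[j jA]|nA] := pselect (exists j, A j = set0).
  by exists j => k; rewrite jA card_ge0.
have ne j : exists x, A j x.
  apply: contrapT => h; apply: nA; exists j.
  by apply/seteqP; split=> // x Ax; apply: h; exists x.
pose P (G : set (J -> T)) := (forall g, G g -> forall j, A j (g j)) /\
  forall g h j, G g -> G h -> g j = h j -> g = h.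
have [|G [[GA Gd] Gmax]] := @Zorn_bigcup _ P.
  move=> F FP tot; split=> [g [X FX Xg]|g h j [X FX Xg] [Y FY Yh]].
    exact: (FP _ FX).1.
  by case: (tot _ _ FX FY) => sub;
    [apply: (FP _ FY).2 => //; exact: sub|apply: (FP _ FX).2 => //; exact: sub].
have [j hj] : exists j, forall x, A j x -> exists2 g, G g & g j = x.
  apply: contrapT => h.
  have /choice[g hg] : forall j, exists x, A j x /\ forall g, G g -> g j <> x.
    move=> j; apply: contrapT => hj; apply: h; exists j => x Ax.
    apply: contrapT => hx; apply: hj; exists x; split=> // g Gg gx.
    by apply: hx; exists g.
  have Gng : ~ G g by move=> Gg; exact: (hg j0).2 Gg erefl.
  apply: (Gmax (G `|` [set g])).
    by split=> [x Gx|/(_ g)]; [left|move=> /(_ (or_intror erefl))].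
  split=> [k [/GA//|->] j|k l j [Gk|->] [Gl|->]] //.
  - exact: (hg j).1.
  - exact: Gd.
  - by move=> e; have := (hg j).2 _ Gk e.
  - by move=> e; have := (hg j).2 _ Gl (esym e).
exists j => k.
apply: (@card_le_sur _ _ _ _ (fun y x => exists g, [/\ G g, g j = x & g k = y])).
  by move=> x /hj[g Gg gx]; exists (g k); [exact: GA|exists g].
move=> y x x' _ _ [g [Gg <- gy]] [h [Gh <- hy]].
by rewrite (Gd g h k) // gy hy.
Qed.

(** The two sets are copied into [T + U] so as to form one family, and [card_min] picks the smaller
    of them. *)
Lemma card_le_total T U (A : set T) (B : set U) : (A #<= B) \/ (B #<= A).
Proof.
pose F (b : bool) : set (T + U) := if b then inl @` A else inr @` B.
have eA : F true #<= A.
  apply: (@card_le_sur _ _ _ _ (fun a y => y = inl a)) => [_ [a Aa <-]|a x x' _ _ -> ->//].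
  by exists a.
have eB : F false #<= B.
  apply: (@card_le_sur _ _ _ _ (fun a y => y = inr a)) => [_ [a Aa <-]|a x x' _ _ -> ->//].
  by exists a.
have eA' : A #<= F true.
  by apply: (@card_le_of _ _ _ _ inl) => [x Ax|x y _ _ []//]; exists x.
have eB' : B #<= F false.
  by apply: (@card_le_of _ _ _ _ inr) => [x Ax|x y _ _ []//]; exists x.
have [[] h] := @card_min _ _ F true.
  by left; apply: card_le_trans eA' _; apply: card_le_trans (h false) eB.
by right; apply: card_le_trans eB' _; apply: card_le_trans (h true) eA.
Qed.

Lemma infinite_seq T (A : set T) : infinite_set A ->
  exists i : nat -> T, (forall n, A (i n)) /\ injective i.
Proof.
move=> Ai; have /infiniteP h := Ai.
have [x Ax] : exists x, A x.
  by apply: contrapT => nA; apply: Ai; rewrite (_ : A = set0) //; apply/seteqP; split=> // x Ax; apply: nA; exists x.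
have [i [iA ii]] := card_le_to x h.
by exists i; split=> [n|m n]; [exact: iA|exact: ii].
Qed.

Definition npair (m n : nat) : nat := choice.pickle (m, n).
Lemma npair_inj m n m' n' : npair m n = npair m' n' -> m = m' /\ n = n'.
Proof. by move=> /(pcan_inj (@choice.pickleK _))[-> ->]. Qed.

Definition pair_fun T (A : set T) (f : T -> T -> T) :=
  (forall x y, A x -> A y -> A (f x y)) /\
  forall x y x' y', A x -> A y -> A x' -> A y' -> f x y = f x' y' -> x = x' /\ y = y'.

(** Zorn's lemma for graphs of injections [D * D -> D] on subsets [D] of [A] that contain a fixed
    countable one. If [D] embedded in its complement by [h], the graph could be extended to the
    union of [D] and [h @] D[by sending the new pairs into]h @[D]. For a maximal graph the
    complement therefore embeds in [D], and then so does [A]. *)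
Lemma hessenberg T (A : set T) : infinite_set A -> exists f, pair_fun A f.
Proof.
move=> Ai; have [i [iA ii]] := infinite_seq Ai.
pose dom (G : set (T * T * T)) := [set x | exists y z, G (x, y, z)].
pose good (G : set (T * T * T)) :=
  [/\ dom G `<=` A,
      forall x y, dom G x -> dom G y -> exists2 z, dom G z & G (x, y, z),
      forall x y z, G (x, y, z) -> dom G y /\ dom G z,
      forall x y z z', G (x, y, z) -> G (x, y, z') -> z = z'
    & forall x y x' y' z, G (x, y, z) -> G (x', y', z) -> x = x' /\ y = y'].
pose G0 : set (T * T * T) :=
  [set p | exists m n, p = (i m, i n, i (npair m n))].
have G0dom x : dom G0 x <-> exists n, x = i n.
  split=> [[y [z [m [n [-> _ _]]]]]|[n ->]]; first by exists m.
  by exists (i 0%N), (i (npair n 0%N)), n, 0%N.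
have G0good : good G0.
  split.
  - by move=> x /G0dom[n ->].
  - move=> x y /G0dom[m ->] /G0dom[n ->]; exists (i (npair m n)); last by exists m, n.
    by apply/G0dom; exists (npair m n).
  - by move=> x y z [m [n [_ -> ->]]]; split; apply/G0dom; [exists n|exists (npair m n)].
  - by move=> x y z z' [m [n [-> -> ->]]] [m' [n' [/ii <- /ii <- ->]]].
  - move=> x y x' y' z [m [n [-> -> ->]]] [m' [n' [-> ->]]] /ii.
    by move=> /npair_inj[-> ->].
pose P G := G = set0 \/ (G0 `<=` G /\ good G).
have [|G [PG Gmax]] := @Zorn_bigcup _ P.
  move=> F FP tot.
  have [[X FX X0]|h] := pselect (exists2 X, F X & X !=set0); last first.
    left; apply/seteqP; split=> // x [X FX Xx]; apply: h; exists X => //; by exists x.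
  right; have gd Y : F Y -> Y !=set0 -> G0 `<=` Y /\ good Y.
    by move=> FY Y0; case: (FP _ FY) => // Y00; move: Y0; rewrite Y00 => -[].
  have up p q : (\bigcup_(X in F) X) p -> (\bigcup_(X in F) X) q ->
      exists Y, [/\ F Y, good Y, Y p & Y q].
    move=> [Y FY Yp] [Z FZ Zq]; case: (tot _ _ FY FZ) => sub.
      exists Z; split=> //; [by apply: (gd Z FZ _).2; exists q|exact: sub].
    by exists Y; split=> //; [apply: (gd Y FY _).2; exists p|exact: sub].
  have domU Y x : F Y -> dom Y x -> dom (\bigcup_(X in F) X) x.
    by move=> FY [y [z h]]; exists y, z, Y.
  split; first by move=> p G0p; exists X => //; exact: (gd X FX X0).1.
  split.
  - by move=> x [y [z [Y FY Yh]]]; have [h _ _ _ _] := (gd Y FY ltac:(by exists (x,y,z))).2; apply: h; exists y, z.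
  - move=> x x' [y [z h]] [y' [z' h']].
    have [Y [FY [_ h2 _ _ _] Yp Yq]] := up _ _ h h'.
    have [|| w dw Yw] := h2 x x'; [by exists y, z|by exists y', z'|].
    by exists w; [exact: domU dw|exists Y].
  - move=> x y z h; have [Y [FY [_ _ h3 _ _] Yp _]] := up _ _ h h.
    by have [d1 d2] := h3 _ _ _ Yp; split; exact: domU FY _.
  - move=> x y z z' h h'; have [Y [FY [_ _ _ h4 _] Yp Yq]] := up _ _ h h'.
    exact: h4 Yp Yq.
  - move=> x y x' y' z h h'; have [Y [FY [_ _ _ _ h5] Yp Yq]] := up _ _ h h'.
    exact: h5 Yp Yq.
have [G0G Gg] : G0 `<=` G /\ good G.
  case: PG => // Ge; exfalso; apply: (Gmax G0); last by right; split.
  rewrite Ge; split=> // /(_ (i 0%N, i 0%N, i (npair 0%N 0%N))); apply.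
  by exists 0%N, 0%N.
pose D := dom G; case: Gg => DA Gtot Gdom Gfun Ginj.
have iD n : D (i n) by exists (i n), (i (npair n n)); apply: G0G; exists n, n.
have /choice[f hf] : forall p, exists z, D p.1 -> D p.2 -> D z /\ G (p.1, p.2, z).
  move=> [x y] /=; have [Dx|nDx] := pselect (D x); last by exists x.
  have [Dy|nDy] := pselect (D y); last by exists x.
  by have [z dz Gz] := Gtot _ _ Dx Dy; exists z.
pose g x y := f (x, y).
have pg : pair_fun D g.
  split=> [x y Dx Dy|x y x' y' Dx Dy Dx' Dy' e]; first exact: (hf (x, y) Dx Dy).1.
  have /= h1 := (hf (x, y) Dx Dy).2; have /= h2 := (hf (x', y') Dx' Dy').2.
  by apply: Ginj h1 _; rewrite -/(g x y) e.
case: pg => gD gi.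
have [DAD|ADD] := card_le_total D (A `\` D).
  exfalso; have [h [hD hi]] := card_le_to (i 0%N) DAD.
  have /choice[q hq] : forall x, exists y, (D x -> y = x) /\ ((h @` D) x -> D y /\ h y = x).
    move=> x; have [Dx|nDx] := pselect (D x).
      exists x; split=> // -[y Dy yx]; exfalso; have [_] := hD _ Dy; by rewrite yx.
    have [[y Dy yx]|nh] := pselect ((h @` D) x); last by exists x.
    by exists y.
  pose E := D `|` (h @` D).
  pose b x : nat := if pselect (D x) is left _ then 0 else 1.
  have qD x : E x -> D (q x) by move=> [Dx|hx]; [rewrite (hq x).1|exact: ((hq x).2 hx).1].
  have qb x y : E x -> E y -> b x = b y -> q x = q y -> x = y.
    rewrite /b; move=> Ex Ey; case: pselect => Dx; case: pselect => Dy //.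
      by rewrite (hq x).1 // (hq y).1.
    case: Ex => // hx; case: Ey => // hy _ e.
    by rewrite -((hq x).2 hx).2 e ((hq y).2 hy).2.
  (* [q] pulls a coordinate back to [D] and the flag [b] remembers from which half it came; both are
     needed for injectivity. *)
  pose k x y := h (g (i (npair (b x) (b y))) (g (q x) (q y))).
  pose G' := G `|` [set p | E p.1.1 /\ E p.1.2 /\ ~ (D p.1.1 /\ D p.1.2) /\ p.2 = k p.1.1 p.1.2].
  have kD x y : E x -> E y -> (h @` D) (k x y).
    by move=> Ex Ey; exists (g (i (npair (b x) (b y))) (g (q x) (q y))) => //; apply: (gD) => //; apply: (gD); exact: qD.
  have nDh x : (h @` D) x -> ~ D x by move=> [y Dy <-]; have [] := hD _ Dy.
  have domG' x : dom G' x <-> E x.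
    split=> [[y [z [Gh|[Ex _]]]]|Ex]; [by left; exists y, z|by []|].
    have [Dx|nDx] := pselect (D x).
      by have [y [z Gh]] := Dx; exists y, z; left.
    by exists x, (k x x); right; split=> //; split=> //; split=> // -[].
  apply: (Gmax G').
    split=> [p Gp|sub]; first by left.
    have : G (h (i 0%N), h (i 0%N), k (h (i 0%N)) (h (i 0%N))).
      have hh : (h @` D) (h (i 0%N)) by exists (i 0%N).
      apply: sub; right; split; first by right.
      by split; [right|split=> // -[/(nDh _ hh)]].
    move=> Gh; have : D (h (i 0%N)) by exists (h (i 0%N)), (k (h (i 0%N)) (h (i 0%N))).
    by apply: nDh; exists (i 0%N).
  right; split=> [p /G0G|]; first by left.
  split.
  - by move=> x /domG'[/DA//|[y /hD[Ay _] <-]].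
  - move=> x y /domG' Ex /domG' Ey.
    have [[Dx Dy]|nD] := pselect (D x /\ D y).
      have [z Dz Gz] := Gtot _ _ Dx Dy; exists z; last by left.
      by apply/domG'; left.
    by exists (k x y); [apply/domG'; right; exact: kD|right].
  - move=> x y z [/Gdom[dy dz]|/= [Ex [Ey [_ ->]]]].
      by split; apply/domG'; left.
    by split; apply/domG' => //; right; exact: kD.
  - move=> x y z z' [Gz|/= [Ex [Ey [nD ->]]]] [Gz'|/= [_ [_ [nD' ->]]]] //.
    + exact: Gfun Gz Gz'.
    + by exfalso; apply: nD'; split; [exists y, z|exact: (Gdom _ _ _ Gz).1].
    + by exfalso; apply: nD; split; [exists y, z'|exact: (Gdom _ _ _ Gz').1].
  - move=> x y x' y' z [Gz|/= [Ex [Ey [nD ez]]]] [Gz'|/= [Ex' [Ey' [nD' ez']]]].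
    + exact: Ginj Gz Gz'.
    + exfalso; apply: (nDh z); last exact: (Gdom _ _ _ Gz).2.
      by rewrite ez'; exact: kD.
    + exfalso; apply: (nDh z); last exact: (Gdom _ _ _ Gz').2.
      by rewrite ez; exact: kD.
    + move: ez; rewrite ez' /k.
      have D2 u v : E u -> E v -> D (g (q u) (q v)) by move=> Eu Ev; apply: gD; exact: qD.
      have D3 u v n : E u -> E v -> D (g (i n) (g (q u) (q v))).
        by move=> Eu Ev; apply: gD => //; exact: D2.
      move=> /(hi _ _ (D3 _ _ _ Ex' Ey') (D3 _ _ _ Ex Ey)).
      move=> /(gi _ _ _ _ (iD _) (D2 _ _ Ex' Ey') (iD _) (D2 _ _ Ex Ey)) [].
      move=> /ii/npair_inj[bx by_] /(gi _ _ _ _ (qD _ Ex') (qD _ Ey') (qD _ Ex) (qD _ Ey)) [qx qy].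
      by split; apply/esym/qb.
have AD : A #<= D.
  have [h [hD hi]] := card_le_to (i 0%N) ADD.
  (* The two parts of [A] are kept apart by the tags [i 0] and [i 1]. *)
  pose c x := if pselect (D x) is left _ then g (i 0%N) x else g (i 1%N) (h x).
  apply: (@card_le_of _ _ _ _ c) => [x Ax|x y Ax Ay]; rewrite /c.
    by case: pselect => Dx; apply: gD => //; apply: hD.
  case: pselect => Dx; case: pselect => Dy.
  - by move=> /gi[].
  - by move=> /gi[] //; [exact: hD|move=> /ii].
  - by move=> /gi[] //; [exact: hD|move=> /ii].
  - by move=> /gi[] //; try exact: hD; move=> _ /hi -> //.
have [h [hD hi]] := card_le_to (i 0%N) AD.
exists (fun x y => g (h x) (h y)); split=> [x y Ax Ay|x y x' y' Ax Ay Ax' Ay'].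
  by apply: DA; apply: gD; exact: hD.
by move=> /gi[]; try exact: hD; move=> /hi-> // /hi ->.
Qed.

Lemma card_prod_le T (A : set T) : infinite_set A -> A `*` A #<= A.
Proof.
move=> /hessenberg[f [fA fi]].
apply: (@card_le_of _ _ _ _ (fun p => f p.1 p.2)) => [[x y] [] //|[x y] [x' y']]; first exact: fA.
by move=> [/= Ax Ay] [/= Ax' Ay'] /fi[] // -> ->.
Qed.

(** An element is coded by an index [u] and its position in [F u], and [B] absorbs a countable
    factor. *)
Lemma card_cover (T : choiceType) U V (A : set T) (D : set U) (B : set V) (F : U -> {fset T}) :
  infinite_set B -> D #<= B -> (forall x, A x -> exists2 u, D u & x \in F u) -> A #<= B.
Proof.
move=> Bi DB cov; have [i [iB ii]] := infinite_seq Bi.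
have [h [hB hi]] := card_le_to (i 0%N) DB.
have [f [fB fi]] := hessenberg Bi.
apply: (@card_le_sur _ _ _ _ (fun y x =>
  exists u n, [/\ D u, x \in F u, index x (F u) = n & y = f (h u) (i n)])).
  move=> x /cov[u Du xu]; exists (f (h u) (i (index x (F u)))); last by exists u, (index x (F u)).
  by apply: fB => //; exact: hB.
move=> y x x' _ _ [u [n [Du xu nu ->]]] [u' [n' [Du' xu' nu']]].
move=> /(fi _ _ _ _ (hB _ Du) (iB _) (hB _ Du') (iB _))[/(hi _ _ Du Du') uu /ii nn].
move: nu' xu'; rewrite -nn -nu -uu => e xu'.
by rewrite -(nth_index x xu) -(nth_index x xu') e.
Qed.

Lemma card_eq_transfer T U (A : set T) (B : set U) (a : T) (b : U) : A #= B ->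
  exists (f : T -> U) (g : U -> T), [/\ forall x, A x -> B (f x), forall y, B y -> A (g y),
    forall x, A x -> g (f x) = x & forall y, B y -> f (g y) = y].
Proof.
move=> /card_bijP[f [g gf fg]].
pose ff x := if pselect (A x) is left h then set_val (f (SigSub (mem_set h))) else b.
pose gg y := if pselect (B y) is left h then set_val (g (SigSub (mem_set h))) else a.
have ffE x (h : A x) : ff x = set_val (f (SigSub (mem_set h))).
  by rewrite /ff; case: pselect => // h'; rewrite (Prop_irrelevance h' h).
have ggE y (h : B y) : gg y = set_val (g (SigSub (mem_set h))).
  by rewrite /gg; case: pselect => // h'; rewrite (Prop_irrelevance h' h).
have ffB x : A x -> B (ff x).
  by move=> h; rewrite ffE; apply: set_mem; exact: (valP (f _)).
have ggA y : B y -> A (gg y).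
  by move=> h; rewrite ggE; apply: set_mem; exact: (valP (g _)).
exists ff, gg; split=> // [x Ax|y By].
- rewrite (ggE _ (ffB _ Ax)).
  have -> : SigSub (mem_set (ffB _ Ax)) = f (SigSub (mem_set Ax)).
    by apply: val_inj; rewrite /= ffE.
  by rewrite gf.
- rewrite (ffE _ (ggA _ By)).
  have -> : SigSub (mem_set (ggA _ By)) = g (SigSub (mem_set By)).
    by apply: val_inj; rewrite /= ggE.
  by rewrite fg.
Qed.

Lemma is_aleph_infinite n T (A : set T) : is_aleph n A -> infinite_set A.
Proof.
elim: n T A => [|n IH] T A /=.
  by move=> h; apply/infiniteP; rewrite (card_le_eqr h).
by move=> [B [/IH Bi BA _ _]]; exact: sub_infinite_set BA Bi.
Qed.

Lemma is_aleph_eq n T U (A : set T) (B : set U) : is_aleph n A -> A #= B -> is_aleph n B.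
Proof.
elim: n T U A B => [|n IH] T U A B /= hA AB.
  by rewrite -(card_eql AB).
have Ai := is_aleph_infinite (n := n.+1) hA.
have [i [iA _]] := infinite_seq Ai.
have AB' : A #<= B by rewrite (card_le_eqr (A := B) (B := A)) ?card_lexx // card_esym.
have [b _] := card_le_ne AB' (iA 0%N).
have [f [g [fB gA gf fg]]] := card_eq_transfer (i 0%N) b AB.
case: hA => A0 [hA0 A0A nA hC].
have fi x y : A x -> A y -> f x = f y -> x = y.
  by move=> Ax Ay e; rewrite -(gf x) // e gf.
have A0e : A0 #= f @` A0.
  rewrite card_eq_sym; apply: inj_card_eq => x y /set_mem /A0A Ax /set_mem /A0A Ay; exact: fi.
exists (f @` A0); split.
- exact: IH hA0 A0e.
- by move=> _ [x /A0A Ax <-]; exact: fB.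
- move=> h; apply: nA; rewrite (card_le_eqr A0e); exact: card_le_trans AB' h.
- move=> D DB.
  have e : D #= g @` D.
    rewrite card_eq_sym; apply: inj_card_eq => x y /set_mem /DB Bx /set_mem /DB By e.
    by rewrite -(fg x) // e fg.
  have [|h|h] := hC (g @` D).
  + by move=> _ [y /DB By <-]; exact: gA.
  + by left; rewrite (card_le_eql e) -(card_le_eqr A0e).
  + by right; rewrite (card_le_eqr e) -(card_le_eql AB).
Qed.

(** The next cardinal is represented by a subset of [set T] that does not embed in [K] and, by
    [card_min], has least cardinality among such subsets. *)
Lemma is_aleph_next n T (K : set T) : is_aleph n K ->
  exists (U : Type) (A : set U), is_aleph n.+1 A.
Proof.
move=> hK; have [i [iK _]] := infinite_seq (is_aleph_infinite hK).
pose J := {A : set (set T) | ~ (A #<= K)}.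
have j0 : J.
  (* Cantor's diagonal argument, for an injection of [set T] into [K]. *)
  exists setT => /(card_le_to (i 0%N))[f [_ fi]].
  pose X : set T := [set x | exists2 Y : set T, f Y = x & ~ Y x].
  have [h|h] := pselect (X (f X)).
    by have [Y /fi -> //] := h.
  by apply: (h); exists X.
have [A Amin] := card_min (fun A : J => sval A) j0.
exists (set T), (sval A).
have KA : K #<= sval A by case: (card_le_total (sval A) K) => // h; have := svalP A.
have [h [hA hi]] := card_le_to (set0 : set T) KA.
have Ke : K #= h @` K.
  by rewrite card_eq_sym; apply: inj_card_eq => x y /set_mem Kx /set_mem Ky; exact: hi.
exists (h @` K); split.
- exact: is_aleph_eq hK Ke.
- by move=> _ [x Kx <-]; exact: hA.
- by move=> hh; apply: (svalP A); rewrite (card_le_eqr Ke).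
- move=> D DA; have [DK|nDK] := pselect (D #<= K); first by left; rewrite -(card_le_eqr Ke).
  by right; exact: (Amin (exist _ D nDK)).
Qed.

Lemma exists_aleph n : exists (U : Type) (A : set U), is_aleph n A.
Proof.
elim: n => [|n [U [A /is_aleph_next//]]].
by exists nat, setT; rewrite /=.
Qed.

Lemma exists_aleph_type n : exists S : choiceType, is_aleph n [set: S].
Proof.
have [U [A hA]] := exists_aleph n.
exists {classic (set_type A)}.
by apply: is_aleph_eq hA _; rewrite card_eq_sym; exact: card_setT.
Qed.

(* Sierpinski's argument: choose c outside the sets F12 a b, then b outside
   the sets F13 a c, then a outside the finite set F23 b c. *)
Lemma free_triple (S : choiceType) (F12 F13 F23 : S -> S -> {fset S}) :
  is_aleph 3 [set: S] ->
  exists a b c, [/\ c \notin F12 a b, b \notin F13 a c & a \notin F23 b c].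
Proof.
case=> [B2 [[B1 [[B0 [hB0 B01 nB1 _]] B12 nB2 _]] _ _ _]].
have i0 : infinite_set B0 := @is_aleph_infinite 0 _ _ hB0.
have i1 : infinite_set B1 := sub_infinite_set B01 i0.
apply: contrapT => nex.
have [c B2c hc] : exists2 c, B2 c & forall a b, B0 a -> B1 b -> c \notin F12 a b.
  apply: contrapT => h; apply: nB2.
  apply: (@card_cover _ _ _ B2 (B1 `*` B1) B1 (fun p => F12 p.1 p.2) i1 (card_prod_le i1)).
  move=> c B2c; apply: contrapT => hc; apply: h; exists c => // a b B0a B1b.
  by apply/negP => h; apply: hc; exists (a, b) => //; split=> //; exact: B01.
have [b B1b hb] : exists2 b, B1 b & forall a, B0 a -> b \notin F13 a c.
  apply: contrapT => h; apply: nB1.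
  apply: (@card_cover _ _ _ B1 B0 B0 (fun a => F13 a c) i0 (card_lexx _)).
  move=> b B1b; apply: contrapT => hb; apply: h; exists b => // a B0a.
  by apply/negP => h; apply: hb; exists a.
apply: i0; apply: (@sub_finite_set _ _ [set` F23 b c]); last exact: finite_fset.
move=> a B0a; apply: contrapT => /negP ha; apply: nex; exists a, b, c.
by split=> //; [exact: hc|exact: hb].
Qed.

(** Iterated pairing; the tags [i 0] and [i 1] separate the empty sequence from the others. *)
Lemma seq_inj_code (S : choiceType) : infinite_set [set: S] ->
  exists f : seq S -> S, injective f.
Proof.
move=> Si; have [i [_ ii]] := infinite_seq Si; have [f [_ fi]] := hessenberg Si.
exists (fix F s := if s is x :: t then f (i 1%N) (f x (F t)) else f (i 0%N) (i 0%N)).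
elim=> [|x s IH] [|y t] //.
- by move=> /fi[] // /ii.
- by move=> /fi[] // /ii.
- by move=> /fi[] // _ /fi[] // -> /IH ->.
Qed.

Lemma is_aleph_fset n (S : choiceType) : is_aleph n [set: S] -> is_aleph n [set: {fset S}].
Proof.
move=> hS; apply: is_aleph_eq (hS) _; apply/card_eqPle; split.
  apply: (@card_le_of _ _ _ _ (fun x : S => [fset x]%fset)) => // x y _ _ /fsetP/(_ x).
  by rewrite !inE eqxx => /esym/eqP.
have [f fi] := seq_inj_code (is_aleph_infinite hS).
apply: (@card_le_of _ _ _ _ (fun X : {fset S} => f X)) => // X Y _ _ /fi e.
by apply/fsetP => x; rewrite -[LHS]/(x \in enum_fset X) e.
Qed.

Lemma card_le_mulnat (S : choiceType) (K : countType) : is_aleph 3 [set: S] ->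
  [set: ({fset S} * K)%type] #<= [set: S].
Proof.
move=> hS; have Si := is_aleph_infinite hS.
have [i [_ ii]] := infinite_seq Si; have [p [_ pi]] := hessenberg Si.
have [f fi] := seq_inj_code Si.
apply: (@card_le_of _ _ _ _ (fun X : ({fset S} * K)%type => p (f X.1) (i (choice.pickle X.2)))) => // -[X k] [Y l] _ _ /=.
move=> /pi[] // /fi e /ii /(pcan_inj (@choice.pickleK _)) ->; congr (_, _).
by apply/fsetP => x; rewrite -[LHS]/(x \in enum_fset X) e.
Qed.
End Cardinals.

(** * Elementary theory of unital C*-algebras *)

Section RngAlgebra.
Variable S : rngType.
Implicit Types x y z : S.
Lemma rmulNl x y : (- x) ** y = - (x ** y).
Proof. by apply: (@addrI _ (x ** y)); rewrite -rmulDl !subrr rmul0r. Qed.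
Lemma rmulNr x y : x ** (- y) = - (x ** y).
Proof. by apply: (@addrI _ (x ** y)); rewrite -rmulDr !subrr rmulr0. Qed.
Lemma rmulBl x y z : (x - y) ** z = x ** z - y ** z.
Proof. by rewrite rmulDl rmulNl. Qed.
Lemma rmulBr x y z : x ** (y - z) = x ** y - x ** z.
Proof. by rewrite rmulDr rmulNr. Qed.
End RngAlgebra.
Definition rmulE := (@rmulDl, @rmulDr, rmulNl, rmulNr, rmul0r, rmulr0).
Ltac ncring := rewrite ?rmulE ?rmulA ?rmul1l ?rmul1r; abel.

Section NormR.
Variables (R : realType) (U : cstarType R).
Notation C := (cplx R).
Implicit Types (x y z : U) (r s : R).

Definition nr x : R := complex.Re `|x|.

Lemma nrE x : `|x| = rc (nr x).
Proof.
have : 0 <= `|x| := normr_ge0 x.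
by rewrite /nr; case: `|x| => a b; rewrite lecE /= => /andP[/eqP -> _].
Qed.
Lemma nr_ge0 x : 0 <= nr x.
Proof. by rewrite -rc_ge0 -nrE. Qed.
Lemma nrD x y : nr (x + y) <= nr x + nr y.
Proof. by rewrite -ler_rc rcD -!nrE ler_normD. Qed.
Lemma nrN x : nr (- x) = nr x.
Proof. by rewrite /nr normrN. Qed.
Lemma nrC x y : nr (x - y) = nr (y - x).
Proof. by rewrite /nr distrC. Qed.
Lemma nrZ (a : C) x : nr (a *: x) = cn a * nr x.
Proof. by apply: rc_inj; rewrite rcM -nrE normrZ cnE nrE. Qed.
Lemma nrZr r x : 0 <= r -> nr (rc r *: x) = r * nr x.
Proof. by move=> r0; rewrite nrZ cn_rc ger0_norm. Qed.
Lemma nrM x y : nr (x ** y) <= nr x * nr y.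
Proof. by rewrite -ler_rc rcM -!nrE ler_normrM. Qed.
Lemma nr0 : nr 0 = 0.
Proof. by rewrite /nr normr0. Qed.
Lemma nr_eq0 x : nr x <= 0 -> x = 0.
Proof.
move=> h; apply/eqP; rewrite -normr_eq0 nrE -rc0 (inj_eq (@rc_inj R)).
by rewrite eq_le h nr_ge0.
Qed.
Lemma nr_cstar x : nr (star x ** x) = nr x ^+ 2.
Proof. by apply: rc_inj; rewrite -nrE normr_starM nrE !expr2 rcM. Qed.
Lemma nr_star x : nr (star x) = nr x.
Proof.
have le y : nr y <= nr (star y).
  have := nrM (star y) y; rewrite nr_cstar expr2.
  have [->|y0] := eqVneq (nr y) 0; first by rewrite nr_ge0.
  by rewrite ler_pM2r // lt_def y0 nr_ge0.
by apply/eqP; rewrite eq_le le andbT -{2}(starK x) le.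
Qed.
Lemma nr_cstar' x : nr (x ** star x) = nr x ^+ 2.
Proof. by rewrite -{1}(starK x) nr_cstar nr_star. Qed.
Lemma star0 : star (0 : U) = 0.
Proof. by apply: (@addrI _ (star 0)); rewrite -starD !addr0. Qed.
Lemma starN x : star (- x) = - star x.
Proof. by apply: (@addrI _ (star x)); rewrite -starD !subrr star0. Qed.
Lemma starB x y : star (x - y) = star x - star y.
Proof. by rewrite starD starN. Qed.
Lemma starZr r x : star (rc r *: x) = rc r *: star x.
Proof. by rewrite starZ rc_conj. Qed.

Definition limS (u : nat -> U) l :=
  forall e, 0 < e -> exists N, forall n, (N <= n)%N -> nr (u n - l) <= e.

Lemma cauchy_limS (u : nat -> U) :
  (forall e, 0 < e -> exists N, forall n, (N <= n)%N -> nr (u n - u N) <= e) ->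
  exists l, limS u l.
Proof.
move=> h; have cu : cvg (u @ \oo).
  apply: cauchy_cvg; apply: cauchy_exP => e /posC[r r0 ->].
  have [N hN] := h _ (divr_gt0 r0 (ltr0n R 2)); exists (u N).
  suff : \forall n \near \oo, ball (u N) (rc r) (u n) by [].
  exists N => // n /= Nn; rewrite -ball_normE /ball_ /= nrE ltr_rc nrC.
  by apply: le_lt_trans (hN n Nn) _; lra.
exists (lim (u @ \oo)) => e e0.
have /cvg_ballP/(_ (rc e)) := cu; rewrite rc_gt0 => /(_ e0) [N _ hN].
exists N => n Nn; have := hN n Nn.
by rewrite -ball_normE /ball_ /= nrE ltr_rc nrC => /ltW.
Qed.

Lemma geo_limS (u : nat -> U) K r : 0 <= r -> r < 1 ->
  (forall n, nr (u n.+1 - u n) <= K * r ^+ n) -> exists l, limS u l.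
Proof.
move=> r0 r1 h; apply: cauchy_limS => e e0.
have K0 : 0 <= K by have := h 0%N; rewrite expr0 mulr1; apply: le_trans; exact: nr_ge0.
have : (fun n => r ^+ n) @ \oo --> (0 : R) by apply: cvg_expr; rewrite ger0_norm.
have d0 : 0 < e * (1 - r) / (K + 1) by rewrite divr_gt0 ?mulr_gt0 ?subr_gt0 //; lra.
move=> /cvgrPdist_lt /(_ _ d0)[N _ hN]; exists N.
have hd d : nr (u (N + d)%N - u N) <= K * r ^+ N * (1 - r ^+ d) / (1 - r).
  elim: d => [|d IH]; first by rewrite addn0 subrr nr0 expr0 subrr mulr0 mul0r.
  rewrite addnS -(subrK (u (N + d)%N) (u (N + d).+1)) -addrA.
  apply: le_trans (nrD _ _) _; apply: le_trans (lerD (h _) IH) _.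
  rewrite le_eqVlt; apply/orP; left; apply/eqP.
  have r1' : 1 - r != 0 by rewrite subr_eq0 eq_sym lt_eqF.
  rewrite exprD exprS; move: (r ^+ N) (r ^+ d) => a b; field; exact: r1'.
move=> n Nn; rewrite -(subnKC Nn); apply: le_trans (hd _) _.
have := hN N (leqnn N); rewrite sub0r normrN ger0_norm ?exprn_ge0 // => hr.
rewrite ler_pdivrMr ?subr_gt0 //.
have q1 : 0 <= r ^+ N := exprn_ge0 _ r0.
have q2 : 1 - r ^+ (n - N) <= 1 by rewrite gerBl exprn_ge0.
have q3 : K * r ^+ N <= e * (1 - r).
  apply: le_trans (_ : (K + 1) * (e * (1 - r) / (K + 1)) <= _).
    by apply: ler_pM => //; [lra|exact: ltW].
  by rewrite mulrC divfK // gt_eqF //; lra.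
apply: le_trans q3; rewrite -[leRHS]mulr1; apply: ler_wpM2l => //.
exact: mulr_ge0.
Qed.

Lemma limS_unique u l l' : limS u l -> limS u l' -> l = l'.
Proof.
move=> h h'; apply/eqP; rewrite -subr_eq0; apply/eqP/nr_eq0/ler_addgt0Pr => e e0.
have e2 : 0 < e / 2 by rewrite divr_gt0.
have [N hN] := h _ e2; have [N' hN'] := h' _ e2.
have := hN _ (leq_maxl N N'); have := hN' _ (leq_maxr N N').
set m := maxn N N'; rewrite (nrC _ l) => h1 h2.
have -> : l - l' = (l - u m) + (u m - l') by rewrite addrA subrK.
by apply: le_trans (nrD _ _) _; lra.
Qed.
Lemma limS_S u l : limS u l -> limS (fun n => u n.+1) l.
Proof. by move=> h e /h[N hN]; exists N => n Nn; apply: hN; exact: leqW. Qed.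
Lemma limS_cst l : limS (fun=> l) l.
Proof. by move=> e e0; exists 0%N => n _; rewrite subrr nr0 ltW. Qed.
Lemma limSD u v l l' : limS u l -> limS v l' -> limS (fun n => u n + v n) (l + l').
Proof.
move=> h h' e e0; have e2 : 0 < e / 2 by rewrite divr_gt0.
have [N hN] := h _ e2; have [N' hN'] := h' _ e2; exists (maxn N N') => n.
rewrite geq_max => /andP[/hN h1 /hN' h2].
rewrite opprD addrACA; apply: le_trans (nrD _ _) _; lra.
Qed.
Lemma limSZ (a : C) u l : limS u l -> limS (fun n => a *: u n) (a *: l).
Proof.
move=> h e e0; have d0 : 0 < e / (cn a + 1) by rewrite divr_gt0 // ltr_wpDl ?cn_ge0.
have [N hN] := h _ d0; exists N => n /hN.
rewrite -scalerBr nrZ ler_pdivlMr ?ltr_wpDl ?cn_ge0 //.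
have := nr_ge0 (u n - l); rewrite mulrDr mulr1 mulrC; lra.
Qed.
Lemma limS_bd u l : limS u l -> exists2 K, 0 < K & exists N, forall n, (N <= n)%N -> nr (u n) <= K.
Proof.
move=> /(_ 1 ltr01)[N hN]; exists (nr l + 1); first by have := nr_ge0 l; lra.
exists N => n /hN h; rewrite -(subrK l (u n)); apply: le_trans (nrD _ _) _; lra.
Qed.
Lemma limSM u v l l' : limS u l -> limS v l' -> limS (fun n => u n ** v n) (l ** l').
Proof.
move=> h h' e e0; have [K K0 [M hM]] := limS_bd h.
have q0 : 0 < nr l' + 1 by have := nr_ge0 l'; lra.
have [N hN] := h _ (divr_gt0 e0 (mulr_gt0 (ltr0n R 2) q0)).
have [N' hN'] := h' _ (divr_gt0 e0 (mulr_gt0 (ltr0n R 2) K0)).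
exists (maxn M (maxn N N')) => n; rewrite !geq_max => /and3P[/hM h1 /hN h2 /hN' h3].
have -> : u n ** v n - l ** l' = u n ** (v n - l') + (u n - l) ** l'.
  by rewrite rmulBr rmulBl addrA subrK.
apply: le_trans (nrD _ _) _.
have k1 : nr (u n ** (v n - l')) <= e / 2.
  apply: le_trans (nrM _ _) _.
  apply: le_trans (ler_pM (nr_ge0 _) (nr_ge0 _) h1 h3) _.
  by rewrite le_eqVlt; apply/orP; left; apply/eqP; field; rewrite gt_eqF.
have k2 : nr ((u n - l) ** l') <= e / 2.
  apply: le_trans (nrM _ _) _.
  have k : nr l' <= nr l' + 1 by lra.
  apply: le_trans (ler_pM (nr_ge0 _) (nr_ge0 _) h2 k) _.
  by rewrite le_eqVlt; apply/orP; left; apply/eqP; field; rewrite gt_eqF.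
lra.
Qed.
Lemma limS_star u l : limS u l -> limS (fun n => star (u n)) (star l).
Proof. by move=> h e /h[N hN]; exists N => n /hN; rewrite -starB nr_star. Qed.
Lemma limS_nr u l K : limS u l -> (forall n, nr (u n) <= K) -> nr l <= K.
Proof.
move=> h hK; apply/ler_addgt0Pr => e /h[N /(_ N (leqnn N))]; rewrite nrC => h1.
by rewrite -(subrK (u N) l); apply: le_trans (nrD _ _) _; have := hK N; lra.
Qed.
End NormR.

Section Unital.
Variables (R : realType) (U : ucstarType R).
Notation C := (cplx R).
Implicit Types (x y z a b c p q w : U) (r s t : R).

Lemma star1 : star (rone : U) = rone.
Proof. by rewrite -[LHS]rmul1r -{2}(starK rone) -starM rmul1r starK. Qed.
Lemma nr1 : nr (rone : U) <= 1.
Proof.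
have := nr_cstar (rone : U); rewrite star1 rmul1l expr2.
by have := nr_ge0 (rone : U); nra.
Qed.

Definition com x y := x ** y = y ** x.
Definition sc r : U := rc r *: rone.
Lemma sc_mull r x : sc r ** x = rc r *: x.
Proof. by rewrite /sc -rscalerAl rmul1l. Qed.
Lemma sc_mulr r x : x ** sc r = rc r *: x.
Proof. by rewrite /sc -rscalerAr rmul1r. Qed.
Lemma star_sc r : star (sc r) = sc r.
Proof. by rewrite /sc starZr star1. Qed.
Lemma nr_sc r : 0 <= r -> nr (sc r) <= r.
Proof. by move=> r0; rewrite nrZr //; have := nr1; have := nr_ge0 (rone : U); nra. Qed.
Lemma scD r s : sc (r + s) = sc r + sc s.
Proof. by rewrite /sc rcD scalerDl. Qed.
Lemma sc1 : sc 1 = rone.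
Proof. by rewrite /sc rc1 scale1r. Qed.
Lemma scZ r s : rc r *: sc s = sc (r * s).
Proof. by rewrite /sc scalerA rcM. Qed.
Lemma com_sc r x : com x (sc r).
Proof. by rewrite /com sc_mull sc_mulr. Qed.
Lemma com_sym x y : com x y -> com y x.
Proof. by []. Qed.
Lemma comD x y z : com x y -> com x z -> com x (y + z).
Proof. by rewrite /com rmulDl rmulDr => -> ->. Qed.
Lemma comN x y : com x y -> com x (- y).
Proof. by rewrite /com rmulNl rmulNr => ->. Qed.
Lemma comB x y z : com x y -> com x z -> com x (y - z).
Proof. by move=> h h'; apply: comD => //; exact: comN. Qed.
Lemma comM x y z : com x y -> com x z -> com x (y ** z).
Proof. by rewrite /com => e1 e2; rewrite rmulA e1 -rmulA e2 rmulA. Qed.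
Lemma comZ (k : C) x y : com x y -> com x (k *: y).
Proof. by rewrite /com -rscalerAl -rscalerAr => ->. Qed.
Lemma com1 x : com x rone.
Proof. by rewrite /com rmul1l rmul1r. Qed.
Lemma com_lim x u l : (forall n, com x (u n)) -> limS u l -> com x l.
Proof.
move=> h hu; apply: (@limS_unique _ _ (fun n => x ** u n)).
  exact: limSM (limS_cst x) hu.
by under eq_fun => n do rewrite h; exact: limSM hu (limS_cst x).
Qed.

Lemma halfD x : rc (1 / 2) *: (x + x) = x.
Proof.
rewrite scalerDr -scalerDl -rcD (_ : 1 / 2 + 1 / 2 = 1); last by lra.
by rewrite rc1 scale1r.
Qed.

(* [c = 1 - x], where [x] is the fixed point of [x |-> (y + x^2) / 2]. *)
Lemma sqrt_1sub y : star y = y -> nr y < 1 -> exists c,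
  [/\ star c = c, c ** c = rone - y, nr (rone - c) <= nr y & forall w, com w y -> com w c].
Proof.
move=> ys y1; pose k : C := rc (1 / 2).
have k0 : 0 <= 1 / 2 :> R by lra.
pose u := fix u n := if n is m.+1 then k *: (y + u m ** u m) else 0.
have r0 := nr_ge0 y.
have ub n : nr (u n) <= nr y.
  elim: n => [|n IH] /=; first by rewrite nr0.
  rewrite nrZr //; have := nrD y (u n ** u n); have := nrM (u n) (u n).
  have := nr_ge0 (u n); nra.
have ud n : nr (u n.+1 - u n) <= nr y * nr y ^+ n.
  elim: n => [|n IH]; first by rewrite subr0 expr0 mulr1.
  have -> : u n.+2 - u n.+1 = k *: ((u n.+1 - u n) ** u n.+1 + u n ** (u n.+1 - u n)).
    rewrite [u n.+2]/= -[X in X - _]/(k *: (y + u n.+1 ** u n.+1)).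
    rewrite [in X in _ - X]/= -scalerBr; congr (_ *: _).
    by rewrite rmulBl rmulBr addrA subrK opprD addrACA subrr add0r.
  rewrite nrZr //.
  have := nrD ((u n.+1 - u n) ** u n.+1) (u n ** (u n.+1 - u n)).
  have := nrM (u n.+1 - u n) (u n.+1); have := nrM (u n) (u n.+1 - u n).
  have := ub n; have := ub n.+1; have := nr_ge0 (u n); have := nr_ge0 (u n.+1).
  have := nr_ge0 (u n.+1 - u n).
  rewrite exprS; move: IH; move: (nr y ^+ n) (nr _) (nr _) (nr _) (nr _) (nr _) (nr _).
  by move=> a b c d e f g; nra.
have [x hx] := geo_limS r0 y1 ud.
have xfix : x = k *: (y + x ** x).
  apply: (limS_unique (limS_S hx)); apply: limSZ; apply: limSD; first exact: limS_cst.
  exact: limSM.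
have us n : star (u n) = u n.
  by elim: n => [|n IH] /=; rewrite ?star0 // starZr starD starM ys IH.
have xs : star x = x.
  apply: (@limS_unique _ _ u) => //.
  by have := limS_star hx; rewrite (_ : (fun n => star (u n)) = u) //; exact/funext.
have x2 : y + x ** x = x + x.
  by rewrite {3 4}xfix -scalerDr halfD.
exists (rone - x); split.
- by rewrite starB star1 xs.
- have -> : (rone - x) ** (rone - x) = rone - (x + x) + x ** x by ncring.
  by rewrite -x2; abel.
- rewrite subKr; exact: limS_nr hx ub.
- move=> w wy; apply: comB; first exact: com1.
  apply: (com_lim _ hx) => n; elim: n => [|n IH] /=; first by rewrite /com rmulr0 rmul0r.
  by apply: comZ; apply: comD => //; apply: comM.
Qed.

Lemma nr_sa a : star a = a -> nr (a ** a) = nr a ^+ 2.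
Proof. by move=> as_; rewrite -nr_cstar as_. Qed.

(** For commuting self-adjoint [a] and [b], the element [z = a + i b] satisfies
    [star z z = a^2 + b^2], and [a] is the mean of [z] and [star z]. This inequality is the
    substitute for functional calculus in what follows. *)
Lemma nr_sumsq a b : star a = a -> star b = b -> com a b ->
  nr a ^+ 2 <= nr (a ** a + b ** b).
Proof.
move=> sa sb ab; pose i : C := (0 +i* 1)%C.
have ii : i * i = -1 by apply/eqP; rewrite eq_complex /=; apply/andP; split; apply/eqP; ring.
have ci : Num.conj i = - i by apply/eqP; rewrite eq_complex /= oppr0 !eqxx.
pose z := a + i *: b.
have sz : star z = a - i *: b by rewrite starD starZ sa sb ci scaleNr.
have -> : a ** a + b ** b = star z ** z.
  rewrite sz rmulBl !rmulDr -!rscalerAl -!rscalerAr scalerA ii ab scaleN1r.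
  by rewrite opprB addrACA subrr addr0.
rewrite nr_cstar ler_sqr ?nnegrE ?nr_ge0 //.
have -> : a = rc (1 / 2) *: (z + star z).
  by rewrite sz addrACA subrr addr0 halfD.
rewrite nrZr; last by lra.
by have := nrD z (star z); rewrite nr_star; lra.
Qed.

(** The Neumann series, as the fixed point of [z |-> 1 + y z]; this equation also yields the norm
    bound. *)
Lemma sub1_inv y : nr y < 1 -> exists z,
  [/\ (rone - y) ** z = rone, z ** (rone - y) = rone, nr z <= (1 - nr y)^-1 &
      forall w, com w y -> com w z].
Proof.
move=> y1; pose u := fix u n := if n is m.+1 then rone + y ** u m else rone.
have r0 := nr_ge0 y.
have ud n : nr (u n.+1 - u n) <= nr y * nr y ^+ n.
  elim: n => [|n IH].
    by rewrite expr0 mulr1 /= rmul1r addrAC subrr add0r.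
  have -> : u n.+2 - u n.+1 = y ** (u n.+1 - u n).
    by rewrite [u n.+2]/= rmulBr opprD addrACA subrr add0r.
  apply: le_trans (nrM _ _) _; rewrite exprS; apply: ler_wpM2l => //.
have [z hz] := geo_limS r0 y1 ud.
have zf : z = rone + y ** z.
  apply: (limS_unique (limS_S hz)); apply: limSD; first exact: limS_cst.
  by apply: limSM => //; exact: limS_cst.
have cz w : com w y -> com w z.
  move=> wy; apply: (com_lim _ hz); elim=> [|n IH] /=; first exact: com1.
  by apply: comD; [exact: com1|exact: comM].
have e1 : (rone - y) ** z = rone by rewrite rmulBl rmul1l {1}zf addrK.
exists z; split=> //.
  by rewrite -[LHS](_ : (rone - y) ** z = _) //; apply: cz; apply: com_sym; apply: comB => //; exact: com1.
have y1' : 0 < 1 - nr y by lra.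
rewrite -[leRHS]mul1r ler_pdivlMr // mulrBr mulr1 lerBlDr.
rewrite {1}zf; apply: le_trans (nrD _ _) _; apply: lerD; first exact: nr1.
by rewrite mulrC; exact: nrM.
Qed.

(** Positivity expressed by a ball around a scalar, which reduces the positivity of sums to the
    triangle inequality. *)
Definition pos a := star a = a /\ exists2 t, 0 <= t & nr (sc t - a) <= t.

Lemma posD a b : pos a -> pos b -> pos (a + b).
Proof.
move=> [sa [t t0 ht]] [sb [r r0 hr]]; split; first by rewrite starD sa sb.
exists (t + r); first exact: addr_ge0.
have -> : sc (t + r) - (a + b) = (sc t - a) + (sc r - b) by rewrite scD opprD addrACA.
by apply: le_trans (nrD _ _) _; lra.
Qed.
Lemma posZ r a : 0 <= r -> pos a -> pos (rc r *: a).
Proof.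
move=> r0 [sa [t t0 ht]]; split; first by rewrite starZr sa.
exists (r * t); first exact: mulr_ge0.
by rewrite -scZ -scalerBr nrZr // ler_wpM2l.
Qed.
Lemma pos_sc r : 0 <= r -> pos (sc r).
Proof. by move=> r0; split; [exact: star_sc|exists r => //; rewrite subrr nr0]. Qed.
Lemma pos_sub r y : star y = y -> nr y <= r -> pos (sc r - y).
Proof.
move=> sy yr; split; first by rewrite starB star_sc sy.
exists r; last by rewrite subKr.
by apply: le_trans yr; exact: nr_ge0.
Qed.
(** Scaled to norm below 1, [b] becomes [k] with a commuting [c] such that [c^2 + k^2 = 1]; then
    [|1 - k^2| = |c|^2 <= 1] by [nr_sumsq]. *)
Lemma pos_sq b : star b = b -> pos (b ** b).
Proof.
move=> sb; split; first by rewrite starM sb.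
pose n := nr b + 1; have n0 : 0 < n by rewrite /n; have := nr_ge0 b; lra.
pose k := rc n^-1 *: b.
have sk : star k = k by rewrite starZr sb.
have nk : nr k < 1 by rewrite nrZr ?invr_ge0 ?ltW // mulrC ltr_pdivrMr // mul1r /n; lra.
have skk : star (k ** k) = k ** k by rewrite starM sk.
have nkk : nr (k ** k) < 1 by rewrite nr_sa // exprn_ilt1 // nr_ge0.
have [c [sc_ c2 _ cc]] := sqrt_1sub skk nkk.
have ck : com c k by apply: com_sym; apply: cc; exact: comM.
have h : nr (rone - k ** k) <= 1.
  rewrite -c2 nr_sa //; apply: le_trans (nr_sumsq sc_ sk ck) _.
  by rewrite c2 subrK nr1.
exists (n ^+ 2); first by rewrite exprn_ge0 // ltW.
have -> : sc (n ^+ 2) - b ** b = rc (n ^+ 2) *: (rone - k ** k).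
  rewrite scalerBr /k -rscalerAl -rscalerAr !scalerA -!rcM; congr (_ - _).
  rewrite [X in rc X](_ : _ = 1) ?rc1 ?scale1r //.
  by field; rewrite gt_eqF.
have n20 : 0 <= n ^+ 2 := sqr_ge0 n.
by rewrite nrZr // -[leRHS]mulr1 ler_wpM2l.
Qed.
(** The shift by [d] brings [y] to norm below 1, where the iteration of [sqrt_1sub] converges. *)
Lemma pos_sqrt a d : pos a -> 0 < d -> exists c,
  [/\ star c = c, c ** c = a + sc d, pos c & forall w, com w a -> com w c].
Proof.
move=> [sa [t t0 ht]] d0; have td : 0 < t + d by lra.
pose y := rc (t + d)^-1 *: (sc t - a).
have sy : star y = y by rewrite starZr starB star_sc sa.
have y1 : nr y < 1.
  by rewrite nrZr ?invr_ge0 ?ltW // mulrC ltr_pdivrMr // mul1r; lra.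
have [c [sc_ c2 cp cc]] := sqrt_1sub sy y1.
pose q := Num.sqrt (t + d); have q0 : 0 <= q := sqrtr_ge0 _.
exists (rc q *: c); split.
- by rewrite starZr sc_.
- rewrite -rscalerAl -rscalerAr scalerA -rcM -expr2 sqr_sqrtr ?ltW // c2.
  rewrite scalerBr /y scalerA -rcM divff ?gt_eqF // rc1 scale1r -/(sc _).
  by rewrite scD; abel.
- apply: posZ => //; split=> //; exists 1 => //; rewrite sc1.
  by apply: le_trans cp (ltW y1).
- move=> w wa; apply: comZ; apply: cc; apply: comZ; apply: comB => //; exact: com_sc.
Qed.
Lemma pos_inv a d : pos a -> 0 < d -> exists b,
  [/\ (a + sc d) ** b = rone, b ** (a + sc d) = rone, nr b <= d^-1 &
    forall w, com w a -> com w b].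
Proof.
move=> [sa [t t0 ht]] d0; have td : 0 < t + d by lra.
pose y := rc (t + d)^-1 *: (sc t - a).
have ny : nr y <= t / (t + d).
  have i0 : 0 <= (t + d)^-1 by rewrite invr_ge0 ltW.
  by rewrite nrZr // mulrC ler_wpM2r.
have y1 : nr y < 1 by apply: le_lt_trans ny _; rewrite ltr_pdivrMr // mul1r; lra.
have [z [z1 z2 nz cz]] := sub1_inv y1.
have e : a + sc d = rc (t + d) *: (rone - y).
  rewrite scalerBr /y scalerA -rcM divff ?gt_eqF // rc1 scale1r -/(sc _).
  by rewrite scD; abel.
exists (rc (t + d)^-1 *: z); split.
- by rewrite e -rscalerAl -rscalerAr scalerA -rcM divff ?gt_eqF // rc1 scale1r.
- by rewrite e -rscalerAl -rscalerAr scalerA -rcM mulVf ?gt_eqF // rc1 scale1r.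
- rewrite nrZr; last by rewrite invr_ge0 ltW.
  have h : nr z <= (t + d) / d.
    apply: le_trans nz _; rewrite -[leRHS]invrK lef_pV2 ?posrE ?subr_gt0 ?invr_gt0 ?divr_gt0 //.
    rewrite invf_div; apply: le_trans (_ : 1 - t / (t + d) <= _); last by lra.
    by rewrite le_eqVlt; apply/orP; left; apply/eqP; field; rewrite gt_eqF.
  rewrite mulrC ler_pdivrMr //; apply: le_trans h _; by rewrite mulrC.
- move=> w wa; apply: comZ; apply: cz; apply: comZ; apply: comB => //; exact: com_sc.
Qed.
(** With [p^2 = r - a + d] and [q^2 = r + a + d] one has [a^2 + (p q)^2 = (r + d)^2], to which
    [nr_sumsq] applies; then [d] tends to 0. *)
Lemma pos_norm a r : 0 <= r -> pos a -> pos (sc r - a) -> nr a <= r.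
Proof.
move=> r0 pa pb; have sa := pa.1.
apply/ler_addgt0Pr => d d0.
have [p [sp p2 _ cp]] := pos_sqrt pb d0.
have [q [sq q2 _ cq]] := pos_sqrt (posD (pos_sc r0) pa) d0.
have aq : com a q by apply: cq; apply: comD => //; exact: com_sc.
have ap : com a p by apply: cp; apply: comB => //; exact: com_sc.
have qp : com q p by apply: cp; apply: comB; [exact: com_sc|exact: com_sym].
have spq : star (p ** q) = p ** q by rewrite starM sp sq qp.
have apq : com a (p ** q) by apply: comM.
have e : a ** a + (p ** q) ** (p ** q) = sc ((r + d) ^+ 2).
  have -> : (p ** q) ** (p ** q) = (p ** p) ** (q ** q).
    by rewrite -!rmulA; congr (_ ** _); rewrite !rmulA qp.
  rewrite p2 q2 -!addrA [a + sc d]addrC !addrA.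
  have -> : sc r - a + sc d = sc (r + d) - a by rewrite addrAC scD.
  rewrite -scD rmulDr !rmulBl !sc_mulr sc_mull scZ.
  by rewrite expr2; abel.
have : nr a ^+ 2 <= (r + d) ^+ 2.
  apply: le_trans (nr_sumsq sa spq apq) _; rewrite e; apply: nr_sc; exact: sqr_ge0.
rewrite ler_sqr ?nnegrE ?nr_ge0 //; lra.
Qed.
(** After scaling, [a^2 = 1 - x^2] and [b^2 = 1 - y^2] give [(x + y)^2 + (a b)^2 = 1], because
    [x y = y x = 0]. *)
Lemma nr_orth x y r : 0 <= r -> star x = x -> star y = y -> x ** y = 0 -> y ** x = 0 ->
  nr x <= r -> nr y <= r -> nr (x + y) <= r.
Proof.
move=> r0 sx sy xy yx xr yr.
have key x' y' : star x' = x' -> star y' = y' -> x' ** y' = 0 -> y' ** x' = 0 ->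
    nr x' < 1 -> nr y' < 1 -> nr (x' + y') <= 1.
  move=> sx' sy' xy' yx' x1 y1.
  have sxx : star (x' ** x') = x' ** x' by rewrite starM sx'.
  have syy : star (y' ** y') = y' ** y' by rewrite starM sy'.
  have [a [sa a2 _ ca]] := sqrt_1sub sxx ltac:(by rewrite nr_sa // exprn_ilt1 // nr_ge0).
  have [b [sb b2 _ cb]] := sqrt_1sub syy ltac:(by rewrite nr_sa // exprn_ilt1 // nr_ge0).
  have zx : com (x' + y') (x' ** x').
    by rewrite /com rmulDl rmulDr [y' ** _]rmulA yx' rmul0r -[(x' ** x') ** y']rmulA xy' rmulr0 rmulA.
  have zy : com (x' + y') (y' ** y').
    by rewrite /com rmulDl rmulDr [x' ** _]rmulA xy' rmul0r -[(y' ** y') ** x']rmulA yx' rmulr0 rmulA.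
  have yyxx : com (y' ** y') (x' ** x').
    by rewrite /com -rmulA [y' ** (x' ** _)]rmulA yx' rmul0r rmulr0 -rmulA [x' ** (y' ** _)]rmulA xy' rmul0r rmulr0.
  have ab : com a b by apply: cb; apply: com_sym; exact: ca.
  have sab : star (a ** b) = a ** b by rewrite starM sa sb -ab.
  have e : (x' + y') ** (x' + y') + (a ** b) ** (a ** b) = rone.
    have -> : (a ** b) ** (a ** b) = (a ** a) ** (b ** b).
      by rewrite -!rmulA; congr (_ ** _); rewrite !rmulA ab.
    have e0 : x' ** x' ** (y' ** y') = 0.
      by rewrite -rmulA [x' ** (y' ** _)]rmulA xy' rmul0r rmulr0.
    rewrite a2 b2 rmulBr rmul1r rmulBl rmul1l e0.
    by rewrite rmulDl !rmulDr xy' yx'; abel.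
  have : nr (x' + y') ^+ 2 <= 1.
    apply: le_trans (nr_sumsq _ sab _) _; rewrite ?starD ?sx' ?sy' //.
      by apply: comM; [exact: ca|exact: cb].
    by rewrite e nr1.
  by rewrite expr_le1 ?nr_ge0.
apply/ler_addgt0Pr => e e0; have re : 0 < r + e by lra.
have := key (rc (r + e)^-1 *: x) (rc (r + e)^-1 *: y).
rewrite !starZr sx sy -!rscalerAl -!rscalerAr xy yx !scaler0 -scalerDr.
have i0 : 0 <= (r + e)^-1 by rewrite invr_ge0 ltW.
rewrite !nrZr // ![(r + e)^-1 * _]mulrC !ltr_pdivrMr // ler_pdivrMr // !mul1r.
by apply => //; lra.
Qed.
Lemma proj_norm p : star p = p -> p ** p = p -> nr p <= 1.
Proof.
move=> sp pp; have := nr_sa sp; rewrite pp expr2.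
by have := nr_ge0 p; nra.
Qed.
Lemma proj_comp p : star p = p -> p ** p = p ->
  star (rone - p) = rone - p /\ (rone - p) ** (rone - p) = rone - p.
Proof.
by move=> sp pp; rewrite starB star1 sp rmulBr rmul1r rmulBl rmul1l pp subrr subr0.
Qed.
(** [t - p a p] is the sum of the orthogonal elements [t (1 - p)] and [p (t - a) p], both of norm at
    most [t]. *)
Lemma pos_compress a p : star p = p -> p ** p = p -> pos a -> pos (p ** a ** p).
Proof.
move=> sp pp [sa [t t0 ht]]; split; first by rewrite !starM sa sp rmulA.
exists t => //.
have [sq qq] := proj_comp sp pp; set q := rone - p in sq qq.
have qp : q ** p = 0 by rewrite rmulBl rmul1l pp subrr.
have pq : p ** q = 0 by rewrite rmulBr rmul1r pp subrr.
have -> : sc t - p ** a ** p = rc t *: q + p ** (sc t - a) ** p.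
  rewrite rmulBr rmulBl sc_mulr -rscalerAl pp scalerBr -/(sc t).
  by rewrite addrA subrK.
apply: nr_orth => //.
- by rewrite starZr sq.
- by rewrite !starM starB star_sc sa sp rmulA.
- by rewrite -rscalerAl !rmulA qp !rmul0r scaler0.
- by rewrite -rscalerAr -!rmulA pq !rmulr0 scaler0.
- by rewrite nrZr // -[leRHS]mulr1 ler_wpM2l // proj_norm.
- apply: le_trans (nrM _ _) _; have := nrM p (sc t - a); have := proj_norm sp pp.
  have := nr_ge0 p; have := nr_ge0 (p ** (sc t - a)); have := nr_ge0 (sc t - a); nra.
Qed.
End Unital.
(** For [|y| < 1] and [a = star y y] there is a commuting [c] with [a^2 + c^2 = 1]. The equation is
    preserved by [f], so [nr_sumsq] bounds the image. *)
Lemma unital_star_hom_le (R : realType) (U V : ucstarType R) (f : U -> V) x :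
  unital_star_hom f -> nr (f x) <= nr x.
Proof.
move=> [[fD fZ fM fS] f1].
have fB y z : f (y - z) = f y - f z by rewrite fD -scaleN1r fZ scaleN1r.
have key y : nr y < 1 -> nr (f y) <= 1.
  move=> y1; pose a := star y ** y.
  have sa : star a = a by rewrite /a starM starK.
  have na : nr (a ** a) < 1.
    rewrite nr_sa // nr_cstar; have := nr_ge0 y; move: (nr y) y1 => t t1 t0.
    by rewrite -exprM exprn_ilt1.
  have saa : star (a ** a) = a ** a by rewrite starM sa.
  have [c [cs c2 _ cc]] := sqrt_1sub saa na.
  have ac : com a c by apply: cc; apply: comM.
  have : nr (f a) ^+ 2 <= 1.
    apply: le_trans (_ : nr (f a ** f a + f c ** f c) <= _).
      by apply: nr_sumsq; rewrite -?fS ?sa ?cs // /com -!fM ac.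
    by rewrite -!fM -fD c2 addrC subrK f1 nr1.
  rewrite /a fM fS nr_cstar -exprM => h.
  by rewrite leNgt; apply/negP => h1; move: h; rewrite leNgt exprn_egt1.
apply/ler_addgt0Pr => e e0.
have d0 : 0 < nr x + e by have := nr_ge0 x; lra.
have := key (rc (nr x + e)^-1 *: x).
have i0 : 0 <= (nr x + e)^-1 by rewrite invr_ge0 ltW.
rewrite fZ !nrZr // [_^-1 * nr x]mulrC ltr_pdivrMr // mul1r ltrDl => /(_ e0).
by rewrite mulrC ler_pdivrMr // mul1r.
Qed.

(** * Idempotents in real rank zero *)

Section RealRankZero.
Variables (R : realType) (U : ucstarType R).
Implicit Types (x y z a b c p q w : U) (r s t : R).

(** Polar decomposition of an invertible self-adjoint element: [r] is the root of [k^2] and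
    [s = k r k^-2]. *)
Lemma sa_inv_sign k z : star k = k -> z ** (k ** k) = rone -> (k ** k) ** z = rone ->
  exists s r : U, [/\ star s = s, s ** s = rone, pos r, s ** r = k & com s r].
Proof.
move=> sk z1 z2; set a := k ** k in z1 z2.
have sa : star a = a by rewrite starM sk.
have sz : star z = z.
  rewrite -[LHS]rmul1r -z2 rmulA -{1}sa -starM z2 star1.
  by rewrite rmul1l.
have ka : com k a by exact: comM.
have kz : com k z.
  have : z ** (a ** k) ** z = z ** (k ** a) ** z by rewrite ka.
  by rewrite rmulA z1 rmul1l rmulA -[X in _ = X]rmulA z2 rmul1r.
(* Here [z = k^-2]. With [v^2 = 2 N - z], the element [k^2 - 1/(2 N)] equals [(k v)^2 / (2 N)] and
   so is positive; [pos_sqrt] with [d = 1/(2 N)] then gives an exact root of [k^2]. *)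
pose N := nr z + 1; have N0 : 0 < N by rewrite /N; have := nr_ge0 z; lra.
have pz : pos (sc U N - z) by apply: pos_sub => //; rewrite /N; lra.
have [v [sv v2 _ cv]] := pos_sqrt pz N0.
have kv : com k v by apply: cv; apply: comB => //; exact: com_sc.
have skv : star (k ** v) = k ** v by rewrite starM sk sv kv.
have N2 : 0 < (N + N)^-1 by rewrite invr_gt0; lra.
have pa : pos (a - sc U (N + N)^-1).
  have -> : a - sc U (N + N)^-1 = rc (N + N)^-1 *: ((k ** v) ** (k ** v)).
    have -> : (k ** v) ** (k ** v) = a ** (v ** v).
      by rewrite -!rmulA; congr (_ ** _); rewrite !rmulA kv.
    have -> : v ** v = sc U (N + N) - z by rewrite v2 scD; abel.
    rewrite rmulBr sc_mulr z2 scalerBr scalerA -rcM mulVf ?gt_eqF ?rc1 ?scale1r //.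
    lra.
  by apply: posZ; [exact: ltW|exact: pos_sq].
have [r [sr r2 pr cr]] := pos_sqrt pa N2.
rewrite subrK in r2.
have kr : com k r by apply: cr; apply: comB => //; exact: com_sc.
have az : com z a by rewrite /com z1 z2.
have zr : com z r by apply: cr; apply: comB => //; exact: com_sc.
exists (k ** r ** z), r; split=> //.
- by rewrite !starM sz sr sk -kr rmulA -kz -[k ** z ** r]rmulA zr rmulA.
- have -> : k ** r ** z ** (k ** r ** z) = (k ** k) ** (r ** r) ** (z ** z).
    by rewrite !rmulA -[k ** r ** z ** k]rmulA -kz rmulA -[k ** r ** k]rmulA -kr !rmulA
      -[_ ** z ** r]rmulA zr !rmulA.
  by rewrite r2 -/a -rmulA [a ** (z ** z)]rmulA z2 rmul1l z2.
- by rewrite -[k ** r ** z ** r]rmulA zr !rmulA -[k ** r ** r]rmulA r2 -rmulA z2 rmul1r.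
- apply: com_sym; apply: comM; last exact: com_sym.
  by apply: comM => //; exact: com_sym.
Qed.

Lemma half_proj (s : U) : star s = s -> s ** s = rone ->
  let q := rc (1 / 2) *: (rone + s) in [/\ star q = q, q ** q = q & q ** s = q].
Proof.
move=> ss s2 q; have qs : q ** s = q.
  by rewrite /q -rscalerAl rmulDl rmul1l s2 addrC.
split=> //; first by rewrite starZr starD star1 ss.
by rewrite {2}/q -rscalerAr rmulDr rmul1r qs halfD.
Qed.

(** An invertible self-adjoint [k] near [h - d] has a spectral projection [q] for its positive part.
    On [q] the element [h] can be inverted, which yields an idempotent [f] factoring through [c]
    with [q c f = q c]. On the complement [p] of [q] the element [h] is small, hence so is [p c]. *)
Lemma RR0_HP : real_rank_le U 0 -> forall c (e : R), 0 < e ->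
  exists f u q, [/\ f = star c ** u ** c, f ** f = f & nr (c - (q ** c) ** f) <= e].
Proof.
(* [h] is the square of [m] so that its positivity is an instance of [pos_sq]. *)
move=> rr c e e0; pose m := c ** star c; pose h := m ** m.
have sm : star m = m by rewrite starM starK.
have sh : star h = h by rewrite starM sm.
(* The fourth power appears since [|p c|^2 <= |p m|] and [|p m|^2 = |p h p| <= d + eta] for the
   complement [p] of [q]. *)
pose d := e ^+ 4 / 2; have d0 : 0 < d by rewrite divr_gt0 // exprn_gt0.
pose eta := d / 2; have eta0 : 0 < eta by rewrite divr_gt0.
have [||y [sy hy [z [z1 z2]]]] := rr (fun=> h - sc U d) _ (rc eta).
- by move=> _; rewrite starB sh star_sc.
- by rewrite rc_gt0.
rewrite big_ord_recl big_ord0 addr0 in z1 z2.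
set k := y ord0 in z1 z2.
have sk : star k = k := sy ord0.
pose err := h - sc U d - k.
have nerr : nr err <= eta by have := hy ord0; rewrite nrE ltr_rc => /ltW.
have serr : star err = err by rewrite !starB sh star_sc sk.
have hE : h = k + sc U d + err by rewrite /err; abel.
clearbody err.
have [s [r [ss s2 pr srk srC]]] := sa_inv_sign sk z1 z2.
have [sq qq qs] := half_proj ss s2.
set q := rc (1 / 2) *: (rone + s) in sq qq qs.
have [sp pp] := proj_comp sq qq; set p := rone - q in sp pp.
have ps : p ** s = - p.
  rewrite rmulBl rmul1l qs /p opprB.
  have q2 : q + q = rone + s by rewrite -scalerDr halfD.
  have -> : s = q + q - rone by rewrite q2; abel.
  by abel.
have rq : com r q.
  by apply: comZ; apply: comD; [exact: com1|exact: com_sym].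
have rp : com r p by apply: comB => //; exact: com1.
have pqr : pos (q ** r).
  by have := pos_compress sq qq pr; rewrite -rmulA rq rmulA qq.
have ppr : pos (p ** r).
  by have := pos_compress sp pp pr; rewrite -rmulA rp rmulA pp.
have [b [b1 b2 nb cb]] := pos_inv pqr d0.
(* [q r + d + q err q = (q r + d)(1 - y0)], and [|y0| <= eta / d = 1/2], so that [Y] inverts the
   left side. *)
pose y0 := - (b ** (q ** err ** q)).
have nq := proj_norm sq qq; have np := proj_norm sp pp.
have nqq (x t : U) : nr t <= 1 -> nr (t ** x ** t) <= nr x.
  move=> nt; apply: le_trans (nrM _ _) _; have := nrM t x.
  have := nr_ge0 (t ** x); have := nr_ge0 x; have := nr_ge0 t; nra.
have ny0 : nr y0 < 1.
  rewrite nrN; apply: le_lt_trans (nrM _ _) _.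
  apply: (@le_lt_trans _ _ (d^-1 * eta)).
    apply: ler_pM; rewrite ?nr_ge0 //; exact: le_trans (nqq _ _ nq) _.
  by rewrite /eta mulrC mulrAC divff ?gt_eqF // mul1r; lra.
have [z' [z1' _ _ _]] := sub1_inv ny0.
pose Y := z' ** b.
have TY : (q ** r + sc U d + q ** err ** q) ** Y = rone.
  have -> : q ** r + sc U d + q ** err ** q = (q ** r + sc U d) ** (rone - y0).
    by rewrite [RHS]rmulBr rmul1r /y0 rmulNr opprK [_ ** (b ** _)]rmulA b1 rmul1l.
  by rewrite /Y -rmulA [(rone - y0) ** _]rmulA z1' rmul1l b1.
have qhqY : q ** h ** q ** Y = q.
  have -> : q ** h ** q = q ** (q ** r + sc U d + q ** err ** q).
    rewrite hE !rmulDr !rmulDl !rmulA qq -srk rmulA qs -[q ** r ** q]rmulA rq rmulA qq.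
    by rewrite -[q ** sc U d ** q]rmulA sc_mull sc_mulr -rscalerAr qq.
  by rewrite -rmulA TY rmul1r.
exists (star c ** (m ** q ** Y ** q) ** c), (m ** q ** Y ** q), q; split=> //.
  have -> : star c ** (m ** q ** Y ** q) ** c ** (star c ** (m ** q ** Y ** q) ** c) =
     star c ** m ** q ** Y ** (q ** h ** q ** Y) ** q ** c by rewrite /h /m !rmulA.
  by rewrite qhqY -[star c ** m ** q ** Y ** q ** q]rmulA qq !rmulA.
have -> : q ** c ** (star c ** (m ** q ** Y ** q) ** c) = (q ** h ** q ** Y) ** q ** c.
  by rewrite /h /m !rmulA.
rewrite qhqY qq.
have -> : c - q ** c = p ** c by rewrite rmulBl rmul1l.
have X1 : nr (p ** h ** p) <= d + eta.
  have de0 : 0 <= d + eta by lra.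
  apply: pos_norm => //; first by apply: pos_compress => //; exact: pos_sq.
  have -> : sc U (d + eta) - p ** h ** p =
    p ** r + (sc U (d + eta) - p ** (sc U d + err) ** p).
    have hp : p ** k ** p = - (p ** r).
      by rewrite -srk rmulA ps !rmulNl -[p ** r ** p]rmulA rp rmulA pp.
    by rewrite hE -addrA [p ** (k + _)]rmulDr [(_ + _) ** p]rmulDl hp; abel.
  apply: posD => //; apply: pos_sub; first by rewrite !starM sp [star (_ + err)]starD star_sc serr rmulA.
  apply: le_trans (nqq _ _ np) _; apply: le_trans (nrD _ _) _.
  by apply: lerD => //; apply: nr_sc; exact: ltW.
have X2 : nr (p ** m) ^+ 2 <= e ^+ 4.
  rewrite -nr_cstar' starM sm sp.
  have -> : p ** m ** (m ** p) = p ** h ** p by rewrite /h !rmulA.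
  apply: le_trans X1 _; rewrite /eta /d; have := exprn_gt0 4 e0; lra.
have X3 : nr (p ** c) ^+ 2 <= nr (p ** m).
  rewrite -nr_cstar' starM sp.
  have -> : p ** c ** (star c ** p) = (p ** m) ** p by rewrite /m !rmulA.
  by apply: le_trans (nrM _ _) _; have := nr_ge0 (p ** m); nra.
have X4 : nr (p ** m) <= e ^+ 2.
  by rewrite -ler_sqr ?nnegrE ?nr_ge0 ?sqr_ge0 // -exprM.
by rewrite -ler_sqr ?nnegrE ?nr_ge0 ?(ltW e0) //; exact: le_trans X3 X4.
Qed.
End RealRankZero.

(** * Idempotent matrices *)

Section Idempotents.
Variable S : rngType.
Implicit Types (x y z : S).
Local Notation idem := (idem S).

Definition mkidem x (h : x ** x = x) : idem :=
  exist (fun a : S => is_true (a ** a == a)) x (introT eqP h).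
End Idempotents.

Section VMonoid.
Variable S : rngType.
Local Notation Mx := (Minf S).
Implicit Types (x y z : Mx) (p q f g h : idem (Minf S)).

Definition Vle (X Y : V S) := exists Z, Y = X + Z.

Lemma Vclass_split p g : val p ** val g = val g -> val g ** val p = val g ->
  exists2 g' : idem Mx, val g' = val p - val g & Vclass p = Vclass g + Vclass g'.
Proof.
move=> pg gp; have pp := idemP p; have gg := idemP g.
have e : (val p - val g) ** (val p - val g) = val p - val g.
  by rewrite rmulBl !rmulBr pp gg pg gp subrr subr0.
pose g' := mkidem e.
have o : orthogonal_idem g g'.
  by split; rewrite /= ?rmulBl ?rmulBr gg ?gp ?pg subrr.
exists g' => //; rewrite (Vclass_addE o); apply: Vclass_val.
by rewrite /= addrC subrK.
Qed.

Lemma Vle_factor p f x y : val f = x ** val p ** y -> Vle (Vclass f) (Vclass p).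
Proof.
move=> fE; have pp := idemP p; have ff := idemP f.
set P := val p in fE pp *; set F := val f in fE ff *.
pose a := F ** x ** P; pose b := P ** y ** F.
have ab : a ** b = F.
  by rewrite /a /b !rmulA -[F ** x ** P ** P]rmulA pp -!rmulA [x ** (P ** _)]rmulA [(x ** P) ** _]rmulA -fE !rmulA !ff.
have bb : b ** a ** (b ** a) = b ** a.
  by rewrite -[LHS]rmulA [a ** (b ** a)]rmulA ab /a !rmulA -[b ** F ** F]rmulA ff.
pose g : idem Mx := mkidem bb.
have fg : Vclass f = Vclass g.
  by apply/Vclass_eqP/asboolP; exists a, b; split.
have pg : P ** val g = val g by rewrite /= /b !rmulA pp.
have gp : val g ** P = val g by rewrite /= /a -!rmulA pp.
by have [g' _ ->] := Vclass_split pg gp; exists (Vclass g'); rewrite fg.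
Qed.

(** The orthogonal sum [A + B] representing [X + Y] is transported into [p] by the equivalence [x],
    [y]. *)
Lemma Vdecomp p X Y : Vclass p = X + Y -> exists p1 p2 : idem Mx,
  [/\ val p = val p1 + val p2, orthogonal_idem p1 p2, Vclass p1 = X & Vclass p2 = Y].
Proof.
have [a ->] := VclassP X; have [b ->] := VclassP Y.
rewrite -(Vclass_spread (isT : (0 < 2)%N) a) -(Vclass_spread (isT : (1 < 2)%N) b).
set a' := spread_idem _ a; set b' := spread_idem _ b.
have o : orthogonal_idem a' b' by exact: spread_orth.
rewrite (Vclass_addE o) => /Vclass_eqP/idem_eqv_norm[x [y [pxy gyx [xp xg] [yg yp]]]].
have aa := idemP a'; have bb := idemP b'; case: o gyx xg yg => /= ab ba gyx xg yg.
set A := val a' in aa ab ba gyx xg yg; set B := val b' in bb ab ba gyx xg yg.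
have mid u v : (x ** u ** y) ** (x ** v ** y) = x ** (u ** (A + B) ** v) ** y.
  by rewrite gyx !rmulA.
have e1 : (x ** A ** y) ** (x ** A ** y) = x ** A ** y.
  by rewrite mid rmulDr aa ab addr0 aa.
have e2 : (x ** B ** y) ** (x ** B ** y) = x ** B ** y.
  by rewrite mid rmulDr bb ba add0r bb.
exists (mkidem e1), (mkidem e2); split.
- by rewrite /= -rmulDl -rmulDr -xg -pxy.
- by split; rewrite /= mid rmulDr ?aa ?ab ?ba ?bb ?addr0 ?add0r ?ab ?ba rmulr0 rmul0r.
- apply/Vclass_eqP/asboolP; exists (x ** A), (A ** y); rewrite /=; split.
    by rewrite !rmulA -[x ** A ** A]rmulA aa.
  by rewrite -rmulA [y ** (x ** A)]rmulA -gyx rmulDl aa ba addr0 aa.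
- apply/Vclass_eqP/asboolP; exists (x ** B), (B ** y); rewrite /=; split.
    by rewrite !rmulA -[x ** B ** B]rmulA bb.
  by rewrite -rmulA [y ** (x ** B)]rmulA -gyx rmulDl bb ab add0r bb.
Qed.

(** Copies of [f] and [g] on the even and the odd indices are orthogonal, so both products pass
    through one idempotent. *)
Lemma idem_join f g x y x' y' : exists h X Y,
  x ** val f ** y + x' ** val g ** y' = X ** val h ** Y /\ Vclass h = Vclass f + Vclass g.
Proof.
pose f' := spread_idem (isT : (0 < 2)%N) f; pose g' := spread_idem (isT : (1 < 2)%N) g.
have o : orthogonal_idem f' g' by exact: spread_orth.
have /idem_eqv_norm[a [b [fab fba [af fa] [bf fb]]]] := spread_eqv (isT : (0 < 2)%N) f.
have /idem_eqv_norm[c [d [gcd gdc [cg gc] [dg gd]]]] := spread_eqv (isT : (1 < 2)%N) g.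
rewrite -/f' in fba fa bf; rewrite -/g' in gdc gc dg.
exists (idem_add o), (x ** a + x' ** c), (b ** y + d ** y'); split; last first.
  by rewrite -(Vclass_addE o) !Vclass_spread.
have [u1 u2] := o; have -> : val (idem_add o) = val f' + val g' by [].
have ad : a ** d = 0 by rewrite fa dg -rmulA [val f' ** _]rmulA u1 rmul0r rmulr0.
have cb : c ** b = 0 by rewrite gc bf -rmulA [val g' ** _]rmulA u2 rmul0r rmulr0.
have aH : a ** (val f' + val g') = a by rewrite rmulDr -fa {2}fa -rmulA u1 rmulr0 addr0.
have cH : c ** (val f' + val g') = c by rewrite rmulDr -gc {1}gc -rmulA u2 rmulr0 add0r.
move: (val f' + val g') aH cH => H aH cH.
rewrite [(x ** a + _) ** H]rmulDl -[x ** a ** H]rmulA -[x' ** c ** H]rmulA aH cH.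
rewrite rmulDl !rmulDr !rmulA -[x ** a ** b]rmulA -fab -[x ** a ** d]rmulA ad.
rewrite -[x' ** c ** b]rmulA cb -[x' ** c ** d]rmulA -gcd !rmulr0 !rmul0r.
by rewrite addr0 add0r.
Qed.
End VMonoid.

(** * Norm estimates for matrices over a C*-algebra *)

Section MatrixNorm.
Variables (R : realType) (U : ucstarType R).
Local Notation Mx := (Minf U).
Implicit Types (A B D : Mx) (n : nat).

Definition supp (S : rngType) n (A : Minf S) :=
  forall i j, (n <= i)%N || (n <= j)%N -> val A i j = 0.

Lemma suppP (S : rngType) (A : Minf S) : exists n, supp n A.
Proof. exact: MinfP. Qed.
Lemma supp_le (S : rngType) n m (A : Minf S) : (n <= m)%N -> supp n A -> supp m A.
Proof.
move=> nm h i j /orP[] k; apply: h; rewrite (leq_trans nm k) ?orbT //.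
Qed.
Lemma suppD (S : rngType) n (A B : Minf S) : supp n A -> supp n B -> supp n (A + B).
Proof. by move=> h h' i j k /=; rewrite h // h' // addr0. Qed.
Lemma suppN (S : rngType) n (A : Minf S) : supp n A -> supp n (- A).
Proof. by move=> h i j k /=; rewrite h // oppr0. Qed.
Lemma supp_mulE (S : rngType) n (A B : Minf S) i j : supp n A ->
  val (A ** B) i j = \sum_(k < n) val A i k ** val B k j.
Proof.
by move=> h; rewrite (@Minf_mulP _ _ _ _ _ n) ?big_mkord // => k nk; rewrite h // nk orbT.
Qed.
Lemma suppM (S : rngType) n (A B : Minf S) : supp n A -> supp n B -> supp n (A ** B).
Proof.
move=> h h' i j k; rewrite (supp_mulE _ _ _ h) big1 // => l _.
by case/orP: k => k; [rewrite h ?k // rmul0r|rewrite h' ?k ?orbT // rmulr0].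
Qed.

(* Not the C*-norm of the matrix, only an equivalent one. *)
Definition mn n A : R := \sum_(i < n) \sum_(j < n) nr (val A i j).

Lemma mn_ge0 n A : 0 <= mn n A.
Proof. by apply: sumr_ge0 => i _; apply: sumr_ge0 => j _; exact: nr_ge0. Qed.
Lemma mn_entry n A (i j : 'I_n) : nr (val A i j) <= mn n A.
Proof.
rewrite /mn (bigD1 i) //= (bigD1 j) //= -addrA lerDl addr_ge0 //.
  by apply: sumr_ge0 => k _; exact: nr_ge0.
by apply: sumr_ge0 => k _; apply: sumr_ge0 => l _; exact: nr_ge0.
Qed.
Lemma mnD n A B : mn n (A + B) <= mn n A + mn n B.
Proof.
rewrite /mn -big_split; apply: ler_sum => i _; rewrite -big_split.
by apply: ler_sum => j _; exact: nrD.
Qed.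
Lemma mnN n A : mn n (- A) = mn n A.
Proof. by apply: eq_bigr => i _; apply: eq_bigr => j _; exact: nrN. Qed.
Lemma nr_sum I (r : seq I) (F : I -> U) : nr (\sum_(i <- r) F i) <= \sum_(i <- r) nr (F i).
Proof.
elim/big_rec2: _ => [|i y z _ h]; first by rewrite nr0.
by apply: le_trans (nrD _ _) _; rewrite lerD2l.
Qed.
Lemma mnM n A B : supp n A -> mn n (A ** B) <= mn n A * mn n B.
Proof.
move=> hA.
apply: (@le_trans _ _ (\sum_(i < n) \sum_(j < n) \sum_(k < n) nr (val A i k) * nr (val B k j))).
  apply: ler_sum => i _; apply: ler_sum => j _; rewrite (supp_mulE _ _ _ hA).
  by apply: le_trans (nr_sum _ _) _; apply: ler_sum => k _; exact: nrM.
rewrite /mn mulr_suml; apply: ler_sum => i _.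
rewrite exchange_big mulr_suml; apply: ler_sum => k _; rewrite -mulr_sumr.
apply: ler_wpM2l; first exact: nr_ge0.
rewrite [leRHS](bigD1 k) //= lerDl; apply: sumr_ge0 => l _; apply: sumr_ge0 => j _.
exact: nr_ge0.
Qed.
Lemma mn_le n A e : (forall i j : 'I_n, nr (val A i j) <= e) -> mn n A <= (n * n)%:R * e.
Proof.
move=> h; apply: (@le_trans _ _ (\sum_(i < n) \sum_(j < n) e)).
  by apply: ler_sum => i _; apply: ler_sum => j _; exact: h.
by rewrite !sumr_const !card_ord -mulrnA mulr_natl.
Qed.

Lemma limS_sum I (r : seq I) (F : nat -> I -> U) (L : I -> U) :
  (forall i, limS (fun n => F n i) (L i)) ->
  limS (fun n => \sum_(i <- r) F n i) (\sum_(i <- r) L i).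
Proof.
move=> h; elim: r => [|i r IH].
  rewrite big_nil; under eq_fun => n do rewrite big_nil; exact: limS_cst.
rewrite big_cons; under eq_fun => n do rewrite big_cons.
exact: limSD.
Qed.

(** [Minf] has no unit, so [e] is a quasi-inverse: formally [1 + e] is the inverse of [1 - D]. *)
Lemma Minf_neumann n D : supp n D -> mn n D < 1 ->
  exists e, [/\ supp n e, e = D + D ** e & e = D + e ** D].
Proof.
move=> hD D1; pose u := fix u k := if k is l.+1 then D + D ** u l else 0.
have su k : supp n (u k).
  by elim: k => [|k IH] //=; apply: suppD => //; exact: suppM.
have uC k : D ** u k = u k ** D.
  by elim: k => [|k IH] /=; rewrite ?rmulr0 ?rmul0r // rmulDr rmulDl {1}IH rmulA.
have ud k : mn n (u k.+1 - u k) <= mn n D * mn n D ^+ k.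
  elim: k => [|k IH]; first by rewrite /= rmulr0 addr0 subr0 expr0 mulr1.
  have -> : u k.+2 - u k.+1 = D ** (u k.+1 - u k).
    by rewrite [u k.+2]/= rmulBr opprD addrACA subrr add0r.
  apply: le_trans (mnM _ hD) _; rewrite exprS; apply: ler_wpM2l => //; exact: mn_ge0.
have /choice[L hL] : forall ij : nat * nat, exists l, limS (fun k => val (u k) ij.1 ij.2) l.
  move=> [i j] /=; have [h|h] := boolP ((n <= i)%N || (n <= j)%N).
    exists 0; rewrite (_ : (fun k => _) = fun=> 0); first exact: limS_cst.
    by apply/funext => k; exact: su.
  move: h; rewrite negb_or -!ltnNge => /andP[i_n j_n].
  apply: (geo_limS (mn_ge0 n D) D1 (K := mn n D)) => k.
  by apply: le_trans (ud k); exact: (mn_entry (u k.+1 - u k) (Ordinal i_n) (Ordinal j_n)).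
have fL : fin_mx (fun i j => L (i, j)).
  exists n => i j h; apply: (limS_unique (hL (i, j))) => /=.
  rewrite (_ : (fun k => _) = fun=> 0); first exact: limS_cst.
  by apply/funext => k; exact: su.
pose e := mkMinf fL.
have se : supp n e.
  move=> i j h; apply: (limS_unique (hL (i, j))) => /=.
  rewrite (_ : (fun k => _) = fun=> 0); first exact: limS_cst.
  by apply/funext => k; exact: su.
exists e; split=> //; apply: Minf_eqP => i j.
  suff h : limS (fun k => val (u k.+1) i j) (val (D + D ** e) i j).
    exact: limS_unique (limS_S (hL (i, j))) h.
  have -> : val (D + D ** e) i j = val D i j + \sum_(l < n) val D i l ** val e l j.
    by rewrite -(supp_mulE e i j hD).
  have E k : val (u k.+1) i j = val D i j + \sum_(l < n) val D i l ** val (u k) l j.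
    by rewrite -(supp_mulE (u k) i j hD).
  under eq_fun => k do rewrite E.
  apply: limSD; first exact: limS_cst.
  by apply: limS_sum => l; apply: limSM; [exact: limS_cst|exact: (hL (_, _))].
suff h : limS (fun k => val (u k.+1) i j) (val (D + e ** D) i j).
  exact: limS_unique (limS_S (hL (i, j))) h.
have -> : val (D + e ** D) i j = val D i j + \sum_(l < n) val e i l ** val D l j.
  by rewrite -(supp_mulE D i j se).
have E k : val (u k.+1) i j = val D i j + \sum_(l < n) val (u k) i l ** val D l j.
  by rewrite -(supp_mulE D i j (su k)) -uC.
under eq_fun => k do rewrite E.
apply: limSD; first exact: limS_cst.
by apply: limS_sum => l; apply: limSM; [exact: (hL (_, _))|exact: limS_cst].
Qed.

(** Formally [1 - D = P Q + (1 - P)(1 - Q)]; it intertwines [P] and [Q] and is invertible when [D]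
    has norm below 1. *)
Lemma close_eqv n (p q : idem Mx) : supp n (val p) -> supp n (val q) ->
  (mn n (val p) + mn n (val q)) * mn n (val p - val q) < 1 -> Vclass p = Vclass q.
Proof.
move=> sp sq h; have pp := idemP p; have qq := idemP q.
set P := val p in sp pp h; set Q := val q in sq qq h.
pose D := P ** (P - Q) + (Q - P) ** Q.
have sPQ : supp n (P - Q) by apply: suppD => //; exact: suppN.
have sQP : supp n (Q - P) by apply: suppD => //; exact: suppN.
have sD : supp n D by apply: suppD; exact: suppM.
have [|e [_ e1 e2]] := Minf_neumann sD.
  apply: le_lt_trans h; apply: le_trans (mnD _ _ _) _; rewrite mulrDl.
  apply: lerD; first exact: mnM.
  by rewrite -(mnN _ (P - Q)) opprB mulrC; exact: mnM.
have PD : P ** D = P - P ** Q.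
  by rewrite /D rmulDr !rmulA pp rmulBr pp rmulBr pp rmulBl -!rmulA qq; abel.
have DQ : D ** Q = Q - P ** Q.
  by rewrite /D !rmulE -!rmulA !qq [P ** (P ** Q)]rmulA pp; abel.
have EPQ : P ** Q = P - P ** D by rewrite PD; abel.
have EPQ' : P ** Q = Q - D ** Q by rewrite DQ; abel.
clearbody D.
apply/Vclass_eqP/asboolP; exists (P ** Q), (Q + Q ** e); split; rewrite -/P -/Q.
  rewrite rmulDr -!rmulA qq [Q ** (Q ** e)]rmulA qq !rmulA EPQ rmulBl [P ** e](congr1 (rmul P) e1) rmulDr rmulA.
  by abel.
rewrite EPQ' rmulBr !rmulDl qq -!rmulA {1}e2 !rmulDl !rmulDr -!rmulA.
by abel.
Qed.
End MatrixNorm.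

(** * The obstruction to lifting *)

Section IdealOfIdempotents.
Variables (B : rngType) (T : V B -> Prop).
Hypothesis TD : forall x y, T x -> T y -> T (x + y).
Hypothesis T0 : T 0.

(** One summand is enough: finite sums are merged by [idem_join], since [T] is closed under
    addition. *)
Definition ideal_gen (w : Minf B) := exists (h : idem (Minf B)) X Y,
  w = X ** val h ** Y /\ T (Vclass h).

Lemma ideal_gen0 : ideal_gen 0.
Proof.
exists (exist (fun a : Minf B => is_true (a ** a == a)) 0 (Minf0_idem B)), 0, 0.
by rewrite rmulr0; split.
Qed.
Lemma ideal_genD x y : ideal_gen x -> ideal_gen y -> ideal_gen (x + y).
Proof.
move=> [f [X [Y [-> Tf]]]] [g [X' [Y' [-> Tg]]]].
have [h [Z [W [-> hfg]]]] := idem_join f g X Y X' Y'.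
by exists h, Z, W; split=> //; rewrite hfg; exact: TD.
Qed.
Lemma ideal_genMl x y : ideal_gen y -> ideal_gen (x ** y).
Proof. by move=> [f [X [Y [-> Tf]]]]; exists f, (x ** X), Y; rewrite !rmulA. Qed.
Lemma ideal_genMr x y : ideal_gen x -> ideal_gen (x ** y).
Proof. by move=> [f [X [Y [-> Tf]]]]; exists f, X, (Y ** y); rewrite !rmulA. Qed.
Lemma ideal_genN x : ideal_gen x -> ideal_gen (- x).
Proof. by move=> [f [X [Y [-> Tf]]]]; exists f, (- X), Y; rewrite !rmulNl. Qed.
End IdealOfIdempotents.

Definition rng_ideal (S : rngType) (J : S -> Prop) :=
  [/\ J 0, forall x y, J x -> J y -> J (x + y),
      forall x y, J y -> J (x ** y) & forall x y, J x -> J (x ** y)].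

(* Every element is, up to a small error, in the ideal generated by idempotents
   factoring through it; and a small element of a corner is not equal to a
   square root of the unit of that corner modulo a proper ideal. *)
Definition approx_idem (B : rngType) (sm : Minf B -> Prop) :=
  [/\ forall z, exists (L : seq (idem (Minf B) * Minf B * Minf B)) d,
        [/\ sm d, z = d + \sum_(t <- L) t.1.2 ** val t.1.1 ** t.2 &
          forall t, t \in L -> exists r s, val t.1.1 = r ** z ** s],
      forall d, sm d -> sm (- d) &
      forall (J : Minf B -> Prop) (p s : Minf B) (ds : 6.-tuple (Minf B)), rng_ideal J ->
        p ** p = p -> s ** s = p -> p ** s = s -> (forall d, d \in ds -> sm d) ->
        J (s - \sum_(d <- ds) d) -> J p].

Section Contradiction.
Variables (S : choiceType) (B : rngType) (W : nmodType) (psi : {additive V B -> W}).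
Variables (sm : Minf B -> Prop) (u : W) (e1 e1' e2 e2' e3 e3' : S -> W).
Variable tv : W -> S -> S -> S -> Prop.
Hypothesis hS : is_aleph 3 [set: S].
Hypothesis hB : approx_idem sm.
Hypothesis psiV : pre_V_hom psi.
Hypothesis psi_surj : forall y, exists x, psi x = y.
Hypothesis e1E : forall a, u = e1 a + e1' a.
Hypothesis e2E : forall a, u = e2 a + e2' a.
Hypothesis e3E : forall a, u = e3 a + e3' a.
Hypothesis tvD : forall x y a b c, tv x a b c -> tv y a b c -> tv (x + y) a b c.
Hypothesis tv0 : forall a b c, tv 0 a b c.
Hypothesis tvle : forall x y a b c, tv (x + y) a b c -> tv x a b c.
Hypothesis tvu : forall a b c, ~ tv u a b c.
Notation wle x y := (exists z, y = x + z).
Hypothesis h12 : forall a b x, (wle x (e1 a) /\ wle x (e2' b)) \/ (wle x (e1' a) /\ wle x (e2 b)) ->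
  exists F : {fset S}, forall c, c \notin F -> tv x a b c.
Hypothesis h23 : forall b c x, (wle x (e2 b) /\ wle x (e3' c)) \/ (wle x (e2' b) /\ wle x (e3 c)) ->
  exists F : {fset S}, forall a, a \notin F -> tv x a b c.
Hypothesis h31 : forall a c x, (wle x (e3 c) /\ wle x (e1 a)) \/ (wle x (e3' c) /\ wle x (e1' a)) ->
  exists F : {fset S}, forall b, b \notin F -> tv x a b c.

Lemma psi_le X Y : Vle X Y -> wle (psi X) (psi Y).
Proof. by move=> [Z ->]; exists (psi Z); rewrite raddfD. Qed.

(** Each idempotent in the approximation of [p q] factors through [p] and through [q], so its class
    lies below both. There are finitely many of them, hence one finite exceptional set. *)
Lemma pair_lemma (T : W -> S -> Prop) (p q : idem (Minf B)) :
  (forall x y s, T x s -> T y s -> T (x + y) s) -> (forall s, T 0 s) ->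
  (forall x, wle x (psi (Vclass p)) -> wle x (psi (Vclass q)) ->
    exists F : {fset S}, forall s, s \notin F -> T x s) ->
  exists (F : {fset S}) d, sm d /\ forall s, s \notin F ->
    ideal_gen (fun X => T (psi X) s) (val p ** val q - d).
Proof.
move=> TD T0 hT; have [/(_ (val p ** val q))[L [d [sd zE hL]]] _ _] := hB.
suff [F hF] : exists F : {fset S}, forall s, s \notin F ->
    ideal_gen (fun X => T (psi X) s) (\sum_(t <- L) t.1.2 ** val t.1.1 ** t.2).
  exists F, d; split=> // s /hF; congr (ideal_gen _ _).
  by rewrite zE; abel.
move: hL {zE}; elim: L => [|[[f X] Y] L IH] hL.
  exists fset0 => s _; rewrite big_nil; apply: ideal_gen0.
  by rewrite raddf0.
have [F hF] := IH (fun t tL => hL t (mem_behead (s := _ :: L) tL)).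
have [r [s fE]] : exists r s, val f = r ** (val p ** val q) ** s := hL _ (mem_head _ _).
have [F' hF'] : exists F : {fset S}, forall s, s \notin F -> T (psi (Vclass f)) s.
  apply: hT; apply: psi_le.
    by apply: (@Vle_factor _ _ _ r (val q ** s)); rewrite fE !rmulA.
  by apply: (@Vle_factor _ _ _ (r ** val p) s); rewrite fE !rmulA.
exists (F `|` F')%fset => x; rewrite in_fsetU negb_or => /andP[xF xF'].
rewrite big_cons /=; apply: ideal_genD; last exact: hF.
  by move=> y z; rewrite raddfD; exact: TD.
by exists f, X, Y; split=> //; exact: hF'.
Qed.

Lemma lift_contradiction : False.
Proof.
have [c0 hc0] := psi_surj u; have [p pE] := VclassP c0.
have dec (e e' : S -> W) : (forall a, u = e a + e' a) -> forall a, exists pp : idem (Minf B) * idem (Minf B),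
    [/\ val p = val pp.1 + val pp.2, orthogonal_idem pp.1 pp.2,
        psi (Vclass pp.1) = e a & psi (Vclass pp.2) = e' a].
  move=> eE a; have := hc0; rewrite (eE a) => /psiV[x [y [cxy <- <-]]].
  have [p1 [p2 [h1 h2 <- <-]]] := Vdecomp (etrans (esym pE) cxy).
  by exists (p1, p2).
have /choice[A hA] := dec _ _ e1E; have /choice[A2 hA2] := dec _ _ e2E.
have /choice[A3 hA3] := dec _ _ e3E.
have k12 : forall ab : S * S, exists (F : {fset S}) (d d' : Minf B), [/\ sm d, sm d' & forall c, c \notin F ->
    ideal_gen (fun X => tv (psi X) ab.1 ab.2 c) (val (A ab.1).1 ** val (A2 ab.2).2 - d) /\
    ideal_gen (fun X => tv (psi X) ab.1 ab.2 c) (val (A ab.1).2 ** val (A2 ab.2).1 - d')].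
  move=> [a b] /=; have [_ _ q1 q2] := hA a; have [_ _ q3 q4] := hA2 b.
  have [F [d [sd hF]]] := @pair_lemma (fun x c => tv x a b c) (A a).1 (A2 b).2
    ltac:(by move=> *; exact: tvD) ltac:(by move=> *; exact: tv0)
    ltac:(by move=> x; rewrite q1 q4 => ? ?; apply: h12; left).
  have [F' [d' [sd' hF']]] := @pair_lemma (fun x c => tv x a b c) (A a).2 (A2 b).1
    ltac:(by move=> *; exact: tvD) ltac:(by move=> *; exact: tv0)
    ltac:(by move=> x; rewrite q2 q3 => ? ?; apply: h12; right).
  exists (F `|` F')%fset, d, d'; split=> // c; rewrite in_fsetU negb_or => /andP[/hF ? /hF' ?].
  by split.
have k23 : forall bc : S * S, exists (F : {fset S}) (d d' : Minf B), [/\ sm d, sm d' & forall a, a \notin F ->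
    ideal_gen (fun X => tv (psi X) a bc.1 bc.2) (val (A2 bc.1).1 ** val (A3 bc.2).2 - d) /\
    ideal_gen (fun X => tv (psi X) a bc.1 bc.2) (val (A2 bc.1).2 ** val (A3 bc.2).1 - d')].
  move=> [b c] /=; have [_ _ q1 q2] := hA2 b; have [_ _ q3 q4] := hA3 c.
  have [F [d [sd hF]]] := @pair_lemma (fun x a => tv x a b c) (A2 b).1 (A3 c).2
    ltac:(by move=> *; exact: tvD) ltac:(by move=> *; exact: tv0)
    ltac:(by move=> x; rewrite q1 q4 => ? ?; apply: h23; left).
  have [F' [d' [sd' hF']]] := @pair_lemma (fun x a => tv x a b c) (A2 b).2 (A3 c).1
    ltac:(by move=> *; exact: tvD) ltac:(by move=> *; exact: tv0)
    ltac:(by move=> x; rewrite q2 q3 => ? ?; apply: h23; right).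
  exists (F `|` F')%fset, d, d'; split=> // a; rewrite in_fsetU negb_or => /andP[/hF ? /hF' ?].
  by split.
have k31 : forall ac : S * S, exists (F : {fset S}) (d d' : Minf B), [/\ sm d, sm d' & forall b, b \notin F ->
    ideal_gen (fun X => tv (psi X) ac.1 b ac.2) (val (A3 ac.2).1 ** val (A ac.1).1 - d) /\
    ideal_gen (fun X => tv (psi X) ac.1 b ac.2) (val (A3 ac.2).2 ** val (A ac.1).2 - d')].
  move=> [a c] /=; have [_ _ q1 q2] := hA a; have [_ _ q3 q4] := hA3 c.
  have [F [d [sd hF]]] := @pair_lemma (fun x b => tv x a b c) (A3 c).1 (A a).1
    ltac:(by move=> *; exact: tvD) ltac:(by move=> *; exact: tv0)
    ltac:(by move=> x; rewrite q1 q3 => ? ?; apply: h31; left).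
  have [F' [d' [sd' hF']]] := @pair_lemma (fun x b => tv x a b c) (A3 c).2 (A a).2
    ltac:(by move=> *; exact: tvD) ltac:(by move=> *; exact: tv0)
    ltac:(by move=> x; rewrite q2 q4 => ? ?; apply: h31; right).
  exists (F `|` F')%fset, d, d'; split=> // b; rewrite in_fsetU negb_or => /andP[/hF ? /hF' ?].
  by split.
have /choice[F12 g12] := k12; have /choice[F23 g23] := k23; have /choice[F31 g31] := k31.
have [a [b [c [cF bF aF]]]] := free_triple (fun a b => F12 (a, b)) (fun a c => F31 (a, c))
  (fun b c => F23 (b, c)) hS.
have [d1 [d2 [s1 s2 /(_ _ cF) /= [j1 j2]]]] := g12 (a, b).
have [d3 [d4 [s3 s4 /(_ _ aF) /= [j3 j4]]]] := g23 (b, c).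
have [d5 [d6 [s5 s6 /(_ _ bF) /= [j5 j6]]]] := g31 (a, c).
pose T X := tv (psi X) a b c.
have TD x y : T x -> T y -> T (x + y) by rewrite /T raddfD; exact: tvD.
have T0 : T 0 by rewrite /T raddf0.
have JI : rng_ideal (ideal_gen T).
  split; [exact: ideal_gen0|exact: ideal_genD|exact: ideal_genMl|exact: ideal_genMr].
have [pa oa _ _] := hA a; have [pb ob _ _] := hA2 b; have [pc oc _ _] := hA3 c.
move: j1 j2 j3 j4 j5 j6 pa oa pb ob pc oc; rewrite -/T /orthogonal_idem.
have i1 := idemP (A a).1; have i2 := idemP (A a).2.
have i3 := idemP (A2 b).1; have i4 := idemP (A2 b).2.
have i5 := idemP (A3 c).1; have i6 := idemP (A3 c).2.
move: i1 i2 i3 i4 i5 i6; set P := val p.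
set P1 := val (A a).1; set P1' := val (A a).2; set P2 := val (A2 b).1; set P2' := val (A2 b).2.
set P3 := val (A3 c).1; set P3' := val (A3 c).2.
move=> i1 i2 i3 i4 i5 i6 j1 j2 j3 j4 j5 j6 pa [oa oa'] pb [ob ob'] pc [oc oc'].
have PP1 : P ** P1 = P1 by rewrite pa rmulDl i1 oa' addr0.
have PP1' : P ** P1' = P1' by rewrite pa rmulDl i2 oa add0r.
have P1P : P1 ** P = P1 by rewrite pa rmulDr i1 oa addr0.
have PP2 : P ** P2 = P2 by rewrite pb rmulDl i3 ob' addr0.
have P2P : P2 ** P = P2 by rewrite pb rmulDr i3 ob addr0.
have PP3 : P ** P3 = P3 by rewrite pc rmulDl i5 oc' addr0.
have P3P : P3 ** P = P3 by rewrite pc rmulDr i5 oc addr0.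
have PP := idemP p; rewrite -/P in PP.
have E1 : P1' = P - P1 by rewrite pa; abel.
have E2 : P2' = P - P2 by rewrite pb; abel.
have E3 : P3' = P - P3 by rewrite pc; abel.
(* The six products group into [P1 - P2], [P2 - P3] and, on the face with the opposite
   identification, [P1 + P3 - P]. These add up to [2 P1 - P], a symmetry of the corner of [P]. *)
pose s := P1 - P1'.
have sE : s = P1 ** P2' - P1' ** P2 + (P2 ** P3' - P2' ** P3) + (P3 ** P1 - P3' ** P1').
  rewrite /s E1 E2 E3 !rmulBl !rmulBr P1P PP2 P2P PP3 P3P PP PP1; abel.
have ss : s ** s = P.
  by rewrite /s !rmulBl !rmulBr i1 i2 oa oa' pa; abel.
have Ps : P ** s = s by rewrite /s rmulBr PP1 PP1'.
have [_ smN hJ] := hB.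
have JP : ideal_gen T P.
  apply: (hJ _ P s [tuple d1; - d2; d3; - d4; d5; - d6] JI PP ss Ps).
    by move=> d; rewrite !inE => /or4P[/eqP ->|/eqP ->|/eqP ->|/or3P[/eqP ->|/eqP ->|/eqP ->]] //; exact: smN.
  rewrite /= !big_cons big_nil sE.
  have -> : P1 ** P2' - P1' ** P2 + (P2 ** P3' - P2' ** P3) + (P3 ** P1 - P3' ** P1') -
     (d1 + (- d2 + (d3 + (- d4 + (d5 + (- d6 + 0)))))) =
    (P1 ** P2' - d1) - (P1' ** P2 - d2) + ((P2 ** P3' - d3) - (P2' ** P3 - d4)) +
    ((P3 ** P1 - d5) - (P3' ** P1' - d6)) by abel.
  by do !(apply: ideal_genD => //); apply: ideal_genN.
(* [P] factors through one idempotent whose class is in [T], so its own class is below it and [tv]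
   would hold for [u]. *)
have [h [X [Y [PE Th]]]] := JP.
have [Z hZ] := Vle_factor PE.
apply: (tvu (a := a) (b := b) (c := c)); rewrite -hc0 pE.
by move: Th; rewrite /T hZ raddfD; exact: tvle.
Qed.
End Contradiction.

(** * Regular rings and C*-algebras of real rank zero *)

Section Entries.
Variable B : rngType.
Implicit Types (z : Minf B) (c : B).

Definition entry_fun (i j : nat) c (k l : nat) : B := if (k == i) && (l == j) then c else 0.
Lemma fin_entry i j c : fin_mx (entry_fun i j c).
Proof.
exists (maxn i j).+1 => k l h; rewrite /entry_fun; case: ifP => // /andP[/eqP ki /eqP lj].
by move: h; rewrite ki lj !ltnNge leq_maxl leq_maxr.
Qed.
Definition Ent i j c := mkMinf (fin_entry i j c).

Lemma EntMl i k c z a b : val (Ent i k c ** z) a b = if a == i then c ** val z k b else 0.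
Proof.
rewrite (@Minf_mulP _ _ _ _ _ k.+1) => [|l kl] /=; rewrite /entry_fun; last first.
  by rewrite [l == k]gtn_eqF ?andbF.
rewrite big_nat_recr //= big_nat big1 ?add0r => [|l /andP[_ lk]]; last first.
  by rewrite [l == k]ltn_eqF ?andbF ?rmul0r.
by rewrite eqxx andbT; case: ifP => // _; rewrite rmul0r.
Qed.
Lemma EntMr l j c z a b : val (z ** Ent l j c) a b = if b == j then val z a l ** c else 0.
Proof.
have -> : val (z ** Ent l j c) a b = \sum_(0 <= k < l.+1) val z a k ** entry_fun l j c k b.
  apply: sum_nat_finsupp => k lk /=; rewrite /entry_fun [k == l]gtn_eqF //.
  by rewrite rmulr0.
rewrite big_nat_recr //= big_nat big1 ?add0r => [|k /andP[_ lk]]; last first.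
  by rewrite /entry_fun [k == l]ltn_eqF //= rmulr0.
by rewrite /entry_fun eqxx /=; case: ifP => // _; rewrite rmulr0.
Qed.
Lemma Ent_mid i k l j r s z : Ent i k r ** z ** Ent l j s = Ent i j (r ** val z k l ** s).
Proof.
apply: Minf_eqP => a b; rewrite EntMr EntMl /= /entry_fun.
by case: (a == i); case: (b == j); rewrite ?rmul0r.
Qed.
Lemma EntM i k j r s : Ent i k r ** Ent k j s = Ent i j (r ** s).
Proof.
apply: Minf_eqP => a b; rewrite EntMl /= /entry_fun eqxx /=.
by case: (a == i); case: (b == j); rewrite ?rmulr0.
Qed.

Lemma val_sum I (r : seq I) (F : I -> Minf B) a b :
  val (\sum_(i <- r) F i) a b = \sum_(i <- r) val (F i) a b.
Proof. by elim/big_rec2: _ => //= i y x _ <-. Qed.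

Lemma sum_pick (I : eqType) (P : seq I) (F : I -> B) q : uniq P ->
  \sum_(i <- P) (if i == q then F i else 0) = if q \in P then F q else 0.
Proof.
elim: P => [|x P IH] /=; first by rewrite big_nil.
case/andP=> xP uP; rewrite big_cons IH // in_cons eq_sym.
case: eqVneq => [->|_] /=; last by rewrite add0r.
by rewrite (negbTE xP) addr0.
Qed.

(** Each entry is treated by itself: [Ent] moves it to position (0, 0) and back. [Q] expresses that
    an error is small. *)
Lemma entry_approx (Q : B -> Prop) n z : supp n z ->
  (forall c, exists f r s x y, [/\ f ** f = f, f = r ** c ** s & Q (c - x ** f ** y)]) ->
  exists (L : seq (idem (Minf B) * Minf B * Minf B)) d,
    [/\ supp n d, forall i j, (i < n)%N -> (j < n)%N -> Q (val d i j),
        z = d + \sum_(t <- L) t.1.2 ** val t.1.1 ** t.2 &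
        forall t, t \in L -> exists r s, val t.1.1 = r ** z ** s].
Proof.
move=> sz Hel.
have /choice[D hD] : forall ij : nat * nat, exists D : B * B * B * B * B,
   let: (f, r, s, x, y) := D in
   [/\ f ** f = f, f = r ** val z ij.1 ij.2 ** s & Q (val z ij.1 ij.2 - x ** f ** y)].
  move=> ij; have [f [r [s [x [y h]]]]] := Hel (val z ij.1 ij.2).
  by exists (f, r, s, x, y).
have idf ij : let f := (D ij).1.1.1.1 in Ent 0 0 f ** Ent 0 0 f = Ent 0 0 f.
  by rewrite /= EntM; have := hD ij; case: (D ij) => [[[[f r] s] x] y] [/= -> _ _].
pose P := [seq (i, j) | i <- iota 0 n, j <- iota 0 n].
have uP : uniq P by apply: allpairs_uniq; rewrite ?iota_uniq // => -[? ?] [? ?].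
have memP a b : ((a, b) \in P) = (a < n)%N && (b < n)%N.
  apply/allpairsP/andP => [[[i j] /= [hi hj [-> ->]]]|[an bn]].
    by move: hi hj; rewrite !mem_iota.
  by exists (a, b); rewrite !mem_iota.
pose X (ij : nat * nat) := Ent ij.1 0 (D ij).1.2.
pose Y (ij : nat * nat) := Ent 0 ij.2 (D ij).2.
exists [seq (mkidem (idf ij), X ij, Y ij) | ij <- P].
have sE a b : val (\sum_(t <- [seq (mkidem (idf ij), X ij, Y ij) | ij <- P])
      t.1.2 ** val t.1.1 ** t.2) a b =
    if (a < n)%N && (b < n)%N then (D (a, b)).1.2 ** (D (a, b)).1.1.1.1 ** (D (a, b)).2 else 0.
  rewrite val_sum big_map -memP -(sum_pick (fun ij => (D ij).1.2 ** (D ij).1.1.1.1 ** (D ij).2) _ uP).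
  apply: eq_bigr => -[i j] _.
  change (val (X (i, j) ** val (mkidem (idf (i, j))) ** Y (i, j)) a b = 
    if (i, j) == (a, b) then (D (i, j)).1.2 ** (D (i, j)).1.1.1.1 ** (D (i, j)).2 else 0).
  have -> : X (i, j) ** val (mkidem (idf (i, j))) ** Y (i, j) =
      Ent i j ((D (i, j)).1.2 ** (D (i, j)).1.1.1.1 ** (D (i, j)).2) by rewrite !EntM.
  rewrite /= /entry_fun xpair_eqE [i == a]eq_sym [j == b]eq_sym.
  by [].
set Sm := \sum_(t <- _) _ in sE *; exists (z - Sm); split.
- move=> a b h /=; rewrite sz // add0r -/(val Sm a b) sE; case: ifP; rewrite ?oppr0 //.
  by case/andP=> an bn; case/orP: h => h; [rewrite ltnNge h in an|rewrite ltnNge h in bn].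
- move=> i j i_n j_n /=; rewrite -/(val Sm i j) sE i_n j_n /=.
  by have := hD (i, j); case: (D (i, j)) => [[[[f r] s] x] y] [/= _ _].
- by rewrite subrK.
- move=> t /mapP[[i j] _ ->] /=; have := hD (i, j).
  exists (Ent 0 i (D (i, j)).1.1.1.2), (Ent j 0 (D (i, j)).1.1.2).
  rewrite Ent_mid; congr Ent; move: (hD (i, j)).
  by case: (D (i, j)) => [[[[f r] s] x] y] [].
Qed.
End Entries.

(** If [c y c = c], then [y c] is idempotent and [c (y c) = c], so the approximation is exact. *)
Lemma regular_approx (B : rngType) : regular_rng B -> approx_idem (fun d : Minf B => d = 0).
Proof.
move=> reg; split.
- move=> z; have [n sz] := suppP z.
  have [|L [d [sd dQ zE hL]]] := @entry_approx _ (fun d => d = 0) n z sz.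
    move=> c; have [y e] := reg c.
    have ff : y ** c ** (y ** c) = y ** c by rewrite rmulA -[y ** c ** y]rmulA -[LHS]rmulA e.
    exists (y ** c), y, (y ** c), c, (y ** c); split=> //.
    by rewrite -[c ** _ ** _]rmulA ff rmulA e subrr.
  exists L, d; split=> //; apply: Minf_eqP => i j.
  have [h|] := boolP ((n <= i)%N || (n <= j)%N); first exact: sd.
  by rewrite negb_or -!ltnNge => /andP[]; exact: dQ.
- by move=> d ->; rewrite oppr0.
- move=> J p s ds [J0 JD Jl Jr] pp ss ps sm Js.
  rewrite -ss; apply: Jl; move: Js; rewrite big_seq big1 ?subr0 // => d; exact: sm.
Qed.

Section RR0approx.
Variables (R : realType) (B : cstarType R) (U : ucstarType R) (j : B -> U).
Hypothesis hj : unitization j.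
Hypothesis rr : real_rank_le U 0.

Let jD : {morph j : x y / x + y}. Proof. by case: hj => [[]]. Qed.
Let jZ (a : cplx R) x : j (a *: x) = a *: j x. Proof. by case: hj => [[]]. Qed.
Let jM : {morph j : x y / x ** y}. Proof. by case: hj => [[]]. Qed.
Let jS : {morph j : x / star x}. Proof. by case: hj => [[]]. Qed.
Let ji : injective j. Proof. by case: hj => _ []. Qed.
Let j0 : j 0 = 0.
Proof. by apply: (@addrI _ (j 0)); rewrite -jD !addr0. Qed.
Let jN x : j (- x) = - j x.
Proof. by apply: (@addrI _ (j x)); rewrite -jD !subrr j0. Qed.
Let jIl u b : exists b', u ** j b = j b'.
Proof.
case: hj => _ [_ [/(_ u)[c ->]|[_ /(_ u)[c [l ->]]]]]; first by exists (c ** b).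
by exists (c ** b + l *: b); rewrite jD jZ jM rmulDl -rscalerAl rmul1l.
Qed.
Let jIr u b : exists b', j b ** u = j b'.
Proof.
case: hj => _ [_ [/(_ u)[c ->]|[_ /(_ u)[c [l ->]]]]]; first by exists (b ** c).
by exists (b ** c + l *: b); rewrite jD jZ jM rmulDr -rscalerAr rmul1r.
Qed.

Lemma fin_mxj (z : Minf B) : fin_mx (fun i k => j (val z i k)).
Proof. by have [n h] := MinfP z; exists n => i k /h ->. Qed.
Definition jmx z : Minf U := mkMinf (fin_mxj z).

Lemma jmx_supp n z : supp n z -> supp n (jmx z).
Proof. by move=> h i k /h /= ->. Qed.
Lemma jmxD : {morph jmx : x y / x + y}.
Proof. by move=> x y; apply: Minf_eqP => i k /=. Qed.
Lemma jmxN x : jmx (- x) = - jmx x.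
Proof. by apply: Minf_eqP => i k /=. Qed.
Lemma jmxM : {morph jmx : x y / x ** y}.
Proof.
move=> x y; apply: Minf_eqP => i k; have [n sx] := suppP x.
rewrite (supp_mulE _ _ _ (jmx_supp sx)).
change (j (val (x ** y) i k) = \sum_(l < n) j (val x i l) ** j (val y l k)).
rewrite (supp_mulE _ _ _ sx).
by rewrite (big_morph j jD j0); apply: eq_bigr => l _.
Qed.
Lemma jmx_inj : injective jmx.
Proof.
move=> x y h; apply: Minf_eqP => i k; apply: ji.
by have := congr1 (fun z : Minf U => val z i k) h.
Qed.
(** The image of [B] is an ideal of [U]. This brings the result of a Neumann series, which lives
    over [U], back to [B]. *)
Lemma jmx_ideal n e z : supp n e -> exists y, e ** jmx z = jmx y.
Proof.
move=> se; have [m sm] := suppP (e ** jmx z).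
have /choice[y hy] : forall ik : nat * nat, exists b, j b = val (e ** jmx z) ik.1 ik.2.
  move=> [i k]; change (exists b, j b = val (e ** jmx z) i k); rewrite (supp_mulE _ _ _ se).
  elim/big_rec: _ => [|l x _ [b <-]]; first by exists 0.
  by have [c] := jIl (val e i l) (val z l k); rewrite /= => ->; exists (c + b).
have fy : fin_mx (fun i k => y (i, k)).
  by exists m => i k h; apply: ji; rewrite hy j0; exact: sm.
by exists (mkMinf fy); apply: Minf_eqP => i k; rewrite /= hy.
Qed.

Lemma mn_mono (n m : nat) (A : Minf U) : supp n A -> (n <= m)%N -> mn m A <= mn n A.
Proof.
move=> sA nm; rewrite /mn.
have E k : \sum_(i < k) \sum_(l < k) nr (val A i l) = \sum_(0 <= i < k) \sum_(0 <= l < k) nr (val A i l).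
  by rewrite big_mkord; apply: eq_bigr => i _; rewrite big_mkord.
rewrite !E (@big_cat_nat _ _ _ n) //= [X in _ + X]big_nat [X in _ + X]big1 ?addr0.
  apply: ler_sum => i _; rewrite (@big_cat_nat _ _ _ n) //= [X in _ + X]big_nat [X in _ + X]big1 ?addr0 //.
  by move=> l /andP[nl _]; rewrite sA ?nl ?orbT // nr0.
by move=> i /andP[ni _]; rewrite big1 // => l _; rewrite sA ?ni // nr0.
Qed.

(** The bound 1/7 keeps the sum of six small matrices below norm 1. *)
Definition jsmall (d : Minf B) := exists2 n, supp n d & mn n (jmx d) < 1 / 7.

Lemma RR0_approx : approx_idem jsmall.
Proof.
split.
- move=> z; have [n sz] := suppP z.
  (* Summed over all entries, errors of size [e] stay below 1/12. *)
  pose e : R := 1 / (12 * ((n * n)%:R + 1)).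
  have N0 : 0 <= (n * n)%:R :> R by rewrite ler0n.
  have e0 : 0 < e by rewrite divr_gt0 // mulr_gt0 //; lra.
  have [|L [d [sd dQ zE hL]]] := @entry_approx _ (fun c => nr (j c) <= e) n z sz.
    move=> c; have [f [u [q [fE ff fe]]]] := RR0_HP rr (j c) e0.
    have [b1 hb1] := jIl u c; have [r hr] := jIr u (star c).
    have [x hx] := jIl q c; rewrite -jS in fE.
    have [f0 jf0] : exists f0, j f0 = f.
      by exists (star c ** b1); rewrite jM -hb1 rmulA -fE.
    have ff0 : f0 ** f0 = f0 by apply: ji; rewrite jM jf0 ff.
    exists f0, (f0 ** r), f0, x, f0; split=> //.
      apply: ji; rewrite !jM jf0 -hr !rmulA -[f ** j (star c) ** u]rmulA.
      by rewrite -[f ** _ ** j c]rmulA -fE !ff.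
    rewrite -[x ** f0 ** f0]rmulA ff0 jD jN jM jf0 -hx; exact: fe.
  exists L, d; split=> //; exists n => //.
  apply: le_lt_trans (mn_le _ : _ <= (n * n)%:R * e) _.
    by move=> i k; exact: dQ.
  have -> : (n * n)%:R * e = (n * n)%:R / (12 * ((n * n)%:R + 1)) by rewrite /e mul1r.
  rewrite ltr_pdivrMr; lra.
- by move=> d [n sd h]; exists n; [exact: suppN|rewrite jmxN mnN].
- move=> J p s ds [J0 JD Jl Jr] pp ss ps sm Js.
  pose d := \sum_(d <- ds) d.
  have [n sd md] : exists2 n, supp n d & mn n (jmx d) < 1.
    suff [n sd md] : exists2 n, supp n d & mn n (jmx d) <= (size ds)%:R * (1 / 7).
      by exists n => //; apply: le_lt_trans md _; rewrite size_tuple; lra.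
    have {}sm : forall d, d \in tval ds -> jsmall d by [].
    rewrite /d; elim: (tval ds) sm => [|x l IH] sm.
      exists 0%N; first by rewrite big_nil.
      by rewrite big_nil mul0r /mn big_ord0.
    have [|n sn mnn] := IH; first by move=> y yl; apply: sm; rewrite inE yl orbT.
    have [m sm' mm] := sm x (mem_head _ _).
    rewrite big_cons; exists (maxn m n).
      by apply: suppD; apply: supp_le; [exact: leq_maxl|done|exact: leq_maxr|done].
    rewrite jmxD; apply: le_trans (mnD _ _ _) _.
    have h1 := mn_mono (jmx_supp sm') (leq_maxl m n).
    have h2 := mn_mono (jmx_supp sn) (leq_maxr m n).
    have -> : (size (x :: l))%:R = 1 + (size l)%:R :> R by rewrite /= -natr1 addrC.
    by have := le_trans h1 (ltW mm); have := le_trans h2 mnn; lra.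
  have sdd : supp n (d ** d) by exact: suppM.
  have mdd : mn n (jmx (d ** d)) < 1.
    rewrite jmxM; apply: le_lt_trans (mnM _ (jmx_supp sd)) _.
    by have := mn_ge0 n (jmx d); nra.
  have [e [se e1 _]] := Minf_neumann (jmx_supp sdd) mdd.
  have [y hy] := jmx_ideal p se.
  (* Modulo [J] the error [d] equals [s], whose square is [p]. As [d^2] has norm below 1, its
     quasi-inverse supplies [y] with [p (p - d^2)(p + y) = p]. *)
  have Jpd : J (p - d ** d).
    have -> : p - d ** d = s ** (s - d) + (s - d) ** d by rewrite rmulBr rmulBl ss; abel.
    by apply: JD; [exact: Jl|exact: Jr].
  have -> : p = p ** (p - d ** d) ** (p + y).
    apply: jmx_inj; rewrite !jmxM !jmxD jmxN -hy jmxM.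
    set P := jmx p; have PP : P ** P = P by rewrite -jmxM pp.
    move: e1; rewrite jmxM; set D := jmx d ** jmx d => e1; clearbody D.
    have E : e ** P = D ** P + D ** e ** P by rewrite {1}e1 rmulDl.
    by rewrite [P ** (P - D)]rmulBr PP rmulBl !rmulDr PP {1}E rmulDr !rmulA; abel.
  by apply: Jr; apply: Jl.
Qed.
End RR0approx.

(** * The algebra E *)

Section Interval.
Variable R : realType.
Notation C := (cplx R).
Notation M := 'M[C]_2.
Notation I := (I01 R).

Definition ival (t : I) : R := set_val t.
Lemma iv01 t : 0 <= ival t <= 1.
Proof. by have := set_mem (valP t); rewrite /= in_itv. Qed.
Lemma ival_inj : injective ival. Proof. exact: val_inj. Qed.
Lemma clamp01 (r : R) : `[0 : R, 1]%classic (Num.max 0 (Num.min 1 r)).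
Proof. by rewrite /= in_itv /= le_max lexx /= ge_max ler01 /= ge_min lexx. Qed.
Definition clampI (r : R) : I := SigSub (mem_set (clamp01 r)).
Lemma clampIE r : 0 <= r <= 1 -> ival (clampI r) = r.
Proof.
move=> /andP[r0 r1]; change (Num.max 0 (Num.min 1 r) = r).
by rewrite (min_idPr r1) (max_idPr r0).
Qed.
Definition i0 := clampI 0.
Definition i1 := clampI 1.
Lemma iv0 : ival i0 = 0. Proof. by rewrite clampIE // lexx ler01. Qed.
Lemma iv1 : ival i1 = 1. Proof. by rewrite clampIE // lexx ler01. Qed.

(* On [[0, 1]] uniform continuity, convenient for limits, is the same as continuity. *)
Definition ucont_mx (g : I -> M) := forall e, 0 < e -> exists2 d, 0 < d &
  forall s t, `|ival s - ival t| <= d -> bd e (g s - g t).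
Definition ucont_c (f : I -> C) := forall e, 0 < e -> exists2 d, 0 < d &
  forall s t, `|ival s - ival t| <= d -> cn (f s - f t) <= e.

Lemma ucont_mx_entry g i j : ucont_mx g -> ucont_c (fun t => g t i j).
Proof.
move=> h e /h[d d0 hd]; exists d => // s t /hd /bd_entry -/(_ i j).
by rewrite !mxE.
Qed.
Lemma entry_ucont (g : I -> M) : (forall i j, ucont_c (fun t => g t i j)) -> ucont_mx g.
Proof.
move=> h e e0; have e2 : 0 < e / 2 by rewrite divr_gt0.
have /choice[D hD] : forall ij : 'I_2 * 'I_2, exists d, 0 < d /\
    forall s t, `|ival s - ival t| <= d -> cn (g s ij.1 ij.2 - g t ij.1 ij.2) <= e / 2.
  by move=> [i j]; have [d d0 hd] := h i j _ e2; exists d.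
exists (\big[Num.min/1]_ij D ij).
  by elim/big_ind: _ => // [x y x0 y0|ij _]; [rewrite lt_min x0|exact: (hD ij).1].
move=> s t st; have -> : e = 2 * (e / 2) by rewrite mulrC divfK.
apply: entry_bd; first exact: ltW.
move=> i j; rewrite !mxE; apply: (hD (i, j)).2; apply: le_trans st _.
exact: bigmin_le_cond.
Qed.
Lemma ucont_mx_cst m : ucont_mx (fun=> m).
Proof. by move=> e e0; exists 1 => // s t _; rewrite subrr; apply/bd0'/ltW. Qed.
Lemma ucont_mx_lin a g h : ucont_mx g -> ucont_mx h -> ucont_mx (fun t => a *: g t + h t).
Proof.
move=> hg hh e e0; have c0 := cn_ge0 a.
have d0 : 0 < e / (2 * (cn a + 1)) by rewrite divr_gt0 // mulr_gt0 // ltr_wpDl.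
have [d1 d10 h1] := hg _ d0.
have [d2 d20 h2] := hh _ (divr_gt0 e0 (ltr0n R 2)).
exists (Num.min d1 d2); first by rewrite lt_min d10.
move=> s t; rewrite le_min => /andP[/h1 b1 /h2 b2].
have -> : a *: g s + h s - (a *: g t + h t) = a *: (g s - g t) + (h s - h t).
  by rewrite scalerBr; abels.
apply: bd_le (bdD (bdZ a b1) b2); rewrite -[leRHS](_ : e / 2 + e / 2 = e); last by lra.
rewrite lerD2r; have k : cn a * (e / (2 * (cn a + 1))) = (e / 2) * (cn a / (cn a + 1)).
  by field; rewrite gt_eqF // ltr_wpDl.
rewrite k ler_piMr //; first by rewrite ltW // divr_gt0.
by rewrite ler_pdivrMr ?ltr_wpDl // mul1r; lra.
Qed.
Lemma ucont_mx_mul g h r s : (forall t, bd r (g t)) -> (forall t, bd s (h t)) ->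
  ucont_mx g -> ucont_mx h -> ucont_mx (fun t => g t *m h t).
Proof.
move=> br bs hg hh e e0.
pose r' := `|r| + 1; pose s' := `|s| + 1.
have r0 : 0 < r' by rewrite ltr_wpDl.
have s0 : 0 < s' by rewrite ltr_wpDl.
have br' t : bd r' (g t) by apply: bd_le (br t); rewrite /r'; have := ler_norm r; lra.
have bs' t : bd s' (h t) by apply: bd_le (bs t); rewrite /s'; have := ler_norm s; lra.
have [d1 d10 h1] := hg (e / 2 / s') (divr_gt0 (divr_gt0 e0 (ltr0n R 2)) s0).
have [d2 d20 h2] := hh (e / 2 / r') (divr_gt0 (divr_gt0 e0 (ltr0n R 2)) r0).
exists (Num.min d1 d2); first by rewrite lt_min d10.
move=> x y; rewrite le_min => /andP[/h1 b1 /h2 b2].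
have -> : g x *m h x - g y *m h y = (g x - g y) *m h x + g y *m (h x - h y).
  by rewrite mulmxBl mulmxBr; abels.
have e1 : 0 <= e / 2 / s' by rewrite ltW // !divr_gt0.
apply: bd_le (bdD (bdM e1 b1 (bs' x)) (bdM (ltW r0) (br' y) b2)).
by rewrite divfK ?gt_eqF // [r' * _]mulrC divfK ?gt_eqF //; lra.
Qed.
Lemma ucont_mx_star g : ucont_mx g -> ucont_mx (fun t => adj (g t)).
Proof.
move=> h e e0; have [d d0 hd] := h e e0; exists d; first exact: d0.
move=> s t /hd b; have -> : adj (g s) - adj (g t) = adj (g s - g t).
  by rewrite adjD adjN.
by apply: bd_adj => //; exact: ltW.
Qed.
Lemma ucont_mx_lim g : (forall e, 0 < e -> exists2 h, ucont_mx h & forall t, bd e (g t - h t)) -> ucont_mx g.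
Proof.
move=> hl e e0; have e3 : 0 < e / 3 by rewrite divr_gt0.
have [h hh gh] := hl _ e3; have [d d0 hd] := hh _ e3; exists d; first exact: d0.
move=> s t /hd b; have -> : g s - g t = (g s - h s) + (h s - h t) + (h t - g t) by abels.
have e33 : e / 3 + e / 3 + e / 3 <= e by lra.
exact: bd_le e33 (bdD (bdD (gh s) b) (bdC (gh t))).
Qed.

Definition mk2 (a b c d : C) : M :=
  \matrix_(i, j) if i == 0 then (if j == 0 then a else b) else (if j == 0 then c else d).
Lemma ord2 (i : 'I_2) : i = 0 \/ i = 1.
Proof. by case: i => [[|[]]] // p; [left|right]; apply: val_inj. Qed.
Lemma mx2P (m m' : M) : m 0 0 = m' 0 0 -> m 0 1 = m' 0 1 -> m 1 0 = m' 1 0 ->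
  m 1 1 = m' 1 1 -> m = m'.
Proof.
by move=> *; apply/matrixP => i j; case: (ord2 i) => ->; case: (ord2 j) => ->.
Qed.
Lemma mk2E a b c d : ((mk2 a b c d 0 0 = a) * (mk2 a b c d 0 1 = b) *
  (mk2 a b c d 1 0 = c) * (mk2 a b c d 1 1 = d))%type.
Proof. by rewrite !mxE. Qed.
Lemma mul2E (m m' : M) i j : (m *m m') i j = m i 0 * m' 0 j + m i 1 * m' 1 j.
Proof. by rewrite mxE !big_ord_recl big_ord0 addr0; congr (_ * m' _ _ + m _ _ * m' _ _); apply: val_inj. Qed.
Lemma one2E : (((1%:M : M) 0 0 = 1) * ((1%:M : M) 0 1 = 0) * ((1%:M : M) 1 0 = 0) * ((1%:M : M) 1 1 = 1))%type.
Proof. by rewrite !mxE. Qed.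
Definition m2E := (mk2E, mul2E, one2E).

Definition e11 := mk2 1 0 0 0.
Definition a3_off (t : I) : R := Num.sqrt (ival t * (1 - ival t)).
(** The projection onto the line spanned by [(sqrt t, sqrt (1 - t))]. *)
Definition a3 (t : I) : M := mk2 (rc (ival t)) (rc (a3_off t)) (rc (a3_off t)) (rc (1 - ival t)).

Lemma wv2 t : a3_off t ^+ 2 = ival t * (1 - ival t).
Proof. by rewrite sqr_sqrtr // mulr_ge0 ?subr_ge0; have /andP[] := iv01 t. Qed.
Lemma a3_idem t : a3 t *m a3 t = a3 t.
Proof.
have h := wv2 t; rewrite expr2 in h.
by apply: mx2P; rewrite !m2E -!rcM -!rcD; congr rc; nra.
Qed.
Lemma a3_adj t : adj (a3 t) = a3 t.
Proof. by apply: mx2P; rewrite !adjE !mk2E rc_conj. Qed.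
Lemma e11_idem : e11 *m e11 = e11.
Proof. by apply: mx2P; rewrite !m2E; ring. Qed.
Lemma e11_adj : adj e11 = e11.
Proof. by apply: mx2P; rewrite !adjE !mk2E ?rmorph1 ?rmorph0. Qed.
Lemma a3_1 : a3 i1 = e11.
Proof. by rewrite /a3 /a3_off iv1 subrr mulr0 sqrtr0 rc1. Qed.
Lemma a3_0 : a3 i0 = mk2 0 0 0 1.
Proof. by rewrite /a3 /a3_off iv0 subr0 mul0r sqrtr0 rc1. Qed.
Lemma a3_off_le1 t : 0 <= a3_off t <= 1.
Proof.
rewrite sqrtr_ge0 /=; have h := wv2 t; have /andP[a b] := iv01 t.
have w0 : 0 <= a3_off t by exact: sqrtr_ge0.
by rewrite -(ler_sqr (y := 1)) ?nnegrE // expr1n h; nra.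
Qed.
Lemma a3_bd t : bd 2 (a3 t).
Proof.
have -> : 2 = 2 * 1 :> R by rewrite mulr1.
apply: entry_bd => // i j; have /andP[a b] := iv01 t; have /andP[c d] := a3_off_le1 t.
by case: (ord2 i) => ->; case: (ord2 j) => ->; rewrite mk2E cn_rc ger0_norm //; lra.
Qed.
Lemma e11_bd : bd 2 e11.
Proof. by rewrite -a3_1; exact: a3_bd. Qed.
Lemma ucont_c_iv : ucont_c (fun t => rc (ival t)).
Proof. by move=> e e0; exists e => // s t st; rewrite -rcN -rcD cn_rc. Qed.
Lemma ucont_c_wv : ucont_c (fun t => rc (a3_off t)).
Proof.
move=> e e0; exists (e ^+ 2 / 3); first by rewrite divr_gt0 ?exprn_gt0.
move=> s t st; rewrite -rcN -rcD cn_rc.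
have h1 := wv2 s; have h2 := wv2 t; have /andP[a b] := iv01 s; have /andP[c d] := iv01 t.
have /andP[ws _] := a3_off_le1 s; have /andP[wt _] := a3_off_le1 t.
have k : `|a3_off s ^+ 2 - a3_off t ^+ 2| <= e ^+ 2.
  rewrite h1 h2; have -> : ival s * (1 - ival s) - ival t * (1 - ival t) = (ival s - ival t) * (1 - ival s - ival t) by ring.
  rewrite normrM; have : `|1 - ival s - ival t| <= 1 by rewrite ler_norml; apply/andP; split; lra.
  by have := normr_ge0 (ival s - ival t); have := normr_ge0 (1 - ival s - ival t); have := exprn_gt0 2 e0; nra.
rewrite -ler_sqr ?nnegrE ?normr_ge0 ?(ltW e0) //; apply: le_trans k.
rewrite subr_sqr normrM expr2 ler_wpM2l ?normr_ge0 //.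
by rewrite ler_norml (ger0_norm (addr_ge0 ws wt)); apply/andP; split; lra.
Qed.
Lemma ucont_c_B1 : ucont_c (fun t => rc (1 - ival t)).
Proof.
move=> e e0; exists e => // s t st; rewrite -rcN -rcD cn_rc.
have -> : 1 - ival s - (1 - ival t) = - (ival s - ival t) by ring.
by rewrite normrN.
Qed.
Lemma a3_ucont : ucont_mx a3.
Proof.
apply: entry_ucont => i j; case: (ord2 i) => ->; case: (ord2 j) => ->;
under eq_fun => t do rewrite mk2E.
- exact: ucont_c_iv.
- exact: ucont_c_wv.
- exact: ucont_c_wv.
- exact: ucont_c_B1.
Qed.

#[local] Opaque mk2 e11 a3 adj bd.
Definition proj_comb (p : M) (a b : C) : M := a *: p + b *: (1%:M - p).
Lemma proj_comb_mul p a b c d : p *m p = p -> proj_comb p a b *m proj_comb p c d = proj_comb p (a * c) (b * d).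
Proof.
move=> pp; rewrite /proj_comb mulmxDl !mulmxDr -!scalemxAl -!scalemxAr !scalerA.
rewrite !mulmxBl !mulmxBr !mul1mx !mulmx1 pp subrr !scaler0 addr0 add0r.
by rewrite subr0.
Qed.
Lemma proj_comb_adj p a b : adj p = p -> adj (proj_comb p a b) = proj_comb p (Num.conj a) (Num.conj b).
Proof.
move=> sp; rewrite /proj_comb adjD !adjZ sp; congr (_ + _ *: _).
by rewrite adjD adj1 adjN sp.
Qed.
Lemma proj_comb_lin p k a b c d : k *: proj_comb p a b + proj_comb p c d = proj_comb p (k * a + c) (k * b + d).
Proof. by rewrite /proj_comb scalerDr !scalerA !scalerDl; abels. Qed.
Lemma proj_comb_e11 a b : proj_comb e11 a b = mk2 a 0 0 b.
Proof. by apply: mx2P; rewrite !mxE /=; ring. Qed.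
Lemma proj_comb_1 p : proj_comb p 1 1 = 1%:M.
Proof. by rewrite /proj_comb !scale1r; abels. Qed.
Lemma proj_comb_scal p a : proj_comb p a a = a%:M.
Proof. by rewrite /proj_comb -scalerDr -[RHS]scalemx1; congr (_ *: _); abels. Qed.
(** The factor is [2 + 3]: the complement of [p] is bounded by [1 + 2]. *)
Lemma proj_comb_bd p a b r : bd 2 p -> cn a <= r -> cn b <= r -> bd (5 * r) (proj_comb p a b).
Proof.
move=> p2 ar br; have p3 := bdB (@bd1 R) p2.
apply: bd_le (bdD (bdZ a p2) (bdZ b p3)).
have := cn_ge0 a; have := cn_ge0 b; lra.
Qed.

(* The position of the blanks in a triple: all ([KC]); the third and at most one
   more ([KE]); the first two ([KT]); the second ([K0]); the first ([K1]); none ([KM]). *)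
Inductive kind := KC | KE | KT | K0 | K1 | KM.

Definition kind_le (k k' : kind) : bool :=
  match k, k' with
  | KC, _ | _, KM | KE, KE | KE, K0 | KE, K1 | KT, KT | KT, K0 | KT, K1
  | K0, K0 | K1, K1 => true
  | _, _ => false
  end.

Definition kind_proj (k : kind) (t : I) : M := if k is KT then a3 t else e11.
Lemma kind_proj_idem k t : kind_proj k t *m kind_proj k t = kind_proj k t.
Proof. by case: k; rewrite /= ?a3_idem ?e11_idem. Qed.
Lemma kind_proj_bd k t : bd 2 (kind_proj k t).
Proof. by case: k; [exact: e11_bd|exact: e11_bd|exact: a3_bd|exact: e11_bd|exact: e11_bd|exact: e11_bd]. Qed.
Lemma kind_proj_ucont k : ucont_mx (kind_proj k).
Proof. by case: k; [exact: ucont_mx_cst|exact: ucont_mx_cst|exact: a3_ucont|exact: ucont_mx_cst|exact: ucont_mx_cst|exact: ucont_mx_cst]. Qed.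
Lemma kind_proj_i1 k : kind_proj k i1 = e11.
Proof. by case: k => //=; rewrite a3_1. Qed.
Definition diag2 (m : M) := m 0 1 = 0 /\ m 1 0 = 0.

(** The scalars of the constant kinds are read off at [i1], where every [kind_proj] is [e11]. The
    conditions are thereby equations, stable under uniform limits. *)
Definition kind_cond (k : kind) (g : I -> M) : Prop :=
  match k with
  | KC => forall t, g t = proj_comb e11 (g i1 0 0) (g i1 0 0)
  | KE | KT => forall t, g t = proj_comb (kind_proj k t) (g i1 0 0) (g i1 1 1)
  | K0 => diag2 (g i0)
  | K1 => diag2 (g i1)
  | KM => True
  end.

Lemma kind_cond_lin k a g h : kind_cond k g -> kind_cond k h -> kind_cond k (fun t => a *: g t + h t).
Proof.
case: k => //=; rewrite /diag2 ?mxE.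
1-3: move=> hg hh t; rewrite {1}hg {1}hh proj_comb_lin; congr proj_comb; by rewrite !mxE.
all: by move=> [-> ->] [-> ->]; rewrite !mulr0 addr0.
Qed.
Lemma kind_cond_cst1 k : kind_cond k (fun=> 1%:M).
Proof. by case: k => //=; rewrite /diag2 ?one2E ?proj_comb_1 // => t; rewrite proj_comb_1. Qed.
Lemma kind_cond_mul k g h : kind_cond k g -> kind_cond k h -> kind_cond k (fun t => g t *m h t).
Proof.
case: k => //=; rewrite /diag2 ?m2E.
- move=> hg hh t; rewrite [in LHS]hg [in LHS]hh proj_comb_mul ?e11_idem //.
  by rewrite [g i1 in RHS]hg [h i1 in RHS]hh !proj_comb_e11 !m2E; congr mk2; ring.
- move=> hg hh t; rewrite [in LHS]hg [in LHS]hh proj_comb_mul ?e11_idem //.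
  by rewrite [g i1 in RHS]hg [h i1 in RHS]hh !proj_comb_e11 !m2E; congr mk2; ring.
- move=> hg hh t; rewrite [in LHS]hg [in LHS]hh proj_comb_mul ?a3_idem //.
  by rewrite [g i1 in RHS]hg [h i1 in RHS]hh !a3_1 !proj_comb_e11 !m2E; congr proj_comb; ring.
- by move=> [-> ->] [-> ->]; rewrite !(mulr0, mul0r, addr0).
- by move=> [-> ->] [-> ->]; rewrite !(mulr0, mul0r, addr0).
Qed.
Lemma kind_cond_star k g : kind_cond k g -> kind_cond k (fun t => adj (g t)).
Proof.
case: k => //=; rewrite /diag2 ?adjE.
- by move=> hg t; rewrite [in LHS]hg proj_comb_adj ?e11_adj // !adjE.
- by move=> hg t; rewrite [in LHS]hg proj_comb_adj ?e11_adj // !adjE.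
- by move=> hg t; rewrite [in LHS]hg proj_comb_adj ?a3_adj // !adjE.
- by move=> [-> ->]; rewrite rmorph0.
- by move=> [-> ->]; rewrite rmorph0.
Qed.
Lemma small_eq0 (z : C) : (forall e, 0 < e -> cn z <= e) -> z = 0.
Proof.
move=> h; apply/eqP; rewrite -cn_eq0 eq_le cn_ge0 andbT.
by apply/ler_addgt0Pr => e /h; rewrite add0r.
Qed.
Lemma small_mx0 (m : M) K : (forall e, 0 < e -> bd (K * e) m) -> m = 0.
Proof.
move=> h; apply: bd_eq0; apply: bd_closed => e e0; rewrite add0r.
have d0 : 0 < e / (`|K| + 1) by rewrite divr_gt0 // ltr_wpDl.
apply: bd_le (h _ d0); rewrite mulrCA -[leRHS]mulr1 ler_wpM2l ?(ltW e0) //.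
rewrite ler_pdivrMr ?ltr_wpDl // mul1r; have := ler_norm K; lra.
Qed.
Lemma kind_cond_lim k g : (forall e, 0 < e -> exists2 h, kind_cond k h & forall t, bd e (g t - h t)) -> kind_cond k g.
Proof.
have en e (h : I -> M) i j : (forall t, bd e (g t - h t)) -> cn (g i1 i j - h i1 i j) <= e.
  by move=> /(_ i1) /bd_entry -/(_ i j); rewrite !mxE.
have main (p : I -> M) i j : (forall t, bd 2 (p t)) -> (forall e, 0 < e -> exists2 h : I -> M,
    (forall t, h t = proj_comb (p t) (h i1 i i) (h i1 j j)) & forall t, bd e (g t - h t)) ->
    forall t, g t = proj_comb (p t) (g i1 i i) (g i1 j j).
  move=> bp hl t; apply/eqP; rewrite -subr_eq0; apply/eqP/(@small_mx0 _ 6) => e /hl[h hE gh].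
  have -> : g t - proj_comb (p t) (g i1 i i) (g i1 j j) = (g t - h t) -
      proj_comb (p t) (g i1 i i - h i1 i i) (g i1 j j - h i1 j j).
    by rewrite {1}hE /proj_comb !scalerBl; abels.
  have -> : 6 * e = e + 5 * e by ring.
  by apply: bdB => //; apply: proj_comb_bd => //; exact: en.
have main2 t : (forall e, 0 < e -> exists2 h, diag2 (h t) & forall t, bd e (g t - h t)) -> diag2 (g t).
  move=> hl; split; apply: small_eq0 => e /hl[h [h1 h2] /(_ t)/bd_entry gh].
    by have := gh 0 1; rewrite !mxE h1 subr0.
  by have := gh 1 0; rewrite !mxE h2 subr0.
case: k => //=; [| | |exact: main2|exact: main2]; apply: main => t.
- exact: e11_bd.
- exact: e11_bd.
- exact: a3_bd.
Qed.
Lemma kind_cond_inv k g h : (forall t, g t *m h t = 1%:M) -> (forall t, h t *m g t = 1%:M) ->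
  kind_cond k g -> kind_cond k h.
Proof.
move=> gh hg.
have uniq t x : g t *m x = 1%:M -> h t = x.
  by move=> gx; rewrite -[LHS]mulmx1 -gx mulmxA hg mul1mx.
have dinv t : diag2 (g t) -> [/\ g t 0 0 != 0, g t 1 1 != 0 & h t = mk2 (g t 0 0)^-1 0 0 (g t 1 1)^-1].
  move=> [g1 g2].
  have n0 : g t 0 0 != 0.
    by apply/eqP => z; have := congr1 (fun m : M => m 0 0) (gh t); rewrite !m2E z g1 !mul0r addr0 => /esym/eqP; rewrite oner_eq0.
  have n1 : g t 1 1 != 0.
    by apply/eqP => z; have := congr1 (fun m : M => m 1 1) (gh t); rewrite !m2E z g2 !mul0r addr0 => /esym/eqP; rewrite oner_eq0.
  split=> //; apply: uniq; apply: mx2P; rewrite !m2E ?g1 ?g2 ?mulfV // ?(mulr0, mul0r, addr0, add0r) //.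
have main (p : I -> M) i j : (forall t, p t *m p t = p t) -> p i1 = e11 -> (i = 0) -> (j = 0 \/ j = 1) ->
    (forall t, g t = proj_comb (p t) (g i1 i i) (g i1 j j)) ->
    forall t, h t = proj_comb (p t) (h i1 i i) (h i1 j j).
  move=> pp p1 ei ej hE t.
  have [|n0 n1 h1] := dinv i1; first by rewrite hE p1 proj_comb_e11 /diag2 !mk2E.
  have hii : h i1 i i = (g i1 i i)^-1 by rewrite h1 ei mk2E.
  have hjj : h i1 j j = (g i1 j j)^-1 by rewrite h1; case: ej => ->; rewrite mk2E.
  apply: uniq; rewrite hE proj_comb_mul // hii hjj !mulfV ?proj_comb_1 // ?ei //.
  by case: ej => ->.
case: k => //=.
- by apply: main; [exact: (fun=> e11_idem)| | |left].
- by apply: main; [exact: (fun=> e11_idem)| | |right].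
- by apply: main; [exact: a3_idem|exact: a3_1| |right].
- by move=> /dinv[_ _ ->]; rewrite /diag2 !mk2E.
- by move=> /dinv[_ _ ->]; rewrite /diag2 !mk2E.
Qed.
(** Filling in blanks weakens the condition: [a3] is diagonal at both end points, and a scalar is a
    combination of any projection with its complement. *)
Lemma kind_cond_mono k k' g : kind_le k k' -> kind_cond k g -> kind_cond k' g.
Proof.
move=> kk hg.
have hd : (k = KE \/ k = KT \/ k = KC) -> diag2 (g i0) /\ diag2 (g i1).
  move=> ek; case: ek hg {kk} => [->|[->|->]] /= hg.
  - by split; rewrite hg proj_comb_e11 /diag2 !mk2E.
  - split; last by rewrite hg a3_1 proj_comb_e11 /diag2 !mk2E.
    by rewrite hg a3_0 /proj_comb /diag2 !mxE /=; split; ring.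
  - by split; rewrite hg proj_comb_e11 /diag2 !mk2E.
have hC : k = KC -> forall p t, g t = proj_comb p (g i1 0 0) (g i1 1 1).
  move=> ek; move: hg {kk hd}; rewrite ek /= => hg p t.
  have -> : g i1 1 1 = g i1 0 0 by rewrite hg proj_comb_e11 !mk2E.
  by rewrite {1}hg !proj_comb_scal.
move: hg kk hd hC; case: k; case: k' => hg kk hd hC; try by case: (notF kk).
- exact: hg.
- exact: (hC erefl).
- by move=> t; exact: (hC erefl).
- by apply: (hd _).1; do 2! right.
- by apply: (hd _).2; do 2! right.
- exact: Logic.I.
- exact: hg.
- by apply: (hd _).1; left.
- by apply: (hd _).2; left.
- exact: Logic.I.
- exact: hg.
- by apply: (hd _).1; right; left.
- by apply: (hd _).2; right; left.
- exact: Logic.I.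
- exact: hg.
- exact: Logic.I.
- exact: hg.
- exact: Logic.I.
- exact: Logic.I.
Qed.

Definition bounded (T : Type) (f : T -> M) := exists r, forall t, bd r (f t).
Lemma bounded_lin T a (f g : T -> M) : bounded f -> bounded g -> bounded (fun t => a *: f t + g t).
Proof. by move=> [r hr] [s hs]; exists (cn a * r + s) => t; apply: bdD => //; exact: bdZ. Qed.
Lemma bounded_mul T (f g : T -> M) : bounded f -> bounded g -> bounded (fun t => f t *m g t).
Proof.
move=> [r hr] [s hs]; exists (`|r| * s) => t; apply: bdM => //.
by apply: bd_le (hr t); exact: ler_norm.
Qed.
Lemma bounded_star T (f : T -> M) : bounded f -> bounded (fun t => adj (f t)).
Proof.
move=> [r hr]; exists `|r| => t; apply: bd_adj => //.
by apply: bd_le (hr t); exact: ler_norm.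
Qed.
Lemma bounded_lim T (f : T -> M) : (forall e, 0 < e -> exists2 g, bounded g & forall t, bd e (f t - g t)) -> bounded f.
Proof.
move=> /(_ 1 ltr01)[g [r hr] h]; exists (1 + r) => t.
by rewrite -(subrK (g t) (f t)); exact: bdD.
Qed.

Definition kind_fun k (g : I -> M) := [/\ bounded g, ucont_mx g & kind_cond k g].
Program Definition kind_csub k : csub R I := @CSub R I (kind_fun k) _ _ _ _ _ _.
Next Obligation. by move=> k f [[r hr]]; exists r. Qed.
Next Obligation.
move=> k a f g [? ? ?] [? ? ?]; split; [exact: bounded_lin|exact: ucont_mx_lin|exact: kind_cond_lin].
Qed.
Next Obligation.
move=> k; split; [by exists 1 => _; exact: bd1|exact: ucont_mx_cst|exact: kind_cond_cst1].
Qed.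
Next Obligation.
move=> k f g [bf uf df] [bg ug dg]; split; [exact: bounded_mul| |exact: kind_cond_mul].
by move: bf bg => [r hr] [s hs]; exact: ucont_mx_mul hr hs uf ug.
Qed.
Next Obligation.
move=> k f [? ? ?]; split; [exact: bounded_star|exact: ucont_mx_star|exact: kind_cond_star].
Qed.
Next Obligation.
move=> k f h; split; [apply: bounded_lim|apply: ucont_mx_lim|apply: kind_cond_lim];
  by move=> e /h[g [? ? ?] ?]; exists g.
Qed.
End Interval.

(** * Families over partially blank triples and the subalgebras of finite sets *)

Section Algebra.
Variables (R : realType) (S : choiceType).
Notation C := (cplx R).
Notation M := 'M[C]_2.
Notation I := (I01 R).
Implicit Types F G : {fset S}.

Definition Omega := (option S * option S * option S)%type.
Definition kind_of (x : Omega) : kind :=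
  match x with
  | (None, None, None) => KC
  | (_, _, None) => KE
  | (None, None, Some _) => KT
  | (Some _, None, Some _) => K0
  | (None, Some _, Some _) => K1
  | (Some _, Some _, Some _) => KM
  end.
Definition coord_of F (o : option S) : option S :=
  if o is Some s then (if s \in F then Some s else None) else None.
Definition cell_of F (x : Omega) : Omega := (coord_of F x.1.1, coord_of F x.1.2, coord_of F x.2).

Lemma coord_of_sub F G o : (F `<=` G)%fset -> coord_of F (coord_of G o) = coord_of F o.
Proof.
move=> /fsubsetP FG; case: o => //= s; case: ifP => //= sG.
by case: ifP => // /FG; rewrite sG.
Qed.
Lemma cell_of_sub F G x : (F `<=` G)%fset -> cell_of F (cell_of G x) = cell_of F x.
Proof. by move=> FG; rewrite /cell_of /= !coord_of_sub. Qed.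
Lemma cell_of_id F x : cell_of F (cell_of F x) = cell_of F x.
Proof. by apply: cell_of_sub; exact: fsubset_refl. Qed.
Lemma kind_rr F x : kind_le (kind_of (cell_of F x)) (kind_of x).
Proof.
by case: x => [[[a|] [b|]] [c|]] //=; do 3? (case: ifP => _ //=); do 2? (case: ifP => _ //=).
Qed.

Definition cells F : seq Omega :=
  let o := None :: [seq Some s | s <- F] in
  [seq (ab, c) | ab <- [seq (a, b) | a <- o, b <- o], c <- o].
Lemma cell_of_cells F x : cell_of F x \in cells F.
Proof.
have h o : coord_of F o \in None :: [seq Some s | s <- F].
  case: o => [s|] //=; case: ifP => [sF|] //; rewrite in_cons; apply/orP; right.
  exact: map_f.
apply/allpairsP; exists ((coord_of F x.1.1, coord_of F x.1.2), coord_of F x.2); split; [|exact: h|by []].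
by apply/allpairsP; exists (coord_of F x.1.1, coord_of F x.1.2); split; [exact: h|exact: h|by []].
Qed.
(** A finite set has finitely many cells, so pointwise bounds become uniform on them. *)
Lemma cells_max F (Q : R -> Omega -> Prop) : (forall r s x, r <= s -> Q r x -> Q s x) ->
  (forall x, exists r, Q r x) -> exists r, forall x, Q r (cell_of F x).
Proof.
move=> mono hQ; suff [r hr] : exists r, forall x, x \in cells F -> Q r x.
  by exists r => x; apply: hr; exact: cell_of_cells.
elim: (cells F) => [|y l [r hr]]; first by exists 0.
have [s hs] := hQ y; exists (Num.max r s) => x; rewrite in_cons => /orP[/eqP ->|/hr].
  by apply: mono hs; rewrite le_max lexx orbT.
by apply: mono; rewrite le_max lexx.
Qed.

Definition cell_approx (f : Omega * I -> M) := forall e, 0 < e ->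
  exists F, forall G, (F `<=` G)%fset -> forall x t, bd e (f (x, t) - f (cell_of G x, t)).
Definition cell_dep F (f : Omega * I -> M) := forall x t, f (x, t) = f (cell_of F x, t).

Lemma cell_dep_loc F f : cell_dep F f -> cell_approx f.
Proof.
move=> hf e e0; exists F => G FG x t; rewrite hf [f (cell_of G x, t)]hf cell_of_sub // subrr.
by apply: bd0'; exact: ltW.
Qed.

Definition E_pred (f : Omega * I -> M) := [/\ bounded f,
  forall x, ucont_mx (fun t => f (x, t)), forall x, kind_cond (kind_of x) (fun t => f (x, t)) & cell_approx f].

Lemma E_pred_lin a f g : E_pred f -> E_pred g -> E_pred (fun z => a *: f z + g z).
Proof.
move=> [bf uf df lf] [bg ug dg lg]; split.
- exact: bounded_lin.
- by move=> x; exact: ucont_mx_lin.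
- by move=> x; exact: kind_cond_lin.
- move=> e e0; have c0 := cn_ge0 a.
  have d0 : 0 < e / (2 * (cn a + 1)) by rewrite divr_gt0 // mulr_gt0 // ltr_wpDl.
  have [F hF] := lf _ d0; have [F' hF'] := lg _ (divr_gt0 e0 (ltr0n R 2)).
  exists (F `|` F')%fset => G; rewrite fsubUset => /andP[FG F'G] x t.
  have -> : a *: f (x, t) + g (x, t) - (a *: f (cell_of G x, t) + g (cell_of G x, t)) =
     a *: (f (x, t) - f (cell_of G x, t)) + (g (x, t) - g (cell_of G x, t)) by rewrite scalerBr; abels.
  apply: bd_le (bdD (bdZ a (hF G FG x t)) (hF' G F'G x t)).
  rewrite -[leRHS](_ : e / 2 + e / 2 = e); last by lra.
  rewrite lerD2r; have -> : cn a * (e / (2 * (cn a + 1))) = (e / 2) * (cn a / (cn a + 1)).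
    by field; rewrite gt_eqF // ltr_wpDl.
  rewrite ler_piMr //; first by rewrite ltW // divr_gt0.
  by rewrite ler_pdivrMr ?ltr_wpDl // mul1r; lra.
Qed.
Lemma E_pred_mul f g : E_pred f -> E_pred g -> E_pred (fun z => f z *m g z).
Proof.
move=> [bf uf df lf] [bg ug dg lg]; split.
- exact: bounded_mul.
- by move=> x; have [r hr] := bf; have [s hs] := bg; exact: ucont_mx_mul (fun t => hr (x, t)) (fun t => hs (x, t)) (uf x) (ug x).
- by move=> x; exact: kind_cond_mul.
- move=> e e0; have [r hr] := bf; have [s hs] := bg.
  pose r' := `|r| + 1; pose s' := `|s| + 1.
  have r0 : 0 < r' by rewrite ltr_wpDl.
  have s0 : 0 < s' by rewrite ltr_wpDl.
  have br' t : bd r' (f t) by apply: bd_le (hr t); rewrite /r'; have := ler_norm r; lra.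
  have bs' t : bd s' (g t) by apply: bd_le (hs t); rewrite /s'; have := ler_norm s; lra.
  have [F hF] := lf (e / 2 / s') (divr_gt0 (divr_gt0 e0 (ltr0n R 2)) s0).
  have [F' hF'] := lg (e / 2 / r') (divr_gt0 (divr_gt0 e0 (ltr0n R 2)) r0).
  exists (F `|` F')%fset => G; rewrite fsubUset => /andP[FG F'G] x t.
  have -> : f (x, t) *m g (x, t) - f (cell_of G x, t) *m g (cell_of G x, t) =
    (f (x, t) - f (cell_of G x, t)) *m g (x, t) + f (cell_of G x, t) *m (g (x, t) - g (cell_of G x, t)).
    by rewrite mulmxBl mulmxBr; abels.
  have e1 : 0 <= e / 2 / s' by rewrite ltW // !divr_gt0.
  apply: bd_le (bdD (bdM e1 (hF G FG x t) (bs' _)) (bdM (ltW r0) (br' _) (hF' G F'G x t))).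
  by rewrite divfK ?gt_eqF // [r' * _]mulrC divfK ?gt_eqF //; lra.
Qed.
Lemma E_pred_star f : E_pred f -> E_pred (fun z => adj (f z)).
Proof.
move=> [bf uf df lf]; split.
- exact: bounded_star.
- by move=> x; exact: ucont_mx_star.
- by move=> x; exact: kind_cond_star.
- move=> e e0; have [F hF] := lf e e0; exists F => G FG x t.
  rewrite -adjN -adjD; apply: bd_adj; [exact: ltW|exact: hF].
Qed.
Lemma E_pred_one : E_pred (fun=> 1%:M).
Proof.
split; [by exists 1 => _; exact: bd1|by move=> x; exact: ucont_mx_cst|
  by move=> x; exact: kind_cond_cst1|exact: (@cell_dep_loc fset0)].
Qed.
Lemma E_pred_lim f : (forall e, 0 < e -> exists2 g, E_pred g & forall z, bd e (f z - g z)) -> E_pred f.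
Proof.
move=> h; split.
- by apply: bounded_lim => e /h[g [? _ _ _] ?]; exists g.
- by move=> x; apply: ucont_mx_lim => e /h[g [_ ? _ _] k]; exists (fun t => g (x, t)) => // t; exact: k.
- by move=> x; apply: kind_cond_lim => e /h[g [_ _ ? _] k]; exists (fun t => g (x, t)) => // t; exact: k.
- move=> e e0; have e3 : 0 < e / 3 by rewrite divr_gt0.
  have [g [_ _ _ lg] fg] := h _ e3; have [F hF] := lg _ e3; exists F => G FG x t.
  have -> : f (x, t) - f (cell_of G x, t) = (f (x, t) - g (x, t)) + (g (x, t) - g (cell_of G x, t)) +
    (g (cell_of G x, t) - f (cell_of G x, t)) by abels.
  have e33 : e / 3 + e / 3 + e / 3 <= e by lra.
  exact: bd_le e33 (bdD (bdD (fg _) (hF G FG x t)) (bdC (fg _))).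
Qed.
Lemma E_pred_bd f : E_pred f -> exists r, forall t, bd r (f t).
Proof. by case. Qed.
Definition E_csub : csub R (Omega * I)%type :=
  CSub E_pred_bd E_pred_lin E_pred_one E_pred_mul E_pred_star E_pred_lim.

Definition A_pred F f := E_pred f /\ cell_dep F f.
Lemma A_pred_bd F f : A_pred F f -> exists r, forall t, bd r (f t).
Proof. by case=> /E_pred_bd. Qed.
Lemma A_pred_lin F a f g : A_pred F f -> A_pred F g -> A_pred F (fun z => a *: f z + g z).
Proof.
move=> [ef ff] [eg fg]; split; first exact: E_pred_lin.
by move=> x t; rewrite /= {1}ff {1}fg.
Qed.
Lemma A_pred_one F : A_pred F (fun=> 1%:M).
Proof. by split; first exact: E_pred_one. Qed.
Lemma A_pred_mul F f g : A_pred F f -> A_pred F g -> A_pred F (fun z => f z *m g z).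
Proof.
move=> [ef ff] [eg fg]; split; first exact: E_pred_mul.
by move=> x t; rewrite /= {1}ff {1}fg.
Qed.
Lemma A_pred_star F f : A_pred F f -> A_pred F (fun z => adj (f z)).
Proof.
move=> [ef ff]; split; first exact: E_pred_star.
by move=> x t; rewrite /= {1}ff.
Qed.
Lemma A_pred_lim F f : (forall e, 0 < e -> exists2 g, A_pred F g & forall z, bd e (f z - g z)) -> A_pred F f.
Proof.
move=> h; split; first by apply: E_pred_lim => e /h[g [? _] ?]; exists g.
move=> x t; apply/eqP; rewrite -subr_eq0; apply/eqP/(@small_mx0 _ _ 2) => e /h[g [_ fg] k].
have -> : f (x, t) - f (cell_of F x, t) = (f (x, t) - g (x, t)) + (g (cell_of F x, t) - f (cell_of F x, t)).
  by rewrite -fg; abels.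
by rewrite mulr_natl mulr2n; apply: bdD (k _) (bdC (k _)).
Qed.
Definition A_csub F : csub R (Omega * I)%type :=
  CSub (@A_pred_bd F) (@A_pred_lin F) (@A_pred_one F) (@A_pred_mul F) (@A_pred_star F) (@A_pred_lim F).

Definition Ealg : ucstarType R := carrier E_csub.
Definition Aalg F : ucstarType R := carrier (A_csub F).

(** Paths may be prescribed independently at the cells of [F]; by [kind_rr] the pullback along
    [cell_of F] respects the kinds. *)
Lemma A_pred_of F (g : Omega -> I -> M) : (forall x, kind_fun (kind_of x) (g x)) ->
  A_pred F (fun z => g (cell_of F z.1) z.2).
Proof.
move=> hg; have fx : cell_dep F (fun z => g (cell_of F z.1) z.2) by move=> x t /=; rewrite cell_of_id.
split=> //; split; last exact: cell_dep_loc fx.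
- have [r hr] := @cells_max F (fun r x => forall t, bd r (g x t))
    ltac:(by move=> r s x rs h t; exact: bd_le rs (h t)) ltac:(by move=> x; case: (hg x)).
  by exists r => -[x t] /=; exact: hr.
- by move=> x /=; case: (hg (cell_of F x)).
- by move=> x; apply: kind_cond_mono (kind_rr F x) _; case: (hg (cell_of F x)).
Qed.
Lemma E_pred_kpred f x : E_pred f -> kind_fun (kind_of x) (fun t => f (x, t)).
Proof. by move=> [[r hr] uf df _]; split=> //; exists r => t. Qed.

Lemma restr_pred F f : E_pred f -> A_pred F (fun z => f (cell_of F z.1, z.2)).
Proof. by move=> ef; apply: (A_pred_of F (g := fun x t => f (x, t))) => x; exact: E_pred_kpred. Qed.
(** A homomorphism retracting [E] onto the subalgebra of [F], so that approximants of an element are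
    obtained explicitly and compatibly with all operations. *)
Definition restr F (h : Ealg) : Aalg F := @mkcar R _ (A_csub F) _ (restr_pred F (carrierP h)).
Definition inclA F (h : Aalg F) : Ealg := @mkcar R _ E_csub _ (carrierP h).1.

Lemma restrK F h : restr F (inclA h) = h.
Proof. by apply: carrier_eqP => -[x t] /=; rewrite -((carrierP h).2 x t). Qed.
Lemma restr_hom F : unital_star_hom (restr F).
Proof.
split; last by apply: (@carrier_eqP _ _ (A_csub F)).
split=> [x y|a x|x y|x]; by apply: (@carrier_eqP _ _ (A_csub F)).
Qed.
Lemma inclA_hom F : unital_star_hom (@inclA F).
Proof.
split; last by apply: (@carrier_eqP _ _ E_csub).
split=> [x y|a x|x y|x]; by apply: (@carrier_eqP _ _ E_csub).
Qed.
Lemma restr_near (h : Ealg) e : 0 < e -> exists F, forall G, (F `<=` G)%fset ->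
  nr (h - inclA (restr G h)) <= e.
Proof.
move=> e0; have [_ _ _ /(_ e e0)[F hF]] := carrierP h; exists F => G FG.
by apply: car_normP; [exact: ltW|move=> [x t] /=; exact: hF].
Qed.
End Algebra.

(** * Index of nilpotence, stable rank and real rank *)

Section Invertible.
Variable R : realType.
Notation C := (cplx R).
Notation M := 'M[C]_2.
Notation I := (I01 R).
Local Notation i0 := (i0 R).
Local Notation i1 := (i1 R).
Local Opaque mk2 e11 a3 adj bd.

Definition det2 (m : M) : C := m 0 0 * m 1 1 - m 0 1 * m 1 0.
Definition inv2 (m : M) : M := let c := (det2 m)^-1 in
  mk2 (c * m 1 1) (c * - m 0 1) (c * - m 1 0) (c * m 0 0).

Lemma inv2l m : det2 m != 0 -> inv2 m *m m = 1%:M.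
Proof.
move=> h; apply: mx2P; rewrite !mul2E one2E /inv2 !mk2E -?mulrA -?mulrDr.
- by rewrite -(mulVf h); congr (_ * _); rewrite /det2; ring.
- by rewrite -(mulr0 (det2 m)^-1); congr (_ * _); ring.
- by rewrite -(mulr0 (det2 m)^-1); congr (_ * _); ring.
- by rewrite -(mulVf h); congr (_ * _); rewrite /det2; ring.
Qed.
Lemma inv2r m : det2 m != 0 -> m *m inv2 m = 1%:M.
Proof. by move=> /inv2l; apply: mulmx1C. Qed.

(** A lower bound on the determinant bounds the inverse through the cofactors, and [inv2 (g s) -
    inv2 (g t) = inv2 (g s) (g t - g s) inv2 (g t)] gives uniform continuity. *)
Lemma kind_fun_inv k g c : kind_fun k g -> 0 < c -> (forall t, c <= cn (det2 (g t))) ->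
  kind_fun k (fun t => inv2 (g t)).
Proof.
move=> [[r hr] ug dg] c0 hc.
have nz t : det2 (g t) != 0 by rewrite -cn_eq0 gt_eqF // (lt_le_trans c0).
have gl t := inv2l (nz t); have gr t := inv2r (nz t).
have r0 : 0 <= r by exact: le_trans (cn_ge0 _) (bd_entry 0 0 (hr i0)).
pose K := 2 * (r / c).
have K0 : 0 <= K by rewrite mulr_ge0 // divr_ge0 // ltW.
have bK t : bd K (inv2 (g t)).
  apply: entry_bd => [|i j]; first by rewrite divr_ge0 // ltW.
  have h z : cn z <= r -> cn ((det2 (g t))^-1 * z) <= r / c.
    move=> zr; rewrite cnM cnV mulrC ler_pM ?cn_ge0 ?invr_ge0 ?cn_ge0 //.
    by rewrite lef_pV2 ?posrE // (lt_le_trans c0).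
  case: (ord2 i) => ->; case: (ord2 j) => ->; rewrite mk2E; apply: h;
  rewrite ?cnN; exact: bd_entry (hr t).
split; [by exists K| |exact: kind_cond_inv gr gl dg].
move=> e e0; have p0 : 0 < (K + 1) * (K + 1) by nra.
have [d d0 hd] := ug (e / ((K + 1) * (K + 1))) (divr_gt0 e0 p0).
exists d; first exact: d0.
move=> s t; rewrite distrC => /hd b.
have -> : inv2 (g s) - inv2 (g t) = inv2 (g s) *m (g t - g s) *m inv2 (g t).
  by rewrite mulmxBr mulmxBl -mulmxA gr gl mulmx1 mul1mx.
have q0 : 0 <= e / ((K + 1) * (K + 1)) by rewrite ltW // divr_gt0.
apply: bd_le (bdM (mulr_ge0 K0 q0) (bdM K0 (bK s) b) (bK t)).
rewrite mulrAC mulrCA ler_piMr ?(ltW e0) //.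
by rewrite ler_pdivrMr // mul1r; nra.
Qed.

Lemma quad_roots (p q : C) : exists x y, x + y = p /\ x * y = q.
Proof.
pose s := sqrtC (p ^+ 2 - 4 * q).
have ss : s ^+ 2 = p ^+ 2 - 4 * q by rewrite sqrtCK.
exists ((p + s) / 2), ((p - s) / 2); split; first by field.
have -> : (p + s) / 2 * ((p - s) / 2) = (p ^+ 2 - s ^+ 2) / 4 by field.
by rewrite ss; field.
Qed.

Definition ic : C := (0 +i* 1)%C.
Lemma cn_ic : cn ic = 1.
Proof. by rewrite /cn /= expr0n add0r expr1n sqrtr1. Qed.

(** The segment from 1 to [l + i d] avoids 0 because its other end is not real. For small [s] the
    real part is at least 1/2; for larger [s] the imaginary part is bounded below. *)
Lemma seg_bound (l : C) (d : R) : complex.Im l + d != 0 -> exists2 c, 0 < c &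
  forall s, 0 <= s <= 1 -> c <= cn (rc (1 - s) + ic * rc (s * d) + rc s * l).
Proof.
move=> h; pose b := `|complex.Im l + d|; have b0 : 0 < b by rewrite normr_gt0.
pose a := `|complex.Re l|; have a0 : 0 <= a by exact: normr_ge0.
exists (Num.min (1 / 2) (b / (2 * (1 + a)))).
  by rewrite lt_min divr_gt0 //= divr_gt0 // mulr_gt0 //; lra.
move=> s /andP[s0 s1]; set z := rc _ + _ + _.
have zR : complex.Re z = 1 - s + s * complex.Re l.
  by rewrite /z; case: (l) => u v /=; ring.
have zI : complex.Im z = s * (complex.Im l + d).
  by rewrite /z; case: (l) => u v /=; ring.
have [ss|ss] := leP (s * (2 * (1 + a))) 1.
  rewrite ge_min; apply/orP; left; apply: le_trans (cn_Re z); rewrite zR.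
  apply: le_trans (ler_norm _).
  have : - a <= complex.Re l by rewrite lerNl /a; have := ler_norm (- complex.Re l); rewrite normrN.
  move: (complex.Re l) => x; nra.
rewrite ge_min; apply/orP; right; apply: le_trans (cn_Im z).
rewrite zI normrM -/b (ger0_norm s0) ler_pdivrMr; last by rewrite mulr_gt0 //; lra.
by nra.
Qed.

Lemma det2_seg (V W : M) (a b : C) : det2 (a *: V + b *: W) =
  a ^+ 2 * det2 V + a * b * (V 0 0 * W 1 1 + V 1 1 * W 0 0 - V 0 1 * W 1 0 - V 1 0 * W 0 1)
    + b ^+ 2 * det2 W.
Proof. by rewrite /det2 !mxE; ring. Qed.

(* Adding [i d V] to [W] shifts the eigenvalues of [W V^-1] by [i d], hence off the
   real axis, so that the segment from [V] consists of invertible matrices. *)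
Lemma perturb_seg (V W : M) d0 : det2 V != 0 -> 0 < d0 -> exists d, exists2 c, 0 < c &
  0 < d <= d0 /\ forall s, 0 <= s <= 1 ->
    c <= cn (det2 (rc (1 - s) *: V + rc s *: (W + (ic * rc d) *: V))).
Proof.
move=> hV d00.
have [x [y [xy1 xy2]]] := quad_roots
  ((V 0 0 * W 1 1 + V 1 1 * W 0 0 - V 0 1 * W 1 0 - V 1 0 * W 0 1) / det2 V) (det2 W / det2 V).
(* Each of [x] and [y] excludes one value of [d], so one of three candidates is admissible. *)
have [d [d1 d2 dx dy]] : exists d, [/\ 0 < d, d <= d0, complex.Im x + d != 0 & complex.Im y + d != 0].
  have [h1|h1] := boolP ((complex.Im x + d0 != 0) && (complex.Im y + d0 != 0)).
    by exists d0; have /andP[] := h1; split.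
  have [h2|h2] := boolP ((complex.Im x + d0 / 2 != 0) && (complex.Im y + d0 / 2 != 0)).
    by exists (d0 / 2); have /andP[] := h2; split=> //; lra.
  exists (d0 / 3); split; [lra|lra| |]; move: h1 h2; rewrite !negb_and !negbK;
  move=> /orP[]/eqP h1 /orP[]/eqP h2; apply/eqP; lra.
have [c c0 hc] := seg_bound dx; have [c' c0' hc'] := seg_bound dy.
exists d, (cn (det2 V) * (c * c')); first by rewrite !mulr_gt0 // lt_def cn_eq0 hV cn_ge0.
split; first by rewrite d1.
move=> s hs; rewrite (_ : _ *: V + _ = (rc (1 - s) + ic * rc (s * d)) *: V + rc s *: W); last first.
  rewrite scalerDr scalerA scalerDl rcM -!addrA; congr (_ + _); rewrite addrC; congr (_ *: _ + _).
  by rewrite mulrCA.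
rewrite det2_seg; set a := rc (1 - s) + _; set b := rc s.
have -> : a ^+ 2 * det2 V +
  a * b * (V 0 0 * W 1 1 + V 1 1 * W 0 0 - V 0 1 * W 1 0 - V 1 0 * W 0 1) +
  b ^+ 2 * det2 W = det2 V * ((a + b * x) * (a + b * y)).
  have -> : det2 V * ((a + b * x) * (a + b * y)) = a ^+ 2 * det2 V + a * b * (det2 V * (x + y)) + b ^+ 2 * (det2 V * (x * y)) by ring.
  by rewrite xy1 xy2 ![det2 V * _]mulrC !divfK.
rewrite !cnM ler_wpM2l ?cn_ge0 // ler_pM ?(ltW c0) ?(ltW c0') //; [exact: hc|exact: hc'].
Qed.

Definition clamp (r : R) := Num.max 0 (Num.min 1 r).
Lemma clampP r : 0 <= clamp r <= 1.
Proof. by rewrite /clamp le_max lexx /= ge_max ler01 /= ge_min lexx. Qed.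
Lemma clamp_le0 r : r <= 0 -> clamp r = 0.
Proof. by move=> h; rewrite /clamp; apply/max_idPl; rewrite ge_min h orbT. Qed.
Lemma clamp_ge1 r : 1 <= r -> clamp r = 1.
Proof. by move=> h; rewrite /clamp (min_idPl h); apply/max_idPr; exact: ler01. Qed.
Lemma clamp_id r : 0 <= r <= 1 -> clamp r = r.
Proof. by move=> /andP[h1 h2]; rewrite /clamp (min_idPr h2); apply/max_idPr. Qed.
Lemma clamp_lip r s : `|clamp r - clamp s| <= `|r - s|.
Proof.
wlog rs : r s / r <= s.
  by move=> h; have [rs|/ltW rs] := leP r s; [exact: h|rewrite distrC (distrC r); exact: h].
rewrite [leRHS]distrC [leLHS]distrC (ger0_norm (_ : 0 <= s - r)); last by rewrite subr_ge0.
have H x : [/\ x <= 0 -> clamp x = 0, 1 <= x -> clamp x = 1 & 0 <= x <= 1 -> clamp x = x].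
  by split; [exact: clamp_le0|exact: clamp_ge1|exact: clamp_id].
have [r1 r2 r3] := H r; have [s1 s2 s3] := H s; rewrite ler_norml.
move: (clamp r) (clamp s) r1 r2 r3 s1 s2 s3 => u v r1 r2 r3 s1 s2 s3.
have [a|a] := leP r 0; [rewrite r1 //|have [b|b] := leP 1 r; [rewrite r2 //|rewrite r3 ?(ltW a) ?(ltW b) //]];
(have [c|c] := leP s 0; [rewrite s1 //|have [d|d] := leP 1 s; [rewrite s2 //|rewrite s3 ?(ltW c) ?(ltW d) //]]);
apply/andP; split; lra.
Qed.

Lemma ucont_mx_ramp (N n : nat) (m : M) : ucont_mx (fun t : I => rc (clamp (N%:R * ival t - n%:R)) *: m).
Proof.
move=> e e0.
pose r := \sum_i \sum_j cn (m i j).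
have r0 : 0 <= r by apply: sumr_ge0 => i _; apply: sumr_ge0 => j _; exact: cn_ge0.
have br : bd (2 * r) m.
  apply: entry_bd => // i j; rewrite /r (bigD1 i) //= (bigD1 j) //= -addrA lerDl addr_ge0 //.
    by apply: sumr_ge0 => k _; exact: cn_ge0.
  by apply: sumr_ge0 => k _; apply: sumr_ge0 => l _; exact: cn_ge0.
have p0 : 0 < (N%:R + 1) * (2 * r + 1) by rewrite mulr_gt0 // ltr_wpDl // mulr_ge0.
exists (e / ((N%:R + 1) * (2 * r + 1))); first exact: divr_gt0.
move=> s t st; rewrite -scalerBl -rcN -rcD.
apply: bd_le (bdZ _ br); rewrite cn_rc.
have h : `|clamp (N%:R * ival s - n%:R) - clamp (N%:R * ival t - n%:R)| <= N%:R * `|ival s - ival t|.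
  apply: le_trans (clamp_lip _ _) _.
  have -> : N%:R * ival s - n%:R - (N%:R * ival t - n%:R) = N%:R * (ival s - ival t) by ring.
  by rewrite normrM ger0_norm.
have N0 : 0 <= N%:R :> R by [].
rewrite ler_pdivlMr // in st; have := normr_ge0 (ival s - ival t).
move: (N%:R : R) (`|ival s - ival t|) (`|_ - _|) N0 h st => n' x y N0 h st x0.
by nra.
Qed.

Lemma convexE (V W : M) s : V + rc s *: (W - V) = rc (1 - s) *: V + rc s *: W.
Proof. by rewrite rcD rcN scalerDl scale1r scaleNr scalerBr -addrA; congr (_ + _); rewrite addrC. Qed.

(** The path is built node by node: after the last treated node it is constant, and the next segment
    is added by a ramp towards a node perturbed by [perturb_seg]. Nodes are within [e / 2] of [g],
    and [g] varies by at most [e / 2] between neighbours, so convex combinations stay within [e]. *)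
Lemma dense_path (g : I -> M) r e : 0 < e -> (forall t, bd r (g t)) -> ucont_mx g ->
  exists w : I -> M, exists2 c, 0 < c & [/\ ucont_mx w, forall t, c <= cn (det2 (w t)),
    forall t, bd e (w t - g t) & diag2 (g i0) -> diag2 (w i0)].
Proof.
move=> e0 br ug.
have r0 : 0 <= r by exact: le_trans (cn_ge0 _) (bd_entry 0 0 (br i0)).
have e2 : 0 < e / 2 by rewrite divr_gt0.
have [d d0 hd] := ug _ e2.
have [N N0 hN] : exists2 N : nat, (0 < N)%N & N%:R^-1 <= d.
  exists (Num.trunc d^-1).+1 => //.
  rewrite -[leRHS]invrK lef_pV2 ?posrE ?invr_gt0 //.
  by apply/ltW/truncnS_gt.
have NR : 0 < N%:R :> R by rewrite ltr0n.
suff main n : (n <= N)%N -> exists w : I -> M, exists V : M, exists2 c, 0 < c & 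
    [/\ ucont_mx w, forall t, c <= cn (det2 (w t)), forall t, n%:R <= N%:R * ival t -> w t = V,
       bd (e / 2) (V - g (clampI (n%:R / N%:R))) &
       (forall t, N%:R * ival t <= n%:R -> bd e (w t - g t)) /\ (diag2 (g i0) -> diag2 (w i0))].
  have [w [V [c c0 [h1 h2 h3 h4 [h5 h6]]]]] := main N (leqnn N).
  exists w, c => //; split=> // t; apply: h5.
  by rewrite ler_piMr ?(ltW NR) //; have /andP[] := iv01 t.
elim: n => [_|n IH nN].
  (* The first node is shifted by a scalar, which keeps a diagonal value diagonal. [x] and [y] are
     the eigenvalues of [g i0]; they exclude at most two of the three candidates for [k]. *)
  have [x [y [xy1 xy2]]] := quad_roots (g i0 0 0 + g i0 1 1) (det2 (g i0)).
  have [k [k1 k2 dx dy]] : exists k : R, [/\ 0 < k, k <= e / 2, x + rc k != 0 & y + rc k != 0].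
    have F : forall u v : R, u != v -> forall z : C, z + rc u = 0 -> z + rc v = 0 -> False.
      move=> u v /eqP uv z h1 h2; apply: uv; apply: rc_inj.
      by apply: (@addrI _ z); rewrite h1 h2.
    have n1 : e / 2 != e / 4 by rewrite gt_eqF //; lra.
    have n2 : e / 2 != e / 8 by rewrite gt_eqF //; lra.
    have n3 : e / 4 != e / 8 by rewrite gt_eqF //; lra.
    have [h1|h1] := boolP ((x + rc (e / 2) != 0) && (y + rc (e / 2) != 0)).
      by exists (e / 2); have /andP[] := h1; split.
    have [h2|h2] := boolP ((x + rc (e / 4) != 0) && (y + rc (e / 4) != 0)).
      by exists (e / 4); have /andP[] := h2; split=> //; lra.
    exists (e / 8); split; [lra|lra| |]; move: h1 h2; rewrite !negb_and !negbK;
    move=> /orP[]/eqP h1 /orP[]/eqP h2; apply/eqP => h3;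
    by [apply: F n1 _ h1 h2|apply: F n2 _ h1 h3|apply: F n3 _ h2 h3].
  pose V := g i0 + (rc k)%:M.
  have V00 : V 0 0 = g i0 0 0 + rc k by rewrite !mxE.
  have V01 : V 0 1 = g i0 0 1 by rewrite !mxE /= addr0.
  have V10 : V 1 0 = g i0 1 0 by rewrite !mxE /= addr0.
  have V11 : V 1 1 = g i0 1 1 + rc k by rewrite !mxE.
  have dV : det2 V != 0.
    have -> : det2 V = (x + rc k) * (y + rc k).
      have -> : (x + rc k) * (y + rc k) = x * y + rc k * (x + y) + rc k ^+ 2 by ring.
      by rewrite xy1 xy2 /det2 V00 V01 V10 V11; ring.
    by rewrite mulf_neq0.
  have bV : bd (e / 2) (V - g i0).
    rewrite /V addrC addKr -scalemx1; apply: bd_le (bdZ _ (@bd1 R)).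
    by rewrite cn_rc mulr1 gtr0_norm.
  have z0 : clampI (0%:R / N%:R) = i0 :> I by rewrite (_ : 0%:R / N%:R = 0 :> R) // mul0r.
  exists (fun=> V), V, (cn (det2 V)); first by rewrite lt_def cn_eq0 dV cn_ge0.
  split; [exact: ucont_mx_cst|by []|by []|rewrite z0; exact: bV|split].
    move=> t; rewrite pmulr_rle0 // => t0; have -> : t = i0.
      by apply: ival_inj; rewrite iv0; apply/eqP; rewrite eq_le t0; have /andP[] := iv01 t.
    by apply: bd_le bV; lra.
  by move=> [g1 g2]; rewrite /diag2 V01 V10.
have [w [V [c c0 [uw dw cw nw [aw gw]]]]] := IH (ltnW nN).
have w1 : w i1 = V by apply: cw; rewrite iv1 mulr1 ler_nat ltnW.
have dV : det2 V != 0 by rewrite -w1 -cn_eq0 gt_eqF // (lt_le_trans c0).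
set tn := clampI (n%:R / N%:R) in nw; pose tn1 : I := clampI (n.+1%:R / N%:R).
have ivn : ival tn = n%:R / N%:R by rewrite clampIE // divr_ge0 //= ler_pdivrMr // mul1r ler_nat ltnW.
have ivn1 : ival tn1 = n.+1%:R / N%:R by rewrite clampIE // divr_ge0 //= ler_pdivrMr // mul1r ler_nat.
have bV : bd (e / 2 + r) V by rewrite -[V](subrK (g tn)); exact: bdD.
(* [V] has norm at most [e / 2 + r], so adding at most this multiple of [V] moves the new node by at
   most [e / 2]. *)
have p0 : 0 < e / 2 / (e / 2 + r) by rewrite divr_gt0 // ltr_wpDr.
have [k [c' c0' [/andP[k0 k1] hk]]] := perturb_seg (g tn1) dV p0.
set W := g tn1 + _ in hk.
have bW : bd (e / 2) (W - g tn1).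
  rewrite /W addrC addKr; apply: bd_le (bdZ _ bV); rewrite cnM cn_ic mul1r cn_rc gtr0_norm //.
  by rewrite -ler_pdivlMr // ltr_wpDr.
pose s t := clamp (N%:R * ival t - n%:R).
pose w' t := w t + rc (s t) *: (W - V).
have w'E t : w' t = w t \/ w t = V /\ w' t = rc (1 - s t) *: V + rc (s t) *: W.
  have [h|/ltW h] := leP (N%:R * ival t) n%:R.
    by left; rewrite /w' /s clamp_le0 ?subr_le0 // scale0r addr0.
  right; have wV := cw t h; split; first exact: wV.
  by rewrite /w' wV; exact: convexE.
exists w', W, (Num.min c c'); first by rewrite lt_min c0.
split.
- have -> : w' = fun t => 1 *: (rc (s t) *: (W - V)) + w t.
    by apply/funext => t; rewrite /w' scale1r addrC.
  exact: ucont_mx_lin (ucont_mx_ramp N n (W - V)) uw.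
- move=> t; case: (w'E t) => [->|[_ ->]]; rewrite ge_min; first by rewrite dw.
  by apply/orP; right; apply: hk; exact: clampP.
- move=> t h; rewrite /w' /s clamp_ge1.
    rewrite cw; last by apply: le_trans h; rewrite ler_nat.
    by rewrite scale1r addrC subrK.
  by move: h; rewrite -natr1; lra.
- exact: bW.
split; last first.
  move=> /gw; rewrite /w' /s clamp_le0 ?scale0r ?addr0 //.
  by rewrite iv0 mulr0 sub0r oppr_le0.
move=> t ht.
have [h|/ltW h] := leP (N%:R * ival t) n%:R.
  by rewrite /w' /s clamp_le0 ?subr_le0 // scale0r addr0; exact: aw.
have -> : w' t = rc (1 - s t) *: V + rc (s t) *: W.
  by rewrite /w' (cw t h); exact: convexE.
have /andP[s0 s1] := clampP (N%:R * ival t - n%:R); rewrite -/(s t) in s0 s1.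
have -> : rc (1 - s t) *: V + rc (s t) *: W - g t =
   rc (1 - s t) *: ((V - g tn) + (g tn - g t)) + rc (s t) *: ((W - g tn1) + (g tn1 - g t)).
  have -> : V - g tn + (g tn - g t) = V - g t by abels.
  have -> : W - g tn1 + (g tn1 - g t) = W - g t by abels.
  rewrite !scalerBr addrACA -opprD -scalerDl -rcD.
  have -> : 1 - s t + s t = 1 by exact: subrK.
  by rewrite rc1 scale1r.
have near u : `|N%:R * ival u - N%:R * ival t| <= 1 -> bd (e / 2) (g u - g t).
  move=> hu; apply: hd; apply: le_trans hN; rewrite -[leRHS]mul1r ler_pdivlMr //.
  by move: hu; rewrite -mulrBr normrM (gtr0_norm NR) mulrC.
have B1 : bd (e / 2) (g tn - g t).
  apply: near; rewrite ivn mulrC divfK ?gt_eqF // distrC ger0_norm ?subr_ge0 //.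
  by move: ht; rewrite -natr1; lra.
have B2 : bd (e / 2) (g tn1 - g t).
  apply: near; rewrite ivn1 mulrC divfK ?gt_eqF // ger0_norm ?subr_ge0 //.
  by move: h; rewrite -natr1; lra.
apply: bd_le (bdD (bdZ _ (bdD nw B1)) (bdZ _ (bdD bW B2))).
rewrite !cn_rc !ger0_norm //; last by lra.
by rewrite -!mulrDl; lra.
Qed.
End Invertible.

Section KindDensity.
Variable R : realType.
Notation C := (cplx R).
Notation M := 'M[C]_2.
Notation I := (I01 R).
Local Notation i0 := (i0 R).
Local Notation i1 := (i1 R).
Local Opaque mk2 e11 a3 adj bd.

Lemma mx2Z (a : C) (m : M) i j : (a *: m) i j = a * m i j.
Proof. by rewrite mxE. Qed.
Lemma mx2D (m m' : M) i j : (m + m') i j = m i j + m' i j.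
Proof. by rewrite mxE. Qed.

Lemma kind_fun_lin2 k (a b : C) : k <> K0 -> k <> K1 -> k <> KM -> (k = KC -> a = b) ->
  kind_fun k (fun t => proj_comb (kind_proj k t) a b).
Proof.
move=> n0 n1 nM hab; split.
- exists (5 * Num.max (cn a) (cn b)) => t.
  by apply: proj_comb_bd; [exact: kind_proj_bd|rewrite le_max lexx|rewrite le_max lexx orbT].
- have -> : (fun t => proj_comb (kind_proj k t) a b) = fun t => (a - b) *: kind_proj k t + b *: 1%:M.
    by apply/funext => t; rewrite /proj_comb scalerBr scalerBl; abels.
  by apply: ucont_mx_lin; [exact: kind_proj_ucont|exact: ucont_mx_cst].
- move: hab n0 n1 nM; case: k => //= h _ _ _ t; last by rewrite a3_1 !proj_comb_e11 !mk2E.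
    by rewrite (h erefl) !proj_comb_e11 !mk2E.
  by rewrite !proj_comb_e11 !mk2E.
Qed.
(** An idempotent of trace 1 has rank one, so the eigenvalues of [proj_comb p a b] are [a] and
    [b]. *)
Lemma det2_lin2 (p : M) a b : p *m p = p -> p 0 0 + p 1 1 = 1 -> det2 (proj_comb p a b) = a * b.
Proof.
move=> pp tp.
have h0 : p 0 0 * p 0 0 + p 0 1 * p 1 0 = p 0 0 by rewrite -mul2E pp.
have p1 : p 1 1 = 1 - p 0 0 by rewrite -tp addrC addKr.
have h1 : p 0 1 * p 1 0 = p 0 0 - p 0 0 * p 0 0 by apply: (addrI (p 0 0 * p 0 0)); rewrite h0; ring.
have e i j : (proj_comb p a b) i j = a * p i j + b * ((i == j)%:R - p i j) by rewrite /proj_comb !mxE.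
rewrite /det2 !e /= p1.
have -> : (a * p 0 0 + b * (1 - p 0 0)) * (a * (1 - p 0 0) + b * (1 - (1 - p 0 0))) -
 (a * p 0 1 + b * (0 - p 0 1)) * (a * p 1 0 + b * (0 - p 1 0)) =
 (a * p 0 0 + b * (1 - p 0 0)) * (a * (1 - p 0 0) + b * (1 - (1 - p 0 0))) -
 (a - b) ^+ 2 * (p 0 1 * p 1 0) by ring.
by rewrite h1; ring.
Qed.
Lemma det2_pk k (a b : C) t : det2 (proj_comb (kind_proj k t) a b) = a * b.
Proof.
apply: det2_lin2; first exact: kind_proj_idem.
case: k; rewrite /= ?/a3 ?/e11 !mk2E ?addr0 //.
by rewrite -rcD -rc1; congr rc; ring.
Qed.

Lemma near_neq0 (a : C) e : 0 < e -> exists2 a', a' != 0 & cn (a - a') <= e.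
Proof.
move=> e0; have [->|h] := eqVneq a 0; last by exists a; rewrite ?subrr ?cn0 ?ltW.
exists (rc e); first by rewrite -rc0 (inj_eq (@rc_inj R)) gt_eqF.
by rewrite sub0r cnN cn_rc gtr0_norm.
Qed.

Definition flip (t : I) : I := clampI (1 - ival t).
Lemma ival_flip t : ival (flip t) = 1 - ival t.
Proof. by rewrite clampIE //; have /andP[a b] := iv01 t; apply/andP; split; lra. Qed.
Lemma flipK : involutive flip.
Proof. by move=> t; apply: ival_inj; rewrite !ival_flip; ring. Qed.
Lemma flip0 : flip i0 = i1.
Proof. by apply: ival_inj; rewrite ival_flip iv0 iv1 subr0. Qed.
Lemma flip1 : flip i1 = i0.
Proof. by rewrite -flip0 flipK. Qed.
Lemma ucont_mx_flip (g : I -> M) : ucont_mx g -> ucont_mx (g \o flip).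
Proof.
move=> ug e e0; have [d d0 hd] := ug e e0; exists d; first exact: d0.
move=> s t st; apply: hd; rewrite !ival_flip.
have -> : 1 - ival s - (1 - ival t) = - (ival s - ival t) by ring.
by rewrite normrN.
Qed.

(** The constant kinds are perturbed through their scalars, the others by [dense_path]; [K1] is
    reduced to a condition at [i0] by reversing the path. *)
Lemma kind_fun_dense k (g : I -> M) e : kind_fun k g -> 0 < e -> exists w, exists2 c, 0 < c &
  [/\ kind_fun k w, forall t, c <= cn (det2 (w t)) & forall t, bd e (w t - g t)].
Proof.
move=> [[r hr] ug dg] e0.
have lin : k <> K0 -> k <> K1 -> k <> KM -> exists w, exists2 c, 0 < c &
    [/\ kind_fun k w, forall t, c <= cn (det2 (w t)) & forall t, bd e (w t - g t)].
  move=> n0 n1 nM; have [a [b [hab gE]]] : exists a b, (k = KC -> a = b) /\ forall t, g t = proj_comb (kind_proj k t) a b.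
    move: n0 n1 nM dg; case: k => //= _ _ _ dg.
    - by exists (g i1 0 0), (g i1 0 0); split.
    - by exists (g i1 0 0), (g i1 1 1); split.
    - by exists (g i1 0 0), (g i1 1 1); split.
  have e5 : 0 < e / 5 by rewrite divr_gt0.
  have [a' a0 aa] := near_neq0 a e5; have [b' b0 bb] := near_neq0 b e5.
  (* At the kind [KC] the two scalars have to remain equal. *)
  pose b2 := if k is KC then a' else b'.
  have b20 : b2 != 0 by rewrite /b2; case: (k).
  have bb2 : cn (b - b2) <= e / 5 by rewrite /b2; case: (k) hab => // <-.
  exists (fun t => proj_comb (kind_proj k t) a' b2), (cn (a' * b2)).
    by rewrite lt_def cn_eq0 mulf_neq0 ?cn_ge0.
  split; [apply: kind_fun_lin2 => // ek; by rewrite /b2 ek|by move=> t; rewrite det2_pk|move=> t].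
  rewrite gE; have -> : proj_comb (kind_proj k t) a' b2 - proj_comb (kind_proj k t) a b = proj_comb (kind_proj k t) (a' - a) (b2 - b).
    by rewrite /proj_comb !scalerBl; abels.
  have -> : e = 5 * (e / 5) by rewrite mulrC divfK.
  by apply: proj_comb_bd; [exact: kind_proj_bd|rewrite cnB|rewrite cnB].
case: k lin dg => [lin _|lin _|lin _|_ dg|_ dg|_ _]; [exact: lin|exact: lin|exact: lin| | |].
- have [w [c c0 [uw dw bw gw]]] := dense_path e0 hr ug.
  exists w, c; [exact: c0|split; [|exact: dw|exact: bw]; split; [|exact: uw|exact: (gw dg)]].
  by exists (e + r) => t; rewrite -[w t](subrK (g t)); exact: bdD (bw t) (hr t).
- have [w [c c0 [uw dw bw gw]]] := dense_path e0 (fun t => hr (flip t)) (ucont_mx_flip ug).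
  have bw' t : bd e (w (flip t) - g t) by have := bw (flip t); rewrite flipK.
  exists (w \o flip), c; [exact: c0|split=> [|t|t]; [|exact: dw|exact: bw']].
  split; [|exact: ucont_mx_flip|].
    by exists (e + r) => t; rewrite -[(w \o flip) t](subrK (g t)); exact: bdD (bw' t) (hr t).
  by rewrite /= flip1; apply: gw; rewrite flip0.
- have [w [c c0 [uw dw bw gw]]] := dense_path e0 hr ug.
  exists w, c; [exact: c0|split; [|exact: dw|exact: bw]; split; [|exact: uw|exact: Logic.I]].
  by exists (e + r) => t; rewrite -[w t](subrK (g t)); exact: bdD (bw t) (hr t).
Qed.

Lemma cn_ge_Re (z : C) : complex.Re z <= cn z.
Proof. exact: le_trans (ler_norm _) (cn_Re z). Qed.

(* This is [y0^2 + y1^2] when [w = y0 + i y1] with [y0] and [y1] self-adjoint. *)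
Definition symsq (w : M) : M := rc (1 / 2) *: (w *m adj w + adj w *m w).
Lemma det2_adj (w : M) : det2 (adj w) = Num.conj (det2 w).
Proof. by rewrite /det2 !adjE rmorphB !rmorphM [in RHS]mulrC /=; ring. Qed.
Lemma dtM (v w : M) : det2 (v *m w) = det2 v * det2 w.
Proof. by rewrite /det2 !mul2E; ring. Qed.
Lemma herm_Re (P : M) : adj P = P -> P 0 0 = rc (complex.Re (P 0 0)) /\
  P 1 1 = rc (complex.Re (P 1 1)) /\ P 1 0 = Num.conj (P 0 1).
Proof.
move=> h.
have f i : P i i = rc (complex.Re (P i i)).
  have := congr1 (fun m : M => m i i) h; rewrite adjE.
  case: (P i i) => u v /eqP; rewrite eq_complex /= => /andP[_ /eqP v0].
  by rewrite /rc; congr Complex; lra.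
by split; [exact: f|split; [exact: f|rewrite -{1}h adjE]].
Qed.
(** [P] and [Q] are positive with determinant [|det w|^2], and [det (P + Q) >= det P + det Q] for
    positive matrices; halving divides the determinant by 4. *)
Lemma symsq_dt w : cn (det2 w) ^+ 2 / 2 <= cn (det2 (symsq w)).
Proof.
set P := w *m adj w; set Q := adj w *m w.
have dP : det2 P = rc (cn (det2 w) ^+ 2) by rewrite dtM det2_adj mulrC cn_conjM.
have dQ : det2 Q = rc (cn (det2 w) ^+ 2) by rewrite dtM det2_adj cn_conjM.
have sP : adj P = P by rewrite /P adjM adjK.
have sQ : adj Q = Q by rewrite /Q adjM adjK.
have P0 i : 0 <= complex.Re (P i i).
  rewrite /P mul2E !adjE ![_ * Num.conj _]mulrC !cn_conjM -rcD /=.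
  by rewrite addr_ge0 ?sqr_ge0.
have Q0 i : 0 <= complex.Re (Q i i).
  by rewrite /Q mul2E !adjE !cn_conjM -rcD /= addr_ge0 ?sqr_ge0.
have [a0 [a1 a2]] := herm_Re sP; have [b0 [b1 b2]] := herm_Re sQ.
move: (P0 0) (P0 1) (Q0 0) (Q0 1) a0 a1 b0 b1.
move: (complex.Re (P 0 0)) (complex.Re (P 1 1)) (complex.Re (Q 0 0)) (complex.Re (Q 1 1)) => x y u v x0 y0 u0 v0 a0 a1 b0 b1.
set p := P 0 1 in a2; set q := Q 0 1 in b2.
have hp : x * y - cn p ^+ 2 = cn (det2 w) ^+ 2.
  apply: rc_inj; rewrite -dP /det2 a0 a1 -/p a2 [p * _]mulrC cn_conjM -rcM -rcN -rcD.
  by congr rc; ring.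
have hq : u * v - cn q ^+ 2 = cn (det2 w) ^+ 2.
  apply: rc_inj; rewrite -dQ /det2 b0 b1 -/q b2 [q * _]mulrC cn_conjM -rcM -rcN -rcD.
  by congr rc; ring.
apply: le_trans (cn_ge_Re _).
have -> : det2 (symsq w) = rc (1 / 4) * (det2 P + det2 Q + rc (x * v + y * u) - (p * Num.conj q + q * Num.conj p)).
  rewrite /symsq -/P -/Q /det2 !mx2Z !mx2D a0 a1 b0 b1 a2 b2 -/p -/q.
  have E4 : rc (1 / 4) = rc (1 / 2 * (1 / 2)) :> C by congr rc; field.
  rewrite E4.
  by rewrite rcD !rcM; ring.
rewrite dP dQ -!rcD.
have -> : p * Num.conj q + q * Num.conj p = rc (2 * complex.Re (p * Num.conj q)).
  by case: (p) (q) => p1 p2 [q1 q2]; apply/eqP; rewrite eq_complex /=; apply/andP; split; apply/eqP; ring.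
rewrite -rcN -rcD -rcM /=.
have := cn_ge_Re (p * Num.conj q); rewrite cnM cn_conj.
have := cn_ge0 p; have := cn_ge0 q; have := cn_ge0 (det2 w).
move: hp hq; move: (complex.Re _) (cn p) (cn q) (cn (det2 w)) => z a b d hp hq d0 b0' a0' hz.
(* The mixed term is nonnegative: [a^2 b^2 <= (x y)(u v)], and the arithmetic mean of [x v] and
   [y u] dominates the geometric mean. *)
suff : 2 * (a * b) <= x * v + y * u by lra.
have k : (2 * (a * b)) ^+ 2 <= (x * v + y * u) ^+ 2.
  have h1 : a ^+ 2 <= x * y by have := sqr_ge0 d; lra.
  have h2 : b ^+ 2 <= u * v by have := sqr_ge0 d; lra.
  have h3 : a ^+ 2 * b ^+ 2 <= (x * y) * (u * v) by rewrite ler_pM ?sqr_ge0.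
  have := sqr_ge0 (x * v - y * u); nra.
by apply: le_sqr_norm k; rewrite addr_ge0 // mulr_ge0.
Qed.
Lemma kind_fun_symsq k (w : I -> M) : kind_fun k w -> kind_fun k (fun t => symsq (w t)).
Proof.
move=> kw; have ks := @cs_star _ _ (kind_csub R k) _ kw.
have k1 := @cs_mul _ _ (kind_csub R k) _ _ kw ks.
have k2 := @cs_mul _ _ (kind_csub R k) _ _ ks kw.
have k3 := @cs_lin _ _ (kind_csub R k) 1 _ _ k1 k2.
have := @cs_scale _ _ (kind_csub R k) (rc (1 / 2)) (mkcar k3).
by congr (kind_fun k _); apply/funext => t /=; rewrite scale1r.
Qed.
End KindDensity.

Section NilpotenceRanks.
Variables (R : realType) (S : choiceType).
Notation C := (cplx R).
Notation M := 'M[C]_2.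
Notation I := (I01 R).
Notation E := (Ealg R S).
Local Opaque mk2 e11 a3 adj bd.

(** The determinant vanishes, so [m^2] is the trace times [m] by Cayley-Hamilton, and [m^3] is the
    squared trace times [m]. *)
Lemma nil3_2 (m : M) : m *m (m *m m) = 0 -> m *m m = 0.
Proof.
move=> h; have d0 : det2 m = 0.
  have := congr1 (@det2 R) h; rewrite !dtM /det2 !mxE mul0r subrr => /eqP.
  rewrite mulf_eq0 => /orP[/eqP //|]; by rewrite mulf_eq0 orbb => /eqP.
have CH : m *m m = (m 0 0 + m 1 1) *: m.
  move: d0; rewrite /det2 => /eqP; rewrite subr_eq0 => /eqP d0.
  by apply: mx2P; rewrite mul2E !mxE; ring: d0.
have [t0|t0] := eqVneq (m 0 0 + m 1 1) 0; first by rewrite CH t0 scale0r.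
move: h; rewrite CH -scalemxAr CH scalerA => /eqP.
by rewrite scaler_eq0 mulf_eq0 !(negbTE t0) /= => /eqP ->; rewrite scaler0.
Qed.

Definition elem F (g : Omega S -> I -> M) (hg : forall x, kind_fun (kind_of x) (g x)) : E :=
  inclA (@mkcar R _ (A_csub R F) _ (A_pred_of F hg)).

Lemma E_nilpotence : (exists s : S, True) -> nilpotence_index E 2.
Proof.
move=> [s _]; split.
  move=> x h; apply: carrier_eqP => z.
  have := congr1 (fun f : E => val f z) h; rewrite /rexp /= !mulmx1.
  exact: nil3_2.
have nilp : exists2 f : E, f ** f = 0 & f <> 0.
  (* At a full triple any constant is admissible; the family is supported on the cell of one such
     triple. *)
  pose n12 := mk2 0 1 0 0 : M; pose top : Omega S := (Some s, Some s, Some s).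
  pose g x := if x == top then (fun _ : I => n12) else fun=> 0.
  have hg x : kind_fun (kind_of x) (g x).
    rewrite /g; case: eqP => [->|_]; last exact: (@cs_zero R _ (kind_csub R (kind_of x))).
    split; [|exact: ucont_mx_cst|exact: Logic.I].
    exists (2 * 1) => t; apply: entry_bd => // i j.
    by case: (ord2 i) => ->; case: (ord2 j) => ->; rewrite mk2E ?cn0 ?cn1.
  exists (elem [fset s]%fset hg).
    apply: carrier_eqP => z; rewrite /= /g; case: eqP => _; last by rewrite mul0mx.
    by apply: mx2P; rewrite mul2E !mk2E !mxE; ring.
  move=> /(congr1 (fun f : E => val f (top, i0 R) 0 1)) /=.
  rewrite /g /cell_of /= in_fset1 eqxx eqxx mk2E mxE => /eqP; by rewrite oner_eq0.
have one0 : (rone : E) <> 0.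
  move=> /(congr1 (fun f : E => val f ((None, None, None), i0 R) 0 0)) /=.
  by rewrite !mxE => /eqP; rewrite oner_eq0.
move=> [|[|m]] // h.
  by exfalso; apply: one0; apply: (h 0); rewrite /rexp /= rmul0r.
have [f ff f0] := nilp; case: f0; have := h f; rewrite /rexp /= rmul1r; exact.
Qed.

(** The restriction to the cells of a finite set is perturbed cell by cell. The last claim inverts
    the sum of two squares that occurs in the real rank. *)
Lemma E_invertible_dense (h : E) e : 0 < e -> exists w z : E, [/\ nr (h - w) <= e,
  z ** w = rone, w ** z = rone &
  exists c, rc (1 / 2) *: (w ** star w + star w ** w) ** c = rone /\
            c ** (rc (1 / 2) *: (w ** star w + star w ** w)) = rone].
Proof.
move=> e0; have e2 : 0 < e / 2 by rewrite divr_gt0.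
have [F /(_ F (fsubset_refl F)) hF] := restr_near h e2.
have /choice[W hW] x : exists w : I -> M, exists2 c, 0 < c & [/\ kind_fun (kind_of x) w,
    forall t, c <= cn (det2 (w t)) & forall t, bd (e / 2) (w t - val h (x, t))].
  by apply: kind_fun_dense => //; apply: E_pred_kpred; exact: (carrierP h).
have kW x : kind_fun (kind_of x) (W x) by have [c _ []] := hW x.
have kZ x : kind_fun (kind_of x) (fun t => inv2 (W x t)).
  by have [c c0 [k1 k2 _]] := hW x; exact: kind_fun_inv k1 c0 k2.
have nz x t : det2 (W x t) != 0.
  by have [c c0 [_ /(_ t) k _]] := hW x; rewrite -cn_eq0 gt_eqF // (lt_le_trans c0).
have kS x : kind_fun (kind_of x) (fun t => symsq (W x t)) by exact: kind_fun_symsq.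
have bS x t : 0 < cn (det2 (symsq (W x t))).
  apply: lt_le_trans (symsq_dt _).
  by rewrite divr_gt0 // exprn_gt0 // lt_def cn_eq0 nz cn_ge0.
have kC x : kind_fun (kind_of x) (fun t => inv2 (symsq (W x t))).
  have [c c0 [k1 k2 _]] := hW x; apply: (kind_fun_inv (c := c ^+ 2 / 2)) => //.
    by rewrite divr_gt0 // exprn_gt0.
  move=> t; apply: le_trans (symsq_dt _).
  by rewrite ler_pM2r // ler_sqr ?nnegrE ?cn_ge0 // ltW.
have nzS x t : det2 (symsq (W x t)) != 0 by rewrite -cn_eq0 gt_eqF.
exists (elem F kW), (elem F kZ); split.
- have -> : h - elem F kW = (h - inclA (restr F h)) + (inclA (restr F h) - elem F kW) by abel.
  apply: le_trans (nrD _ _) _; have -> : e = e / 2 + e / 2 by field.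
  apply: lerD; first exact: hF.
  apply: car_normP; first exact: ltW.
  move=> [x t]; change (bd (e / 2) (val h (cell_of F x, t) - W (cell_of F x) t)); apply: bdC; have [c _ [_ _]] := hW (cell_of F x); exact.
- by apply: (@carrier_eqP _ _ (E_csub R S)) => -[x t]; exact: (inv2l (nz (cell_of F x) t)).
- by apply: (@carrier_eqP _ _ (E_csub R S)) => -[x t]; exact: (inv2r (nz (cell_of F x) t)).
exists (elem F kC); split; apply: (@carrier_eqP _ _ (E_csub R S)) => -[x t] /=.
  exact: (inv2r (nzS (cell_of F x) t)).
exact: (inv2l (nzS (cell_of F x) t)).
Qed.

Lemma E_stable_rank : stable_rank E 1.
Proof.
split; last by move=> m [].
split=> // x e /posC[r r0 ->].
have r2 : 0 < r / 2 by rewrite divr_gt0.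
have [w [z [h1 h2 _ _]]] := E_invertible_dense (x 0) r2.
exists (fun=> w); split; last by exists (fun=> z); rewrite big_ord1.
move=> i; rewrite (ord1 i) nrE ltr_rc; apply: le_lt_trans h1 _; lra.
Qed.

Lemma nr_half (u v : E) r : nr u <= r -> nr v <= r -> nr (rc (1 / 2) *: (u + v)) <= r.
Proof.
move=> hu hv; rewrite nrZr ?divr_ge0 // div1r mulrC ler_pdivrMr //.
rewrite mulr_natr mulr2n; exact: le_trans (nrD u v) (lerD hu hv).
Qed.

(* Real rank at most [2 sr - 1]: approximate [x0 + i x1] by an invertible element. *)
Lemma E_real_rank_le1 : real_rank_le E 1.
Proof.
move=> x sx e /posC[r r0 ->].
have r2 : 0 < r / 2 by rewrite divr_gt0.
have [w [_ [h1 _ _ [c [c1 c2]]]]] := E_invertible_dense (x 0 + ic R *: x 1) r2.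
have icc : Num.conj (ic R) = - ic R.
  by apply/eqP; rewrite eq_complex /= oppr0 !eqxx.
have ici : ic R * ic R = -1.
  by apply/eqP; rewrite eq_complex /=; apply/andP; split; apply/eqP; ring.
pose y0 : E := rc (1 / 2) *: (w + star w).
pose y1 : E := (- (ic R * rc (1 / 2))) *: (w - star w).
have sy0 : star y0 = y0 by rewrite /y0 starZr starD starK addrC.
have sy1 : star y1 = y1.
  have cc : Num.conj (- (ic R * rc (1 / 2))) = ic R * rc (1 / 2).
    by apply/eqP; rewrite eq_complex /=; apply/andP; split; apply/eqP; ring.
  by rewrite /y1 starZ starB starK cc scaleNr -scalerN opprB.
have hh : rc (1 / 2) + rc (1 / 2) = 1 :> C by rewrite -rcD -rc1; congr rc; field.
pose y := fun i : 'I_2 => if i == 0 then y0 else y1.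
exists y; split.
- by move=> i; rewrite /y; case: ifP.
- move=> i; rewrite nrE ltr_rc; apply: (@le_lt_trans _ _ (r / 2)); last by rewrite ltr_pdivrMr // ltr_pMr // ltr1n.
  set d := x 0 + ic R *: x 1 - w in h1.
  have sd : star d = x 0 - ic R *: x 1 - star w.
    by rewrite /d starB starD starZ !sx icc scaleNr.
  have [->|->] := ord2 i; rewrite /y /=.
    have -> : x 0 - y0 = rc (1 / 2) *: (d + star d).
      rewrite sd /d /y0 -{1}[x 0]scale1r -hh scalerDl -scalerDr -scalerBr; congr (_ *: _); abel.
    by apply: nr_half; rewrite ?nr_star; exact: h1.
  have -> : x 1 - y1 = (- ic R) *: (rc (1 / 2) *: (d + - star d)).
    have -> : d + - star d = ic R *: (x 1 + x 1) - (w - star w).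
      by rewrite sd /d scalerDr; abel.
    have cz : - ic R * rc (1 / 2) * ic R = rc (1 / 2).
      by rewrite mulrAC mulNr ici opprK; exact: mul1r.
    by rewrite scalerA scalerBr scalerA cz mulNr -/y1 scalerDr -scalerDl hh scale1r.
  rewrite nrZ cnN cn_ic mul1r; by apply: nr_half; rewrite ?nrN ?nr_star; exact: h1.
have yE : \sum_i y i ** y i = rc (1 / 2) *: (w ** star w + star w ** w).
  rewrite !big_ord_recl big_ord0 addr0 /y /=.
  rewrite /y0 /y1 -!rscalerAl -!rscalerAr !scalerA.
  have -> : - (ic R * rc (1 / 2)) * - (ic R * rc (1 / 2)) = - (rc (1 / 2) * rc (1 / 2)).
    by rewrite mulrNN mulrACA ici mulN1r.
  rewrite scaleNr -scalerBr.
  have -> : (w + star w) ** (w + star w) - (w - star w) ** (w - star w) =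
      (w ** star w + star w ** w) + (w ** star w + star w ** w).
    by rewrite !rmulE; abel.
  by rewrite -scalerA halfD.
by exists c; rewrite yE; split.
Qed.
End NilpotenceRanks.

(** * Traces and idempotent complex matrices *)

Section Trace.
Variables (S : rngType) (W : zmodType) (phi : S -> W).
Hypothesis phiD : {morph phi : x y / x + y}.
Hypothesis phiC : forall x y, phi (x ** y) = phi (y ** x).
Local Notation Mx := (Minf S).
Implicit Types A B : Mx.

Let phi0 : phi 0 = 0.
Proof. by apply: (@addrI _ (phi 0)); rewrite -phiD !addr0. Qed.

Definition Tr A : W := \sum_(i < projT1 (cid (suppP A))) phi (val A i i).

Lemma TrE n A : supp n A -> Tr A = \sum_(i < n) phi (val A i i).
Proof.
rewrite /Tr; case: (cid _) => m /= sm sn.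
have key k l : (k <= l)%N -> supp k A -> \sum_(i < k) phi (val A i i) = \sum_(i < l) phi (val A i i).
  move=> kl sk; rewrite -!(big_mkord xpredT (fun i => phi (val A i i))).
  rewrite [RHS](@big_cat_nat _ _ _ k) //= [X in _ + X]big_nat [X in _ + X]big1 ?addr0 //.
  by move=> i /andP[ki _]; rewrite sk ?ki.
by rewrite (key _ _ (leq_maxl m n) sm) (key _ _ (leq_maxr m n) sn).
Qed.

Lemma supp_common A B : exists n, supp n A /\ supp n B.
Proof.
have [n sn] := suppP A; have [m sm] := suppP B; exists (maxn n m).
by split; [exact: supp_le (leq_maxl _ _) sn|exact: supp_le (leq_maxr _ _) sm].
Qed.

Lemma TrD A B : Tr (A + B) = Tr A + Tr B.
Proof.
have [n [sA sB]] := supp_common A B.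
rewrite (TrE (suppD sA sB)) (TrE sA) (TrE sB) -big_split; apply: eq_bigr => i _.
exact: phiD.
Qed.

Lemma TrC A B : Tr (A ** B) = Tr (B ** A).
Proof.
have [n [sA sB]] := supp_common A B.
rewrite (TrE (suppM sA sB)) (TrE (suppM sB sA)).
under eq_bigr => i _ do rewrite (supp_mulE _ _ _ sA) (big_morph phi phiD phi0).
under [RHS]eq_bigr => i _ do rewrite (supp_mulE _ _ _ sB) (big_morph phi phiD phi0).
rewrite exchange_big; apply: eq_bigr => i _; apply: eq_bigr => j _; exact: phiC.
Qed.

(** Equivalent idempotents [x y] and [y x] have equal traces, so the choice of the representative is
    immaterial. *)
Definition Vtr (z : V S) : W := Tr (val (projT1 (cid (VclassP z)))).
Lemma Vtr_class p : Vtr (Vclass p) = Tr (val p).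
Proof.
rewrite /Vtr; case: (cid _) => q /= /Vclass_eqP/asboolP[x [y [-> ->]]].
exact: TrC.
Qed.
Lemma VtrD x y : Vtr (x + y) = Vtr x + Vtr y.
Proof.
have [a ->] := VclassP x; have [b ->] := VclassP y.
rewrite -(Vclass_spread (isT : (0 < 2)%N) a) -(Vclass_spread (isT : (1 < 2)%N) b).
set a' := spread_idem _ a; set b' := spread_idem _ b.
have o : orthogonal_idem a' b' by exact: spread_orth.
by rewrite (Vclass_addE o) !Vtr_class -TrD.
Qed.
End Trace.

Section MapMx.
Variables (A B : rngType) (f : A -> B).
Hypothesis fD : {morph f : x y / x + y}.
Hypothesis fM : {morph f : x y / x ** y}.

Let f0 : f 0 = 0.
Proof. by apply: (@addrI _ (f 0)); rewrite -fD !addr0. Qed.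

Lemma fin_mx_map (z : Minf A) : fin_mx (fun i k => f (val z i k)).
Proof. by have [n h] := MinfP z; exists n => i k /h ->. Qed.
Definition mapm z : Minf B := mkMinf (fin_mx_map z).
Lemma mapm_supp n z : supp n z -> supp n (mapm z).
Proof. by move=> h i k /h /= ->. Qed.
Lemma mapmM : {morph mapm : x y / x ** y}.
Proof.
move=> x y; apply: Minf_eqP => i k; have [n sx] := suppP x.
rewrite (supp_mulE _ _ _ (mapm_supp sx)).
change (f (val (x ** y) i k) = \sum_(l < n) f (val x i l) ** f (val y l k)).
rewrite (supp_mulE _ _ _ sx).
by rewrite (big_morph f fD f0); apply: eq_bigr => l _.
Qed.
Lemma mapm_idem (p : idem (Minf A)) : mapm (val p) ** mapm (val p) = mapm (val p).
Proof. by rewrite -mapmM idemP. Qed.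
End MapMx.

(** * Idempotent matrices over a field are classified by their trace *)

Section LinearAlgebra.
Variable F : numFieldType.

Lemma cancel_idem n r (L : 'M[F]_(n, r)) (T : 'M[F]_(r, n)) L' T' :
  L' *m L = 1%:M -> T *m T' = 1%:M -> L *m T *m (L *m T) = L *m T -> T *m L = 1%:M.
Proof.
move=> hL hT h; have : L' *m (L *m T *m (L *m T)) *m T' = L' *m (L *m T) *m T' by rewrite h.
by rewrite !mulmxA hL !mul1mx -!mulmxA hT mulmx1.
Qed.

(** For a rank factorization [A = L T], idempotence can be cancelled to [T L = 1], so the trace is
    the rank. *)
Lemma idem_rank n (A : 'M[F]_n) : A *m A = A -> exists r,
  exists (L : 'M[F]_(n, r)) (T : 'M[F]_(r, n)), [/\ A = L *m T, T *m L = 1%:M & mxtrace A = r%:R].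
Proof.
move=> AA; exists (\rank A), (col_base A), (row_base A).
have E : row_base A *m col_base A = 1%:M.
  have /row_fullP[L' hL] := col_base_full A; have /row_freeP[T' hT] := row_base_free A.
  by apply: cancel_idem hL hT _; rewrite mulmx_base.
split; [by rewrite mulmx_base|exact: E|].
by rewrite -{1}(mulmx_base A) mxtrace_mulC E mxtrace1.
Qed.

(** In characteristic 0 equal traces mean equal ranks, so [A] and [B] factor through the same
    space. *)
Lemma idem_similar n (A B : 'M[F]_n) : A *m A = A -> B *m B = B -> \tr A = \tr B ->
  exists X Y, A = X *m Y /\ B = Y *m X.
Proof.
move=> /idem_rank[r [L [T [-> TL ->]]]] /idem_rank[s [L' [T' [-> TL' ->]]]].
move=> /eqP; rewrite eqr_nat => /eqP rs; move: L' T' TL'; rewrite -rs => L' T' TL'.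
exists (L *m T'), (L' *m T); split.
  by rewrite mulmxA -(mulmxA L) TL' mulmx1.
by rewrite mulmxA -(mulmxA L') TL mulmx1.
Qed.

Definition fmx n (p : nat -> nat -> F) : 'M[F]_n := \matrix_(i, j) p i j.
Definition mxf n (A : 'M[F]_n) (i j : nat) : F :=
  if insub i is Some i' then if insub j is Some j' then A i' j' else 0 else 0.
Lemma mxfE n (A : 'M[F]_n) (i j : 'I_n) : mxf A i j = A i j.
Proof. by rewrite /mxf !valK. Qed.
Lemma mxf_out n (A : 'M[F]_n) i j : (n <= i)%N || (n <= j)%N -> mxf A i j = 0.
Proof.
by rewrite /mxf; case: insubP => [i' hi _|//]; case: insubP => [j' hj _|//]; lia.
Qed.

Definition nsupp n (p : nat -> nat -> F) := forall i j, (n <= i)%N || (n <= j)%N -> p i j = 0.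

Lemma idem_similar_nat n (p q : nat -> nat -> F) : nsupp n p -> nsupp n q ->
  (forall i j, \sum_(k < n) p i k * p k j = p i j) ->
  (forall i j, \sum_(k < n) q i k * q k j = q i j) ->
  \sum_(i < n) p i i = \sum_(i < n) q i i ->
  exists x y, [/\ nsupp n x, nsupp n y, forall i j, p i j = \sum_(k < n) x i k * y k j
    & forall i j, q i j = \sum_(k < n) y i k * x k j].
Proof.
move=> sp sq pp qq pq.
have fI (u : nat -> nat -> F) : (forall i j, \sum_(k < n) u i k * u k j = u i j) -> fmx n u *m fmx n u = fmx n u.
  move=> uu; apply/matrixP => i j; rewrite !mxE -[RHS]uu.
  by apply: eq_bigr => k _; rewrite !mxE.
have fT u : \tr (fmx n u) = \sum_(i < n) u i i by apply: eq_bigr => i _; rewrite mxE.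
have [|X [Y [e1 e2]]] := idem_similar (fI _ pp) (fI _ qq); first by rewrite !fT.
have fE u A B : nsupp n u -> fmx n u = A *m B ->
    forall i j, u i j = \sum_(k < n) mxf A i k * mxf B k j.
  move=> su uE i j; have [h|h] := boolP ((n <= i)%N || (n <= j)%N).
    rewrite su // big1 // => k _; case/orP: h => h.
      by rewrite mxf_out ?h // mul0r.
    by rewrite (mxf_out B) ?h ?orbT // mulr0.
  move: h; rewrite negb_or -!ltnNge => /andP[hi hj].
  have := congr1 (fun m : 'M[F]_n => m (Ordinal hi) (Ordinal hj)) uE; rewrite !mxE /= => ->.
  by apply: eq_bigr => k _; rewrite -!mxfE.
exists (mxf X), (mxf Y); split; [exact: mxf_out|exact: mxf_out|exact: fE e1|exact: fE e2].
Qed.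

Lemma idem_nat_trace n (p : nat -> nat -> F) :
  (forall i j, \sum_(k < n) p i k * p k j = p i j) -> exists r : nat, \sum_(i < n) p i i = r%:R.
Proof.
move=> pp; have [|r [L [T [_ _ h]]]] := @idem_rank n (fmx n p).
  apply/matrixP => i j; rewrite !mxE -[RHS]pp.
  by apply: eq_bigr => k _; rewrite !mxE.
by exists r; rewrite -h; apply: eq_bigr => i _; rewrite mxE.
Qed.
End LinearAlgebra.

Section Blocks.
Variable F : numFieldType.
Local Notation M := 'M[F]_2.
Implicit Types p q : nat -> nat -> M.

Definition o2 (i : nat) : 'I_2 := inord (i %% 2).
(** A matrix of [2 x 2] blocks is read as a scalar matrix of twice the size, to which rank arguments
    apply. *)
Definition flat p (i j : nat) : F := p (i %/ 2)%N (j %/ 2)%N (o2 i) (o2 j).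
Definition unflat (x : nat -> nat -> F) (i j : nat) : M :=
  \matrix_(a, b) x (2 * i + a)%N (2 * j + b)%N.
Lemma o2E (i : nat) (a : 'I_2) : ((2 * i + a) %/ 2 = i)%N /\ o2 (2 * i + a)%N = a.
Proof.
have h := ltn_ord a; split; first by lia.
by apply: val_inj; rewrite /o2 /= inordK; lia.
Qed.
Lemma flatK p i j : unflat (flat p) i j = p i j.
Proof.
apply/matrixP => a b; rewrite mxE /flat.
by have [-> ->] := o2E i a; have [-> ->] := o2E j b.
Qed.
Lemma sum_pairs n (G : nat -> F) : \sum_(k < 2 * n) G k = \sum_(k < n) \sum_(a < 2) G (2 * k + a)%N.
Proof.
elim: n => [|n IH]; first by rewrite muln0 !big_ord0.
rewrite mulnS !addSn add0n !big_ord_recr /= IH big_ord0 add0r addn0 addn1 -addrA //.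
Qed.
Lemma flat_mul n p q i j :
  \sum_(k < 2 * n) flat p i k * flat q k j = flat (fun i j => \sum_(k < n) p i k *m q k j) i j.
Proof.
rewrite (sum_pairs n (fun k => flat p i k * flat q k j)) /flat summxE; apply: eq_bigr => k _; rewrite mxE.
by apply: eq_bigr => a _; have [-> ->] := o2E k a.
Qed.
Lemma unflat_mul n (x y : nat -> nat -> F) i j :
  unflat (fun i j => \sum_(k < 2 * n) x i k * y k j) i j = \sum_(k < n) unflat x i k *m unflat y k j.
Proof.
apply/matrixP => a b; rewrite summxE mxE (sum_pairs n (fun k => x _ k * y k _)); apply: eq_bigr => k _.
by rewrite mxE; apply: eq_bigr => c _; rewrite !mxE.
Qed.
Lemma flat_trace n p : \sum_(i < 2 * n) flat p i i = \sum_(i < n) \tr (p i i).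
Proof.
rewrite (sum_pairs n (fun i => flat p i i)); apply: eq_bigr => i _; apply: eq_bigr => a _.
by rewrite /flat; have [-> ->] := o2E i a.
Qed.
Definition block_supp n p := forall i j, (n <= i)%N || (n <= j)%N -> p i j = 0.
Lemma flat_supp n p : block_supp n p -> nsupp (2 * n) (flat p).
Proof.
by move=> h i j k; rewrite /flat h ?mxE //; apply/orP; case/orP: k => k; [left|right]; lia.
Qed.
Lemma unflat_supp n x : nsupp (2 * n) x -> block_supp n (unflat x).
Proof.
move=> h i j k; apply/matrixP => a b; rewrite !mxE h //.
by apply/orP; case/orP: k => k; [left|right]; lia.
Qed.

Definition block_mul n p q i j := \sum_(k < n) p i k *m q k j.

Lemma block_trace n p : (forall i j, block_mul n p p i j = p i j) ->
  exists r : nat, \sum_(i < n) \tr (p i i) = r%:R.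
Proof.
move=> pp; rewrite -flat_trace; apply: idem_nat_trace => i j.
by rewrite flat_mul /flat; have := pp (i %/ 2)%N (j %/ 2)%N; rewrite /block_mul => ->.
Qed.

Lemma block_similar n p q : block_supp n p -> block_supp n q ->
  (forall i j, block_mul n p p i j = p i j) -> (forall i j, block_mul n q q i j = q i j) ->
  \sum_(i < n) \tr (p i i) = \sum_(i < n) \tr (q i i) ->
  exists x y, [/\ block_supp n x, block_supp n y, forall i j, p i j = block_mul n x y i j
    & forall i j, q i j = block_mul n y x i j].
Proof.
move=> sp sq pp qq; rewrite -!flat_trace => pq.
have hi u : (forall i j, block_mul n u u i j = u i j) ->
    forall i j, \sum_(k < 2 * n) flat u i k * flat u k j = flat u i j.
  by move=> uu i j; rewrite flat_mul /flat; have := uu (i %/ 2)%N (j %/ 2)%N; rewrite /block_mul => ->.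
have [x [y [sx sy px qy]]] := idem_similar_nat (flat_supp sp) (flat_supp sq) (hi _ pp) (hi _ qq) pq.
exists (unflat x), (unflat y); split; [exact: unflat_supp|exact: unflat_supp| |].
  move=> i j; rewrite -flatK /block_mul -unflat_mul.
  by apply/matrixP => a b; rewrite !mxE px.
move=> i j; rewrite -flatK /block_mul -unflat_mul.
by apply/matrixP => a b; rewrite !mxE qy.
Qed.
End Blocks.

(** * Rank functions of idempotents over E *)

Section KindData.
Variable R : realType.
Notation C := (cplx R).
Notation M := 'M[C]_2.
Notation I := (I01 R).
Local Notation i0 := (i0 R).
Local Notation i1 := (i1 R).
Local Opaque mk2 e11 a3 adj bd.
Implicit Types (k : kind) (m : M) (g : I -> M) (s t : I).

(* Values at this point are diagonal, except for the kind [KM]. *)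
Definition end_pt k : I := match k with K0 | KM => i0 | _ => i1 end.
(** The matrices that can be values at [end_pt k] of paths of kind [k]. *)
Definition kind_mx k m : Prop :=
  match k with KC => diag2 m /\ m 1 1 = m 0 0 | KM => True | _ => diag2 m end.
Definition kind_embed k m t : M := if k is KM then m else proj_comb (kind_proj k t) (m 0 0) (m 1 1).

Lemma diag2D m m' : diag2 m -> diag2 m' -> diag2 (m + m').
Proof. by rewrite /diag2 !mxE => -[-> ->] [-> ->]; rewrite addr0. Qed.
Lemma diag2M m m' : diag2 m -> diag2 m' -> diag2 (m *m m').
Proof. by rewrite /diag2 !mul2E => -[-> ->] [-> ->]; rewrite !(mulr0, mul0r) addr0. Qed.
Lemma mtyped0 k : kind_mx k 0.
Proof. by case: k; rewrite /= /diag2 ?mxE. Qed.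
Lemma mtypedD k m m' : kind_mx k m -> kind_mx k m' -> kind_mx k (m + m').
Proof.
case: k => //=; try exact: diag2D.
by move=> [d e] [d' e']; split; [exact: diag2D|rewrite !mxE e e'].
Qed.
Lemma mtypedM k m m' : kind_mx k m -> kind_mx k m' -> kind_mx k (m *m m').
Proof.
case: k => //=; try exact: diag2M.
move=> [d e] [d' e']; split; first exact: diag2M.
by rewrite !mul2E e e' d.1 d.2 !mul0r addr0 add0r.
Qed.

Lemma lin2D (p : M) (a b c d : C) : proj_comb p (a + c) (b + d) = proj_comb p a b + proj_comb p c d.
Proof. by rewrite /proj_comb !scalerDl; abels. Qed.
Lemma embedD k m m' t : kind_embed k (m + m') t = kind_embed k m t + kind_embed k m' t.
Proof. by case: k; rewrite /kind_embed // !mx2D lin2D. Qed.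
Lemma embed0 k t : kind_embed k 0 t = 0.
Proof. by case: k; rewrite /kind_embed // !mxE /proj_comb !scale0r addr0. Qed.
Lemma kind_embed_mul k m m' t : kind_mx k m -> kind_mx k m' -> kind_embed k (m *m m') t = kind_embed k m t *m kind_embed k m' t.
Proof.
have D : diag2 m -> diag2 m' ->
    proj_comb (kind_proj k t) ((m *m m') 0 0) ((m *m m') 1 1) = proj_comb (kind_proj k t) (m 0 0) (m 1 1) *m proj_comb (kind_proj k t) (m' 0 0) (m' 1 1).
  move=> [d1 d2] [d1' d2']; rewrite proj_comb_mul; last exact: kind_proj_idem.
  by rewrite !mul2E d1 d2 !mul0r addr0 add0r.
by case: k D => //= D [d _] [d' _]; exact: D.
Qed.
Lemma proj_comb_diag m : diag2 m -> proj_comb (e11 R) (m 0 0) (m 1 1) = m.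
Proof. by move=> [d1 d2]; rewrite proj_comb_e11; apply: mx2P; rewrite mk2E. Qed.
Lemma cst_kpred k m : (k = K0 \/ k = K1 -> diag2 m) -> k <> KC -> k <> KE -> k <> KT -> kind_fun k (fun=> m).
Proof.
move=> d n1 n2 n3; split; [|exact: ucont_mx_cst|].
  have [r hr] : exists r, bd r m.
    exists (2 * \big[Num.max/0]_(ij : 'I_2 * 'I_2) cn (m ij.1 ij.2)).
    have h i j : cn (m i j) <= \big[Num.max/0]_(ij : 'I_2 * 'I_2) cn (m ij.1 ij.2).
      by apply: (@le_bigmax_cond _ _ _ _ (i, j) xpredT (fun ij => cn (m ij.1 ij.2))).
    by apply: entry_bd => //; apply: le_trans (h 0 0); exact: cn_ge0.
  by exists r.
by case: k d n1 n2 n3 => //= d *; apply: d; [left|right].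
Qed.
Lemma kind_fun_embed k m : kind_mx k m -> kind_fun k (kind_embed k m).
Proof.
have L : k <> K0 -> k <> K1 -> k <> KM -> (k = KC -> m 0 0 = m 1 1) -> kind_fun k (fun t => proj_comb (kind_proj k t) (m 0 0) (m 1 1)).
  by move=> *; exact: kind_fun_lin2.
case: k L => /= L h.
- by apply: L => //; case: h.
- exact: L.
- exact: L.
- by have := @cst_kpred K0 m (fun _ => h); rewrite -{1}(proj_comb_diag h); apply.
- by have := @cst_kpred K1 m (fun _ => h); rewrite -{1}(proj_comb_diag h); apply.
- by apply: (@cst_kpred KM m) => // -[].
Qed.

(** A deformation of the interval onto [end_pt k]: the identity at [s = 1], constant at [s = 0], and
    fixing that point throughout, so that the condition of the kind survives. Paths of the other
    kinds are already given by scalars. *)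
Definition contract_pt k s t : I :=
  match k with
  | K0 | KM => clampI (ival s * ival t)
  | K1 => clampI (1 - ival s * (1 - ival t))
  | _ => t
  end.
Lemma ival_rho0 s t : ival (clampI (ival s * ival t)) = ival s * ival t.
Proof. by rewrite clampIE //; have /andP[a b] := iv01 s; have /andP[c d] := iv01 t; apply/andP; split; nra. Qed.
Lemma ival_rho1 s t : ival (clampI (1 - ival s * (1 - ival t))) = 1 - ival s * (1 - ival t).
Proof. by rewrite clampIE //; have /andP[a b] := iv01 s; have /andP[c d] := iv01 t; apply/andP; split; nra. Qed.
Lemma contract_pt_lip k s s' t t' : `|ival (contract_pt k s t) - ival (contract_pt k s' t')| <= `|ival s - ival s'| + `|ival t - ival t'|.
Proof.
have le01 (a b : R) : 0 <= b <= 1 -> `|a * b| <= `|a|.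
  by move=> /andP[b0 b1]; rewrite normrM (ger0_norm b0) ler_piMr.
have /andP[u0 u1] := iv01 s; have /andP[v0 v1] := iv01 s'.
have /andP[w0 w1] := iv01 t; have /andP[z0 z1] := iv01 t'.
case: k => /=; try by rewrite lerDr.
- rewrite !ival_rho0; have -> : ival s * ival t - ival s' * ival t' = (ival s - ival s') * ival t + (ival t - ival t') * ival s' by ring.
  by apply: le_trans (ler_normD _ _) _; apply: lerD; apply: le01; rewrite ?w0 ?v0.
- rewrite !ival_rho1.
  have -> : 1 - ival s * (1 - ival t) - (1 - ival s' * (1 - ival t')) =
     - ((ival s - ival s') * (1 - ival t)) + (ival t - ival t') * ival s' by ring.
  apply: le_trans (ler_normD _ _) _; rewrite normrN; apply: lerD; apply: le01; last by rewrite v0.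
  by apply/andP; split; lra.
- rewrite !ival_rho0; have -> : ival s * ival t - ival s' * ival t' = (ival s - ival s') * ival t + (ival t - ival t') * ival s' by ring.
  by apply: le_trans (ler_normD _ _) _; apply: lerD; apply: le01; rewrite ?w0 ?v0.
Qed.
Lemma contract_pt_i1 k t : contract_pt k i1 t = t.
Proof.
case: k => //=; apply: ival_inj; rewrite ?ival_rho0 ?ival_rho1 iv1 ?mul1r //; ring.
Qed.
Lemma contract_pt_end0 s : contract_pt K0 s i0 = i0.
Proof. by apply: ival_inj; rewrite ival_rho0 iv0 mulr0. Qed.
Lemma contract_pt_end1 s : contract_pt K1 s i1 = i1.
Proof. by apply: ival_inj; rewrite ival_rho1 iv1 subrr mulr0 subr0. Qed.
Lemma kind_fun_rho k g s : kind_fun k g -> kind_fun k (fun t => g (contract_pt k s t)).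
Proof.
move=> [[r hr] ug dg]; split; first by exists r => t; exact: hr.
  move=> e e0; have [d d0 hd] := ug e e0; exists d; first exact: d0.
  move=> t t' tt; apply: hd; apply: le_trans (contract_pt_lip k s s t t') _.
  by rewrite subrr normr0 add0r.
case: k dg => //=; first by rewrite -/(contract_pt K0 s i0) contract_pt_end0.
by rewrite -/(contract_pt K1 s i1) contract_pt_end1.
Qed.
Lemma kind_mx_end k g : kind_fun k g -> kind_mx k (g (end_pt k)).
Proof.
move=> [_ _]; have d (p q : C) : diag2 (proj_comb (e11 R) p q) by rewrite proj_comb_e11 /diag2 !mk2E.
case: k => //= dg; rewrite dg ?a3_1; try exact: d.
by split; [exact: d|rewrite proj_comb_e11 !mk2E].
Qed.
Lemma kind_embed_end k g t : kind_fun k g -> kind_embed k (g (end_pt k)) t = g (contract_pt k i0 t).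
Proof.
move=> [_ _]; case: k => /= dg.
- have e : g i1 1 1 = g i1 0 0 by rewrite dg proj_comb_e11 !mk2E.
  by rewrite [RHS]dg e.
- by rewrite [RHS]dg.
- by rewrite [RHS]dg.
- rewrite proj_comb_diag //; congr g; apply: ival_inj; rewrite ival_rho0 iv0; ring.
- rewrite proj_comb_diag //; congr g; apply: ival_inj; rewrite ival_rho1 iv0 iv1; ring.
- congr g; apply: ival_inj; rewrite ival_rho0 iv0; ring.
Qed.

Definition kind_ranks k m : C * C := if k is KM then (\tr m, \tr m) else (m 0 0, m 1 1).
End KindData.

Section Transition.
Variable W : zmodType.
Implicit Types v w : (W * W)%type.

(* How the pair of ranks at [r_F x], of kind [k], determines the pair at [x], of kind
   [k']: forgetting a splitting adds the ranks, and [a3] is [e22] at [0]. *)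
Definition transfer k k' v : W * W :=
  match k, k' with
  | KM, _ => v
  | _, KM => (v.1 + v.2, v.1 + v.2)
  | KT, K0 => (v.2, v.1)
  | _, _ => v
  end.
(** At [KC] both ranks come from one scalar; at [KM] both components record the total rank. *)
Definition kind_pair k v := match k with KC | KM => v.1 = v.2 | _ => True end.

Lemma phD k k' v w : transfer k k' (v + w) = transfer k k' v + transfer k k' w.
Proof.
by case: k; case: k'; case: v => v1 v2; case: w => w1 w2 //; congr pair; rewrite addrACA.
Qed.
Lemma phid k v : transfer k k v = v.
Proof. by case: k. Qed.
(** From [KC] through [KT] to [K0] the components are swapped, while the direct map does not swap
    them; the two agree since the components are equal at [KC]. *)
Lemma transfer_comp k k' k'' v : kind_le k k' -> kind_le k' k'' -> kind_pair k v ->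
  transfer k' k'' (transfer k k' v) = transfer k k'' v.
Proof.
by case: k; case: k'; case: k'' => //= _ _; case: v => a b /= h; first [by []|by rewrite h|by rewrite addrC].
Qed.
Lemma transfer_typed k k' v : kind_le k k' -> kind_pair k v -> kind_pair k' (transfer k k' v).
Proof. by case: k; case: k'. Qed.
End Transition.

Section KindData2.
Variable R : realType.
Notation C := (cplx R).
Notation M := 'M[C]_2.
Local Opaque mk2 e11 a3 adj bd.

Lemma tr2E (m : M) : \tr m = m 0 0 + m 1 1.
Proof. by rewrite /mxtrace !big_ord_recl big_ord0 addr0; congr (_ + m _ _); apply: val_inj. Qed.
Lemma kind_ranks_embed k k' (m : M) : kind_le k k' -> kind_mx k m -> kind_ranks k' (kind_embed k m (end_pt R k')) = transfer k k' (kind_ranks k m).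
Proof.
have D (a b : C) : proj_comb (a3 (i0 R)) a b = mk2 b 0 0 a.
  by rewrite a3_0 /proj_comb; apply: mx2P; rewrite !mxE /=; ring.
case: k; case: k' => //= _ h; rewrite ?kind_proj_i1 ?a3_1 ?D ?proj_comb_e11 ?tr2E ?mk2E //.
all: by rewrite addrC.
Qed.
Lemma tdatD k (m m' : M) : kind_ranks k (m + m') = kind_ranks k m + kind_ranks k m'.
Proof. by case: k; rewrite /kind_ranks ?mxtraceD ?mx2D. Qed.
Lemma kind_ranks_typed k (m : M) : kind_mx k m -> kind_pair k (kind_ranks k m).
Proof. by case: k => //= -[_ ->]. Qed.
Lemma tdatC k (m m' : M) : kind_mx k m -> kind_mx k m' -> kind_ranks k (m *m m') = kind_ranks k (m' *m m).
Proof.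
have D : diag2 m -> diag2 m' -> (m *m m') 0 0 = (m' *m m) 0 0 /\ (m *m m') 1 1 = (m' *m m) 1 1.
  by move=> [d1 d2] [e1 e2]; rewrite !mul2E d1 d2 e1 e2; split; ring.
case: k => //=; [move=> [d _] [d' _]|move=> d d'|move=> d d'|move=> d d'|move=> d d'|move=> _ _; by rewrite mxtrace_mulC];
by have [-> ->] := D d d'.
Qed.
End KindData2.

Section NormalForm.
Variables (R : realType) (S : choiceType).
Notation C := (cplx R).
Notation M := 'M[C]_2.
Notation I := (I01 R).
Notation E := (Ealg R S).
Local Notation i0 := (i0 R).
Local Notation i1 := (i1 R).
Local Opaque mk2 e11 a3 adj bd.
Implicit Types (F G : {fset S}) (x : Omega S) (p q : Omega S -> nat -> nat -> M).

Lemma E_eqP (f g : E) : (forall x t, val f (x, t) = val g (x, t)) -> f = g.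
Proof. by move=> h; apply: (@carrier_eqP _ _ (E_csub R S)) => -[x t]. Qed.
Lemma E_kpred (f : E) x : kind_fun (kind_of x) (fun t => val f (x, t)).
Proof. exact: E_pred_kpred (carrierP f). Qed.
Lemma val_sum_E n (f : 'I_n -> E) z : val (\sum_(i < n) f i) z = \sum_(i < n) val (f i) z.
Proof. by apply: (big_morph (fun f : E => val f z)). Qed.

Definition cell_ranks x (f : E) : C * C := kind_ranks (kind_of x) (val f (x, end_pt R (kind_of x))).
Lemma cell_ranksD x : {morph cell_ranks x : f g / f + g}.
Proof. by move=> f g; exact: tdatD. Qed.
Lemma cell_ranksC x (f g : E) : cell_ranks x (f ** g) = cell_ranks x (g ** f).
Proof. by apply: tdatC; exact: kind_mx_end (E_kpred _ _). Qed.
Definition class_ranks (z : V E) x : C * C := Vtr (cell_ranks x) z.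

Definition typed_fam n p := (forall x i j, kind_mx (kind_of x) (p x i j)) /\ forall x, block_supp n (p x).
Definition fam_entry F n p (h : typed_fam n p) i j : E := elem F (fun x => kind_fun_embed (h.1 x i j)).
Lemma elE F n p (h : typed_fam n p) i j x t :
  val (fam_entry F h i j) (x, t) = kind_embed (kind_of (cell_of F x)) (p (cell_of F x) i j) t.
Proof. by []. Qed.
Lemma fin_El F n p (h : typed_fam n p) : fin_mx (fam_entry F h).
Proof. by exists n => i j k; apply: E_eqP => x t; rewrite elE (h.2 _ _ _ k) embed0. Qed.
Definition fam_mx F n p (h : typed_fam n p) : Minf E := mkMinf (fin_El F h).
Lemma fam_mx_supp F n p (h : typed_fam n p) : supp n (fam_mx F h).
Proof. by move=> i j k; apply: E_eqP => x t; rewrite elE (h.2 _ _ _ k) embed0. Qed.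
Lemma fam_mx_ext F n p q (h : typed_fam n p) (h' : typed_fam n q) :
  (forall x i j, p (cell_of F x) i j = q (cell_of F x) i j) -> fam_mx F h = fam_mx F h'.
Proof. by move=> e; apply: Minf_eqP => i j; apply: E_eqP => x t; rewrite !elE e. Qed.
Lemma kind_mx_sum k n (f : 'I_n -> M) : (forall i, kind_mx k (f i)) -> kind_mx k (\sum_(i < n) f i).
Proof. by move=> h; elim/big_ind: _ => // [|a b]; [exact: mtyped0|exact: mtypedD]. Qed.
Lemma typed_fam_mul n p q : typed_fam n p -> typed_fam n q -> typed_fam n (fun x => block_mul n (p x) (q x)).
Proof.
move=> [tp sp] [tq sq]; split=> [x i j|x i j k].
  by apply: kind_mx_sum => l; exact: mtypedM.
rewrite /block_mul big1 // => l _; case/orP: k => k; first by rewrite sp ?k // mul0mx.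
by rewrite sq ?k ?orbT // mulmx0.
Qed.
Lemma fam_mx_mul F n p q (h : typed_fam n p) (h' : typed_fam n q) : fam_mx F h ** fam_mx F h' = fam_mx F (typed_fam_mul h h').
Proof.
apply: Minf_eqP => i j; rewrite (supp_mulE _ _ _ (fam_mx_supp F h)); apply: E_eqP => x t.
rewrite val_sum_E elE /block_mul (big_morph _ (fun a b => embedD (kind_of (cell_of F x)) a b t) (embed0 _ t)).
apply: eq_bigr => k _; rewrite kind_embed_mul; [by []|exact: h.1|exact: h'.1].
Qed.
Definition idem_fam n p := forall x i j, block_mul n (p x) (p x) i j = p x i j.
Lemma fam_mx_idem F n p (h : typed_fam n p) : idem_fam n p -> fam_mx F h ** fam_mx F h = fam_mx F h.
Proof. by move=> e; rewrite fam_mx_mul; apply: fam_mx_ext => x i j; exact: e. Qed.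
Definition fam_class F n p (h : typed_fam n p) (e : idem_fam n p) : V E := Vclass (mkidem (fam_mx_idem F h e)).

Definition fam_ranks n p x : C * C := \sum_(i < n) kind_ranks (kind_of x) (p x i i).
Lemma D_Elc F n p (h : typed_fam n p) (e : idem_fam n p) x :
  class_ranks (fam_class F h e) x = transfer (kind_of (cell_of F x)) (kind_of x) (fam_ranks n p (cell_of F x)).
Proof.
rewrite /class_ranks (Vtr_class (@cell_ranksD x) (@cell_ranksC x)) (TrE (@cell_ranksD x) (fam_mx_supp F h)).
have ph0 : transfer (kind_of (cell_of F x)) (kind_of x) (0 : C * C) = 0.
  by apply: (@addrI _ (transfer (kind_of (cell_of F x)) (kind_of x) (0 : C * C))); rewrite -phD !addr0.
rewrite /fam_ranks (big_morph _ (phD (kind_of (cell_of F x)) (kind_of x)) ph0).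
by apply: eq_bigr => i _; apply: kind_ranks_embed; [exact: kind_rr|exact: h.1].
Qed.

(* At [s = 1] this is restriction to the cells of [F]; at [s = 0] it has values
   determined by finitely many matrices. *)
Definition contract F (s : I) (f : E) : E := elem F (fun x => kind_fun_rho s (E_kpred f x)).
Lemma HsE F s f x t : val (contract F s f) (x, t) = val f (cell_of F x, contract_pt (kind_of (cell_of F x)) s t).
Proof. by []. Qed.
Lemma HsD F s : {morph contract F s : f g / f + g}.
Proof. by move=> f g; apply: E_eqP. Qed.
Lemma HsM F s : {morph contract F s : f g / f ** g}.
Proof. by move=> f g; apply: E_eqP. Qed.
Lemma contract_le F s f : nr (contract F s f) <= nr f.
Proof.
apply: car_normP; first exact: nr_ge0.
by move=> [x t]; rewrite HsE; exact: (car_norm_bd f).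
Qed.
Lemma contract_near f e : 0 < e -> exists F, forall G, (F `<=` G)%fset -> nr (f - contract G i1 f) <= e.
Proof.
move=> e0; have [F hF] := restr_near f e0; exists F => G /hF h.
have -> : contract G i1 f = inclA (restr G f) by apply: E_eqP => x t; rewrite HsE contract_pt_i1.
exact: h.
Qed.
Lemma contract_cont F f e : 0 < e -> exists2 d, 0 < d & forall s s', `|ival s - ival s'| <= d ->
  nr (contract F s f - contract F s' f) <= e.
Proof.
move=> e0.
have [r hr] := @cells_max R S F (fun r x => forall s s', `|ival s - ival s'| * r <= 1 -> forall t,
    bd e (val f (x, contract_pt (kind_of x) s t) - val f (x, contract_pt (kind_of x) s' t)))
  ltac:(by move=> r r' x le_rr h s s' ss; apply: h; apply: le_trans ss; rewrite ler_wpM2l)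
  ltac:(by move=> x; have [_ /(_ e e0)[d d0 hd] _] := E_kpred f x; exists d^-1 => s s' ss t;
    apply: hd; apply: le_trans (contract_pt_lip _ s s' t t) _; rewrite subrr normr0 addr0;
    rewrite ler_pdivrMr // mul1r in ss).
exists (`|r| + 1)^-1; first by rewrite invr_gt0 ltr_wpDl.
move=> s s' ss; apply: car_normP; first exact: ltW.
move=> [x t]; apply: hr; rewrite -div1r ler_pdivlMr ?ltr_wpDl // in ss.
apply: le_trans ss; rewrite ler_wpM2l //; have := ler_norm r; lra.
Qed.

Definition contract_mx F s := mapm (HsD F s).
Lemma contract_mx_near A n e : 0 < e -> exists F, forall G, (F `<=` G)%fset -> mn n (A - contract_mx G i1 A) <= e.
Proof.
move=> e0; have N0 : 0 < (n * n)%:R + 1 :> R by rewrite ltr_wpDl.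
have /choice[F hF] : forall ij : 'I_n * 'I_n, exists F, forall G, (F `<=` G)%fset ->
    nr (val (A - contract_mx G i1 A) ij.1 ij.2) <= e / ((n * n)%:R + 1).
  by move=> ij; exact: (contract_near (val A ij.1 ij.2) (divr_gt0 e0 N0)).
exists (\big[fsetU/fset0]_(ij : 'I_n * 'I_n) F ij) => G FG.
apply: (@le_trans _ _ ((n * n)%:R * (e / ((n * n)%:R + 1)))).
  apply: mn_le => i j; apply: (hF (i, j)); apply: fsubset_trans FG.
  by rewrite (bigD1 (i, j)) //=; exact: fsubsetUl.
by rewrite mulrCA ler_piMr ?(ltW e0) // ler_pdivrMr // mul1r lerDl.
Qed.
Lemma contract_mx_cont F A n e : 0 < e -> exists2 d, 0 < d & forall s s', `|ival s - ival s'| <= d ->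
  mn n (contract_mx F s A - contract_mx F s' A) <= e.
Proof.
move=> e0; have N0 : 0 < (n * n)%:R + 1 :> R by rewrite ltr_wpDl.
have /choice[d hd] : forall ij : 'I_n * 'I_n, exists d, 0 < d /\ forall s s', `|ival s - ival s'| <= d ->
    nr (val (contract_mx F s A - contract_mx F s' A) ij.1 ij.2) <= e / ((n * n)%:R + 1).
  by move=> ij; have [d d0 h] := contract_cont F (val A ij.1 ij.2) (divr_gt0 e0 N0); exists d.
exists (\big[Num.min/1]_ij d ij).
  by elim/big_ind: _ => // [x y x0 y0|ij _]; [rewrite lt_min x0|exact: (hd ij).1].
move=> s s' ss.
apply: (@le_trans _ _ ((n * n)%:R * (e / ((n * n)%:R + 1)))).
  apply: mn_le => i j; apply: (hd (i, j)).2; apply: le_trans ss _; exact: bigmin_le_cond.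
by rewrite mulrCA ler_piMr ?(ltW e0) // ler_pdivrMr // mul1r lerDl.
Qed.
Lemma contract_mx_le F s A n : mn n (contract_mx F s A) <= mn n A.
Proof. by apply: ler_sum => i _; apply: ler_sum => j _; exact: contract_le. Qed.

Definition contract_idem F s (P : idem (Minf E)) := mkidem (mapm_idem (HsD F s) (HsM F s) P).

Lemma half_bound (B : R) : 0 <= B -> (B + B) * (2 * B + 1)^-1 < 1.
Proof. by move=> B0; rewrite ltr_pdivrMr ?ltr_wpDl ?mulr_ge0 // mul1r; lra. Qed.

(** All idempotents of the deformation have norm at most [B], so one threshold [1 / (2 B + 1)]
    serves in [close_eqv], and finitely many steps of length [1 / N] lead from [s = 1] to
    [s = 0]. *)
Lemma contract_idem_class P n : supp n (val P) -> exists F, forall G, (F `<=` G)%fset ->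
  Vclass P = Vclass (contract_idem G i0 P).
Proof.
move=> sP; set B := mn n (val P); have B0 : 0 <= B by exact: mn_ge0.
have e0 : 0 < (2 * B + 1)^-1 by rewrite invr_gt0 ltr_wpDl // mulr_ge0.
have sH F s : supp n (val (contract_idem F s P)) by exact: mapm_supp.
have clo (Q Q' : idem (Minf E)) : supp n (val Q) -> supp n (val Q') -> mn n (val Q) <= B ->
    mn n (val Q') <= B -> mn n (val Q - val Q') <= (2 * B + 1)^-1 -> Vclass Q = Vclass Q'.
  move=> sQ sQ' bQ bQ' bQQ; apply: (close_eqv sQ sQ').
  have h0 := mn_ge0 n (val Q - val Q').
  apply: (@le_lt_trans _ _ ((B + B) * (2 * B + 1)^-1)).
    exact: ler_pM (addr_ge0 (mn_ge0 _ _) (mn_ge0 _ _)) h0 (lerD bQ bQ') bQQ.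
  exact: half_bound.
have [F hF] := contract_mx_near (val P) n e0; exists F => G /hF FG.
have hle s : mn n (val (contract_idem G s P)) <= B by exact: contract_mx_le.
have -> : Vclass P = Vclass (contract_idem G i1 P).
  by apply: clo; [exact: sP|exact: sH|exact: lexx|exact: hle|exact: FG].
have [d d0 hd] := contract_mx_cont G (val P) n e0.
have [N N0 hN] : exists2 N : nat, (0 < N)%N & N%:R^-1 <= d.
  exists (Num.trunc d^-1).+1 => //.
  rewrite -[leRHS]invrK lef_pV2 ?posrE ?invr_gt0 //.
  by apply/ltW/truncnS_gt.
have NR : 0 < N%:R :> R by rewrite ltr0n.
have main k : (k <= N)%N -> Vclass (contract_idem G (clampI (k%:R / N%:R)) P) = Vclass (contract_idem G i0 P).
  elim: k => [_|k IH kN].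
    by have -> : clampI (0%:R / N%:R) = i0 by rewrite (_ : 0%:R / N%:R = 0 :> R) // mul0r.
  rewrite -(IH (ltnW kN)); apply: clo; [exact: sH|exact: sH|exact: hle|exact: hle|].
  apply: hd; have iE l : (l <= N)%N -> ival (clampI (l%:R / N%:R) : I) = l%:R / N%:R.
    by move=> lN; rewrite clampIE // divr_ge0 //= ler_pdivrMr // mul1r ler_nat.
  rewrite !iE ?(ltnW kN) //.
  have -> : k.+1%:R / N%:R - k%:R / N%:R = N%:R^-1 :> R by rewrite -mulrBl -natr1 addrAC subrr add0r mul1r.
  by rewrite ger0_norm // invr_ge0 ler0n.
by rewrite -(main N) // divff ?gt_eqF.
Qed.

(** [G] and [m] can be enlarged at will, so that two classes can be brought to a common format. *)
Lemma normal_form (z : V E) : exists F n, forall G m, (F `<=` G)%fset -> (n <= m)%N ->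
  exists p (h : typed_fam m p) (e : idem_fam m p), z = fam_class G h e.
Proof.
have [P ->] := VclassP z; have [n sP] := suppP (val P).
have [F hF] := contract_idem_class sP; exists F, n => G m FG nm.
have sPm := supp_le nm sP.
pose p x i j := val (val (val P) i j) (x, end_pt R (kind_of x)).
have h : typed_fam m p.
  split=> [x i j|x i j k]; first exact: kind_mx_end (E_kpred _ _).
  by rewrite /p sPm.
have e : idem_fam m p.
  move=> x i j; rewrite /block_mul /p -[in RHS](idemP P) (supp_mulE _ _ _ sPm) val_sum_E.
  by [].
exists p, h, e; rewrite (hF G FG) /fam_class; apply: Vclass_val; apply: Minf_eqP => i j.
apply: E_eqP => x t.
exact: (esym (kind_embed_end t (E_kpred (val (val P) i j) (cell_of G x)))).
Qed.

Lemma block_mul_diag n (u v : nat -> nat -> M) i j (a : 'I_2) : (forall i j, diag2 (u i j)) ->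
  block_mul n u v i j a a = \sum_(k < n) u i k a a * v k j a a.
Proof.
move=> du; rewrite summxE; apply: eq_bigr => k _; rewrite mul2E.
by have [d1 d2] := du i k; case: (ord2 a) => ->; rewrite ?d1 ?d2 mul0r ?addr0 ?add0r.
Qed.
Lemma kind_mx_diag k (m : M) : k <> KM -> kind_mx k m -> diag2 m.
Proof. by case: k => // _ []. Qed.

Lemma fam_ranks_comp n p x (a : 'I_2) : kind_of x <> KM ->
  (if a == 0 then (fam_ranks n p x).1 else (fam_ranks n p x).2) = \sum_(i < n) p x i i a a.
Proof.
move=> nM; rewrite /fam_ranks.
have -> : \sum_(i < n) kind_ranks (kind_of x) (p x i i) = (\sum_(i < n) p x i i 0 0, \sum_(i < n) p x i i 1 1).
  elim: n => [|n IH]; first by rewrite !big_ord0.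
  rewrite !big_ord_recr /= IH; move: nM; rewrite /kind_ranks; by case: (kind_of x).
by case: (ord2 a) => ->.
Qed.
Lemma fam_ranks_KM n p x : kind_of x = KM -> fam_ranks n p x = (\sum_(i < n) \tr (p x i i), \sum_(i < n) \tr (p x i i)).
Proof.
move=> hM; rewrite /fam_ranks hM /kind_ranks; elim: n => [|n IH]; first by rewrite !big_ord0.
by rewrite !big_ord_recr /= IH.
Qed.

Lemma fam_ranks_nat n p x : typed_fam n p -> idem_fam n p -> exists a b : nat, fam_ranks n p x = (a%:R, b%:R).
Proof.
move=> h e; have [hM|nM] : kind_of x = KM \/ kind_of x <> KM.
- by case: (kind_of x); [right|right|right|right|right|left].
- have [r hr] := block_trace (e x); exists r, r.
  by rewrite (fam_ranks_KM _ _ hM) hr.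
have dx i j : diag2 (p x i j) by apply: kind_mx_diag nM _; exact: h.1.
have H (a : 'I_2) : exists r : nat, \sum_(i < n) p x i i a a = r%:R.
  apply: (@idem_nat_trace C n (fun i j => p x i j a a)) => i j.
  by rewrite -block_mul_diag // e.
have [r0 h0] := H 0; have [r1 h1] := H 1; exists r0, r1.
have := fam_ranks_comp n p 0 nM; have := fam_ranks_comp n p 1 nM; rewrite /= h0 h1 => e1 e0.
by rewrite [LHS]surjective_pairing e0 e1.
Qed.

Lemma fam_ranks_typed n p x : typed_fam n p -> kind_pair (kind_of x) (fam_ranks n p x).
Proof.
move=> h; rewrite /fam_ranks; elim/big_ind: _ => [|u v|i _]; [by case: (kind_of x)| |exact: kind_ranks_typed (h.1 _ _ _)].
by case: (kind_of x) => //= -> ->.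
Qed.
End NormalForm.

Section Classification.
Variables (R : realType) (S : choiceType).
Notation C := (cplx R).
Notation M := 'M[C]_2.
Notation I := (I01 R).
Notation E := (Ealg R S).
Local Opaque mk2 e11 a3 adj bd.
Implicit Types (F G : {fset S}) (x : Omega S) (p q : Omega S -> nat -> nat -> M).

(** The witnesses of similarity are to be a function of the pair [uv]: at the kind [KC] the two
    diagonal components coincide, and they must receive the same witnesses to remain scalar. *)
Definition sim_spec n (uv xy : (nat -> nat -> C) * (nat -> nat -> C)) :=
  nsupp n uv.1 -> nsupp n uv.2 ->
  (forall i j, \sum_(k < n) uv.1 i k * uv.1 k j = uv.1 i j) ->
  (forall i j, \sum_(k < n) uv.2 i k * uv.2 k j = uv.2 i j) ->
  \sum_(i < n) uv.1 i i = \sum_(i < n) uv.2 i i ->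
  [/\ nsupp n xy.1, nsupp n xy.2, forall i j, uv.1 i j = \sum_(k < n) xy.1 i k * xy.2 k j
    & forall i j, uv.2 i j = \sum_(k < n) xy.2 i k * xy.1 k j].
Lemma sim_choice n : exists f, forall uv, sim_spec n uv (f uv).
Proof.
suff /choice[f hf] : forall uv, exists xy, sim_spec n uv xy by exists f.
move=> uv.
have [h|h] := EM (exists xy, sim_spec n uv xy); first exact: h.
exists uv => h1 h2 h3 h4 h5; case: h.
by have [x [y k]] := idem_similar_nat h1 h2 h3 h4 h5; exists (x, y) => *.
Qed.

Lemma block_mul_mk2 n (u0 u1 v0 v1 : nat -> nat -> C) i j :
  block_mul n (fun i j => mk2 (u0 i j) 0 0 (u1 i j)) (fun i j => mk2 (v0 i j) 0 0 (v1 i j)) i j =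
  mk2 (\sum_(k < n) u0 i k * v0 k j) 0 0 (\sum_(k < n) u1 i k * v1 k j).
Proof.
apply: mx2P; rewrite summxE mk2E; [apply: eq_bigr| rewrite big1 //|rewrite big1 //|apply: eq_bigr];
by move=> k _; rewrite mul2E !mk2E; ring.
Qed.

Lemma typed_similar n p q x : typed_fam n p -> typed_fam n q -> idem_fam n p -> idem_fam n q ->
  fam_ranks n p x = fam_ranks n q x -> exists X Y : nat -> nat -> M,
  [/\ block_supp n X, block_supp n Y & forall i j, [/\ kind_mx (kind_of x) (X i j), kind_mx (kind_of x) (Y i j),
    p x i j = block_mul n X Y i j & q x i j = block_mul n Y X i j]].
Proof.
move=> hp hq ep eq dpq; have [hM|nM] : kind_of x = KM \/ kind_of x <> KM.
- by case: (kind_of x); [right|right|right|right|right|left].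
- move: dpq; rewrite !fam_ranks_KM // => -[dpq].
  have [X [Y [sX sY h1 h2]]] := block_similar (hp.2 x) (hq.2 x) (ep x) (eq x) dpq.
  by exists X, Y; split=> // i j; rewrite hM; split.
have [f hf] := sim_choice n.
have dd (r : Omega S -> nat -> nat -> M) : typed_fam n r -> forall i j, diag2 (r x i j) by move=> h i j; apply: kind_mx_diag nM _; exact: h.1.
pose ev r (a : 'I_2) := fun i j : nat => (r x i j : M) a a.
pose g a := f (ev p a, ev q a).
have hg a : [/\ nsupp n (g a).1, nsupp n (g a).2, forall i j, ev p a i j = \sum_(k < n) (g a).1 i k * (g a).2 k j
    & forall i j, ev q a i j = \sum_(k < n) (g a).2 i k * (g a).1 k j].
  apply: (hf (ev p a, ev q a)) => /=.
  - by move=> i j k; rewrite /ev hp.2 // mxE.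
  - by move=> i j k; rewrite /ev hq.2 // mxE.
  - by move=> i j; rewrite /ev -block_mul_diag ?ep //; exact: dd.
  - by move=> i j; rewrite /ev -block_mul_diag ?eq //; exact: dd.
  - by rewrite /ev -!fam_ranks_comp // dpq.
have g01 : kind_of x = KC -> g 0 = g 1.
  move=> kC; have e01 (r : Omega S -> nat -> nat -> M) : typed_fam n r -> ev r 0 = ev r 1.
    move=> h; apply/funext => i; apply/funext => j; have := h.1 x i j.
    by rewrite kC /= /ev => -[_ ->].
  by rewrite /g !e01.
exists (fun i j => mk2 ((g 0).1 i j) 0 0 ((g 1).1 i j)), (fun i j => mk2 ((g 0).2 i j) 0 0 ((g 1).2 i j)).
have [s1 s2 h1 h2] := hg 0; have [s1' s2' h1' h2'] := hg 1.
have Z : mk2 0 0 0 0 = 0 :> M by apply: mx2P; rewrite mk2E mxE.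
split; [by move=> i j k; rewrite s1 // s1'|by move=> i j k; rewrite s2 // s2'|].
move=> i j; have T (a b : C) : (kind_of x = KC -> a = b) -> kind_mx (kind_of x) (mk2 a 0 0 b).
  move=> ab; move: nM ab; case: (kind_of x) => //= _ ab; rewrite /diag2 !mk2E //.
  by rewrite ab.
split; [by apply: T => /g01 ->|by apply: T => /g01 ->| |].
  rewrite block_mul_mk2 -h1 -h1'; have [d1 d2] := dd p hp i j.
  by apply: mx2P; rewrite mk2E.
rewrite block_mul_mk2 -h2 -h2'; have [d1 d2] := dd q hq i j.
by apply: mx2P; rewrite mk2E.
Qed.

Lemma D_inj (z z' : V E) : (forall x, class_ranks z x = class_ranks z' x) -> z = z'.
Proof.
move=> hD; have [F [n hF]] := normal_form z; have [F' [n' hF']] := normal_form z'.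
pose G := (F `|` F')%fset; pose m := maxn n n'.
have [p [hp [ep zE]]] := hF G m (fsubsetUl _ _) (leq_maxl _ _).
have [q [hq [eq zE']]] := hF' G m (fsubsetUr _ _) (leq_maxr _ _).
(* Only cells fixed by [cell_of G] matter, and there [transfer] is the identity; elsewhere the
   witnesses may be 0. *)
have dpq x : cell_of G x = x -> fam_ranks m p x = fam_ranks m q x.
  by move=> rx; have := hD x; rewrite zE zE' !D_Elc rx !phid.
have /choice[XY hXY] x : exists XY : (nat -> nat -> M) * (nat -> nat -> M),
    [/\ block_supp m XY.1, block_supp m XY.2, forall i j, kind_mx (kind_of x) (XY.1 i j) /\ kind_mx (kind_of x) (XY.2 i j) &
    cell_of G x = x -> forall i j, p x i j = block_mul m XY.1 XY.2 i j /\ q x i j = block_mul m XY.2 XY.1 i j].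
  have [rx|rx] := eqVneq (cell_of G x) x.
    have [X [Y [sX sY h]]] := typed_similar hp hq ep eq (dpq x rx).
    by exists (X, Y); split=> // [i j|_ i j]; have [] := h i j.
  exists (fun _ _ => 0, fun _ _ => 0); split=> // [i j|h]; first by split; exact: mtyped0.
  by rewrite h eqxx in rx.
have tX : typed_fam m (fun x => (XY x).1).
  by split=> [x i j|x]; have [h1 h2 h3 h4] := hXY x; [have [] := h3 i j|].
have tY : typed_fam m (fun x => (XY x).2).
  by split=> [x i j|x]; have [h1 h2 h3 h4] := hXY x; [have [] := h3 i j|].
rewrite zE zE'; apply/Vclass_eqP/asboolP; exists (fam_mx G tX), (fam_mx G tY).
rewrite !fam_mx_mul; split; apply: fam_mx_ext => x i j; have [_ _ _ h] := hXY (cell_of G x);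
by have [] := h (cell_of_id G x) i j.
Qed.

Definition natC (c : C) : nat := xget 0%N [set n : nat | n%:R = c].
Lemma natCE (n : nat) : natC n%:R = n.
Proof.
rewrite /natC; have /= := @xgetPex _ 0%N [set k : nat | k%:R = n%:R :> C].
by move=> /(_ (ex_intro _ n erefl))/eqP; rewrite eqr_nat => /eqP.
Qed.
Lemma D_nat (z : V E) x : exists a b : nat, class_ranks z x = (a%:R, b%:R).
Proof.
have [F [n hF]] := normal_form z; have [p [hp [ep ->]]] := hF F n (fsubset_refl _) (leqnn _).
rewrite D_Elc; have [a [b ->]] := fam_ranks_nat (cell_of F x) hp ep.
case: (kind_of (cell_of F x)); case: (kind_of x); rewrite /= -?natrD;
  by [exists a, b|exists b, a|exists (a + b)%N, (a + b)%N].
Qed.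

Definition complex_pair (v : int * int) : C * C := (v.1%:~R, v.2%:~R).
Lemma complex_pair_inj : injective complex_pair.
Proof. by move=> [a b] [c d] [] /intr_inj -> /intr_inj ->. Qed.
Lemma czD u v : complex_pair (u + v) = complex_pair u + complex_pair v.
Proof. by rewrite /complex_pair /= !intrD. Qed.
Lemma complex_pair_ph k k' v : complex_pair (transfer k k' v) = transfer k k' (complex_pair v).
Proof. by case: k; case: k' => //=; rewrite /complex_pair /= intrD. Qed.
Lemma complex_pair_typed k v : kind_pair k (complex_pair v) -> kind_pair k v.
Proof. by case: k => //= /intr_inj. Qed.

Definition rank_of (z : V E) x : int * int := (Posz (natC (class_ranks z x).1), Posz (natC (class_ranks z x).2)).
Lemma complex_pair_dn z x : complex_pair (rank_of z x) = class_ranks z x.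
Proof. by rewrite /rank_of /complex_pair; have [a [b ->]] := D_nat z x; rewrite !natCE. Qed.
Lemma rank_of_ge0 z x : 0 <= (rank_of z x).1 /\ 0 <= (rank_of z x).2.
Proof. by []. Qed.
Lemma rank_of_inj z z' : (forall x, rank_of z x = rank_of z' x) -> z = z'.
Proof. by move=> h; apply: D_inj => x; rewrite -!complex_pair_dn h. Qed.
Lemma rank_ofD z z' x : rank_of (z + z') x = rank_of z x + rank_of z' x.
Proof.
by apply: complex_pair_inj; rewrite czD !complex_pair_dn /class_ranks (VtrD (@cell_ranksD R S x) (@cell_ranksC R S x)).
Qed.
Lemma dn0 x : rank_of 0 x = 0.
Proof. by apply: (@addrI _ (rank_of 0 x)); rewrite -rank_ofD !addr0. Qed.

(** Together with nonnegativity this describes the range of [rank_of]; without it, the ambient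
    group. *)
Definition rank_fun (u : Omega S -> int * int) := (forall x, kind_pair (kind_of x) (u x)) /\
  exists F, forall x, u x = transfer (kind_of (cell_of F x)) (kind_of x) (u (cell_of F x)).

(** [F] can be enlarged because [transfer] is functorial on admissible pairs. *)
Lemma rank_fun_sup (u : Omega S -> int * int) F G : (forall x, kind_pair (kind_of x) (u x)) -> (F `<=` G)%fset ->
  (forall x, u x = transfer (kind_of (cell_of F x)) (kind_of x) (u (cell_of F x))) ->
  forall x, u x = transfer (kind_of (cell_of G x)) (kind_of x) (u (cell_of G x)).
Proof.
move=> tu FG hF x.
have k1 : kind_le (kind_of (cell_of F x)) (kind_of (cell_of G x)) by rewrite -(cell_of_sub x FG); exact: kind_rr.
by rewrite [u (cell_of G x)]hF cell_of_sub // (transfer_comp k1 (kind_rr G x) (tu _)); exact: hF.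
Qed.

Lemma rank_of_Gp z : rank_fun (rank_of z).
Proof.
have [F [n hF]] := normal_form z; have [p [hp [ep zE]]] := hF F n (fsubset_refl _) (leqnn _).
have E1 x : complex_pair (rank_of z x) = transfer (kind_of (cell_of F x)) (kind_of x) (fam_ranks n p (cell_of F x)).
  by rewrite complex_pair_dn zE D_Elc.
split=> [x|].
  apply: complex_pair_typed; rewrite E1; apply: transfer_typed; first exact: kind_rr.
  exact: fam_ranks_typed.
exists F => x; apply: complex_pair_inj; rewrite complex_pair_ph !E1 cell_of_id phid //.
Qed.

Lemma count_lt n a : (\sum_(i < n) (i < a))%N = minn n a.
Proof.
elim: n => [|n IH]; first by rewrite big_ord0 min0n.
by rewrite big_ord_recr /= IH; case: ltnP; lia.
Qed.
Lemma sum_lt n a : (a <= n)%N -> \sum_(i < n) ((i < a)%N%:R : C) = a%:R.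
Proof.
by move=> an; rewrite -natr_sum count_lt (minn_idPr an).
Qed.

Lemma rank_of_surj u : rank_fun u -> (forall x, 0 <= (u x).1 /\ 0 <= (u x).2) -> exists z, forall x, rank_of z x = u x.
Proof.
move=> [tu [F hF]] u0.
have [r hr] := @cells_max R S F (fun r x => (u x).1%:~R <= r /\ (u x).2%:~R <= r)
  ltac:(by move=> r s x rs [h h']; split; exact: le_trans rs)
  ltac:(by move=> x; exists (Num.max (u x).1%:~R (u x).2%:~R); rewrite !le_max !lexx orbT).
pose n := (Num.trunc r).+1.
pose a x := `|(u x).1|%N; pose b x := `|(u x).2|%N.
have aE x : (u x).1 = a x by rewrite gez0_abs //; exact: (u0 x).1.
have bE x : (u x).2 = b x by rewrite gez0_abs //; exact: (u0 x).2.
have ab x : (a (cell_of F x) <= n)%N /\ (b (cell_of F x) <= n)%N.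
  have [] := hr x; rewrite aE bE => h h'.
  have k (c : nat) : (c : int)%:~R <= r -> (c <= n)%N.
    by move=> cr; rewrite -(ler_nat R); apply: le_trans cr _; exact/ltW/truncnS_gt.
  by split; exact: k.
(* A diagonal idempotent with the prescribed numbers of ones. At [KM] both components of [u] are the
   total rank, so only the first one is used. *)
pose p x i j : M := if (i == j) && (i < n)%N then
  mk2 (i < a x)%N%:R 0 0 (if kind_of x is KM then 0 else (i < b x)%N%:R) else 0.
have Z : mk2 0 0 0 0 = 0 :> M by apply: mx2P; rewrite mk2E mxE.
have hp : typed_fam n p.
  split=> [x i j|x i j k]; rewrite /p; last first.
    by case: ifP => // /andP[/eqP ij i_n]; move: k; rewrite -ij orbb leqNgt i_n.
  case: ifP => _; last exact: mtyped0.
  case: (kind_of x) (tu x) => [h|_|_|_|_|_] /=; rewrite /diag2 ?mk2E //; split=> //.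
  by move: h; rewrite /= aE bE => -[->].
have ep : idem_fam n p.
  move=> x i j; have [/andP[/eqP <- i_n]|h] := boolP ((i == j) && (i < n)%N).
    rewrite /block_mul (bigD1 (Ordinal i_n)) //= big1 ?addr0 => [|k].
      rewrite /p eqxx i_n /=; apply: mx2P; rewrite mul2E !mk2E !(mulr0, mul0r, addr0, add0r) //.
        by case: (i < a x)%N; rewrite ?mulr1 ?mulr0.
      by case: (kind_of x); rewrite ?mulr0 //; case: (i < b x)%N; rewrite ?mulr1 ?mulr0.
    rewrite -val_eqE /= => /negbTE ki; by rewrite {1}/p eq_sym ki mul0mx.
  rewrite /block_mul {3}/p (negbTE h) big1 // => k _.
  have [ik|ik] := boolP ((i == k) && (i < n)%N); last by rewrite {1}/p (negbTE ik) mul0mx.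
  move/andP: ik => [/eqP ik i_n]; have [/andP[/eqP kj kn]|kj] := boolP ((val k == j) && (k < n)%N).
    by move: h; rewrite ik kj eqxx -kj kn.
  by rewrite [p x k j]/p (negbTE kj) mulmx0.
exists (fam_class F hp ep) => x; apply: complex_pair_inj; rewrite complex_pair_dn D_Elc.
rewrite hF complex_pair_ph; congr transfer; have [an bn] := ab x; move: (cell_of F x) an bn => y an bn.
have dE i : (i < n)%N -> p y i i = mk2 (i < a y)%N%:R 0 0 (if kind_of y is KM then 0 else (i < b y)%N%:R).
  by move=> i_n; rewrite /p eqxx i_n.
rewrite /complex_pair aE bE -!pmulrn.
have [hM|nM] : kind_of y = KM \/ kind_of y <> KM.
- by case: (kind_of y); [right|right|right|right|right|left].
- rewrite fam_ranks_KM //; have e : b y = a y by have := tu y; rewrite hM /= aE bE => -[].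
  have -> : \sum_(i < n) \tr (p y i i) = (a y)%:R; last by rewrite e.
  rewrite -(sum_lt an); apply: eq_bigr => i _; rewrite dE // tr2E !mk2E hM addr0 //.
have h0 := fam_ranks_comp n p 0 nM; have h1 := fam_ranks_comp n p 1 nM; rewrite /= in h0 h1.
rewrite [LHS]surjective_pairing h0 h1 -(sum_lt an) -(sum_lt bn); congr pair; apply: eq_bigr => i _.
  by rewrite dE // mk2E.
by rewrite dE // mk2E; case: (kind_of y) nM.
Qed.
End Classification.

(** * The dimension group *)

Section DimensionGroup.
Variable S : choiceType.
Implicit Types (F G : {fset S}) (x : Omega S).
Local Notation fn := (Omega S -> int * int).

Definition rank_group := {u : fn | `[< rank_fun u >]}.
HB.instance Definition _ := SubChoice.on rank_group.
Implicit Types u v : rank_group.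
Lemma GtP u : rank_fun (val u).
Proof. by case: u => u /= /asboolP. Qed.
Definition mk_rank (u : fn) (h : rank_fun u) : rank_group := exist (fun u : fn => is_true `[< rank_fun u >]) u (asboolT h).
Lemma rank_group_eqP u v : (forall x, val u x = val v x) -> u = v.
Proof. by move=> h; apply/val_inj/funext. Qed.

Lemma Gp0 : rank_fun (fun _ : Omega S => 0).
Proof.
split=> [x|]; first by case: (kind_of x).
by exists fset0 => x; case: (kind_of _); case: (kind_of _); rewrite /= ?addr0.
Qed.
Lemma phN (W : zmodType) k k' (v : W * W) : transfer k k' (- v) = - transfer k k' v.
Proof. by case: k; case: k'; case: v => //= a b; congr pair; rewrite opprD. Qed.
Lemma vtypedN (W : zmodType) k (v : W * W) : kind_pair k v -> kind_pair k (- v).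
Proof. by case: k => //= ->. Qed.
Lemma vtypedD (W : zmodType) k (v w : W * W) : kind_pair k v -> kind_pair k w -> kind_pair k (v + w).
Proof. by case: k => //= -> ->. Qed.
Lemma GpN (u : fn) : rank_fun u -> rank_fun (fun x => - u x).
Proof.
move=> [tu [F hF]]; split=> [x|]; first exact: vtypedN.
by exists F => x; rewrite phN -hF.
Qed.
Lemma GpD (u v : fn) : rank_fun u -> rank_fun v -> rank_fun (fun x => u x + v x).
Proof.
move=> [tu [F hF]] [tv [G hG]]; split=> [x|]; first exact: vtypedD.
exists (F `|` G)%fset => x; rewrite phD.
by rewrite -(rank_fun_sup tu (fsubsetUl F G) hF) -(rank_fun_sup tv (fsubsetUr F G) hG).
Qed.
Definition G0 := mk_rank Gp0.
Definition GN u := mk_rank (GpN (GtP u)).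
Definition GD u v := mk_rank (GpD (GtP u) (GtP v)).
Lemma GDA : associative GD.
Proof. by move=> u v w; apply: rank_group_eqP => x /=; rewrite addrA. Qed.
Lemma GDC : commutative GD.
Proof. by move=> u v; apply: rank_group_eqP => x /=; rewrite addrC. Qed.
Lemma G0D : left_id G0 GD.
Proof. by move=> u; apply: rank_group_eqP => x /=; rewrite add0r. Qed.
Lemma GND : left_inverse G0 GN GD.
Proof. by move=> u; apply: rank_group_eqP => x /=; rewrite addNr. Qed.
HB.instance Definition _ := GRing.isZmodule.Build rank_group GDA GDC G0D GND.

Definition le_pair (v w : int * int) := v.1 <= w.1 /\ v.2 <= w.2.
Definition Gle u v : bool := `[< forall x, le_pair (val u x) (val v x) >].
Lemma Gle_refl : reflexive Gle.
Proof. by move=> u; apply/asboolP => x; split. Qed.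
Lemma Gle_anti : antisymmetric Gle.
Proof.
move=> u v /andP[/asboolP h1 /asboolP h2]; apply: rank_group_eqP => x.
have [a b] := h1 x; have [c d] := h2 x.
rewrite [LHS]surjective_pairing [RHS]surjective_pairing.
by congr pair; apply/le_anti/andP.
Qed.
Lemma Gle_trans : transitive Gle.
Proof.
move=> v u w /asboolP h1 /asboolP h2; apply/asboolP => x.
have [a b] := h1 x; have [c d] := h2 x.
by split; [exact: le_trans a c|exact: le_trans b d].
Qed.
HB.instance Definition _ := Order.Le_isPOrder.Build ring_display rank_group Gle_refl Gle_anti Gle_trans.

Lemma GleP u v : reflect (forall x, le_pair (val u x) (val v x)) (u <= v).
Proof. exact: asboolP. Qed.

Lemma transfer_ge0 k k' (v : int * int) : le_pair 0 v -> le_pair 0 (transfer k k' v).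
Proof. by case: k; case: k'; case: v => a b; rewrite /le_pair /= => -[h1 h2]; split=> //; exact: addr_ge0. Qed.

Definition extend_cells F (m : fn) x := transfer (kind_of (cell_of F x)) (kind_of x) (m (cell_of F x)).
Lemma rank_fun_ext F (m : fn) : (forall x, kind_pair (kind_of x) (m x)) -> rank_fun (extend_cells F m).
Proof.
move=> tm; split=> [x|].
  by apply: transfer_typed; [exact: kind_rr|exact: tm].
by exists F => x; rewrite /extend_cells cell_of_id phid.
Qed.

Lemma common_loc u F : (forall x, val u x = extend_cells F (val u) x) -> forall G, (F `<=` G)%fset ->
  forall x, val u x = extend_cells G (val u) x.
Proof. by move=> hF G FG x; apply: (rank_fun_sup (GtP u).1 FG hF). Qed.

Lemma rank_group_dimension_group : dimension_group rank_group.
Proof.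
split.
- move=> u v w /GleP h; apply/GleP => x; have [a b] := h x.
  by split; rewrite /= lerD2r.
- move=> u; have [tu [F hF]] := GtP u.
  (* Positive parts are taken on the cells and then extended: [transfer] into [KM] adds components
     and does not commute with maxima. *)
  pose m x : int * int := (Num.max 0 (val u x).1, Num.max 0 (val u x).2).
  have tm x : kind_pair (kind_of x) (m x) by move: (tu x); rewrite /m; case: (kind_of x) => //= ->.
  pose v : rank_group := mk_rank (rank_fun_ext F tm).
  exists v, (v - u); split.
  + by apply/GleP => x; apply: transfer_ge0; split; rewrite /= le_max lexx.
  + apply/GleP => x; change (le_pair 0 (extend_cells F m x - val u x)); rewrite hF -phN -phD.
    by apply: transfer_ge0; split; rewrite /= subr_ge0 le_max lexx orbT.
  + by rewrite opprB addrC subrK.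
- move=> u m m0 /GleP h; apply/GleP => x; have := h x.
  have -> : val (u *+ m) x = val u x *+ m.
    by elim: (m) => // k IH; rewrite !mulrS -IH.
  move: (val u x) => [a b]; rewrite /le_pair /=.
  have -> : (a, b) *+ m = (a *+ m, b *+ m) by elim: (m) => // k IH; rewrite !mulrS IH.
  by rewrite /= !pmulrn_lge0.
move=> a0 a1 b0 b1 /GleP pa0 /GleP pa1 /GleP pb0 /GleP pb1 eab.
have [_ [Fa ha]] := GtP a0; have [_ [Fb hb]] := GtP b0; have [_ [Fc hc]] := GtP a1.
pose F := (Fa `|` Fb `|` Fc)%fset.
have ha' : forall x, val a0 x = extend_cells F (val a0) x.
  by apply: common_loc ha _ _; rewrite /F -fsetUA; exact: fsubsetUl.
have hb' : forall x, val b0 x = extend_cells F (val b0) x.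
  by apply: common_loc hb _ _; rewrite /F [(Fa `|` Fb)%fset]fsetUC -fsetUA; exact: fsubsetUl.
have hc' : forall x, val a1 x = extend_cells F (val a1) x by apply: common_loc hc _ _; exact: fsubsetUr.
(* Refinement takes place in the lattices at the cells of a common [F], with the meet of [a0] and
   [b0] as common part; [transfer] carries nonnegativity to all points. *)
pose m x : int * int := (Num.min (val a0 x).1 (val b0 x).1, Num.min (val a0 x).2 (val b0 x).2).
have tm x : kind_pair (kind_of x) (m x).
  by have := (GtP a0).1 x; have := (GtP b0).1 x; rewrite /m; case: (kind_of x) => //= -> ->.
pose c : rank_group := mk_rank (rank_fun_ext F tm).
have eab' x : val a0 x + val a1 x = val b0 x + val b1 x by have := congr1 (fun w : rank_group => val w x) eab.
exists c, (a0 - c), (b0 - c), (a1 - b0 + c); split; split.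
- apply/GleP => x; apply: transfer_ge0; have [? ?] := pa0 (cell_of F x); have [? ?] := pb0 (cell_of F x).
  by split; rewrite /= le_min; apply/andP.
- apply/GleP => x; change (le_pair 0 (val a0 x - extend_cells F m x)); rewrite ha' -phN -phD.
  by apply: transfer_ge0; split; rewrite /= subr_ge0 ge_min lexx.
- apply/GleP => x; change (le_pair 0 (val b0 x - extend_cells F m x)); rewrite hb' -phN -phD.
  by apply: transfer_ge0; split; rewrite /= subr_ge0 ge_min lexx orbT.
- apply/GleP => x; change (le_pair 0 (val a1 x - val b0 x + extend_cells F m x)); rewrite hb' hc' -phN -!phD.
  apply: transfer_ge0; have := eab' (cell_of F x); rewrite /m.
  have := pa1 (cell_of F x); have := pb1 (cell_of F x); rewrite /le_pair.
  move: (val a0 (cell_of F x)) (val a1 (cell_of F x)) (val b0 (cell_of F x)) (val b1 (cell_of F x)).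
  move=> [p p'] [q q'] [r r'] [s s'] /= [h1 h2] [h3 h4] [e1 e2].
  by split=> /=; lia.
- by rewrite addrC subrK.
- by clearbody c; abel.
- by rewrite addrC subrK.
- have -> : b1 = a0 + a1 - b0 by rewrite eab addrAC subrr add0r.
  by clearbody c; abel.
Qed.
End DimensionGroup.

Section VE.
Variables (R : realType) (S : choiceType).
Notation C := (cplx R).
Notation E := (Ealg R S).
Implicit Types (F G : {fset S}) (x : Omega S) (z : V E).
Local Opaque mk2 e11 a3 adj bd.

Definition rank_map z : rank_group S := mk_rank (rank_of_Gp z).
Lemma rank_map_morph : nmod_morphism rank_map.
Proof.
split=> [|z z']; apply: rank_group_eqP => x; first exact: dn0.
exact: rank_ofD.
Qed.
HB.instance Definition _ := GRing.isNmodMorphism.Build (V E) (rank_group S) rank_map rank_map_morph.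

Lemma rank_of_real (u : Omega S -> int * int) : rank_fun u -> (forall x, le_pair 0 (u x)) -> exists z, forall x, rank_of z x = u x.
Proof. exact: rank_of_surj. Qed.

Lemma VE_cone : positive_cone_of (rank_map : {additive V E -> rank_group S}).
Proof.
split.
  move=> z z' h; apply: rank_of_inj => x; exact: (congr1 (fun w : rank_group S => val w x) h).
apply/seteqP; split=> [_ [z _ <-]|u /GleP h] /=.
  by apply/GleP => x; exact: rank_of_ge0.
have [z hz] := rank_of_real (GtP u) h.
by exists z => //; apply: rank_group_eqP => x; exact: hz.
Qed.

(* At the kind [KM] both components of a rank vector are the total rank. *)
Definition unit_ranks k : int * int := if k is KM then (2, 2) else (1, 1).
Lemma rank_of_unit x : rank_of (Vunit E) x = unit_ranks (kind_of x).
Proof.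
apply: (@complex_pair_inj R); rewrite complex_pair_dn /class_ranks /Vunit (Vtr_class (@cell_ranksD R S x) (@cell_ranksC R S x)).
have s1 : supp 1 (val (exist (fun a : Minf E => is_true (a ** a == a)) _ (unit_idem_subproof E))).
  by move=> [|i] [|j].
rewrite (TrE (@cell_ranksD R S x) s1) big_ord1 /= /unit_entry /= /cell_ranks /=.
by case: (kind_of x); rewrite /kind_ranks /unit_ranks /complex_pair ?tr2E ?one2E.
Qed.
Lemma unit_ranks_ph k k' : kind_le k k' -> transfer k k' (unit_ranks k) = unit_ranks k'.
Proof. by case: k; case: k'. Qed.

Lemma rank_ofMn z n x : rank_of (z *+ n) x = rank_of z x *+ n.
Proof. by elim: n => [|n IH]; rewrite ?mulr0n ?dn0 // !mulrS rank_ofD IH. Qed.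
Lemma pairMn (a b : int) n : (a, b) *+ n = (a *+ n, b *+ n).
Proof. by elim: n => // n IH; rewrite !mulrS IH. Qed.

Lemma VE_order_unit : order_unit (Vunit E).
Proof.
move=> z; have [tz [F hF]] := rank_of_Gp z.
have [r hr] := @cells_max R S F (fun r x => (rank_of z x).1%:~R <= r /\ (rank_of z x).2%:~R <= r)
  ltac:(by move=> r s x rs [h h']; split; exact: le_trans rs)
  ltac:(by move=> x; exists (Num.max (rank_of z x).1%:~R (rank_of z x).2%:~R); rewrite !le_max !lexx orbT).
pose n := (Num.trunc r).+1; exists n => //.
pose w := mk_rank (rank_of_Gp (Vunit E)) *+ n - mk_rank (rank_of_Gp z).
have wE x : val w x = unit_ranks (kind_of x) *+ n - rank_of z x.
  by have := rank_map_morph; rewrite -(rank_of_unit x) -rank_ofMn /w -[mk_rank _]/(rank_map _) -[mk_rank (rank_of_Gp z)]/(rank_map z) -raddfMn.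
have [|z' hz'] := rank_of_real (GtP w).
  move=> x; rewrite wE hF -(unit_ranks_ph (kind_rr F x)).
  have -> : forall k k' (v : int * int), transfer k k' v *+ n = transfer k k' (v *+ n).
    move=> k k' v; elim: (n) => [|m IH]; last by rewrite !mulrS phD IH.
    by case: k; case: k'; rewrite /= ?addr0.
  rewrite -phN -phD; apply: transfer_ge0; have [] := hr x.
  have k (c : int) : c%:~R <= r -> c <= n%:R.
    move=> cr; rewrite -(ler_int R); apply: le_trans cr _.
    by rewrite mulrz_nat; exact/ltW/truncnS_gt.
  move: (kind_of (cell_of F x)) => kk; move: (rank_of z (cell_of F x)) => [a b] /= /k h1 /k h2.
  by rewrite /unit_ranks; case: kk; rewrite pairMn /le_pair /= !subr_ge0 //; split; lia.
exists z'; apply: rank_of_inj => x; rewrite rank_ofD rank_ofMn hz' wE rank_of_unit addrC subrK //.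
Qed.

(** The unit has ranks at most 2, which leaves no room for [3 x] with [x] nonzero. A class of rank
    one at a single full triple fits twice and excludes smaller indices. *)
Lemma VE_index : (exists s : S, True) -> monoid_index (Vunit E) 2.
Proof.
move=> [s _]; split.
  move=> z [w hw]; apply: rank_of_inj => x; rewrite dn0.
  have := congr1 (fun v => rank_of v x) hw; rewrite rank_ofD rank_ofMn rank_of_unit.
  have := rank_of_ge0 z x; have := rank_of_ge0 w x; move: (rank_of z x) (rank_of w x) => [a b] [c d] /=.
  rewrite pairMn /unit_ranks => -[c0 d0] [a0 b0].
  case: (kind_of x) => -[h1 h2]; congr pair; lia.
pose top : Omega S := (Some s, Some s, Some s).
pose m x : int * int := if x == top then (1, 1) else 0.
have tm x : kind_pair (kind_of x) (m x).
  by rewrite /m; case: eqP => [->|_] //; case: (kind_of x).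
have m0 x : le_pair 0 (m x) by rewrite /m; case: eqP.
have [|z hz] := rank_of_real (rank_fun_ext [fset s]%fset tm); first by move=> x; exact: transfer_ge0.
pose w := rank_map (Vunit E) - rank_map z *+ 2.
have wE x : val w x = unit_ranks (kind_of x) - rank_of z x *+ 2 by rewrite -rank_of_unit -rank_ofMn /w -raddfMn.
have [|z' hz'] := rank_of_real (GtP w).
  move=> x; rewrite wE hz /extend_cells /m; case: eqP => [rx|_].
    rewrite rx; have [k1 k2] : kind_of x = KM /\ kind_of top = KM.
      by split=> //; have := kind_rr [fset s]%fset x; rewrite rx; case: (kind_of x).
    by rewrite k1 k2 /= pairMn.
  have -> : transfer (kind_of (cell_of [fset s]%fset x)) (kind_of x) (0 : int * int) = 0.
    by case: (kind_of _); case: (kind_of _).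
  by rewrite mul0rn subr0; case: (kind_of x).
have uE : Vunit E = z *+ 2 + z'.
  by apply: rank_of_inj => x; rewrite rank_ofD rank_ofMn hz' wE rank_of_unit addrC subrK.
have z0 : z <> 0.
  move=> z0; have := hz top; rewrite z0 dn0 /extend_cells /m /cell_of /= in_fset1 eqxx eqxx.
  by [].
move=> [|[|k]] // h; exfalso; apply: z0.
  have u0 : Vunit E = 0 by apply: h; exists 0; rewrite addr0.
  have := rank_of_unit top; by rewrite u0 dn0.
by apply: h; exists z'.
Qed.
End VE.

(** * No surjective pre-V-homomorphism *)

Section NoLifting.
Variables (R : realType) (S : choiceType).
Hypothesis hS : is_aleph 3 [set: S].
Notation C := (cplx R).
Notation E := (Ealg R S).
Implicit Types (F G : {fset S}) (x : Omega S) (z : V E).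
Local Opaque mk2 e11 a3 adj bd.

(** The projections of the obstruction enter only through their rank functions, which are (1, 0) at
    the kind [k0] and transferred from there. The complement exists because the unit minus such a
    function is nonnegative. *)
Lemma indicator_idem (P : Omega S -> bool) k0 F : k0 = KE \/ k0 = KT ->
  (forall x, P x -> kind_le k0 (kind_of x)) -> (forall x, P (cell_of F x) = P x) ->
  exists e e' : V E, Vunit E = e + e' /\
    forall x, rank_of e x = if P x then transfer k0 (kind_of x) (1, 0) else 0.
Proof.
move=> hk hP PF; pose f x : int * int := if P x then transfer k0 (kind_of x) (1, 0) else 0.
have t0 : kind_pair k0 ((1, 0) : int * int) by case: hk => ->.
have tf x : kind_pair (kind_of x) (f x).
  rewrite /f; case: ifP => [/hP h|_]; first exact: transfer_typed h t0.
  by case: (kind_of x).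
have gf : rank_fun f.
  split=> //; exists F => x; rewrite /f PF; case: ifP => h.
    by rewrite transfer_comp //; [apply: hP; rewrite PF|exact: kind_rr].
  by case: (kind_of (cell_of F x)); case: (kind_of x).
have f0 x : le_pair 0 (f x) by rewrite /f; case: ifP => // _; apply: transfer_ge0.
have [e he] := rank_of_real R gf f0.
have [e' he'] : exists e' : V E, forall x, rank_of e' x = unit_ranks (kind_of x) - f x.
  pose w := rank_map (Vunit E) - rank_map e.
  have wE x : val w x = unit_ranks (kind_of x) - f x by rewrite -(rank_of_unit R) -he.
  have [|e' h] := rank_of_real R (GtP w); last by exists e' => x; rewrite h wE.
  move=> x; rewrite wE /f; case: ifP => [/hP|_]; last by rewrite subr0; case: (kind_of x).
  by case: hk => ->; case: (kind_of x).
exists e, e'; split; last by move=> x; rewrite he.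
by apply: rank_of_inj => x; rewrite rank_ofD he he' rank_of_unit addrC subrK.
Qed.

Lemma coord_of_eq a (o : option S) : (coord_of [fset a]%fset o == Some a) = (o == Some a).
Proof.
case: o => //= u; rewrite in_fset1; case: (eqVneq u a) => [->|ne] //=.
by apply/esym/negbTE; apply: contraNneq ne => -[->].
Qed.
Lemma coord_idem (pi : Omega S -> option S) k0 : k0 = KE \/ k0 = KT ->
  (forall x a, pi x = Some a -> kind_le k0 (kind_of x)) -> (forall F x, pi (cell_of F x) = coord_of F (pi x)) ->
  exists e e' : S -> V E, forall a, Vunit E = e a + e' a /\
  forall x, rank_of (e a) x = if pi x == Some a then transfer k0 (kind_of x) (1, 0) else 0.
Proof.
move=> hk hp hr.
suff /choice[f hf] : forall a, exists ee : V E * V E, Vunit E = ee.1 + ee.2 /\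
    forall x, rank_of ee.1 x = if pi x == Some a then transfer k0 (kind_of x) (1, 0) else 0.
  by exists (fun a => (f a).1), (fun a => (f a).2).
move=> a; have [||e [e' h]] := @indicator_idem (fun x => pi x == Some a) k0 [fset a]%fset hk.
- by move=> x /eqP /hp.
- by move=> x; rewrite hr coord_of_eq.
by exists (e, e').
Qed.

Definition top a b c : Omega S := (Some a, Some b, Some c).
Definition vanish_top z a b c : Prop := rank_of z (top a b c) = 0.

(** For large [G] the ranks at a full triple are the image under [transfer] of those at its cell,
    and [transfer] preserves 0. *)
Lemma face_zero z y : rank_of z y = 0 -> exists F, forall G a b c, (F `<=` G)%fset ->
  cell_of G (top a b c) = y -> vanish_top z a b c.
Proof.
move=> zy; have [tz [F hF]] := rank_of_Gp z; exists F => G a b c FG ry.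
rewrite /vanish_top (rank_fun_sup tz FG hF) ry zy.
by case: (kind_of y); case: (kind_of _).
Qed.

(** Ranks are nonnegative integers, so in each component one of [e] and [f] has rank 0. *)
Lemma two_le (z e f z1 z2 : V E) x : e = z + z1 -> f = z + z2 ->
  rank_of e x + rank_of f x = (1, 1) -> rank_of z x = 0.
Proof.
move=> -> ->; rewrite !rank_ofD; have := rank_of_ge0 z x; have := rank_of_ge0 z1 x; have := rank_of_ge0 z2 x.
move: (rank_of z x) (rank_of z1 x) (rank_of z2 x) => [a b] [c d] [g h] /= [g0 h0] [c0 d0] [a0 b0] [e1 e2].
congr pair; lia.
Qed.

Lemma E_no_lift (B : rngType) (sm : Minf B -> Prop) (psi : {additive V B -> V E}) :
  approx_idem sm -> pre_V_hom psi -> (forall y, exists b, psi b = y) -> False.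
Proof.
move=> hB psiV psiS.
have [|||e1 [e1' h1]] := @coord_idem (fun x => x.1.1) KE.
- by left.
- by move=> [[u v] w] a /= ->; case: v; case: w.
- by [].
have [|||e2 [e2' h2]] := @coord_idem (fun x => x.1.2) KE.
- by left.
- by move=> [[u v] w] a /= ->; case: u; case: w.
- by [].
have [|||e3 [e3' h3]] := @coord_idem (fun x => x.2) KT.
- by right.
- by move=> [[u v] w] a /= ->; case: u; case: v.
- by [].
have compl (e e' : S -> V E) a x : Vunit E = e a + e' a -> rank_of (e' a) x = unit_ranks (kind_of x) - rank_of (e a) x.
  by move=> h; rewrite -(rank_of_unit R) h rank_ofD addrC addKr.
have C1 a x := compl _ _ a x (h1 a).1; have C2 a x := compl _ _ a x (h2 a).1.
have C3 a x := compl _ _ a x (h3 a).1.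
have D1 a := (h1 a).2; have D2 a := (h2 a).2; have D3 a := (h3 a).2.
apply: (@lift_contradiction S B _ psi sm (Vunit E) e1 e1' e2 e2' e3 e3' vanish_top hS hB psiV psiS).
- by move=> a; exact: (h1 a).1.
- by move=> a; exact: (h2 a).1.
- by move=> a; exact: (h3 a).1.
- by move=> x y a b c; rewrite /vanish_top rank_ofD => -> ->; rewrite addr0.
- by move=> a b c; exact: dn0.
- move=> x y a b c; rewrite /vanish_top rank_ofD; have := rank_of_ge0 x (top a b c); have := rank_of_ge0 y (top a b c).
  move: (rank_of x _) (rank_of y _) => [p q] [p' q'] /= [p0 q0] [p0' q0'] [e f]; congr pair; lia.
- by move=> a b c; rewrite /vanish_top rank_of_unit.
- move=> a b x hx; have z0 : rank_of x (Some a, Some b, None) = 0.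
    case: hx => -[[u eu] [v ev]].
      by apply: (two_le eu ev); rewrite C2 D1 D2 /= !eqxx.
    by apply: (two_le eu ev); rewrite C1 D1 D2 /= !eqxx.
  (* Adjoining [a] and [b] keeps these coordinates, while a [c] outside the set is blanked; the cell
     of the full triple is then the face. *)
  have [F hF] := face_zero z0; exists (F `|` [fset a; b])%fset => c cF.
  apply: (hF (F `|` [fset a; b])%fset); first exact: fsubsetUl.
  by rewrite /cell_of /= (negbTE cF) !in_fsetU !in_fset1 !eqxx !orbT.
- move=> b c x hx; have z0 : rank_of x (None, Some b, Some c) = 0.
    case: hx => -[[u eu] [v ev]].
      by apply: (two_le eu ev); rewrite C3 D2 D3 /= !eqxx.
    by apply: (two_le eu ev); rewrite C2 D2 D3 /= !eqxx.
  have [F hF] := face_zero z0; exists (F `|` [fset b; c])%fset => a aF.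
  apply: (hF (F `|` [fset b; c])%fset); first exact: fsubsetUl.
  by rewrite /cell_of /= (negbTE aF) !in_fsetU !in_fset1 !eqxx !orbT.
(* On this face, of kind [K0], [transfer] swaps the ranks of [e3 c], so [e1 a] is disjoint from
   [e3 c] itself and not from its complement. *)
- move=> a c x hx; have z0 : rank_of x (Some a, None, Some c) = 0.
    case: hx => -[[u eu] [v ev]].
      by apply: (two_le eu ev); rewrite D1 D3 /= !eqxx.
    by apply: (two_le eu ev); rewrite C1 C3 D1 D3 /= !eqxx.
  have [F hF] := face_zero z0; exists (F `|` [fset a; c])%fset => b bF.
  apply: (hF (F `|` [fset a; c])%fset); first exact: fsubsetUl.
  by rewrite /cell_of /= (negbTE bF) !in_fsetU !in_fset1 !eqxx !orbT.
Qed.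

Lemma E_no_RR0 (B : cstarType R) : real_rank_zero B -> ~ exists f : {additive V B -> V E},
  pre_V_hom f /\ forall y : V E, exists x : V B, f x = y.
Proof.
move=> [U [j [hj [hr _]]]] [f [fV fS]].
exact: (E_no_lift (RR0_approx hj hr) fV fS).
Qed.
Lemma E_no_regular (B : rngType) : regular_rng B -> ~ exists f : {additive V B -> V E},
  pre_V_hom f /\ forall y : V E, exists x : V B, f x = y.
Proof. by move=> reg [f [fV fS]]; exact: (E_no_lift (regular_approx reg) fV fS). Qed.

Lemma bij_inverse_preV (M N : nmodType) (f : {additive M -> N}) : bijective f ->
  exists g : {additive N -> M}, pre_V_hom g /\ forall y, exists b, g b = y.
Proof.
move=> [g gf fg].
have gm : nmod_morphism g.
  split; first by rewrite -(raddf0 f) gf.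
  by move=> x y; rewrite -{1}(fg x) -{1}(fg y) -raddfD gf.
pose g' : {additive N -> M} := HB.pack g (GRing.isNmodMorphism.Build N M g gm).
exists g'; split; last by move=> y; exists (f y); exact: gf.
move=> a b c /= h; exists (f a), (f b); split; [|exact: gf|exact: gf].
by rewrite -raddfD -h fg.
Qed.

(** The identity of [V E] is a surjective pre-V-homomorphism, so [E_no_RR0] can be applied to [E]
    itself. *)
Lemma E_not_RR0 : ~ real_rank_le E 0.
Proof.
move=> h; apply: (@E_no_RR0 E).
  exists E, id; split; last by split=> // m _.
  by split; [split|split; [|left=> u; exists u]].
exists (idfun : {additive V E -> V E}); split; last by move=> y; exists y.
by move=> a b c /= ->; exists a, b.
Qed.
End NoLifting.

(** * E as a direct limit *)

Section DirectLimit.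
Variables (R : realType) (S : choiceType).
Notation C := (cplx R).
Notation E := (Ealg R S).
Implicit Types (F G : {fset S}).

Definition fset_index := {fset S}.
HB.instance Definition _ := Choice.on fset_index.
Definition index_le : rel fset_index := fun F G => (F `<=` G)%fset.
Lemma index_le_refl : reflexive index_le.
Proof. by move=> F; exact: fsubset_refl. Qed.
Lemma index_le_anti : antisymmetric index_le.
Proof. by move=> F G /andP[h1 h2]; apply/eqP; rewrite eqEfsubset; apply/andP. Qed.
Lemma index_le_trans : transitive index_le.
Proof. by move=> G F H; exact: fsubset_trans. Qed.
Fact index_display : Order.disp_t. Proof. exact: Order.Disp tt tt. Qed.
HB.instance Definition _ := Order.Le_isPOrder.Build index_display fset_index
  index_le_refl index_le_anti index_le_trans.
Lemma indexE (F G : fset_index) : (F <= G)%O = (F `<=` G)%fset.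
Proof. by []. Qed.

(** Restriction provides a map for every pair; when [F] is contained in [G] it is the inclusion. *)
Definition transition (F G : fset_index) (x : Aalg R F) : Aalg R G := restr G (inclA x).

Lemma hom_comp (A B D : ucstarType R) (f : A -> B) (g : B -> D) :
  unital_star_hom f -> unital_star_hom g -> unital_star_hom (g \o f).
Proof.
move=> [[f1 f2 f3 f4] f5] [[g1 g2 g3 g4] g5]; split; last by rewrite /= f5 g5.
by split=> [x y|a x|x y|x] /=; rewrite ?f1 ?f2 ?f3 ?f4.
Qed.

Lemma inclA_trans (F G : fset_index) (x : Aalg R F) : (F `<=` G)%fset -> inclA (transition G x) = inclA x.
Proof.
move=> FG; apply: (@carrier_eqP _ _ (E_csub R S)) => -[z t].
change (val x (cell_of G z, t) = val x (z, t)).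
by rewrite (carrierP x).2 [RHS](carrierP x).2 cell_of_sub.
Qed.

Section Universal.
Variables (B : ucstarType R) (h : forall F : fset_index, Aalg R F -> B).
Hypothesis hh : forall F, unital_star_hom (@h F).
Hypothesis hc : forall (F G : fset_index) (x : Aalg R F), (F <= G)%O -> h (transition G x) = h x.

(* [y] is the limit of the images of the restrictions of [x]. *)
Definition netlim (x : E) (y : B) := forall e, 0 < e -> exists F, forall G, (F `<=` G)%fset ->
  nr (y - h (restr G x)) <= e.

Lemma homB (A D : ucstarType R) (f : A -> D) x y : unital_star_hom f -> f (x - y) = f x - f y.
Proof.
move=> [[fD fZ _ _] _]; rewrite fD; congr (_ + _).
by rewrite -scaleN1r fZ scaleN1r.
Qed.

Lemma netlim_unique x y y' : netlim x y -> netlim x y' -> y = y'.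
Proof.
move=> hy hy'; apply/eqP; rewrite -subr_eq0; apply/eqP/nr_eq0.
apply/ler_addgt0Pr => e e0; rewrite add0r; have e2 : 0 < e / 2 by rewrite divr_gt0.
have [F hF] := hy _ e2; have [F' hF'] := hy' _ e2.
have k := hF _ (fsubsetUl F F'); have k' := hF' _ (fsubsetUr F F').
have -> : y - y' = (y - h (restr (F `|` F')%fset x)) + (h (restr (F `|` F')%fset x) - y') by abel.
apply: le_trans (nrD _ _) _; rewrite [nr (h _ - y')]nrC; have -> : e = e / 2 + e / 2 by field.
exact: lerD.
Qed.

(** Finite sets with errors [1 / (n + 1)] are accumulated into an increasing sequence. The maps [h]
    are contractive, so the images are Cauchy, and the same estimate compares them with all larger
    finite sets. *)
Lemma netlim_ex x : exists y, netlim x y.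
Proof.
have /choice[F hF] : forall n : nat, exists F, forall G, (F `<=` G)%fset ->
    nr (x - inclA (restr G x)) <= n.+1%:R^-1.
  by move=> n; apply: restr_near; rewrite invr_gt0.
pose G n := (\big[fsetU/fset0]_(k < n.+1) F k)%fset.
have GS n : G n.+1 = (G n `|` F n.+1)%fset by rewrite /G big_ord_recr.
have Gm n m : (n <= m)%N -> (G n `<=` G m)%fset.
  elim: m => [|m IH]; first by rewrite leqn0 => /eqP ->; exact: fsubset_refl.
  rewrite leq_eqVlt => /orP[/eqP ->|nm]; first exact: fsubset_refl.
  by apply: fsubset_trans (IH nm) _; rewrite GS; exact: fsubsetUl.
have FG n : (F n `<=` G n)%fset.
  by case: n => [|n]; [rewrite /G big_ord_recr /=|rewrite GS]; exact: fsubsetUr.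
have key n K : (G n `<=` K)%fset -> nr (h (restr (G n) x) - h (restr K x)) <= n.+1%:R^-1.
  move=> GK; rewrite -(@hc (G n) K) //.
  rewrite -homB //; apply: le_trans (unital_star_hom_le _ (hh K)) _.
  rewrite /transition -(homB _ _ (restr_hom R K)); apply: le_trans (unital_star_hom_le _ (restr_hom R K)) _.
  by rewrite nrC; apply: hF; exact: FG.
have [|y hy] := @cauchy_limS _ B (fun n => h (restr (G n) x)).
  move=> e e0; exists (Num.trunc e^-1) => n hn; rewrite nrC.
  apply: le_trans (key _ _ (Gm _ _ hn)) _.
  rewrite -[leRHS]invrK lef_pV2 ?posrE ?invr_gt0 //; exact: ltW (truncnS_gt _).
exists y => e e0; have e2 : 0 < e / 2 by rewrite divr_gt0.
have [N hN] := hy _ e2; pose n := maxn N (Num.trunc (e / 2)^-1).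
exists (G n) => K GK.
have -> : y - h (restr K x) = (y - h (restr (G n) x)) + (h (restr (G n) x) - h (restr K x)) by abel.
apply: le_trans (nrD _ _) _; have -> : e = e / 2 + e / 2 by field.
apply: lerD; first by rewrite nrC; apply: hN; exact: leq_maxl.
apply: le_trans (key _ _ GK) _; rewrite -[leRHS]invrK lef_pV2 ?posrE ?invr_gt0 //.
apply: le_trans (ltW (truncnS_gt _)) _; rewrite ler_nat ltnS; exact: leq_maxr.
Qed.

Lemma netlim_incl (F : fset_index) (a : Aalg R F) : netlim (inclA a) (h a).
Proof.
move=> e e0; exists F => G FG; rewrite -[restr G _]/(transition G a) hc //.
by rewrite subrr nr0 ltW.
Qed.

Lemma netlim_op (op : B -> B) (opE : E -> E) K x y :
  0 <= K -> (forall u v, nr (op u - op v) <= K * nr (u - v)) ->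
  (forall F, h (restr F (opE x)) = op (h (restr F x))) -> netlim x y -> netlim (opE x) (op y).
Proof.
move=> K0 hop hE hy e e0; have e2 : 0 < e / (K + 1) by rewrite divr_gt0 // ltr_wpDl.
have [F hF] := hy _ e2; exists F => G /hF b; rewrite hE; apply: le_trans (hop _ _) _.
apply: le_trans (ler_wpM2l K0 b) _; rewrite mulrCA ler_piMr ?(ltW e0) //.
by rewrite ler_pdivrMr ?ltr_wpDl // mul1r lerDl.
Qed.
Lemma netlimD x x' y y' : netlim x y -> netlim x' y' -> netlim (x + x') (y + y').
Proof.
move=> hy hy' e e0; have e2 : 0 < e / 2 by rewrite divr_gt0.
have [F hF] := hy _ e2; have [F' hF'] := hy' _ e2.
exists (F `|` F')%fset => G; rewrite fsubUset => /andP[/hF b /hF' b'].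
have [[rD _ _ _] _] := restr_hom R G; have [[hD _ _ _] _] := hh G; rewrite rD hD.
have -> : y + y' - (h (restr G x) + h (restr G x')) = (y - h (restr G x)) + (y' - h (restr G x')) by abel.
apply: le_trans (nrD _ _) _; have -> : e = e / 2 + e / 2 by field.
exact: lerD.
Qed.
Lemma netlimM x x' y y' : netlim x y -> netlim x' y' -> netlim (x ** x') (y ** y').
Proof.
move=> hy hy' e e0; pose K := nr y' + nr x + 1.
have K0 : 0 < K by rewrite ltr_wpDl // addr_ge0 ?nr_ge0.
have e2 : 0 < e / K by rewrite divr_gt0.
have [F hF] := hy _ e2; have [F' hF'] := hy' _ e2.
exists (F `|` F')%fset => G; rewrite fsubUset => /andP[/hF b /hF' b'].
have [[_ _ rM _] _] := restr_hom R G; have [[_ _ hM _] _] := hh G; rewrite rM hM.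
have bx : nr (h (restr G x)) <= nr x.
  exact: le_trans (unital_star_hom_le _ (hh G)) (unital_star_hom_le _ (restr_hom R G)).
have -> : y ** y' - h (restr G x) ** h (restr G x') =
  (y - h (restr G x)) ** y' + h (restr G x) ** (y' - h (restr G x')).
  by rewrite rmulBl rmulBr; abel.
apply: le_trans (nrD _ _) _.
apply: le_trans (lerD (nrM _ _) (nrM _ _)) _.
apply: (@le_trans _ _ (e / K * nr y' + nr x * (e / K))).
  by apply: lerD; apply: ler_pM; rewrite ?nr_ge0.
rewrite [nr x * _]mulrC -mulrDr mulrAC ler_pdivrMr // ler_wpM2l ?(ltW e0) // /K lerDl //.
Qed.

Lemma universal : exists! u : E -> B, unital_star_hom u /\ forall (F : fset_index) (x : Aalg R F), u (inclA x) = h x.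
Proof.
have /choice[u hu] := netlim_ex.
exists u; split; last first.
  move=> v [hv vE]; apply/funext => x; apply: netlim_unique (hu x) _ => e e0.
  have [F hF] := restr_near x e0; exists F => G /hF b.
  rewrite -vE -homB //; exact: le_trans (unital_star_hom_le _ hv) b.
split; last by move=> F x; apply: netlim_unique (hu _) (netlim_incl x).
split; last first.
  apply: netlim_unique (hu _) _ => e e0; exists fset0 => G _.
  by have [_ ->] := restr_hom R G; have [_ ->] := hh G; rewrite subrr nr0 ltW.
split=> [x y|a x|x y|x].
- exact: netlim_unique (hu _) (netlimD (hu x) (hu y)).
- apply: netlim_unique (hu _) _.
  apply: (@netlim_op (fun b => a *: b) (fun b => a *: b) (cn a)) (hu x).
  + exact: cn_ge0.
  + by move=> v w; rewrite -scalerBr nrZ.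
  + by move=> F; have [[_ rZ _ _] _] := restr_hom R F; have [[_ hZ _ _] _] := hh F; rewrite rZ hZ.
- exact: netlim_unique (hu _) (netlimM (hu x) (hu y)).
- apply: netlim_unique (hu _) _.
  apply: (@netlim_op (@star R B) (@star R E) 1) (hu x).
  + exact: ler01.
  + by move=> v w; rewrite -starB nr_star mul1r.
  + by move=> F; have [[_ _ _ rS] _] := restr_hom R F; have [[_ _ _ hS] _] := hh F; rewrite rS hS.
Qed.
End Universal.

Lemma E_direct_limit : @direct_limit R _ fset_index (@Aalg R S) transition E (@inclA R S).
Proof.
split.
- split; first by exists fset0.
  move=> F G; exists (F `|` G)%fset; rewrite !indexE; split; [exact: fsubsetUl|exact: fsubsetUr].
- split.
  + by move=> F G _; exact: hom_comp (inclA_hom R F) (restr_hom R G).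
  + by move=> F x; exact: restrK.
  + by move=> F G H x FG GH; rewrite /transition inclA_trans.
- split; first by move=> F; exact: inclA_hom.
  by move=> F G x FG; exact: inclA_trans.
move=> B h [hh hc]; exact: universal.
Qed.
End DirectLimit.

(** * Separability *)

Section Separability.
Variables (R : realType) (S : choiceType).
Notation C := (cplx R).
Notation M := 'M[C]_2.
Notation I := (I01 R).
Notation E := (Ealg R S).
Implicit Types (F G : {fset S}) (f g : E).
Local Opaque mk2 e11 a3 adj bd.

(** The modulus of continuity is recorded by a natural number so that it can be a part of a
    countable code. *)
Lemma cells_modulus F f (n : nat) : exists N : nat, (0 < N)%N /\ forall x s t,
  `|ival s - ival t| * N%:R <= 1 -> bd n.+1%:R^-1 (val f (cell_of F x, s) - val f (cell_of F x, t)).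
Proof.
have n0 : 0 < n.+1%:R^-1 :> R by rewrite invr_gt0.
have [r hr] := @cells_max R S F (fun r x => forall s t, `|ival s - ival t| * r <= 1 ->
    bd n.+1%:R^-1 (val f (x, s) - val f (x, t)))
  ltac:(by move=> r r' x le_rr h s t ss; apply: h; apply: le_trans ss; rewrite ler_wpM2l)
  ltac:(by move=> x; have [_ uf _ _] := carrierP f; have [d d0 hd] := uf x _ n0;
    exists d^-1 => s t ss; apply: hd; rewrite ler_pdivrMr // mul1r in ss).
exists (Num.trunc r).+1; split=> // x s t h; apply: hr; apply: le_trans h.
by rewrite ler_wpM2l //; exact/ltW/truncnS_gt.
Qed.
Definition modulus F n f : nat := projT1 (cid (cells_modulus F f n)).
Lemma modulusP F n f : (0 < modulus F n f)%N /\ forall x s t,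
  `|ival s - ival t| * (modulus F n f)%:R <= 1 -> bd n.+1%:R^-1 (val f (cell_of F x, s) - val f (cell_of F x, t)).
Proof. by rewrite /modulus; case: (cid _). Qed.

Definition rnd (n : nat) (c : C) : int * int :=
  (Num.floor (complex.Re c * n.+1%:R), Num.floor (complex.Im c * n.+1%:R)).
Lemma floor_close (n : nat) (a b : R) : Num.floor (a * n.+1%:R) = Num.floor (b * n.+1%:R) ->
  `|a - b| <= n.+1%:R^-1.
Proof.
move=> h; have n0 : 0 < n.+1%:R :> R by [].
rewrite -[leRHS]div1r ler_pdivlMr // -{1}(ger0_norm (ltW n0)) -normrM mulrBl.
have /andP[a1 a2] := Num.Theory.floor_itv (a * n.+1%:R); have /andP[b1 b2] := Num.Theory.floor_itv (b * n.+1%:R).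
rewrite h in a1 a2; rewrite intrD in a2; rewrite intrD in b2.
by rewrite ler_norml; apply/andP; split; lra.
Qed.
Lemma rnd_close n c d : rnd n c = rnd n d -> cn (c - d) <= 2 * n.+1%:R^-1.
Proof.
move=> [h1 h2]; apply: le_trans (cn_ReIm _) _; rewrite mulr_natl mulr2n.
by apply: lerD; [rewrite ReB|rewrite ImB]; exact: floor_close.
Qed.

Definition grid F (N : nat) : seq (Omega S * nat * ('I_2 * 'I_2)) :=
  [seq (xj, ab) | xj <- [seq (x, j) | x <- cells F, j <- iota 0 N.+1], ab <- enum [set: 'I_2 * 'I_2]].
Definition table F n N f := [seq rnd n (val f (c.1.1, clampI (c.1.2%:R / N%:R)) c.2.1 c.2.2) | c <- grid F N].
(* Two functions with the same code are close, and there are countably many codes. *)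
Definition code F n f := (modulus F n f, table F n (modulus F n f) f).

Lemma code_close F n f g : cell_dep F (val f) -> cell_dep F (val g) -> code F n f = code F n g ->
  nr (f - g) <= 6 * n.+1%:R^-1.
Proof.
move=> ff fg h; have [N0 hf] := modulusP F n f; have [_ hg] := modulusP F n g.
have eN : modulus F n f = modulus F n g := congr1 fst h.
have : table F n (modulus F n f) f = table F n (modulus F n g) g := congr1 snd h.
rewrite -eN in hg *; move: (modulus F n f) N0 hf hg => N N0 hf hg /eq_in_map tE {h eN}.
have n0 : 0 < n.+1%:R^-1 :> R by rewrite invr_gt0.
have NR : 0 < N%:R :> R by rewrite ltr0n.
apply: car_normP; first by rewrite mulr_ge0 // ltW.
move=> [x t]; change (bd (6 * n.+1%:R^-1) (val f (x, t) - val g (x, t))).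
rewrite ff fg; pose j := Num.trunc (N%:R * ival t); pose tj : I := clampI (j%:R / N%:R).
have /andP[t0 t1] := iv01 t.
have Nt0 : 0 <= N%:R * ival t by rewrite mulr_ge0.
have /andP[j1 j2] : j%:R <= N%:R * ival t < j.+1%:R by rewrite /j truncn_itv.
have jN : (j <= N)%N by rewrite -(ler_nat R); apply: le_trans j1 _; apply: ler_piMr; [exact: ltW|exact: t1].
have ij : ival tj = j%:R / N%:R by rewrite clampIE // divr_ge0 //= ler_pdivrMr // mul1r ler_nat.
have near : `|ival t - ival tj| * N%:R <= 1.
  rewrite -{1}(ger0_norm (ltW NR)) -normrM ij mulrBl divfK ?gt_eqF // mulrC ger0_norm ?subr_ge0 //.
  by rewrite -natr1 in j2; lra.
have mid : bd (2 * (2 * n.+1%:R^-1)) (val f (cell_of F x, tj) - val g (cell_of F x, tj)).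
  apply: entry_bd => [|a b]; first by rewrite mulr_ge0 // ltW.
  have -> : (val f (cell_of F x, tj) - val g (cell_of F x, tj)) a b =
      val f (cell_of F x, tj) a b - val g (cell_of F x, tj) a b by rewrite !mxE.
  apply: rnd_close.
  apply: (tE ((cell_of F x, j), (a, b))).
  have jin : (j \in iota 0 N.+1) by rewrite mem_iota add0n ltnS.
  have xj : (cell_of F x, j) \in [seq (x, j) | x <- cells F, j <- iota 0 N.+1].
    by apply/allpairsP; exists (cell_of F x, j); split; [exact: cell_of_cells|exact: jin|by []].
  have abin : (a, b) \in enum [set: 'I_2 * 'I_2] by rewrite mem_enum in_setT.
  by apply/allpairsP; exists ((cell_of F x, j), (a, b)); split; [exact: xj|exact: abin|by []].
have -> : val f (cell_of F x, t) - val g (cell_of F x, t) = (val f (cell_of F x, t) - val f (cell_of F x, tj)) +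
   (val f (cell_of F x, tj) - val g (cell_of F x, tj)) - (val g (cell_of F x, t) - val g (cell_of F x, tj)) by abels.
(* Two moduli of continuity, and the rounding error [2 / (n + 1)] of an entry, doubled by
   [entry_bd]. *)
have k : n.+1%:R^-1 + 2 * (2 * n.+1%:R^-1) + n.+1%:R^-1 = 6 * n.+1%:R^-1 :> R by ring.
rewrite -k; apply: bdB (hg x _ _ near); exact: bdD (hf x _ _ near) mid.
Qed.

(** One function for each code, and 0 for codes that do not occur; these functions form the dense
    set. *)
Definition pickE (q : {fset S} * (nat * (nat * seq (int * int)))) : E :=
  xget 0 [set f : E | cell_dep q.1 (val f) /\ code q.1 q.2.1 f = q.2.2].

Lemma trunc_bound (e : R) : 0 < e -> 6 * (Num.trunc (6 / e)).+1%:R^-1 <= e.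
Proof.
move=> e0; rewrite ler_pdivrMr // mulrC -ler_pdivrMr //; exact: ltW (truncnS_gt _).
Qed.

Lemma pick_near f e : 0 < e -> exists q, nr (f - pickE q) <= e.
Proof.
move=> e0; have e2 : 0 < e / 2 by rewrite divr_gt0.
have [F /(_ F (fsubset_refl F)) hF] := restr_near f e2.
pose g := inclA (restr F f); pose n := Num.trunc (6 / (e / 2)).
have fg : cell_dep F (val g) by exact: (carrierP (restr F f)).2.
exists (F, (n, code F n g)).
have [fp cp] : cell_dep F (val (pickE (F, (n, code F n g)))) /\ code F n (pickE (F, (n, code F n g))) = code F n g.
  have := @xgetPex _ 0 [set f : E | cell_dep F (val f) /\ code F n f = code F n g].
  by apply; exists g.
have k := code_close fg fp (esym cp).
have -> : f - pickE (F, (n, code F n g)) = (f - g) + (g - pickE (F, (n, code F n g))) by abel.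
apply: le_trans (nrD _ _) _; have -> : e = e / 2 + e / 2 by field.
apply: lerD; first exact: hF.
exact: le_trans k (trunc_bound e2).
Qed.

Lemma E_separable : is_aleph 3 [set: S] -> aleph_separable 3 E.
Proof.
move=> hS; exists (range pickE); split.
  move=> O [f Of] oO; have /nbhs_ballP[e e0 he] := open_nbhs_nbhs (conj oO Of).
  have [r r0 er] := posC e0; have [q hq] := pick_near f (divr_gt0 r0 (ltr0n R 2)).
  exists (pickE q); split; last by exists q.
  apply: he; rewrite er -ball_normE /ball_ /= nrE ltr_rc; apply: le_lt_trans hq _; lra.
exists S, [set: S]; split; first exact: hS.
apply: card_le_trans (card_image_le _ _) _.
exact: (@card_le_mulnat S _ hS).
Qed.
End Separability.

(** * Finite products of blocks *)

Section Continuity.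
Variable R : realType.
Notation C := (cplx R).
Notation M := 'M[C]_2.
Notation I := (I01 R).

Definition pt_cont (f : I -> C) := forall t e, 0 < e -> exists2 d, 0 < d &
  forall s, `|ival s - ival t| <= d -> cn (f s - f t) <= e.

(** Heine's theorem by a supremum: let [c] be the supremum of the [a] for which [e] has a modulus on
    [[0, a]]. Continuity at [c] extends this past [c], so the whole interval is reached. *)
Lemma pt_cont_uconts f : pt_cont f -> ucont_c f.
Proof.
move=> hf e e0; have e2 : 0 < e / 2 by rewrite divr_gt0.
pose P (a : R) := exists2 d, 0 < d & forall s t, ival s <= a -> ival t <= a ->
  `|ival s - ival t| <= d -> cn (f s - f t) <= e.
pose A := [set a : R | 0 <= a <= 1 /\ P a].
have A0 : A 0.
  split; first by rewrite lexx ler01.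
  exists 1 => // s t s0 t0 _; have -> : s = t; last by rewrite subrr cn0 ltW.
  have /andP[s1 _] := iv01 s; have /andP[t1 _] := iv01 t.
  by apply: ival_inj; apply/le_anti; rewrite (le_trans s0 t1) (le_trans t0 s1).
have hA : has_sup A by split; [exists 0|exists 1 => a [/andP[]]].
set c := sup A.
have c0 : 0 <= c by exact: (sup_upper_bound hA) _ A0.
have c1 : c <= 1 by apply: ge_sup hA.1 _ => a [/andP[]].
have cE : ival (clampI c : I) = c by rewrite clampIE // c0.
have [d d0 hd] := hf (clampI c) _ e2; rewrite cE in hd.
have d2 : 0 < d / 2 by rewrite divr_gt0.
have [a [_ [d' d'0 ha]] ca] := sup_adherent d2 hA; rewrite -/c in ca.
have near s t : `|ival s - c| <= d -> `|ival t - c| <= d -> cn (f s - f t) <= e.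
  move=> /hd h1 /hd h2; have -> : f s - f t = (f s - f (clampI c)) - (f t - f (clampI c)) by ring.
  apply: le_trans (cnD _ _) _; rewrite cnN; have -> : e = e / 2 + e / 2 by field.
  exact: lerD.
have Pc : P (c + d / 2).
  exists (Num.min d' (d / 2)); first by rewrite lt_min d'0.
  move=> s t sc tc; rewrite le_min => /andP[st1 st2].
  have /andP[st3 st4] : ival t - d / 2 <= ival s <= ival t + d / 2 by rewrite -ler_distl.
  have out : a < ival s \/ a < ival t -> cn (f s - f t) <= e.
    by move=> [h|h]; apply: near; rewrite ler_distl; apply/andP; split; lra.
  have [sa|sa] := leP (ival s) a; last by apply: out; left.
  by have [ta|ta] := leP (ival t) a; [exact: ha|apply: out; right].
have [c1'|c1'] := leP 1 (c + d / 2).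
  have [d1 d10 h] := Pc; exists d1 => // s t; apply: h.
    by have /andP[_ k] := iv01 s; exact: le_trans k c1'.
  by have /andP[_ k] := iv01 t; exact: le_trans k c1'.
have : A (c + d / 2) by split=> //; apply/andP; split; lra.
by move=> /(sup_upper_bound hA); rewrite -/c; lra.
Qed.
Lemma ucont_c_ptc (f : I -> C) : ucont_c f -> pt_cont f.
Proof. by move=> h t e /h[d d0 hd]; exists d => // s; exact: hd. Qed.

Lemma nbhs_I (t : I) (A : set I) : nbhs t A <-> exists2 d : R, 0 < d & forall s, `|ival s - ival t| <= d -> A s.
Proof.
split.
  move=> [_ [[U oU <-] Ut UA]].
  have /nbhs_ballP[d d0 hd] := open_nbhs_nbhs (conj oU Ut).
  exists (d / 2); first by rewrite divr_gt0.
  move=> s st; apply: UA; apply: hd; rewrite /ball /= distrC.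
  by apply: le_lt_trans st _; rewrite ltr_pdivrMr // ltr_pMr // ltr1n.
move=> [d d0 hd].
have h := @initial_continuous I R set_val t (ball (ival t) d) (nbhsx_ballx _ _ d0).
apply: (@filterS I (nbhs t) (nbhs_filter t) _ _ _ h) => s.
by rewrite /ball /= distrC => st; apply: hd; exact: ltW.
Qed.

Lemma continuous_ptc (f : I -> C) : continuous f <-> pt_cont f.
Proof.
split=> h t.
  move=> e e0; have := h t; move=> /cvg_ballP /(_ (rc e)); rewrite rc_gt0 => /(_ e0) /nbhs_I[d d0 hd].
  exists d => // s /hd; rewrite /ball /= cnE ltr_rc cnB; exact: ltW.
move=> A /nbhs_ballP[c /posC[e e0 ->] he].
suff : nbhs t (f @^-1` A) by []; apply/nbhs_I.
have [d d0 hd] := h t (e / 2) (divr_gt0 e0 (ltr0n R 2)); exists d => // s /hd k; apply: he.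
rewrite /ball /= cnE ltr_rc cnB; apply: le_lt_trans k _.
by rewrite ltr_pdivrMr // ltr_pMr // ltr1n.
Qed.
Lemma continuous_uconts (f : I -> C) : continuous f <-> ucont_c f.
Proof. by rewrite continuous_ptc; split; [exact: pt_cont_uconts|exact: ucont_c_ptc]. Qed.

Lemma continuous_ucont (g : I -> M) : continuous g <-> ucont_mx g.
Proof.
split=> [h|h t].
  apply: entry_ucont => i j; apply/continuous_uconts/continuous_ptc => t e e0.
  have := h t; move=> /cvg_ballP /(_ (rc e)); rewrite rc_gt0 => /(_ e0) /nbhs_I[d d0 hd].
  exists d => // s /hd [_ /(_ i j)]; rewrite /ball /= cnE ltr_rc cnB; exact: ltW.
move=> A /nbhs_ballP[c /posC[e e0 ->] he].
suff : nbhs t (g @^-1` A) by []; apply/nbhs_I.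
have [d d0 hd] := h (e / 2) (divr_gt0 e0 (ltr0n R 2)); exists d => // s /hd k; apply: he.
split; first by rewrite rc_gt0.
move=> i j; rewrite /ball /= cnE ltr_rc cnB.
have := bd_entry i j k; rewrite !mxE => k'; apply: le_lt_trans k' _.
by rewrite ltr_pdivrMr // ltr_pMr // ltr1n.
Qed.
End Continuity.

(** If [t <= (k + 1) d], multiplying [t] by [k / (k + 1)] moves it by at most [d] and leads below
    [k d]; each such step costs at most 1 in the bound. *)
Lemma ucont_mx_bounded (R : realType) (g : I01 R -> 'M[cplx R]_2) : ucont_mx g -> bounded g.
Proof.
move=> ug; have [d d0 hd] := ug 1 ltr01.
have [r hr] : exists r, bd r (g (i0 R)).
  exists (2 * \big[Num.max/0]_(ij : 'I_2 * 'I_2) cn (g (i0 R) ij.1 ij.2)).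
  have h i j : cn (g (i0 R) i j) <= \big[Num.max/0]_(ij : 'I_2 * 'I_2) cn (g (i0 R) ij.1 ij.2).
    by apply: (@le_bigmax_cond _ _ _ _ (i, j) xpredT (fun ij => cn (g (i0 R) ij.1 ij.2))).
  by apply: entry_bd => //; apply: le_trans (h 0 0); exact: cn_ge0.
have main k : forall t, ival t <= k%:R * d -> bd (r + k%:R) (g t).
  elim: k => [|k IH] t ht.
    have -> : t = i0 R.
      by apply: ival_inj; rewrite iv0; apply/le_anti; rewrite -[X in _ <= X](mul0r d) ht; have /andP[] := iv01 t.
    by rewrite addr0.
  have /andP[t0 t1] := iv01 t; have k0 : 0 < k.+1%:R :> R by [].
  have q : k%:R / k.+1%:R = 1 - k.+1%:R^-1 :> R.
    by rewrite -[k.+1%:R in LHS]natr1 -natr1; field; rewrite natr1 gt_eqF.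
  have v0 : 0 <= k.+1%:R^-1 :> R by rewrite invr_ge0 ltW.
  have v1 : k.+1%:R^-1 <= 1 :> R by rewrite invf_le1 // ler1n.
  have e1 : ival (clampI (ival t * (1 - k.+1%:R^-1)) : I01 R) = ival t * (1 - k.+1%:R^-1).
    by rewrite clampIE // mulr_ge0 ?subr_ge0 //= mulr_ile1 ?subr_ge0 // gerBl.
  have step : ival t * k.+1%:R^-1 <= d by rewrite ler_pdivrMr // mulrC.
  rewrite -[g t](subrK (g (clampI (ival t * (1 - k.+1%:R^-1))))).
  have -> : r + k.+1%:R = 1 + (r + k%:R) by rewrite -natr1; ring.
  apply: bdD; [apply: hd|apply: IH]; rewrite e1.
    have -> : ival t - ival t * (1 - k.+1%:R^-1) = ival t * k.+1%:R^-1 by ring.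
    by rewrite ger0_norm // mulr_ge0.
  rewrite -q; have -> : ival t * (k%:R / k.+1%:R) = k%:R * (ival t * k.+1%:R^-1) by ring.
  exact: ler_wpM2l.
exists (r + (Num.trunc d^-1).+1%:R) => t; apply: main.
have /andP[_ t1] := iv01 t; apply: le_trans t1 _.
by rewrite -ler_pdivrMr // div1r; exact/ltW/truncnS_gt.
Qed.

Section Blocks.
Variable R : realType.
Notation C := (cplx R).
Notation M := 'M[C]_2.
Notation I := (I01 R).
Local Notation i0 := (i0 R).
Local Notation i1 := (i1 R).
Local Opaque mk2 e11 a3 adj bd.

Definition kind_alg (k : kind) : ucstarType R := carrier (kind_csub R k).

Lemma adj_conj (m : M) : adj m = map_mx Num.conj m^T.
Proof. by []. Qed.

Lemma kind_alg_C : is_C (kind_alg KC).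
Proof.
have E (f : kind_alg KC) : forall t, val f t = proj_comb (e11 R) (val f i1 0 0) (val f i1 0 0).
  by have [_ _] := carrierP f.
exists (fun f : kind_alg KC => val f i1 0 0); split; split.
- by move=> f g; rewrite /= mxE.
- by move=> f g; rewrite /= mul2E (E f) (E g) !proj_comb_e11 !mk2E mulr0 addr0.
- by rewrite /= one2E.
- by move=> a f; rewrite /= mxE.
- by move=> f; rewrite /= adjE.
- by move=> f g h; apply: carrier_eqP => t; rewrite (E f) (E g) h.
apply/seteqP; split=> // a _.
have k : kind_fun KC (fun t => proj_comb (kind_proj KC t) a a : M) by exact: kind_fun_lin2.
by exists (@mkcar R _ (kind_csub R KC) _ k) => //=; rewrite proj_comb_e11 mk2E.
Qed.

Lemma kind_alg_D : is_D (kind_alg K0).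
Proof.
exists (fun f : kind_alg K0 => val f); split; split.
- by [].
- by [].
- by [].
- by [].
- by move=> f; apply/funext => t; rewrite /= adj_conj.
- by move=> f g h; apply: carrier_eqP => t; rewrite h.
apply/seteqP; split=> [_ [f _ <-]|g [cg dg]] /=.
  have [_ uf df] := carrierP f; split; first exact/continuous_ucont.
  move=> t t0; have -> : t = i0 by apply: ival_inj; rewrite iv0.
  apply/is_diag_mxP => i j; case: (ord2 i) => ->; case: (ord2 j) => -> //.
    by rewrite df.1.
  by rewrite df.2.
have ug : ucont_mx g by exact/continuous_ucont.
have k : kind_fun K0 g.
  split; [exact: ucont_mx_bounded|exact: ug|].
  have /is_diag_mxP h := dg i0 (iv0 R).
  by split; apply: h.
by exists (@mkcar R _ (kind_csub R K0) _ k).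
Qed.

Lemma kind_alg_M : is_M2C (kind_alg KM).
Proof.
exists (fun f : kind_alg KM => \matrix_(i, j) fun t => val f t i j); split; split.
- by move=> f g; apply/matrixP => i j; rewrite !mxE; apply/funext => t; rewrite /= mxE.
- move=> f g; apply/matrixP => i j; rewrite !mxE; apply/funext => t; rewrite /= mxE.
  by rewrite fct_sumE; apply: eq_bigr => k _; rewrite !mxE.
- have one_fct i j : (1 : 'M[I -> C]_2) i j = (i == j)%:R by rewrite mxE.
  apply/matrixP => i j; rewrite one_fct mxE; apply/funext => t.
  by rewrite /= mxE; case: (i == j).
- by move=> a f; apply/matrixP => i j; rewrite !mxE; apply/funext => t; rewrite /= mxE.
- by move=> f; apply/matrixP => i j; rewrite !mxE; apply/funext => t; rewrite /= adjE.
- move=> f g /matrixP h; apply: carrier_eqP => t; apply/matrixP => i j.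
  by have := h i j; rewrite !mxE => /(congr1 (fun u : I -> C => u t)).
apply/seteqP; split=> [_ [f _ <-]|g cg] /=.
  by move=> i j; rewrite mxE; apply/continuous_uconts/ucont_mx_entry; have [] := carrierP f.
have ug : ucont_mx (fun t => \matrix_(i, j) g i j t).
  apply: entry_ucont => i j; apply/continuous_uconts.
  have -> : (fun t => (\matrix_(i0, j0) g i0 j0 t : M) i j) = g i j.
    by apply/funext => t; rewrite mxE.
  exact: cg.
have k : kind_fun KM (fun t => \matrix_(i, j) g i j t : M).
  by split; [exact: ucont_mx_bounded|exact: ug|].
exists (@mkcar R _ (kind_csub R KM) _ k) => //.
by apply/matrixP => i j; rewrite mxE; apply/funext => t; rewrite /= mxE.
Qed.
End Blocks.

Section CellBlocks.
Variable R : realType.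
Notation C := (cplx R).
Notation M := 'M[C]_2.
Notation I := (I01 R).
Local Notation i0 := (i0 R).
Local Notation i1 := (i1 R).
Local Opaque mk2 e11 a3 adj bd.
Implicit Types (k : kind) (g : I -> M) (b : bool).

(** Two independent scalars ([KE], [KT]) count as two copies of the complex numbers, and [K1]
    becomes [K0] by reversing the path. *)
Definition block_kind k : kind := match k with KC | KE | KT => KC | K0 | K1 => K0 | KM => KM end.
Definition two_blocks k : bool := match k with KE | KT => true | _ => false end.
Definition bi b : 'I_2 := if b then 1 else 0.

Definition to_block k b g : I -> M :=
  match k with
  | KC | KE | KT => fun=> (g i1 (bi b) (bi b))%:M
  | K1 => fun t => g (flip t)
  | K0 | KM => g
  end.
Definition of_blocks k g0 g1 : I -> M :=
  match k with
  | KE | KT => fun t => proj_comb (kind_proj k t) (g0 i1 0 0) (g1 i1 0 0)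
  | K1 => fun t => g0 (flip t)
  | KC | K0 | KM => g0
  end.

Lemma block_bk k : block (kind_alg R (block_kind k)).
Proof.
by case: k => /=; [exact: Or31 (kind_alg_C R)|exact: Or31 (kind_alg_C R)|exact: Or31 (kind_alg_C R)|
  exact: Or32 (kind_alg_D R)|exact: Or32 (kind_alg_D R)|exact: Or33 (kind_alg_M R)].
Qed.
Lemma kind_fun_scal (c : C) : kind_fun KC (fun=> c%:M).
Proof.
have -> : (fun=> c%:M) = fun t : I => proj_comb (kind_proj KC t) c c by apply/funext => t; rewrite proj_comb_scal.
exact: kind_fun_lin2.
Qed.
Lemma kind_fun_flip k k' g : (k = K0 /\ k' = K1) \/ (k = K1 /\ k' = K0) -> kind_fun k g -> kind_fun k' (fun t => g (flip t)).
Proof.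
move=> hk [[r hr] ug dg]; split; [by exists r => t; exact: hr|exact: ucont_mx_flip|].
by case: hk dg => -[-> ->] /=; [rewrite flip1|rewrite flip0].
Qed.
Lemma kind_fun_pfun k b g : kind_fun k g -> kind_fun (block_kind k) (to_block k b g).
Proof.
case: k => /= h; [exact: kind_fun_scal|exact: kind_fun_scal|exact: kind_fun_scal|exact: h| |exact: h].
by apply: kind_fun_flip h; right.
Qed.
Lemma kind_fun_qfun k g0 g1 : kind_fun (block_kind k) g0 -> kind_fun k (of_blocks k g0 g1).
Proof.
case: k => /= h; [exact: h| | |exact: h| |exact: h].
- exact: (@kind_fun_lin2 R KE).
- exact: (@kind_fun_lin2 R KT).
- by apply: kind_fun_flip h; left.
Qed.
Lemma kC_const g t : kind_fun KC g -> g t = (g i1 0 0)%:M.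
Proof. by move=> [_ _ /= h]; rewrite {1}h proj_comb_scal. Qed.
Lemma to_block_qfun k g0 g1 b : kind_fun (block_kind k) g0 -> (b -> two_blocks k /\ kind_fun KC g1) ->
  to_block k b (of_blocks k g0 g1) = if b then g1 else g0.
Proof.
move=> h0 h1; apply/funext => t; case: k h0 h1 => /= h0 h1.
- case: b h1 => [/(_ isT)[]//|_]; by rewrite [RHS]kC_const.
- rewrite proj_comb_e11 /bi; case: b h1 => [/(_ isT)[_ h1]|_]; rewrite mk2E; first by rewrite [RHS]kC_const.
  by rewrite [RHS]kC_const.
- rewrite a3_1 proj_comb_e11 /bi; case: b h1 => [/(_ isT)[_ h1]|_]; rewrite mk2E; first by rewrite [RHS]kC_const.
  by rewrite [RHS]kC_const.
- by case: b h1 => [/(_ isT)[]|].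
- by case: b h1 => [/(_ isT)[]|] // _; rewrite flipK.
- by case: b h1 => [/(_ isT)[]|].
Qed.
Lemma of_blocks_pfun k g : kind_fun k g -> of_blocks k (to_block k false g) (to_block k true g) = g.
Proof.
move=> hg; apply/funext => t; have [_ _ dg] := hg; case: k hg dg => /= hg dg.
- by rewrite [RHS]kC_const.
- by rewrite [RHS]dg !mxE.
- by rewrite [RHS]dg !mxE.
- by [].
- by rewrite flipK.
- by [].
Qed.
Lemma of_blocks_ext k g0 g1 g1' : (two_blocks k -> g1 = g1') -> of_blocks k g0 g1 = of_blocks k g0 g1'.
Proof. by case: k => //= ->. Qed.
End CellBlocks.

(** * Block coordinates for the algebra of a finite set *)

Section Products.
Variables (R : realType) (S : choiceType).
Notation C := (cplx R).
Notation M := 'M[C]_2.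
Notation I := (I01 R).
Local Opaque mk2 e11 a3 adj bd.
Variable F : {fset S}.
Implicit Types (x : Omega S) (b : bool).

Lemma A_kpred (f : Aalg R F) x : kind_fun (kind_of x) (fun t => val f (x, t)).
Proof. exact: E_pred_kpred (carrierP f).1. Qed.
Definition proj x b (f : Aalg R F) : kind_alg R (block_kind (kind_of x)) :=
  @mkcar R _ (kind_csub R (block_kind (kind_of x))) _ (kind_fun_pfun b (A_kpred f x)).
Lemma projE x b f : val (proj x b f) = to_block (kind_of x) b (fun t => val f (x, t)).
Proof. by []. Qed.

Lemma end_diag (g : I -> M) k : k = KC \/ k = KE \/ k = KT -> kind_fun k g -> diag2 (g (i1 R)).
Proof.
move=> hk [_ _]; case: hk => [->|[->|->]] /= ->; rewrite ?a3_1 proj_comb_e11 /diag2 !mk2E //.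
Qed.
Lemma proj_hom x b : unital_star_hom (proj x b).
Proof.
have D (f g : Aalg R F) (c : 'I_2) : diag2 (val f (x, i1 R)) ->
    (val f (x, i1 R) *m val g (x, i1 R)) c c = val f (x, i1 R) c c * val g (x, i1 R) c c.
  by move=> [d1 d2]; rewrite mul2E; case: (ord2 c) => ->; rewrite ?d1 ?d2 mul0r ?addr0 ?add0r.
split; [split=> [f g|a f|f g|f]|]; apply: (@carrier_eqP _ _ (kind_csub R (block_kind (kind_of x)))) => t;
  rewrite /= /to_block.
- by case: (kind_of x) => //=; rewrite mxE raddfD.
- by case: (kind_of x) => //=; rewrite mxE scale_scalar_mx.
- have dg := end_diag _ (A_kpred f x); case: (kind_of x) dg => //= dg.
  + by rewrite D ?scalar_mxM //; apply: dg; left.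
  + by rewrite D ?scalar_mxM //; apply: dg; right; left.
  + by rewrite D ?scalar_mxM //; apply: dg; right; right.
- have S1 (c : C) : adj (c%:M) = (Num.conj c)%:M.
    by rewrite -[c%:M]scalemx1 adjZ adj1 scalemx1.
  by case: (kind_of x) => //=; rewrite adjE S1.
- by case: (kind_of x) => //=; rewrite mxE eqxx.
Qed.

(** Each cell fixed by [cell_of F] contributes one block, and the flag [true] marks the second
    scalar where there is one. *)
Definition blocks : seq (Omega S * bool) :=
  undup [seq z <- [seq (x, b) | x <- cells F, b <- [:: false; true]] |
    (cell_of F z.1 == z.1) && (z.2 ==> two_blocks (kind_of z.1))].
Lemma mem_blocks x b : ((x, b) \in blocks) = (cell_of F x == x) && (b ==> two_blocks (kind_of x)).
Proof.
rewrite mem_undup mem_filter; case: eqP => [rx|] //; case: (b ==> _) => //.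
have h : (x, b) \in [seq (x, b) | x <- cells F, b <- [:: false; true]].
  apply/allpairsP; exists (x, b); split; [by rewrite -rx; exact: cell_of_cells|by case: (b)|by []].
by rewrite h.
Qed.

Local Notation n := (size blocks).
Definition blk (i : 'I_n) : Omega S * bool := tnth (in_tuple blocks) i.
Lemma blk_in i : blk i \in blocks.
Proof. exact: mem_tnth. Qed.
Definition Balg (i : 'I_n) : ucstarType R := kind_alg R (block_kind (kind_of (blk i).1)).

Definition glue_at (c : forall i, Balg i) (z : Omega S * bool) : I -> M :=
  if insub (index z blocks) is Some i then val (c i) else fun=> 0.
Lemma glue_blk c i : glue_at c (blk i) = val (c i).
Proof.
rewrite /glue_at; have -> : index (blk i) blocks = val i.
  rewrite /blk (tnth_nth (blk i)) index_uniq ?undup_uniq //.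
by rewrite valK.
Qed.
Lemma blk_ex z : z \in blocks -> exists i, blk i = z.
Proof.
move=> hz; have h : (index z blocks < n)%N by rewrite index_mem.
by exists (Ordinal h); rewrite /blk (tnth_nth z) /= nth_index.
Qed.
Lemma glue_kpred c z : z \in blocks -> kind_fun (block_kind (kind_of z.1)) (glue_at c z).
Proof. by move=> /blk_ex[i <-]; rewrite glue_blk; exact: (carrierP (c i)). Qed.

(** [glued] reads this only at cells fixed by [cell_of F]; the value 0 elsewhere merely satisfies
    the kind condition. *)
Definition glue c x : I -> M :=
  if cell_of F x == x then of_blocks (kind_of x) (glue_at c (x, false)) (glue_at c (x, true)) else fun=> 0.
Lemma kind_fun_glue c x : kind_fun (kind_of x) (glue c x).
Proof.
rewrite /glue; case: eqP => rx; last exact: (@cs_zero R _ (kind_csub R (kind_of x))).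
by apply: kind_fun_qfun; apply: (@glue_kpred c (x, false)); rewrite mem_blocks rx eqxx.
Qed.
Definition glued c : Aalg R F := @mkcar R _ (A_csub R F) _ (A_pred_of F (kind_fun_glue c)).

Lemma A_blocks : finite_block_product (Aalg R F).
Proof.
exists n, Balg, (fun i => proj (blk i).1 (blk i).2); split.
- by move=> i; exact: block_bk.
- by move=> i; exact: proj_hom.
move=> c; exists (glued c); split.
  move=> i; apply: (@carrier_eqP _ _ (kind_csub R (block_kind (kind_of (blk i).1)))) => t.
  rewrite projE -(glue_blk c i); have := blk_in i.
  case: (blk i) => x b /=; rewrite mem_blocks => /andP[/eqP rx hb].
  have -> : (fun t => glue c (cell_of F x) t) = of_blocks (kind_of x) (glue_at c (x, false)) (glue_at c (x, true)).
    by rewrite rx /glue rx eqxx.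
  rewrite to_block_qfun; [by case: (b)| |].
    by apply: (@glue_kpred c (x, false)); rewrite mem_blocks rx eqxx.
  move=> b1; rewrite b1 /= in hb; split=> //.
  have := @glue_kpred c (x, true); rewrite mem_blocks rx eqxx hb => /(_ isT) /=.
  by case: (kind_of x) hb.
move=> f hf; apply: (@carrier_eqP _ _ (A_csub R F)) => -[y t].
rewrite [RHS](carrierP f).2; change (glue c (cell_of F y) t = val f (cell_of F y, t)).
have rx := cell_of_id F y; move: (cell_of F y) rx => x rx; rewrite /glue rx eqxx.
have hb b : (x, b) \in blocks -> glue_at c (x, b) = to_block (kind_of x) b (fun t => val f (x, t)).
  move=> /blk_ex[i ei]; rewrite -ei glue_blk -hf projE ei //.
rewrite hb ?mem_blocks ?rx ?eqxx // (@of_blocks_ext _ _ _ _ (to_block (kind_of x) true (fun t => val f (x, t)))).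
  by rewrite of_blocks_pfun //; exact: A_kpred.
by move=> h2; apply: hb; rewrite mem_blocks rx eqxx.
Qed.
End Products.

Theorem theorem14p1 (R : realType) :
  exists E : ucstarType R,
    aleph_separable 3 E /\
    (nilpotence_index E 2 /\ real_rank E 1 /\ stable_rank E 1) /\
    ((exists (G : porderZmodType) (f : {additive V E -> G}),
        dimension_group G /\ positive_cone_of f) /\
     order_unit (Vunit E) /\ monoid_index (Vunit E) 2) /\
    ((forall B : cstarType R, real_rank_zero B ->
        ~ exists f : {additive V B -> V E},
            pre_V_hom f /\ forall y : V E, exists x : V B, f x = y) /\
     (forall B : rngType, regular_rng B ->
        ~ exists f : {additive V B -> V E},
            pre_V_hom f /\ forall y : V E, exists x : V B, f x = y)) /\
    ((~ exists B : cstarType R, real_rank_zero B /\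
        exists f : {additive V E -> V B}, bijective f) /\
     (~ exists B : rngType, regular_rng B /\
        exists f : {additive V E -> V B}, bijective f)) /\
    exists (d : Order.disp_t) (I : porderType d) (A : I -> ucstarType R)
           (f : forall i j : I, A i -> A j) (g : forall i : I, A i -> E),
      [/\ is_aleph 3 [set: I], forall i : I, finite_block_product (A i)
        & direct_limit f g].
Proof.
have [S hS] := exists_aleph_type 3.
have s0 : exists s : S, True.
  by have [u [uS _]] := infinite_seq (is_aleph_infinite hS); exists (u 0%N).
exists (Ealg R S); split; first exact: E_separable hS.
split.
  split; first exact: E_nilpotence.
  split; last exact: E_stable_rank.
  split; first exact: E_real_rank_le1.
  by move=> [|m] // h; case: (E_not_RR0 hS h).
split.
  split; last by split; [exact: VE_order_unit|exact: VE_index].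
  exists (rank_group S), (rank_map (R := R) (S := S)); split; [exact: rank_group_dimension_group|exact: VE_cone].
split; first by split; [exact: E_no_RR0|exact: E_no_regular].
split.
  split.
    move=> [B [hB [f bf]]]; have [g hg] := bij_inverse_preV bf.
    by apply: (E_no_RR0 hS hB); exists g.
  move=> [B [hB [f bf]]]; have [g hg] := bij_inverse_preV bf.
  by apply: (E_no_regular hS hB); exists g.
exists (index_display), (fset_index S), (@Aalg R S), (@transition R S), (@inclA R S); split.
- exact: is_aleph_fset hS.
- by move=> F; exact: A_blocks.
- exact: E_direct_limit.
Qed.
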